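(* (i) Let $0<p,q<\infty$ and let $C_\psi$ be in $C(\mathcal{F}_\varphi^p,\mathcal{F}_\varphi^q)$. (a) If $p\neq q$, then the space $C(\mathcal{F}_\varphi^p,\mathcal{F}_\varphi^q)$ is connected. (b) If $p=q$, then $C_\psi$ is isolated in $C(\mathcal{F}_\varphi^p,\mathcal{F}_\varphi^p)$ if and only if it is not compact. In this case ($p=q$), the set of all compact composition operators on $\mathcal{F}_\varphi^p$ is a connected component of $C(\mathcal{F}_\varphi^p,\mathcal{F}_\varphi^p)$. (ii) Let $0<p<\infty$ and $C_{\psi_1},C_{\psi_2}\in C(\mathcal{F}_\varphi^p,\mathcal{F}_\varphi^p)$ where $\psi_1\neq\psi_2$. Then (a) $C_{\psi_1}-C_{\psi_2}$ is compact on $\mathcal{F}_\varphi^p$ if and only if both $C_{\psi_1}$ and $C_{\psi_2}$ are compact; (b) (case $p=2$) if $C_{\psi_1}-C_{\psi_2}$ is compact on $\mathcal{F}_\varphi^2$, then it belongs to the Schatten class $\mathcal{S}_s(\mathcal{F}_\varphi^2)$ for all $0<s<\infty$.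
   Context: Weight: $\varphi:[0,\infty)\to[0,\infty)$ is a twice continuously differentiable function, extended to $\mathbb{C}$ by $\varphi(z)=\varphi(|z|)$, with Laplacian $\Delta\varphi>0$. It is assumed that there is a positive radial differentiable function $\tau$ on $\mathbb{C}$ with $\tau(z)\simeq(\Delta\varphi(z))^{-1/2}$ for $|z|\ge 1$ and $\tau(z)\simeq 1$ for $0\le|z|<1$, satisfying $\lim_{r\to\infty}\tau(r)=0$ and $\lim_{r\to\infty}\tau'(r)=0$, and such that either there exists a constant $C>0$ for which $\tau(r)r^C$ increases for large $r$, or $\lim_{r\to\infty}\tau'(r)\log\frac{1}{\tau(r)}=0$. Here $U\simeq V$ means that $U\le cV$ and $V\le cU$ on the set in question for some constant $c>0$. Spaces: for $0<p<\infty$, $\mathcal{F}_\varphi^p$ is the space of entire functions $f$ with $\|f\|_p^p=\int_{\mathbb{C}}|f(z)|^pe^{-p\varphi(z)}\,dA(z)<\infty$, where $dA$ is Lebesgue area measure on $\mathbb{C}$. $\mathcal{F}_\varphi^2$ is a Hilbert space with inner product $\langle f,g\rangle=\int_{\mathbb{C}}f\overline{g}e^{-2\varphi}dA$. Operators: for a holomorphic map $\psi$ on $\mathbb{C}$, $C_\psi f=f\circ\psi$. $C(\mathcal{F}_\varphi^p,\mathcal{F}_\varphi^q)$ denotes the set of all bounded composition operators $C_\psi:\mathcal{F}_\varphi^p\to\mathcal{F}_\varphi^q$, equipped with the operator norm topology, i.e. the topology of convergence with respect to $\|T\|=\sup\{\|Tf\|_q:\|f\|_p\le1\}$ applied to differences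 (a quasi-norm when $q<1$). Isolated points and connected components are understood in this topology. An operator is compact if it maps the unit ball to a relatively compact set. A compact operator $T$ on the Hilbert space $\mathcal{F}_\varphi^2$ belongs to the Schatten class $\mathcal{S}_s(\mathcal{F}_\varphi^2)$ if its sequence of singular values $(\lambda_n)$ satisfies $\sum_n\lambda_n^s<\infty$. *)

(* Defs.v *)
From HB Require Import structures.
From mathcomp Require Import all_boot all_order all_algebra.
From mathcomp Require Import all_classical all_reals all_analysis.
From mathcomp Require Import measurable_realfun complex.

Set Implicit Arguments.
Unset Strict Implicit.
Unset Printing Implicit Defensive.

Import Order.TTheory GRing.Theory Num.Theory.
Import numFieldNormedType.Exports.
Import ComplexField.Normc.

Local Open Scope classical_set_scope.
Local Open Scope ring_scope.
Local Open Scope complex_scope.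

Section quasinorm_entourage.
Context {R : realType} {V : zmodType} (N : V -> \bar R) (K : R).
Hypotheses (K0 : 0 < K) (N0 : N 0 = 0%E) (NN : forall x, N (- x) = N x).
Hypothesis ND : forall x y, (N (x + y) <= K%:E * maxe (N x) (N y))%E.

Definition qn_entourage : set_system (V * V) :=
  filter_from [set e : R | 0 < e]
              (fun e => [set xy | (N (xy.1 - xy.2) < e%:E)%E]).

Lemma qn_entourage_filter : Filter qn_entourage.
Proof.
apply: filter_from_filter; first by exists 1 => /=.
move=> e e' /= e0 e'0; exists (Num.min e e'); first by rewrite /= lt_min e0 e'0.
move=> xy /=; rewrite EFin_min lt_min => /andP[? ?]; by split.
Qed.

Lemma qn_entourage_diagonal A : qn_entourage A -> diagonal `<=` A.
Proof.
by move=> [e /= e0 eA] xy /= xyE; apply: eA; rewrite /= xyE subrr N0.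
Qed.

Lemma qn_entourage_inv A : qn_entourage A -> qn_entourage A^-1%relation.
Proof.
move=> [e /= e0 eA]; exists e => // -[x y] /= xye; apply: eA => /=.
by rewrite -NN opprB.
Qed.

Lemma qn_entourage_split A : qn_entourage A ->
  exists2 B, qn_entourage B & (B \; B `<=` A)%relation.
Proof.
move=> [e /= e0 eA].
exists [set xy | (N (xy.1 - xy.2) < (e / K)%:E)%E].
  by exists (e / K) => //=; rewrite divr_gt0.
move=> [x z] /= [y] /= xy yz; apply: eA => /=.
have -> : x - z = (x - y) + (y - z) by rewrite addrA subrK.
apply: le_lt_trans (ND _ _) _.
have -> : e = K * (e / K) by rewrite mulrCA divff ?gt_eqF// mulr1.
by rewrite [ltRHS]EFinM lte_pmul2l ?lte_fin// gt_max xy yz.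
Qed.

End quasinorm_entourage.

Section plane.
Context {R : realType}.

Definition entire (f : R[i] -> R[i]) : Prop :=
  forall z, derivable (f : R[i]^o -> R[i]^o) z 1.

Definition area : set (measurableTypeR R * measurableTypeR R) -> \bar R :=
  (lebesgue_measure \x lebesgue_measure)%E.
HB.instance Definition _ := Measure.on area.

Definition laplacian (u : R[i] -> R) (z : R[i]) : R :=
  derive1n 2 (fun x => u (x +i* complex.Im z)) (complex.Re z) +
  derive1n 2 (fun y => u (complex.Re z +i* y)) (complex.Im z).

Definition simeq_on (D : set R[i]) (U V : R[i] -> R) : Prop :=
  exists2 c : R, 0 < c & forall z, D z -> U z <= c * V z /\ V z <= c * U z.

(* f' is the derivative of f on the half-line; at 0 the limit is one-sided. *)
Definition has_deriv_ge0 (f f' : R -> R) : Prop :=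
  forall x, 0 <= x ->
    (f y - f x) / (y - x) @[y --> within [set y | 0 <= y] x^'] --> f' x.

Definition C2_ge0 (f : R -> R) : Prop :=
  exists f' f'' : R -> R, [/\ has_deriv_ge0 f f', has_deriv_ge0 f' f'' &
    {within `[0, +oo[, continuous f''}].

Definition admissible_tau (phi : R -> R) (tau : R[i] -> R) : Prop :=
  let t (r : R) := tau r%:C in
  [/\ (forall z, 0 < tau z)
      /\ (forall z, tau z = tau (normc z)%:C),
      forall z : R * R, differentiable (fun z : R * R => tau (z.1 +i* z.2)) z,
      simeq_on [set z | 1 <= normc z] tau
        (fun z => laplacian (phi \o @normc R) z `^ (- 2^-1))
      /\ simeq_on [set z | normc z < 1] tau (fun=> 1),
      t r @[r --> +oo%R] --> (0 : R)
      /\ t^`()%classic r @[r --> +oo%R] --> (0 : R) &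
      (exists2 c : R, 0 < c & exists r0 : R,
         {in `]r0, +oo[ &, {homo (fun r => t r * r `^ c) : r s / r <= s}})
      \/ (t^`()%classic r * ln (1 / t r) @[r --> +oo%R] --> (0 : R))].

(* The values of phi on the negative half-line are irrelevant.  If the
   one-sided derivative of phi at 0 is nonzero, then phi (normc z) has no
   partial derivatives at 0 and [laplacian] takes the default value 0 there, so
   the positivity condition also says that the Laplacian exists at 0. *)
Definition admissible (phi : R -> R) : Prop :=
  [/\ forall r, 0 <= r -> 0 <= phi r,
      C2_ge0 phi,
      forall z, 0 < laplacian (phi \o @normc R) z &
      exists tau, admissible_tau phi tau].

End plane.

Record weight (R : realType) := Weight {
  phi :> R -> R;
  weightP : admissible phi }.

Section measurability.
Context {R : realType}.
Local Notation plane := (measurableTypeR R * measurableTypeR R)%type.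

Lemma open_measurable_plane (U : set (R * R)) :
  open U -> measurable (U : set plane).
Proof.
move=> oU.
pose box (q : (rat * rat) * (rat * rat)) : set plane :=
  (`]ratr q.1.1, ratr q.1.2[%classic : set R) `*`
  (`]ratr q.2.1, ratr q.2.2[%classic : set R).
pose F q : set plane := [set z | box q `<=` U /\ box q z].
have -> : U = \bigcup_q F q.
  apply/seteqP; split => [[x y] Uxy|z [q _]]; last first.
    by move=> [/[apply]].
  have [[A B] /= [/nbhs_ballP[e /= e0 eA] /nbhs_ballP[d /= d0 dB]] ABU] :
    nbhs (x, y) U by move: oU; rewrite openE; exact.
  have [a /[!in_itv]/= /andP[a1 a2]] : exists a : rat, ratr a \in `]x - e, x[.
    by apply: rat_in_itvoo; rewrite ltrBlDr ltrDl.
  have [b /[!in_itv]/= /andP[b1 b2]] : exists a : rat, ratr a \in `]x, x + e[.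
    by apply: rat_in_itvoo; rewrite ltrDl.
  have [c /[!in_itv]/= /andP[c1 c2]] : exists a : rat, ratr a \in `]y - d, y[.
    by apply: rat_in_itvoo; rewrite ltrBlDr ltrDl.
  have [h /[!in_itv]/= /andP[h1 h2]] : exists a : rat, ratr a \in `]y, y + d[.
    by apply: rat_in_itvoo; rewrite ltrDl.
  exists ((a, b), (c, h)) => //; split; last first.
    by rewrite /box /= !in_itv/= a2 b1 c2 h1.
  move=> -[u v]; rewrite /box /= !in_itv/=.
  move=> [/andP[u1 u2] /andP[v1 v2]]; apply: ABU; split => /=.
    by apply: eA; rewrite /ball/= ltr_distlC (lt_trans a1 u1) (lt_trans u2 b2).
  by apply: dB; rewrite /ball/= ltr_distlC (lt_trans c1 v1) (lt_trans v2 h2).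
apply: countable_bigcupT_measurable => // q.
have [qU|qU] := pselect (box q `<=` U); last first.
  by rewrite (_ : F q = set0)// -subset0 => z [].
rewrite (_ : F q = box q); last by apply/seteqP; split => [z []|].
by apply: measurableX; exact: measurable_itv.
Qed.

Lemma continuous_measurable_plane (f : R * R -> R) :
  continuous f -> measurable_fun [set: plane] (f : plane -> measurableTypeR R).
Proof.
move=> /continuousP cf; apply: (measurability _ (RGenOpens.measurableE R)).
move=> _ [_ [a [b ->] <-]]; rewrite setTI; apply: open_measurable_plane.
exact/cf/interval_open.
Qed.

Lemma normc_plane_continuous :
  continuous (fun z : R * R => normc (z.1 +i* z.2)).
Proof.
pose q (z : R * R) := z.1 ^+ 2 + z.2 ^+ 2.
rewrite (_ : (fun _ => _) = (@Num.sqrt R) \o q)// => z.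
apply: continuous_comp; last exact: sqrt_continuous.
have c1 : {for z, continuous (fun z : R * R => z.1 ^+ 2)}.
  by apply: (@continuous_comp _ _ _ fst (fun x : R => x ^+ 2));
    [exact: cvg_fst|exact: exprn_continuous].
have c2 : {for z, continuous (fun z : R * R => z.2 ^+ 2)}.
  by apply: (@continuous_comp _ _ _ snd (fun x : R => x ^+ 2));
    [exact: cvg_snd|exact: exprn_continuous].
exact: cvgD c1 c2.
Qed.

Lemma normc_triangle (a b : R[i]) : normc (a + b) <= normc a + normc b.
Proof. exact: le_normcD. Qed.

Lemma normc_opp (a : R[i]) : normc (- a) = normc a.
Proof. exact: normcN. Qed.

Lemma normc_dist (a b : R[i]) : `|normc a - normc b| <= normc (a - b).
Proof.
have H (c d : R[i]) : normc c - normc d <= normc (c - d).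
  by rewrite lerBlDr; have := normc_triangle (c - d) d; rewrite subrK.
by rewrite ler_norml H andbT lerNl opprB (le_trans (H _ _))// -normc_opp opprB.
Qed.

Lemma normc_le (a b : R) : normc (a +i* b) <= `|a| + `|b|.
Proof.
rewrite -[leRHS]ger0_norm ?addr_ge0// -sqrtr_sqr ler_wsqrtr// sqrrD.
rewrite !real_normK ?num_real// addrAC lerDl.
by rewrite mulrn_wge0// mulr_ge0.
Qed.

Lemma entire_plane_continuous (f : R[i] -> R[i]) : entire f ->
  continuous (fun z : R * R => normc (f (z.1 +i* z.2))).
Proof.
move=> ef [x y].
have /differentiable_continuous := (derivable1_diffP _ _).1 (ef (x +i* y)).
move=> /cvgrPdist_lt cf; apply/cvgrPdist_lt => e e0 /=.
have /cf : 0 < e%:C by rewrite ltcR.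
move=> /nbhs_ballP[[d d'] /=]; rewrite ltcE /= => /andP[/eqP -> d0] dP.
exists (ball x (d / 2), ball y (d / 2)).
  by split; apply: nbhsx_ballx; rewrite /= divr_gt0.
move=> [u v] /= [xu yv]; apply: le_lt_trans (normc_dist _ _) _.
rewrite -ltcR; apply: (dP (u +i* v)); rewrite /ball/= ltcR.
apply: le_lt_trans (normc_le _ _) _; rewrite (splitr d); exact: ltrD.
Qed.

End measurability.

Section weight_measurability.
Context {R : realType}.
Local Notation plane := (measurableTypeR R * measurableTypeR R)%type.

Lemma has_deriv_ge0_continuous (f f' : R -> R) : has_deriv_ge0 f f' ->
  continuous (fun r : R => f `|r|).
Proof.
move=> ff' x; apply/cvgrPdist_lt => e e0.
have /cvgrPdist_lt/(_ _ ltr01) := ff' `|x| (normr_ge0 x).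
move=> /nbhs_ballP[d /= d0 dP].
pose M := `|f' `|x| | + 1.
have M0 : 0 < M by rewrite ltr_wpDl.
apply/nbhs_ballP; exists (Num.min d (e / M)) => /=.
  by rewrite lt_min d0 divr_gt0.
move=> y; rewrite /ball/= lt_min => /andP[xyd xye].
have xy : `| `|x| - `|y| | <= `|x - y| by exact: ler_dist_dist.
have [<-|yx] := eqVneq `|y| `|x|; first by rewrite subrr normr0.
have := dP `|y| (le_lt_trans xy xyd) yx (normr_ge0 y); set q := _ / _ => q1.
have -> : f `|x| - f `|y| = q * (`|x| - `|y|).
  rewrite /q -[in RHS](opprB `|y|) mulrN divfK ?opprB// subr_eq0.
  exact: yx.
have qM : `|q| <= M.
  rewrite -lerBlDl; apply/ltW/(le_lt_trans _ q1).
  by rewrite distrC (le_trans _ (lerB_dist _ _)).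
rewrite normrM; apply: le_lt_trans (_ : M * `|x - y| < e).
  exact: ler_pM.
by rewrite -lter_pdivlMl// mulrC.
Qed.

Lemma weight_measurable (w : weight R) :
  measurable_fun [set: plane]
    (fun z : plane => w (normc (z.1 +i* z.2)) : measurableTypeR R).
Proof.
have [_ [f' [f'' [wf' _ _]]] _ _] := weightP w.
have cw := has_deriv_ge0_continuous wf'.
apply: (continuous_measurable_plane (f := fun z => w (normc (z.1 +i* z.2)))).
rewrite (_ : (fun z => _) =
  (fun r : R => w `|r|) \o (fun z : R * R => normc (z.1 +i* z.2))).
  move=> z; apply: continuous_comp; last exact: cw.
  exact: normc_plane_continuous.
by apply/funext => z /=; rewrite ger0_norm// sqrtr_ge0.
Qed.

End weight_measurability.

Section fock_space.
Context {R : realType}.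
Implicit Types (w : weight R) (p : {posnum R}) (f g : R[i] -> R[i]).

Definition fock_integral w p f : \bar R :=
  \int[area]_z (normc (f (z.1 +i* z.2)) `^ p%:num *
                expR (- p%:num * w (normc (z.1 +i* z.2))))%:E.

Definition fock_norm w p f : \bar R := (fock_integral w p f `^ p%:num^-1)%E.

Definition fock_pred w p : {pred R[i] -> R[i]} :=
  mem [set f | entire f /\ (fock_norm w p f < +oo)%E].

Lemma fock_integral_ge0 w p f : (0 <= fock_integral w p f)%E.
Proof.
by apply: integral_ge0 => z _; rewrite lee_fin mulr_ge0 ?powR_ge0 ?expR_ge0.
Qed.

Lemma fock_norm_ge0 w p f : (0 <= fock_norm w p f)%E.
Proof. exact: poweR_ge0. Qed.

Lemma fock_integrand_measurable w p f : entire f ->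
  measurable_fun [set: measurableTypeR R * measurableTypeR R]
    (fun z => (normc (f (z.1 +i* z.2)) `^ p%:num *
               expR (- p%:num * w (normc (z.1 +i* z.2))))%:E).
Proof.
move=> ef; apply/measurable_EFinP; apply: measurable_funM.
  apply: (measurableT_comp (measurable_powR p%:num)).
  exact: (continuous_measurable_plane (entire_plane_continuous ef)).
apply: (measurableT_comp (@measurable_expR R)).
apply: measurable_funM => //; exact: weight_measurable.
Qed.

Lemma powR_normcD p (a b : R[i]) :
  normc (a + b) `^ p%:num <=
  2 `^ p%:num * (normc a `^ p%:num + normc b `^ p%:num).
Proof.
have n0 (c : R[i]) : 0 <= normc c by case: c => ? ?; exact: sqrtr_ge0.
wlog ab : a b / normc a <= normc b.
  move=> H; have [/H//|/ltW/H] := leP (normc a) (normc b).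
  by rewrite addrC [X in _ * X]addrC.
apply: (@le_trans _ _ ((2 * normc b) `^ p%:num)).
  apply: ge0_ler_powR; rewrite ?nnegrE ?mulr_ge0//.
  by apply: le_trans (normc_triangle _ _) _; rewrite mulr_natl mulr2n lerD2r.
by rewrite powRM// ler_wpM2l ?powR_ge0// lerDr powR_ge0.
Qed.

Lemma fock_integralD w p f g : entire f -> entire g ->
  (fock_integral w p (f + g)%R <=
   (2 `^ p%:num)%:E * (fock_integral w p f + fock_integral w p g))%E.
Proof.
move=> ef eg; rewrite /fock_integral -ge0_integralD//; first last.
- exact: fock_integrand_measurable.
- by move=> z _; rewrite lee_fin mulr_ge0 ?powR_ge0 ?expR_ge0.
- exact: fock_integrand_measurable.
- by move=> z _; rewrite lee_fin mulr_ge0 ?powR_ge0 ?expR_ge0.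
rewrite -ge0_integralZl//; first last.
- by move=> z _; rewrite -EFinD lee_fin addr_ge0// mulr_ge0 ?powR_ge0 ?expR_ge0.
- by apply: emeasurable_funD; exact: fock_integrand_measurable.
apply: ge0_le_integral => //.
- by move=> z _; rewrite lee_fin mulr_ge0 ?powR_ge0 ?expR_ge0.
- apply: fock_integrand_measurable => z; exact: derivableD.
- apply: measurable_funeM; apply: emeasurable_funD;
  exact: fock_integrand_measurable.
move=> z _; rewrite -EFinD -EFinM lee_fin -mulrDl mulrA.
rewrite ler_wpM2r ?expR_ge0//.
exact: powR_normcD.
Qed.

Lemma fock_integralZ w p (c : R[i]) f : entire f ->
  fock_integral w p (c *: f)%R =
  ((normc c `^ p%:num)%:E * fock_integral w p f)%E.
Proof.
move=> ef; rewrite -ge0_integralZl//; first last.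
- by rewrite lee_fin powR_ge0.
- by move=> z _; rewrite lee_fin mulr_ge0 ?powR_ge0 ?expR_ge0.
- exact: fock_integrand_measurable.
apply: eq_integral => z _; rewrite -EFinM mulrA -powRM.
- by congr (_ `^ _ * _)%:E; exact: normcM.
- by case: c => ? ?; exact: sqrtr_ge0.
- by case: (f _) => ? ?; exact: sqrtr_ge0.
Qed.

Lemma fock_normN w p f : fock_norm w p (- f) = fock_norm w p f.
Proof.
apply: (congr1 (fun x => (x `^ p%:num^-1)%E)).
by apply: eq_integral => z _; rewrite normc_opp.
Qed.

Lemma fock_norm0 w p : fock_norm w p 0 = 0%E.
Proof.
have powE (x : \bar R) : x = 0%E -> (x `^ p%:num^-1 = 0)%E.
  by move=> ->; rewrite poweR0r// gt_eqF.
apply: powE; apply: integral0_eq => z _.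
by rewrite normc0 powR0 ?mul0r// gt_eqF.
Qed.

Definition fock_const p : R := 2 * 2 `^ p%:num^-1.

Lemma poweR_quasi p (a b c : \bar R) : (0 <= a)%E -> (0 <= b)%E ->
  (0 <= c)%E -> (c <= (2 `^ p%:num)%:E * (a + b))%E ->
  (c `^ p%:num^-1 <=
   (fock_const p)%:E * maxe (a `^ p%:num^-1) (b `^ p%:num^-1))%E.
Proof.
move=> a0 b0 c0 cab.
have m0 : (0 <= maxe a b)%E by rewrite le_max a0.
have q0 : 0 <= p%:num^-1 :> R by [].
apply: (@le_trans _ _
    (((2 `^ p%:num)%:E * (2%:E * maxe a b)) `^ p%:num^-1)%E).
  apply: gt0_ler_poweR => //.
  - by rewrite in_itv/= leey c0.
  - by rewrite in_itv/= leey !mule_ge0 ?lee_fin ?powR_ge0.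
  apply: (le_trans cab).
  rewrite lee_wpmul2l ?lee_fin ?powR_ge0//.
  rewrite (_ : 2%:E = 1 + 1)%E; last by rewrite -EFinD.
  by rewrite ge0_muleDl// mul1e leeD// le_max lexx ?orbT.
rewrite !poweRM ?mule_ge0 ?lee_fin ?powR_ge0// !poweR_EFin -powRrM.
rewrite mulfV ?gt_eqF// powRr1// muleA -EFinM -/(fock_const p).
rewrite lee_wpmul2l ?lee_fin ?mulr_ge0 ?powR_ge0//.
by have [ab|ba] := leP a b; rewrite le_max lexx ?orbT.
Qed.

Lemma fock_normD w p f g : entire f -> entire g ->
  (fock_norm w p (f + g)%R <=
   (fock_const p)%:E * maxe (fock_norm w p f) (fock_norm w p g))%E.
Proof.
move=> ef eg; apply: poweR_quasi; [exact: fock_integral_ge0..|].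
exact: fock_integralD.
Qed.

Lemma fock_submod_closed w p : submod_closed (fock_pred w p).
Proof.
split.
  apply/mem_set; split; last by rewrite fock_norm0.
  by move=> z; exact: derivable_cst.
move=> c f g /set_mem[ef nf] /set_mem[eg ng]; apply/mem_set.
have ecf : entire (c *: f).
  by move=> z; exact: (@derivableZ R[i] R[i]^o R[i]^o f c z 1 (ef z)).
have p0 : p%:num^-1 != 0 :> R by rewrite gt_eqF.
split.
  by move=> z; exact: (@derivableD R[i] R[i]^o R[i]^o _ g z 1 (ecf z) (eg z)).
apply: poweR_lty; apply: le_lt_trans (fock_integralD _ _ ecf eg) _.
have := lty_poweRy p0 nf; have := lty_poweRy p0 ng.
have := fock_integral_ge0 w p f; have := fock_integral_ge0 w p g.
rewrite (fock_integralZ w p c ef).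
move: (fock_integral w p f) (fock_integral w p g) => a b b0 a0 boo aoo.
rewrite lte_mul_pinfty ?lee_fin ?powR_ge0// lte_add_pinfty//.
by rewrite lte_mul_pinfty ?lee_fin ?powR_ge0.
Qed.

HB.instance Definition _ w p :=
  GRing.isSubmodClosed.Build _ _ (fock_pred w p) (fock_submod_closed w p).

End fock_space.

Record fock (R : realType) (w : weight R) (p : {posnum R}) := Fock {
  fock_fun :> R[i] -> R[i];
  fockP : fock_fun \in fock_pred w p }.

Section fock_type.
Context {R : realType} (w : weight R) (p : {posnum R}).
Local Notation F := (fock w p).

HB.instance Definition _ := [isSub for @fock_fun R w p].
HB.instance Definition _ := [Choice of F by <:].
HB.instance Definition _ := [SubChoice_isSubLmodule of F by <:].

Lemma fock_entire (f : F) : entire f.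
Proof. by case: f => f /=; rewrite inE => -[]. Qed.

Lemma fock_const_gt0 : 0 < fock_const p.
Proof. by rewrite mulr_gt0// powR_gt0. Qed.

Definition fnorm (f : F) : \bar R := fock_norm w p f.

Lemma fnorm0 : fnorm 0 = 0%E.
Proof. exact: fock_norm0. Qed.

Lemma fnormN (f : F) : fnorm (- f) = fnorm f.
Proof. exact: fock_normN. Qed.

Lemma fnormD (f g : F) :
  (fnorm (f + g)%R <= (fock_const p)%:E * maxe (fnorm f) (fnorm g))%E.
Proof. by apply: fock_normD; exact: fock_entire. Qed.

HB.instance Definition _ := isUniform.Build F
  (qn_entourage_filter fnorm)
  (qn_entourage_diagonal fnorm0)
  (qn_entourage_inv fnormN)
  (qn_entourage_split fock_const_gt0 fnormD).

End fock_type.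

(* All maps between the two spaces, so that the operator quasi-norm may be
   infinite; bounded operators are singled out by [bounded_oper]. *)
Definition oper (R : realType) (w : weight R) (p q : {posnum R}) :=
  fock w p -> fock w q.

Section operators.
Context {R : realType} (w : weight R) (p q : {posnum R}).
Implicit Types (T : oper w p q) (psi : R[i] -> R[i]).

HB.instance Definition _ :=
  GRing.Lmodule.copy (oper w p q) (fock w p -> fock w q).

Definition unit_ball : set (fock w p) := [set f | (fnorm f <= 1)%E].

Definition opnorm T : \bar R := ereal_sup [set fnorm (T f) | f in unit_ball].

Lemma unit_ball0 : unit_ball 0.
Proof. by rewrite /unit_ball/= fnorm0. Qed.

Lemma opnorm0 : opnorm 0 = 0%E.
Proof.
rewrite /opnorm (_ : [set _ | _ in _] = [set 0%E]) ?ereal_sup1//.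
apply/seteqP; split => [_ [f _ <-]|_ ->]; first exact: fnorm0.
by exists 0; [exact: unit_ball0|exact: fnorm0].
Qed.

Lemma opnormN T : opnorm (- T) = opnorm T.
Proof.
have E : [set fnorm ((- T) f) | f in unit_ball] =
         [set fnorm (T f) | f in unit_ball].
  by apply: eq_imagel => f _; exact: fnormN.
exact: (congr1 (fun A : set (\bar R) => ereal_sup A) E).
Qed.

Lemma opnormD T1 T2 : (opnorm (T1 + T2)%R <=
  (fock_const q)%:E * maxe (opnorm T1) (opnorm T2))%E.
Proof.
apply: ge_ereal_sup => _ [f f1 <-]; apply: (le_trans (fnormD _ _)).
have T1f : (fnorm (T1 f) <= opnorm T1)%E by apply: ereal_sup_ubound; exists f.
have T2f : (fnorm (T2 f) <= opnorm T2)%E by apply: ereal_sup_ubound; exists f.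
apply: lee_wpmul2l; first by rewrite lee_fin; exact/ltW/fock_const_gt0.
move: T1f T2f; move: (fnorm _) (fnorm _) (opnorm _) (opnorm _) => a b c d ac bd.
by rewrite ge_max !le_max ac bd orbT.
Qed.

HB.instance Definition _ := isUniform.Build (oper w p q)
  (qn_entourage_filter opnorm)
  (qn_entourage_diagonal opnorm0)
  (qn_entourage_inv opnormN)
  (qn_entourage_split (fock_const_gt0 q) opnormD).

Definition bounded_oper T : Prop :=
  exists M : R, forall f, (fnorm (T f) <= M%:E * fnorm f)%E.

Definition compact_oper T : Prop := precompact (T @` unit_ball).

(* f \o psi is replaced by 0 if it is not in the target space. *)
Definition comp_oper psi : oper w p q := fun f => insubd 0 (f \o psi).

Definition bounded_symbol psi : Prop :=
  [/\ entire psi,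
      forall f : fock w p, f \o psi \in fock_pred w q &
      bounded_oper (comp_oper psi)].

Definition comp_opers : set (oper w p q) := comp_oper @` bounded_symbol.

End operators.

Arguments comp_oper {R} w p q psi.
Arguments bounded_symbol {R} w p q psi.
Arguments comp_opers {R} w p q _.

Definition two_pos {R : realType} : {posnum R} := 2%:pos.

Section schatten.
Context {R : realType} (w : weight R).
Local Notation F2 := (fock w two_pos).
Local Notation oper2 := (oper w two_pos two_pos).

Definition inner (f g : F2) : R[i] :=
  let h (z : R[i]) :=
    f z * conjc (g z) * (expR (- 2 * w (normc z)))%:C in
  (\int[area]_z complex.Re (h (z.1 +i* z.2)))%R +i*
  (\int[area]_z complex.Im (h (z.1 +i* z.2)))%R.

Definition adjoint_of (T S : oper2) : Prop :=
  forall f g, inner (T f) g = inner f (S g).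

(* lam lists in nonincreasing order the square roots of the positive
   eigenvalues of T^* T, each repeated according to its multiplicity (the
   e n with lam n = t form an orthonormal basis of the eigenspace for t ^+ 2),
   followed by zeros if there are only finitely many of them. *)
Definition singular_values (T : oper2) (lam : nat -> R) : Prop :=
  [/\ forall n, 0 <= lam n,
      nonincreasing_seq lam &
      exists (S : oper2) (e : nat -> F2),
      [/\ adjoint_of T S,
          forall m n, 0 < lam m -> 0 < lam n ->
            inner (e m) (e n) = (m == n)%:R,
          forall n, 0 < lam n -> S (T (e n)) = (lam n ^+ 2)%:C *: e n &
          forall t f, 0 < t -> S (T f) = (t ^+ 2)%:C *: f ->
            exists (N : nat) (c : nat -> R[i]),
              f = \sum_(0 <= n < N | lam n == t) c n *: e n]].

Definition schatten (s : R) : set oper2 :=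
  [set T | compact_oper T /\ exists2 lam, singular_values T lam &
    (\sum_(0 <= n <oo) (lam n `^ s)%:E < +oo)%E].

End schatten.

Arguments schatten {R} w s _.

(* Main.v *)
From HB Require Import structures.
Require Import Defs.
From mathcomp Require Import all_boot all_order all_algebra.
From mathcomp Require Import all_classical all_reals all_analysis.
From mathcomp Require Import complex measurable_realfun ring lra zify.

(* Since tau tends to 0, the Laplacian of the weight w tends to infinity; hence w is
   convex in ln r, with derivative r w'(r) eventually above every K r^2. Evaluating
   a bounded C_psi on the monomials z^n at well chosen points shows that psi grows at
   most linearly, so that psi(z) = a z + b with |a| <= 1, and b = 0 if |a| = 1.

   If |a| < 1, then w(|a z + b|) <= w(|z|) - K |z|^2 up to a constant, and the Taylor
   coefficients of f in the unit ball are bounded so that the tails of f(a z + b) decay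
   geometrically. Hence C_psi is bounded and compact, depends continuously on the path
   t (a z + b), and everything of this kind is connected to the constant symbol 0. If
   |a| = 1 and p = q, then C_psi is an isometry; on normalised monomials it acts by a^n,
   which stays away from b^n for infinitely many n if b <> a, and C_{b z + c} f tends to
   0 on these monomials if |b| < 1. So rotations are isolated, not compact, and not
   compact modulo other composition operators.

   If p <> q there are no rotations, because F^p is not continuously embedded in F^q. For
   p < q this is seen on z^n exp(lambda z), which peaks at one point with small area; for
   q < p on lacunary sums of monomials that are everywhere bounded, and bounded below on
   average over circles, up to arbitrarily large radii.

   For p = 2 a compact difference T is a difference of contractions, and |T f| <= C k^n |f|
   with k < 1 for every f vanishing to order n. The singular vectors are obtained by
   maximising |T f| successively, and the n-th singular value is at most C k^n, since
   some combination of the first n + 1 singular vectors vanishes to order n. *)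

Set Implicit Arguments.
Unset Strict Implicit.
Unset Printing Implicit Defensive.

Import Order.TTheory GRing.Theory Num.Theory.
Import numFieldNormedType.Exports.
Import ComplexField.Normc.

Local Open Scope classical_set_scope.
Local Open Scope ring_scope.
Local Open Scope complex_scope.

(** * Complex numbers and entire functions *)

(** The modulus of [z ^+ n] times the weight lives on a ring whose area may tend to 0, stay bounded
    or tend to infinity, depending on the weight. Monomials therefore settle the shape of the
    symbols, where powers of the radius are negligible, but separate no pair of exponents; this is
    why two other families of test functions are needed. Polar coordinates are replaced by averaging
    over rotations, which leaves area integrals unchanged up to a factor and carries facts on
    circles over to the plane. Compactness is tested on coefficient sequences instead of functions:
    the unit ball is enlarged to the sequences that satisfy Cauchy's estimates against the weight.
    This set is compact for coefficientwise convergence by Tychonoff's theorem, and contractions act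
    continuously on it. For small exponents there is only a quasi-norm. Arguments by distance use
    one inequality with a maximum and the constant [fock_const]; continuity of the norm is used in
    the Hilbert space only, where the inner product supplies it. *)

Section complex_norm.
Context {R : realType}.
Implicit Types (z w : R[i]) (x y : R).

Lemma normc_ge0 z : 0 <= normc z.
Proof. by case: z => a b; exact: sqrtr_ge0. Qed.

Lemma normcX z n : normc (z ^+ n) = normc z ^+ n.
Proof. by elim: n => [|n IH]; rewrite ?expr0 ?normc1// !exprS normcM IH. Qed.

Lemma normcR x : normc x%:C = `|x|.
Proof. by rewrite /normc/= expr0n/= addr0 sqrtr_sqr. Qed.

Lemma normc_real_ge0 x : 0 <= x -> normc x%:C = x.
Proof. by move=> x0; rewrite normcR ger0_norm. Qed.

Lemma normc_eq0 z : (normc z == 0) = (z == 0).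
Proof.
by apply/eqP/eqP => [/eq0_normc//|->]; rewrite normc0.
Qed.

Lemma normc_gt0 z : (0 < normc z) = (z != 0).
Proof. by rewrite lt_neqAle normc_ge0 andbT eq_sym normc_eq0. Qed.

Lemma normc_Re z : `|complex.Re z| <= normc z.
Proof.
case: z => a b /=; rewrite -sqrtr_sqr ler_wsqrtr// lerDl sqr_ge0//.
Qed.

Lemma normc_Im z : `|complex.Im z| <= normc z.
Proof.
case: z => a b /=; rewrite -[leLHS]sqrtr_sqr ler_wsqrtr// lerDr sqr_ge0//.
Qed.

Lemma normc_leRI z : normc z <= `|complex.Re z| + `|complex.Im z|.
Proof. by case: z => a b; exact: normc_le. Qed.

Lemma normc_sum (I : Type) (r : seq I) (P : pred I) (F : I -> R[i]) :
  normc (\sum_(i <- r | P i) F i) <= \sum_(i <- r | P i) normc (F i).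
Proof.
elim/big_rec2: _ => [|i x y _ H]; first by rewrite normc0.
by apply: le_trans (normc_triangle _ _) _; rewrite lerD2l.
Qed.

Lemma normcB z w : normc (z - w) = normc (w - z).
Proof. by rewrite -normcN opprB. Qed.

Lemma ReB z w : complex.Re (z - w) = complex.Re z - complex.Re w.
Proof. by case: z w => [? ?] [? ?]. Qed.
Lemma ImB z w : complex.Im (z - w) = complex.Im z - complex.Im w.
Proof. by case: z w => [? ?] [? ?]. Qed.
Lemma ReD z w : complex.Re (z + w) = complex.Re z + complex.Re w.
Proof. by case: z w => [? ?] [? ?]. Qed.
Lemma ImD z w : complex.Im (z + w) = complex.Im z + complex.Im w.
Proof. by case: z w => [? ?] [? ?]. Qed.
Lemma complexEta z : z = complex.Re z +i* complex.Im z.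
Proof. by case: z. Qed.

Lemma normc_small0 z : (forall e, 0 < e -> normc z <= e) -> z = 0.
Proof.
move=> H; apply/eqP; rewrite -normc_eq0 eq_le normc_ge0 andbT.
by apply/ler_addgt0Pl => e e0; rewrite addr0 H.
Qed.

End complex_norm.

Section entire_eps.
Context {R : realType}.
Implicit Types (f g : R[i] -> R[i]).

(** Differentiability as an increment estimate: nothing is divided by [h] and all sizes are real
    numbers, so that products and compositions need no limits in [R[i]]. *)
Definition cderiv f (z l : R[i]) := forall e : R, 0 < e -> exists2 d : R, 0 < d &
  forall h, normc h < d -> normc (f (z + h) - f z - l * h) <= e * normc h.

Lemma entire_cderiv f : entire f <-> forall z, exists l, cderiv f z l.
Proof.
split => [ef z|ef z].
- have /cvg_ex[/= l /cvgrPdist_le fl] := ef z.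
  exists l => e e0.
  have /fl : 0 < e%:C by rewrite ltcR.
  rewrite near_withinE => /nbhs_ballP[[d d'] /=].
  rewrite ltcE /= => /andP[/eqP -> d0] dP.
  exists d => // h hd.
  have [->|h0] := eqVneq h 0.
    by rewrite addr0 subrr mulr0 subr0 normc0 mulr0.
  have := dP h; rewrite /ball/= sub0r => /(_ _ h0) H.
  have : normc (l - h^-1 * (f (h * 1 + z) - f z)) <= e.
    rewrite -lecR; apply: H.
    have : normc (-h) < d by rewrite normcN.
    by rewrite -ltcR.
  rewrite mulr1 -(ler_pM2r (x := normc h)) ?normc_gt0// -normcM.
  rewrite mulrBl mulrAC mulVf// mul1r normcB.
  by rewrite (addrC h z).
- have [l fl] := ef z; apply/cvg_ex; exists l; apply/cvgrPdist_le => -[e e'].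
  rewrite ltcE /= => /andP[/eqP -> e0].
  have [d d0 dP] := fl e e0.
  rewrite near_withinE; apply/nbhs_ballP; exists d%:C => /=; first by rewrite ltcR.
  move=> h; rewrite /ball/= sub0r => hd h0.
  have {}hd : normc h < d by rewrite -normcN -ltcR.
  have : normc (l - h^-1 * (f (h * 1 + z) - f z)) <= e; last by rewrite -lecR.
  rewrite mulr1 -(ler_pM2r (x := normc h)) ?normc_gt0// -normcM.
  rewrite mulrBl mulrAC mulVf// mul1r normcB.
  by rewrite (addrC h z); exact: dP.
Qed.

End entire_eps.

Opaque entire.

Section entire_closure.
Context {R : realType}.
Implicit Types (f g : R[i] -> R[i]).

Lemma cderiv_continuous f z l : cderiv f z l -> forall e : R, 0 < e ->
  exists2 d : R, 0 < d & forall w, normc (w - z) < d -> normc (f w - f z) < e.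
Proof.
move=> H e e0; have [d d0 dP] := H 1 ltr01.
pose M := normc l + 1.
have M0 : 0 < M by rewrite ltr_wpDl// normc_ge0.
exists (Num.min d (e / M)); first by rewrite lt_min d0 divr_gt0.
move=> w; rewrite lt_min => /andP[wd we].
have := dP _ wd; rewrite (addrC z) subrK mul1r => H1.
have -> : f w - f z = (f w - f z - l * (w - z)) + l * (w - z) by rewrite subrK.
apply: le_lt_trans (normc_triangle _ _) _; rewrite normcM.
apply: (@le_lt_trans _ _ (M * normc (w - z))).
  by rewrite mulrDl mul1r addrC lerD2l.
by rewrite -ltr_pdivlMl// mulrC.
Qed.

Lemma cderiv_cst (c z : R[i]) : cderiv (fun=> c) z 0.
Proof.
move=> e e0; exists 1 => // h _.
by rewrite subrr mul0r subr0 normc0 mulr_ge0// ?normc_ge0// ltW.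
Qed.

Lemma cderiv_id (z : R[i]) : cderiv id z 1.
Proof.
move=> e e0; exists 1 => // h _.
by rewrite (addrC z) addrK mul1r subrr normc0 mulr_ge0// ?normc_ge0// ltW.
Qed.

Lemma cderivD f g z l m : cderiv f z l -> cderiv g z m ->
  cderiv (fun z => f z + g z) z (l + m).
Proof.
move=> F G e e0; have e20 : 0 < e / 2 by rewrite divr_gt0.
have [d d0 dP] := F _ e20; have [d' d'0 d'P] := G _ e20.
exists (Num.min d d'); first by rewrite lt_min d0.
move=> h; rewrite lt_min => /andP[/dP h1 /d'P h2].
rewrite (_ : _ - _ = (f (z + h) - f z - l * h) + (g (z + h) - g z - m * h)); last by ring.
apply: le_trans (normc_triangle _ _) _.
by rewrite {1}[e]splitr mulrDl; exact: lerD.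
Qed.

Lemma cderiv_comp f g z l m : cderiv g z m -> cderiv f (g z) l ->
  cderiv (fun z => f (g z)) z (l * m).
Proof.
move=> G F e e0.
pose M := normc m + 1.
have M0 : 0 < M by rewrite ltr_wpDl// normc_ge0.
pose L := normc l + 1.
have L0 : 0 < L by rewrite ltr_wpDl// normc_ge0.
have [d d0 dP] := F (e / 2 / M) (divr_gt0 (divr_gt0 e0 (ltr0Sn _ 1)) M0).
have m0 : 0 < Num.min 1 (e / 2 / L) by rewrite lt_min ltr01 !divr_gt0.
have [d' d'0 d'P] := G _ m0.
exists (Num.min d' (d / M)); first by rewrite lt_min d'0 divr_gt0.
move=> h; rewrite lt_min => /andP[/d'P h1 h2].
pose k := g (z + h) - g z.
have gk : g (z + h) = g z + k by rewrite /k [RHS]addrC subrK.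
have km : normc (k - m * h) <= normc h.
  apply: le_trans h1 _; rewrite -[leRHS]mul1r ler_wpM2r ?normc_ge0//.
  by rewrite ge_min lexx.
have kM : normc k <= M * normc h.
  rewrite (_ : k = (k - m * h) + m * h); last by rewrite subrK.
  apply: le_trans (normc_triangle _ _) _; rewrite normcM mulrDl mul1r addrC.
  by rewrite lerD2l.
have kd : normc k < d.
  by apply: le_lt_trans kM _; rewrite -ltr_pdivlMl// mulrC.
rewrite gk (_ : _ - _ = (f (g z + k) - f (g z) - l * k) + l * (k - m * h)); last by ring.
apply: le_trans (normc_triangle _ _) _; rewrite [e]splitr mulrDl; apply: lerD.
  apply: le_trans (dP _ kd) _; rewrite -mulrA ler_wpM2l ?divr_ge0 ?(ltW e0) ?(ltW M0)//.
  by rewrite ler_pdivrMl.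
rewrite normcM; apply: (@le_trans _ _ (L * (e / 2 / L * normc h))).
  apply: ler_pM; rewrite ?normc_ge0// ?lerDl//.
  by apply: le_trans h1 _; rewrite ler_wpM2r ?normc_ge0// ge_min lexx orbT.
by rewrite mulrA [L * _]mulrC divfK ?gt_eqF.
Qed.

Lemma cderivM f g z l m : cderiv f z l -> cderiv g z m ->
  cderiv (fun z => f z * g z) z (l * g z + f z * m).
Proof.
move=> F G e e0.
(* The four error terms are at most [e / A * normc h] times [normc (g z)], [normc (f z)], 1 and
   [normc m], which add up to [A - 1]. *)
pose A := normc (f z) + normc (g z) + normc m + 2.
have A0 : 0 < A by rewrite ltr_wpDl// !addr_ge0// normc_ge0.
have [d d0 dP] := F (e / A) (divr_gt0 e0 A0).
have m0 : 0 < Num.min 1 (e / A) by rewrite lt_min ltr01 divr_gt0.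
have [d' d'0 d'P] := G _ m0.
have [d'' d''0 d''P] := cderiv_continuous F (divr_gt0 e0 A0).
exists (Num.min d (Num.min d' d'')); first by rewrite !lt_min d0 d'0.
move=> h; rewrite !lt_min => /and3P[/dP h1 /d'P h2 h3].
have := d''P (z + h); rewrite [z + h - z]addrC addKr => /(_ h3)/ltW h4.
rewrite (_ : _ - _ = (f (z + h) - f z - l * h) * g z +
  f z * (g (z + h) - g z - m * h) +
  (f (z + h) - f z) * (g (z + h) - g z - m * h) +
  (f (z + h) - f z) * (m * h)); last by ring.
have H0 := normc_ge0 h.
have h2' : normc (g (z + h) - g z - m * h) <= normc h.
  apply: le_trans h2 _; rewrite -[leRHS]mul1r ler_wpM2r//.
  by rewrite ge_min lexx.
have h2'' : normc (g (z + h) - g z - m * h) <= e / A * normc h.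
  apply: le_trans h2 _; rewrite ler_wpM2r//.
  by rewrite ge_min lexx orbT.
have eA0 : 0 <= e / A by rewrite divr_ge0// ltW.
apply: (@le_trans _ _ (e / A * normc h * normc (g z) + normc (f z) * (e / A * normc h) + e / A * normc h + e / A * (normc m * normc h))).
  apply: le_trans (normc_triangle _ _) _; apply: lerD; last first.
    by rewrite !normcM ler_pM ?mulr_ge0 ?normc_ge0.
  apply: le_trans (normc_triangle _ _) _; apply: lerD; last first.
    by rewrite !normcM ler_pM ?mulr_ge0 ?normc_ge0.
  apply: le_trans (normc_triangle _ _) _; apply: lerD.
    by rewrite !normcM ler_pM ?mulr_ge0 ?normc_ge0.
  by rewrite !normcM ler_pM ?mulr_ge0 ?normc_ge0.
rewrite (_ : _ + _ = e * normc h * ((A - 1) / A)); last by rewrite /A; ring.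
rewrite -[leRHS]mulr1 ler_wpM2l ?mulr_ge0 ?(ltW e0)//.
by rewrite ler_pdivrMr// mul1r lerBlDr lerDl.
Qed.

Lemma cderivX n (z : R[i]) : cderiv (fun z => z ^+ n) z (n%:R * z ^+ n.-1).
Proof.
elim: n => [|n IH].
  by rewrite mul0r (_ : (fun _ => _) = fun=> 1)//; exact: cderiv_cst.
have := cderivM (cderiv_id z) IH.
rewrite (_ : (fun _ => _) = fun z => z ^+ n.+1); last by apply/funext => w; rewrite exprS.
rewrite mul1r (_ : _ + _ = n.+1%:R * z ^+ n)//.
case: n {IH} => [|n]; first by rewrite expr0 mul0r mulr0 addr0 mulr1.
by rewrite mulrCA -exprS -[in LHS]mulr_natl -[in RHS]natr1 mulrDl mul1r addrC !mulr_natl.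
Qed.

Lemma entire_cst c : entire (fun=> c : R[i]).
Proof. by apply/entire_cderiv => z; exists 0; exact: cderiv_cst. Qed.

Lemma entire_id : entire (@id R[i]).
Proof. by apply/entire_cderiv => z; exists 1; exact: cderiv_id. Qed.

Lemma entireD f g : entire f -> entire g -> entire (fun z => f z + g z).
Proof.
move=> /entire_cderiv F /entire_cderiv G; apply/entire_cderiv => z.
by have [l] := F z; have [m] := G z => ? ?; exists (l + m); exact: cderivD.
Qed.

Lemma entireM f g : entire f -> entire g -> entire (fun z => f z * g z).
Proof.
move=> /entire_cderiv F /entire_cderiv G; apply/entire_cderiv => z.
have [l] := F z; have [m] := G z => ? ?; exists (l * g z + f z * m); exact: cderivM.
Qed.

Lemma entire_comp f g : entire f -> entire g -> entire (fun z => f (g z)).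
Proof.
move=> /entire_cderiv F /entire_cderiv G; apply/entire_cderiv => z.
have [m Gm] := G z; have [l Fl] := F (g z); exists (l * m); exact: cderiv_comp.
Qed.

Lemma entireX n : entire (fun z : R[i] => z ^+ n).
Proof. by apply/entire_cderiv => z; eexists; exact: cderivX. Qed.

Lemma entire_affine (a b : R[i]) : entire (fun z => a * z + b).
Proof.
by apply: entireD; [apply: entireM; [exact: entire_cst|exact: entire_id]|exact: entire_cst].
Qed.

Lemma entireB f g : entire f -> entire g -> entire (fun z => f z - g z).
Proof.
move=> F G; rewrite (_ : (fun _ => _) = fun z => f z + (-1 : R[i]) * g z).
  by apply: entireD F _; apply: entireM G; exact: entire_cst.
by apply/funext => z; rewrite mulN1r.
Qed.

Lemma entire_sum n (F : nat -> R[i] -> R[i]) : (forall k, entire (F k)) ->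
  entire (fun z => \sum_(k < n) F k z).
Proof.
move=> H; elim: n => [|n IH].
  rewrite (_ : (fun _ => _) = fun=> 0); first exact: entire_cst.
  by apply/funext => z; rewrite big_ord0.
rewrite (_ : (fun _ => _) = fun z => (\sum_(k < n) F k z) + F n z).
  exact (entireD IH (H n)).
by apply/funext => z; rewrite big_ord_recr.
Qed.

Lemma entire_continuous f : entire f -> forall z (e : R), 0 < e ->
  exists2 d : R, 0 < d & forall w, normc (w - z) < d -> normc (f w - f z) < e.
Proof. by move=> /entire_cderiv + z => /(_ z)[l] /cderiv_continuous. Qed.

End entire_closure.

Arguments entire_cst {R} c.
Arguments entire_id {R}.
Arguments entireX {R} n.
Arguments entire_affine {R} a b.

(** * Absolutely convergent series of complex numbers *)

Section complex_series.
Context {R : realType}.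
Implicit Types (u v : nat -> R[i]) (l : R[i]).

Definition cvgc u l := forall e : R, 0 < e ->
  exists N, forall n, (N <= n)%N -> normc (u n - l) <= e.

Lemma cvgc_unique u l l' : cvgc u l -> cvgc u l' -> l = l'.
Proof.
move=> ul ul'; apply/eqP; rewrite -subr_eq0; apply/eqP/normc_small0 => e e0.
have [N NP] := ul _ (divr_gt0 e0 (ltr0Sn _ 1)).
have [N' N'P] := ul' _ (divr_gt0 e0 (ltr0Sn _ 1)).
have := NP (maxn N N') (leq_maxl _ _); rewrite normcB => H1.
have H2 := N'P (maxn N N') (leq_maxr _ _).
rewrite [e]splitr (_ : l - l' = (l - u (maxn N N')) + (u (maxn N N') - l')); last by ring.
by apply: le_trans (normc_triangle _ _) _; exact: lerD.
Qed.

Lemma cvgcD u v l l' : cvgc u l -> cvgc v l' -> cvgc (fun n => u n + v n) (l + l').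
Proof.
move=> ul ul' e e0; have [N NP] := ul _ (divr_gt0 e0 (ltr0Sn _ 1)).
have [N' N'P] := ul' _ (divr_gt0 e0 (ltr0Sn _ 1)).
exists (maxn N N') => n; rewrite geq_max => /andP[/NP h1 /N'P h2].
rewrite [e]splitr (_ : _ - _ = (u n - l) + (v n - l')); last by ring.
by apply: le_trans (normc_triangle _ _) _; exact: lerD.
Qed.

Lemma cvgcZ c u l : cvgc u l -> cvgc (fun n => c * u n) (c * l).
Proof.
move=> ul e e0; have c0 : 0 < normc c + 1 by rewrite ltr_wpDl// normc_ge0.
have [N NP] := ul _ (divr_gt0 e0 c0); exists N => n /NP H.
rewrite -mulrBr normcM; apply: (@le_trans _ _ ((normc c + 1) * (e / (normc c + 1)))).
  by apply: ler_pM => //; rewrite ?normc_ge0// lerDl.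
by rewrite mulrC divfK ?gt_eqF.
Qed.

Lemma cvgc_shift u l k : cvgc u l -> cvgc (fun n => u (n + k)%N) l.
Proof.
move=> ul e /ul[N NP]; exists N => n Nn; apply: NP.
by rewrite (leq_trans Nn)// leq_addr.
Qed.

Lemma cvgc_le u l (B : R) N : cvgc u l -> (forall n, (N <= n)%N -> normc (u n) <= B) ->
  normc l <= B.
Proof.
move=> ul uB; apply/ler_addgt0Pl => e e0; have [M MP] := ul _ e0.
have := MP (maxn M N) (leq_maxl _ _); rewrite normcB => H1.
have := uB (maxn M N) (leq_maxr _ _) => H2.
rewrite -(subrK (u (maxn M N)) l).
by apply: le_trans (normc_triangle _ _) _; exact: lerD.
Qed.

Lemma cvgc_cst l : cvgc (fun=> l) l.
Proof. by move=> e e0; exists 0%N => n _; rewrite subrr normc0 ltW. Qed.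

Definition partial u n : R[i] := \sum_(m < n) u m.

(** Real and imaginary parts separately, to use limits of real sequences; the value is the sum only
    if [u] is [summable]. *)
Definition csum u : R[i] :=
  limn (fun n => complex.Re (partial u n)) +i* limn (fun n => complex.Im (partial u n)).

Definition summable u := exists B : R, forall n, \sum_(m < n) normc (u m) <= B.

Lemma partialS u n : partial u n.+1 = partial u n + u n.
Proof. by rewrite /partial big_ord_recr. Qed.

Lemma summable_real_cvg (v : nat -> R) (B : R) :
  (forall n, \sum_(m < n) `|v m| <= B) -> cvgn (fun n => \sum_(m < n) v m).
Proof.
move=> vB; rewrite (_ : (fun n => _) = series v); last first.
  by apply/funext => n; rewrite /series/= big_mkord.
apply: normed_cvg; apply: nondecreasing_is_cvgn.
  by apply: nondecreasing_series => // n _; rewrite normr_ge0.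
by exists B => _ [n _ <-]; have := vB n; rewrite -(big_mkord xpredT (fun m => `|v m|)).
Qed.

Lemma summable_cvg u : summable u -> cvgc (partial u) (csum u).
Proof.
move=> [B uB] e e0.
have e2 : 0 < e / 2 by rewrite divr_gt0.
have H1 : cvgn (fun n => complex.Re (partial u n)).
  rewrite (_ : (fun n => _) = fun n => \sum_(m < n) complex.Re (u m)).
    apply: (@summable_real_cvg (fun m => complex.Re (u m)) B) => n; apply: le_trans (uB n).
    by apply: ler_sum => m _; exact: normc_Re.
  apply/funext => n; rewrite /partial; elim: n => [|n IH]; first by rewrite !big_ord0.
  by rewrite !big_ord_recr/= ReD IH.
have H2 : cvgn (fun n => complex.Im (partial u n)).
  rewrite (_ : (fun n => _) = fun n => \sum_(m < n) complex.Im (u m)).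
    apply: (@summable_real_cvg (fun m => complex.Im (u m)) B) => n; apply: le_trans (uB n).
    by apply: ler_sum => m _; exact: normc_Im.
  apply/funext => n; rewrite /partial; elim: n => [|n IH]; first by rewrite !big_ord0.
  by rewrite !big_ord_recr/= ImD IH.
move/cvgrPdist_le : H1 => /(_ _ e2)[N1 _ N1P].
move/cvgrPdist_le : H2 => /(_ _ e2)[N2 _ N2P].
exists (maxn N1 N2) => n; rewrite geq_max => /andP[n1 n2].
apply: le_trans (normc_leRI _) _; rewrite ReB ImB/= [e]splitr.
by apply: lerD; rewrite distrC; [exact: N1P|exact: N2P].
Qed.

Lemma csum_eq u l : summable u -> cvgc (partial u) l -> csum u = l.
Proof. by move=> /summable_cvg h1 h2; exact: cvgc_unique h1 h2. Qed.

Lemma summableW u (v : nat -> R) : (forall m, normc (u m) <= v m) ->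
  (exists B : R, forall n, \sum_(m < n) v m <= B) -> summable u.
Proof.
move=> uv [B vB]; exists B => n; apply: le_trans (vB n).
by apply: ler_sum => m _.
Qed.

Lemma geo_sum (C k : R) n : 0 <= C -> 0 <= k < 1 ->
  \sum_(m < n) C * k ^+ m <= C / (1 - k).
Proof.
move=> C0 /andP[k0 k1]; rewrite -mulr_sumr ler_wpM2l//.
rewrite -(mulr1 (1 - k)^-1) ler_pdivlMl ?subr_gt0//.
rewrite -opprB mulNr -subrX1 opprB gerBl exprn_ge0//.
Qed.

Lemma geo_summable u (C k : R) : 0 <= C -> 0 <= k < 1 ->
  (forall m, normc (u m) <= C * k ^+ m) -> summable u.
Proof.
move=> C0 k01 uC; apply: summableW uC _; exists (C / (1 - k)) => n.
exact: geo_sum.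
Qed.

Lemma csum_le u (B : R) : (forall n, \sum_(m < n) normc (u m) <= B) ->
  normc (csum u) <= B.
Proof.
move=> uB; apply: (@cvgc_le (partial u) _ _ 0).
  by apply: summable_cvg; exists B.
by move=> n _; apply: le_trans (uB n); exact: normc_sum.
Qed.

Lemma csum_tail u n (B : R) :
  (forall k, \sum_(m < k) normc (u (m + n)%N) <= B) ->
  normc (csum u - partial u n) <= B.
Proof.
move=> uB.
have su : summable u.
  exists (\sum_(m < n) normc (u m) + B) => k.
  apply: (@le_trans _ _ (\sum_(m < n + k) normc (u m))).
    rewrite -!(big_mkord xpredT (fun m => normc (u m))).
    rewrite (big_cat_nat (leq0n _) (leq_addl n k))/= lerDl.
    by apply: sumr_ge0 => ? _; exact: normc_ge0.
  rewrite big_split_ord/= lerD2l.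
  by under eq_bigr do rewrite addnC; exact: uB.
have H : cvgc (fun k => partial u (k + n) + - partial u n) (csum u - partial u n).
  by apply: cvgcD; [exact: (cvgc_shift (u := partial u)) (summable_cvg su)|exact: cvgc_cst].
apply: (cvgc_le (N := 0) H) => k _; apply: le_trans (uB k).
rewrite (_ : _ + _ = \sum_(m < k) u (m + n)%N); first exact: normc_sum.
rewrite /partial addnC big_split_ord/= addrAC subrr add0r.
by apply: eq_bigr => i _; rewrite addnC.
Qed.

Lemma geo_tail u (C k : R) n : 0 <= C -> 0 <= k < 1 ->
  (forall m, normc (u m) <= C * k ^+ m) ->
  normc (csum u - partial u n) <= C / (1 - k) * k ^+ n.
Proof.
move=> C0 k01 uC; apply: csum_tail => j.
apply: (@le_trans _ _ (\sum_(m < j) (C * k ^+ n) * k ^+ m)).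
  apply: ler_sum => m _; apply: le_trans (uC _) _.
  by rewrite exprD mulrA mulrAC.
apply: le_trans (geo_sum _ _ k01) _; last by rewrite mulrAC.
by case/andP: k01 => k0 _; rewrite mulr_ge0// exprn_ge0.
Qed.

Lemma csumD u v : summable u -> summable v ->
  csum (fun m => u m + v m) = csum u + csum v.
Proof.
move=> [B uB] [B' vB]; apply: csum_eq.
  exists (B + B') => n; apply: le_trans (lerD (uB n) (vB n)).
  by rewrite -big_split/=; apply: ler_sum => m _; exact: normc_triangle.
rewrite (_ : partial _ = fun n => partial u n + partial v n).
  by apply: cvgcD; apply: summable_cvg; [exists B|exists B'].
by apply/funext => n; rewrite /partial big_split.
Qed.

Lemma csumZ c u : summable u -> csum (fun m => c * u m) = c * csum u.
Proof.
move=> [B uB]; apply: csum_eq.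
  exists (normc c * B) => n.
  apply: (@le_trans _ _ (normc c * (\sum_(m < n) normc (u m)))).
    by rewrite mulr_sumr; apply: ler_sum => m _; rewrite normcM.
  by rewrite ler_wpM2l ?normc_ge0.
rewrite (_ : partial _ = fun n => c * partial u n).
  by apply: cvgcZ; apply: summable_cvg; exists B.
by apply/funext => n; rewrite /partial mulr_sumr.
Qed.

End complex_series.

(** * Power series with infinite radius of convergence *)

Section power_series.
Context {R : realType}.
Implicit Types (a : nat -> R[i]).

(** The coefficients decay faster than every geometric sequence, that is, the radius of convergence
    is infinite. *)
Definition rapid a := forall r : R, 0 < r ->
  exists2 C : R, 0 <= C & forall m, normc (a m) * r ^+ m <= C.

Definition psum a z := csum (fun m => a m * z ^+ m).

Lemma rapid_geo a (r k : R) : rapid a -> 0 <= r -> 0 < k ->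
  exists2 C : R, 0 <= C & forall m, normc (a m) * r ^+ m <= C * k ^+ m.
Proof.
move=> ra r0 k0.
(* The radius [r / k] would give the bound, but [rapid] asks for a positive one; hence [r + 1]. *)
have r10 : 0 < (r + 1) / k by rewrite divr_gt0// ltr_wpDl.
have [C C0 CP] := ra _ r10; exists C => // m.
rewrite -ler_pdivrMr ?exprn_gt0// -mulrA -expr_div_n; apply: le_trans (CP m).
rewrite ler_wpM2l ?normc_ge0//; apply: lerXn2r; rewrite ?nnegrE ?divr_ge0 ?(ltW k0)//.
  by rewrite addr_ge0.
by rewrite ler_wpM2r ?invr_ge0 ?(ltW k0)// lerDl.
Qed.

Lemma rapid_summable a z : rapid a -> summable (fun m => a m * z ^+ m).
Proof.
move=> ra; have h2 : 0 < 2^-1 :> R by rewrite invr_gt0.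
have [C C0 CP] := rapid_geo ra (normc_ge0 z) h2.
apply: (@geo_summable _ _ C 2^-1) => //.
  by rewrite ltW//= invf_lt1// ltr1n.
by move=> m; rewrite normcM normcX.
Qed.

(** In the step from [m] to [m.+1] the remainder is multiplied by [z + h], and the only new term is
    [m%:R * z ^+ m.-1 * h ^+ 2]. The factor [m * m] is a convenient bound for the binomial
    coefficient of order 2. *)
Lemma powD_bound (z h : R[i]) (r : R) m : normc z <= r -> 1 <= r -> normc (z + h) <= r ->
  normc ((z + h) ^+ m - z ^+ m - m%:R * z ^+ m.-1 * h) <= (m * m)%:R * r ^+ m * normc h ^+ 2.
Proof.
move=> zr r1 hr; have r0 : 0 <= r by exact: le_trans r1.
elim: m => [|m IH]; first by rewrite !expr0 subrr !mul0r subrr normc0.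
have -> : (z + h) ^+ m.+1 - z ^+ m.+1 - m.+1%:R * z ^+ m * h =
  (z + h) * ((z + h) ^+ m - z ^+ m - m%:R * z ^+ m.-1 * h) + m%:R * z ^+ m.-1 * h ^+ 2.
  case: m {IH} => [|m] /=; first by rewrite !expr0 !expr1; ring.
  by rewrite !exprS -!natr1; ring.
apply: le_trans (normc_triangle _ _) _.
rewrite normcM [normc (_ * h ^+ 2)]normcM (normcX h) [normc (_%:R * _)]normcM normcX.
apply: (@le_trans _ _ (r * ((m * m)%:R * r ^+ m * normc h ^+ 2) + m%:R * r ^+ m * normc h ^+ 2)).
  apply: lerD; first by apply: ler_pM => //; rewrite normc_ge0.
  rewrite ler_wpM2r ?exprn_ge0 ?normc_ge0//.
  have -> : normc (m%:R : R[i]) = m%:R.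
    by rewrite (_ : m%:R = (m%:R : R)%:C) ?normc_real_ge0// rmorph_nat.
  rewrite ler_wpM2l//; apply: (@le_trans _ _ (r ^+ m.-1)).
    by apply: lerXn2r; rewrite ?nnegrE ?normc_ge0.
  by apply: ler_weXn2l => //; exact: leq_pred.
have := exprn_ge0 2 (normc_ge0 h); move: (normc h ^+ 2) => H H0.
rewrite (_ : _ + _ = ((m * m)%:R * r ^+ m.+1 + m%:R * r ^+ m) * H); last by rewrite exprS; ring.
rewrite ler_wpM2r//.
apply: (@le_trans _ _ ((m * m)%:R * r ^+ m.+1 + m%:R * r ^+ m.+1)).
  by rewrite lerD2l ler_wpM2l//; apply: ler_weXn2l.
by rewrite -mulrDl ler_wpM2r ?exprn_ge0// -natrD ler_nat; lia.
Qed.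

Lemma sqr_le_4X m : (m * m <= 4 ^ m)%N.
Proof.
rewrite (_ : 4 = 2 * 2)%N// expnMn leq_mul// ltnW// ltn_expl//.
Qed.

(** Termwise differentiation: by [powD_bound] the total remainder is at most a constant times
    [normc h ^+ 2]. Decay like [8^-1 ^+ m] outweighs [m * m <= 4 ^ m] and leaves a geometric series
    of ratio one half. *)
Lemma psum_entire a : rapid a -> entire (psum a).
Proof.
move=> ra; apply/entire_cderiv => z.
pose l := csum (fun m => m%:R * a m * z ^+ m.-1); exists l.
pose r := normc z + 1.
have r1 : 1 <= r by rewrite lerDr normc_ge0.
have r0 : 0 < r by rewrite (lt_le_trans ltr01).
have h8 : 0 < 8^-1 :> R by rewrite invr_gt0.
have [C C0 CP] := rapid_geo ra (ltW r0) h8.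
have CP2 m : (m * m)%:R * (normc (a m) * r ^+ m) <= C * 2^-1 ^+ m.
  apply: (@le_trans _ _ ((4 ^ m)%:R * (C * 8^-1 ^+ m))).
    by apply: ler_pM => //; rewrite ?mulr_ge0 ?normc_ge0 ?exprn_ge0 ?(ltW r0)// ler_nat sqr_le_4X.
  rewrite natrX mulrCA ler_wpM2l// -exprMn.
  by rewrite (_ : 4%:R * 8^-1 = 2^-1 :> R)//; field.
have half : 0 <= (2^-1 : R) < 1 by rewrite invr_ge0 ler0n invf_lt1 ?ltr1n.
have sl : summable (fun m => m%:R * a m * z ^+ m.-1).
  apply: (geo_summable C0 half) => m; rewrite !normcM normcX.
  have -> : normc (m%:R : R[i]) = m%:R.
    by rewrite (_ : m%:R = (m%:R : R)%:C) ?normc_real_ge0// rmorph_nat.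
  apply: le_trans (CP2 m); rewrite -mulrA; apply: ler_pM => //.
  - by rewrite mulr_ge0 ?normc_ge0 ?exprn_ge0 ?normc_ge0.
  - by rewrite ler_nat; case: m => // m; rewrite leq_pmulr.
  - rewrite ler_wpM2l ?normc_ge0//.
    apply: (@le_trans _ _ (r ^+ m.-1)).
      by apply: lerXn2r; rewrite ?nnegrE ?normc_ge0 ?lerDl ?(ltW r0).
    by apply: ler_weXn2l => //; exact: leq_pred.
move=> e e0; exists (Num.min 1 (e / (C / (1 - 2^-1) + 1))).
  rewrite lt_min ltr01 divr_gt0// ltr_wpDl// divr_ge0// subr_ge0.
  by case/andP: half => _ /ltW.
move=> h; rewrite lt_min => /andP[h1 h2].
have -> : psum a (z + h) - psum a z - l * h =
  csum (fun m => a m * ((z + h) ^+ m - z ^+ m - m%:R * z ^+ m.-1 * h)).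
  have s1 := rapid_summable (z + h) ra; have s2 := rapid_summable z ra.
  apply/esym/csum_eq.
    apply: (@geo_summable _ _ (C * normc h ^+ 2) 2^-1) => //.
      by rewrite mulr_ge0// exprn_ge0// normc_ge0.
    move=> m; rewrite normcM [leRHS]mulrAC.
    apply: le_trans (ler_wpM2r (exprn_ge0 2 (normc_ge0 h)) (CP2 m)).
    rewrite [(m * m)%:R * _]mulrCA -[leRHS]mulrA -[in leRHS]mulrA ler_wpM2l ?normc_ge0// [leRHS]mulrA.
    apply: powD_bound => //; first by rewrite lerDl.
    by apply: le_trans (normc_triangle _ _) _; rewrite lerD2l ltW.
  rewrite (_ : partial _ = fun n => partial (fun m => a m * (z + h) ^+ m) n +
    (-1) * partial (fun m => a m * z ^+ m) n +
    (- h) * partial (fun m => m%:R * a m * z ^+ m.-1) n); last first.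
    apply/funext => n; rewrite /partial !mulr_sumr -!big_split/=.
    by apply: eq_bigr => m _; ring.
  rewrite (_ : _ - _ - _ = psum a (z + h) + (-1) * psum a z + (- h) * l); last by rewrite mulN1r mulNr [l * h]mulrC.
  by apply: cvgcD; [apply: cvgcD; [|apply: cvgcZ]|apply: cvgcZ]; exact: summable_cvg.
apply: (@le_trans _ _ (C * normc h ^+ 2 / (1 - 2^-1))).
  apply: csum_le => n; apply: le_trans (geo_sum n _ half); last first.
    by rewrite mulr_ge0// exprn_ge0// normc_ge0.
  apply: ler_sum => m _; rewrite normcM [leRHS]mulrAC.
  apply: le_trans (ler_wpM2r (exprn_ge0 2 (normc_ge0 h)) (CP2 m)).
  rewrite [(m * m)%:R * _]mulrCA -[leRHS]mulrA -[in leRHS]mulrA ler_wpM2l ?normc_ge0// [leRHS]mulrA.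
  apply: powD_bound => //; first by rewrite lerDl.
  by apply: le_trans (normc_triangle _ _) _; rewrite lerD2l ltW.
rewrite mulrAC expr2 mulrA ler_wpM2r ?normc_ge0//.
have D0 : 0 < C / (1 - 2^-1) + 1.
  by rewrite ltr_wpDl// divr_ge0// subr_ge0; case/andP: half => _ /ltW.
move: h2; rewrite ltr_pdivlMr// => /ltW; apply: le_trans.
by rewrite mulrDr mulr1 [normc h * _]mulrC lerDl normc_ge0.
Qed.

End power_series.

(** * The complex exponential *)

Section complex_exponential.
Context {R : realType}.
Implicit Types (z : R[i]).

Definition cexp z : R[i] :=
  (expR (complex.Re z) * cos (complex.Im z)) +i* (expR (complex.Re z) * sin (complex.Im z)).

Lemma cexpD z w : cexp (z + w) = cexp z * cexp w.
Proof.
case: z w => [a b] [c d]; apply/eqP; rewrite eq_complex/=.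
rewrite expRD cosD sinD; apply/andP; split; apply/eqP; ring.
Qed.

Lemma normc_cexp z : normc (cexp z) = expR (complex.Re z).
Proof.
rewrite /normc/= !exprMn -mulrDr cos2Dsin2 mulr1 sqrtr_sqr ger0_norm//; exact: expR_ge0.
Qed.

Lemma cexp0 : cexp 0 = 1.
Proof. by rewrite /cexp/= expR0 cos0 sin0 mul1r mulr0. Qed.

Lemma real_deriv_eps (f : R -> R) (x l : R) : is_derive x 1 f l ->
  forall e : R, 0 < e -> exists2 d : R, 0 < d &
  forall t : R, `|t| < d -> `|f (x + t) - f x - l * t| <= e * `|t|.
Proof.
move=> [df <-] e e0.
have /cvgrPdist_le/(_ _ e0) : h^-1 *: (f (h *: 1 + x) - f x) @[h --> 0^'] --> 'D_1 f x by exact: df.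
rewrite near_withinE => /nbhs_ballP[d /= d0 dP]; exists d => // t td.
have [->|t0] := eqVneq t 0; first by rewrite addr0 subrr mulr0 subr0 normr0 mulr0.
have := dP t; rewrite /ball/= sub0r normrN => /(_ td t0).
rewrite -(ler_pM2r (x := `|t|)) ?normr_gt0// -normrM.
rewrite mulrBl {2}/GRing.scale/= mulrAC mulVf// mul1r distrC.
by rewrite mulr1 (addrC t x).
Qed.

(** The functional equation reduces the claim to the origin, where it follows from the derivatives
    of [expR], [cos] and [sin]. *)
Lemma cderiv_cexp z : cderiv cexp z (cexp z).
Proof.
suff H0 : cderiv cexp 0 1.
  move=> e e0; have c0 : 0 < normc (cexp z) by rewrite normc_cexp expR_gt0.
  have [d d0 dP] := H0 _ (divr_gt0 e0 c0); exists d => // h /dP.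
  rewrite add0r cexp0 mul1r => H; rewrite cexpD.
  rewrite (_ : _ - _ = cexp z * (cexp h - 1 - h)); last by ring.
  rewrite normcM; apply: le_trans (ler_wpM2l (ltW c0) H) _.
  by rewrite mulrA [normc _ * _]mulrC divfK ?gt_eqF.
(* In units of [e / 10 * n] the real part costs at most 4 and the imaginary part at most 5. The
   minimum with 1 keeps [expR x] below 3. *)
move=> e e0; have e8 : 0 < Num.min 1 (e / 10) by rewrite lt_min ltr01 divr_gt0.
have := real_deriv_eps (is_derive_expR (0 : R)) e8.
have := real_deriv_eps (is_derive_cos (0 : R)) e8.
have := real_deriv_eps (is_derive_sin (0 : R)) e8.
rewrite sin0 cos0 expR0 oppr0; set e' := Num.min _ _.
move=> [d1 d10 d1P] [d2 d20 d2P] [d3 d30 d3P].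
exists (Num.min (Num.min 1 (e / 10)) (Num.min d1 (Num.min d2 d3))).
  by rewrite !lt_min d10 d20 d30 ltr01 divr_gt0.
move=> [x y]; rewrite !lt_min => /andP[/andP[n1 ne] /and3P[n2 n3 n4]].
set n := normc _ in n1 ne n2 n3 n4 *.
have xn : `|x| <= n by exact: (normc_Re (x +i* y)).
have yn : `|y| <= n by exact: (normc_Im (x +i* y)).
have := d1P _ (le_lt_trans yn n2); rewrite add0r addr0 mul1r => A1.
have := d2P _ (le_lt_trans yn n3); rewrite add0r mul0r subr0 => A2.
have := d3P _ (le_lt_trans xn n4); rewrite add0r mul1r => A3.
have e'0 : 0 <= e' by exact: ltW.
have e'1 : e' <= 1 by rewrite ge_min lexx.
have e'8 : e' <= e / 10 by rewrite ge_min lexx orbT.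
have A4 : `|expR x - 1| <= 2 * n.
  rewrite -(subrK x (expR x - 1)); apply: le_trans (ler_normD _ _) _.
  rewrite mulr_natl mulr2n; apply: lerD => //; apply: le_trans A3 _.
  by rewrite -[leRHS]mul1r; apply: ler_pM => //.
have A5 : expR x <= 3.
  rewrite -(subrK 1 (expR x)); apply: (@le_trans _ _ (`|expR x - 1| + 1)).
    by rewrite lerD2r ler_norm.
  by rewrite (_ : 3 = 2 * 1 + 1); [rewrite lerD2r; apply: le_trans A4 _; rewrite ler_wpM2l// ltW|ring].
rewrite add0r cexp0 mul1r; apply: le_trans (normc_leRI _) _; rewrite /= oppr0 !addr0.
have n0 : 0 <= n by exact: normc_ge0.
have en0 : 0 <= e / 10 * n by rewrite mulr_ge0 ?divr_ge0 ?(ltW e0).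
have -> : e * n = e / 10 * n * 5 + e / 10 * n * 5 by field.
have B1 : e' * `|x| <= e / 10 * n by apply: ler_pM.
have B2 : e' * `|y| <= e / 10 * n by apply: ler_pM.
apply: lerD.
- rewrite (_ : _ - _ - _ = (expR x - 1 - x) + expR x * (cos y - 1)); last by ring.
  apply: le_trans (ler_normD _ _) _; rewrite normrM (ger0_norm (expR_ge0 _)).
  have : expR x * `|cos y - 1| <= 3 * (e / 10 * n).
    by apply: ler_pM; [exact: expR_ge0|exact: normr_ge0|exact: A5|exact: le_trans A2 B2].
  have := le_trans A3 B1; lra.
- rewrite (_ : _ - _ = expR x * (sin y - y) + (expR x - 1) * y); last by ring.
  apply: le_trans (ler_normD _ _) _; rewrite !normrM (ger0_norm (expR_ge0 _)).
  have : expR x * `|sin y - y| <= 3 * (e / 10 * n).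
    by apply: ler_pM; [exact: expR_ge0|exact: normr_ge0|exact: A5|exact: le_trans A1 B2].
  have : `|expR x - 1| * `|y| <= 2 * n * (e / 10) by apply: ler_pM => //; apply: le_trans yn (ltW _).
  lra.
Qed.

Lemma cexp_entire : entire cexp.
Proof. by apply/entire_cderiv => z; eexists; exact: cderiv_cexp. Qed.

End complex_exponential.

(** * Goursat's theorem and Taylor coefficients *)

Section complex_integral.
Context {R : realType}.
Local Notation mu := (@lebesgue_measure R).
Implicit Types (f g : R -> R) (h k : R -> R[i]) (a b c : R).

Definition rint a b f : R := (\int[mu]_(x in `[a, b]) f x)%R.

Lemma cont_integrable f a b : continuous f ->
  mu.-integrable `[a, b] (EFin \o f).
Proof.
move=> cf; apply: continuous_compact_integrable; first exact: segment_compact.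
exact: continuous_subspaceT.
Qed.

Lemma rintD a b f g : continuous f -> continuous g ->
  rint a b (fun x => f x + g x) = rint a b f + rint a b g.
Proof. by move=> cf cg; rewrite /rint RintegralD//; exact: cont_integrable. Qed.

Lemma rintZ a b r f : continuous f -> rint a b (fun x => r * f x) = r * rint a b f.
Proof. by move=> cf; rewrite /rint RintegralZl//; exact: cont_integrable. Qed.

Lemma rint_cst a b r : a <= b -> rint a b (fun=> r) = r * (b - a).
Proof.
move=> ab; rewrite /rint Rintegral_cst//= lebesgue_measure_itv/= lte_fin.
by have [//|ba|->] := ltgtP a b; [move: ab; rewrite leNgt ba|rewrite subrr].
Qed.

Lemma rint_split a b c f : a <= c -> c <= b -> continuous f ->
  rint a b f = rint a c f + rint c b f.
Proof.
move=> ac cb cf; apply/eqP; rewrite addrC -subr_eq; apply/eqP; rewrite /rint.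
rewrite Rintegral_itvB ?bnd_simp//; last exact: cont_integrable.
rewrite Rintegral_itv_obnd_cbnd//; apply: integrableS (cont_integrable c b cf) => //.
by apply: subset_itvr; rewrite bnd_simp.
Qed.

Lemma rint_le a b f g : continuous f -> continuous g ->
  (forall x, a <= x <= b -> f x <= g x) -> rint a b f <= rint a b g.
Proof.
move=> cf cg fg; apply: le_Rintegral => //; first [exact: cont_integrable|move=> x; rewrite /= in_itv/=; exact: fg].
Qed.

Lemma rint_norm a b f : continuous f -> `|rint a b f| <= rint a b (fun x => `|f x|).
Proof. by move=> cf; apply: le_normr_Rintegral => //; exact: cont_integrable. Qed.

Lemma rint_bound a b f M : a <= b -> continuous f ->
  (forall x, a <= x <= b -> `|f x| <= M) -> `|rint a b f| <= M * (b - a).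
Proof.
move=> ab cf fM; apply: le_trans (rint_norm _ _ cf) _.
rewrite -rint_cst//; apply: rint_le => //; last by move=> x; exact: cst_continuous.
by move=> x; apply: continuous_comp; [exact: cf|exact: norm_continuous].
Qed.

Lemma eq_rint a b f g : (forall x, a <= x <= b -> f x = g x) -> rint a b f = rint a b g.
Proof.
by move=> fg; apply: eq_Rintegral => x; rewrite inE/= in_itv/=; exact: fg.
Qed.

Definition ccont h := forall x (e : R), 0 < e -> exists2 d : R, 0 < d &
  forall y, `|y - x| < d -> normc (h y - h x) < e.

Lemma ccont_Re h : ccont h -> continuous (fun x => complex.Re (h x)).
Proof.
move=> ch x; apply/cvgrPdist_lt => e e0; have [d d0 dP] := ch x _ e0.
apply/nbhs_ballP; exists d => // y; rewrite /ball/= distrC => /dP.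
by apply: le_lt_trans; rewrite distrC -ReB; exact: normc_Re.
Qed.

Lemma ccont_Im h : ccont h -> continuous (fun x => complex.Im (h x)).
Proof.
move=> ch x; apply/cvgrPdist_lt => e e0; have [d d0 dP] := ch x _ e0.
apply/nbhs_ballP; exists d => // y; rewrite /ball/= distrC => /dP.
by apply: le_lt_trans; rewrite distrC -ImB; exact: normc_Im.
Qed.

Lemma ccont_normc h : ccont h -> continuous (fun x => normc (h x)).
Proof.
move=> ch x; apply/cvgrPdist_lt => e e0; have [d d0 dP] := ch x _ e0.
apply/nbhs_ballP; exists d => // y; rewrite /ball/= distrC => /dP.
by apply: le_lt_trans; rewrite distrC; exact: normc_dist.
Qed.

Definition cint a b h : R[i] :=
  rint a b (fun x => complex.Re (h x)) +i* rint a b (fun x => complex.Im (h x)).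

Lemma ccontD h k : ccont h -> ccont k -> ccont (fun x => h x + k x).
Proof.
move=> H K x e e0; have e20 : 0 < e / 2 by rewrite divr_gt0.
have [d d0 dP] := H x _ e20; have [d' d'0 d'P] := K x _ e20.
exists (Num.min d d'); first by rewrite lt_min d0.
move=> y; rewrite lt_min => /andP[/dP h1 /d'P h2].
rewrite (_ : _ - _ = (h y - h x) + (k y - k x)); last by ring.
apply: le_lt_trans (normc_triangle _ _) _.
by rewrite [e]splitr; exact: ltrD.
Qed.

Lemma ccontZ z h : ccont h -> ccont (fun x => z * h x).
Proof.
move=> H x e e0; have c0 : 0 < normc z + 1 by rewrite ltr_wpDl// normc_ge0.
have [d d0 dP] := H x _ (divr_gt0 e0 c0).
exists d => // y /dP; rewrite ltr_pdivlMr// => H1.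
rewrite -mulrBr normcM; apply: le_lt_trans H1.
by rewrite mulrC ler_wpM2l ?normc_ge0// lerDl.
Qed.

Lemma ccont_comp (f : R[i] -> R[i]) h : entire f -> ccont h -> ccont (fun x => f (h x)).
Proof.
move=> ef H x e e0; have [d d0 dP] := entire_continuous ef (h x) e0.
by have [d' d'0 d'P] := H x _ d0; exists d' => // y /d'P /dP.
Qed.

Lemma ccont_cst z : ccont (fun=> z).
Proof. by move=> x e e0; exists 1 => // y _; rewrite subrr normc0. Qed.

Lemma ccont_x (y : R) : ccont (fun x => x +i* y).
Proof.
move=> x e e0; exists e => // x' H.
rewrite (_ : _ - _ = (x' - x)%:C) ?normcR//.
by apply/eqP; rewrite eq_complex/= !eqxx subrr eqxx.
Qed.

Lemma ccont_y (x : R) : ccont (fun y => x +i* y).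
Proof.
move=> y e e0; exists e => // y' H.
apply: le_lt_trans (normc_leRI _) _.
by rewrite ReB ImB/= subrr normr0 add0r.
Qed.

Lemma ccontB h k : ccont h -> ccont k -> ccont (fun x => h x - k x).
Proof.
move=> H K; have := ccontD H (ccontZ (-1) K).
by rewrite (_ : (fun _ => _) = fun x => h x - k x)//; apply/funext => x; rewrite mulN1r.
Qed.

Lemma cintD a b h k : ccont h -> ccont k ->
  cint a b (fun x => h x + k x) = cint a b h + cint a b k.
Proof.
move=> H K; apply/eqP; rewrite eq_complex/= -!rintD; try exact: ccont_Re; try exact: ccont_Im.
by apply/andP; split; apply/eqP; apply: eq_rint => x _; rewrite ?ReD ?ImD.
Qed.

Lemma cintZ a b z h : ccont h ->
  cint a b (fun x => z * h x) = z * cint a b h.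
Proof.
move=> H; case: z => p q; apply/eqP; rewrite eq_complex/=.
have cR := ccont_Re H; have cI := ccont_Im H.
have cZ (r : R) (f : R -> R) : continuous f -> continuous (fun x => r * f x).
  by move=> cf x; apply: cvgMr; exact: cf.
rewrite -mulNr -!rintZ// -!rintD; try exact: cZ.
by apply/andP; split; apply/eqP; apply: eq_rint => x _; case: (h x) => u v /=; rewrite ?mulNr.
Qed.

Lemma cintB a b h k : ccont h -> ccont k ->
  cint a b (fun x => h x - k x) = cint a b h - cint a b k.
Proof.
move=> H K; rewrite -mulN1r -cintZ// -cintD//; last exact: ccontZ.
by congr (cint _ _ _); apply/funext => x; rewrite mulN1r.
Qed.

Lemma cint_cst a b z : a <= b -> cint a b (fun=> z) = z * (b - a)%:C.
Proof.
move=> ab; rewrite /cint !rint_cst//; case: z => p q.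
by apply/eqP; rewrite eq_complex/= !mulr0 subr0 add0r !eqxx.
Qed.

Lemma cint_split a b c h : a <= c -> c <= b -> ccont h ->
  cint a b h = cint a c h + cint c b h.
Proof.
move=> ac cb H; rewrite /cint (rint_split ac cb (ccont_Re H)).
by rewrite (rint_split ac cb (ccont_Im H)).
Qed.

(** The factor 2 pays for bounding the real and the imaginary part separately. *)
Lemma cint_bound a b h M : a <= b -> ccont h ->
  (forall x, a <= x <= b -> normc (h x) <= M) -> normc (cint a b h) <= 2 * M * (b - a).
Proof.
move=> ab H hM; apply: le_trans (normc_leRI _) _.
rewrite -mulrA mulr_natl mulr2n; apply: lerD; apply: rint_bound => //.
- exact: ccont_Re.
- by move=> x /hM; apply: le_trans; exact: normc_Re.
- exact: ccont_Im.
- by move=> x /hM; apply: le_trans; exact: normc_Im.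
Qed.

Lemma cint_norm a b h : ccont h ->
  normc (cint a b h) <= 2 * rint a b (fun x => normc (h x)).
Proof.
move=> H; apply: le_trans (normc_leRI _) _.
rewrite mulr_natl mulr2n; apply: lerD.
- apply: le_trans (rint_norm _ _ (ccont_Re H)) _; apply: rint_le.
  + by move=> x; apply: continuous_comp; [exact: ccont_Re|exact: norm_continuous].
  + exact: ccont_normc.
  + by move=> x _; exact: normc_Re.
- apply: le_trans (rint_norm _ _ (ccont_Im H)) _; apply: rint_le.
  + by move=> x; apply: continuous_comp; [exact: ccont_Im|exact: norm_continuous].
  + exact: ccont_normc.
  + by move=> x _; exact: normc_Im.
Qed.

End complex_integral.

(** * Cauchy's theorem for rectangles *)

Section goursat.
Context {R : realType}.
Context (G : R[i] -> R[i]).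
Context (eG : entire G).

(** The contour integral over the boundary of the rectangle, counterclockwise, with opposite sides
    combined. *)
Definition rectint (F : R[i] -> R[i]) (x0 x1 y0 y1 : R) : R[i] :=
  cint x0 x1 (fun x => F (x +i* y0) - F (x +i* y1)) +
  'i * cint y0 y1 (fun y => F (x1 +i* y) - F (x0 +i* y)).

Lemma ccont_horiz (F : R[i] -> R[i]) y : entire F -> ccont (fun x => F (x +i* y)).
Proof. by move=> eF; apply: ccont_comp => //; exact: ccont_x. Qed.

Lemma ccont_vert (F : R[i] -> R[i]) x : entire F -> ccont (fun y => F (x +i* y)).
Proof. by move=> eF; apply: ccont_comp => //; exact: ccont_y. Qed.

Lemma rectint_splitx c x0 x1 y0 y1 : x0 <= c -> c <= x1 -> y0 <= y1 ->
  rectint G x0 x1 y0 y1 = rectint G x0 c y0 y1 + rectint G c x1 y0 y1.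
Proof.
move=> h1 h2 h3; rewrite /rectint (cint_split h1 h2); last first.
  by apply: ccontB; exact: ccont_horiz.
rewrite (_ : (fun y => G (x1 +i* y) - G (x0 +i* y)) =
  fun y => (G (c +i* y) - G (x0 +i* y)) + (G (x1 +i* y) - G (c +i* y))).
  rewrite (@cintD _ y0 y1 (fun y => G (c +i* y) - G (x0 +i* y)) (fun y => G (x1 +i* y) - G (c +i* y))).
  - ring.
  - by apply: ccontB; exact: ccont_vert.
  - by apply: ccontB; exact: ccont_vert.
by apply/funext => y; ring.
Qed.

Lemma rectint_splity c x0 x1 y0 y1 : y0 <= c -> c <= y1 -> x0 <= x1 ->
  rectint G x0 x1 y0 y1 = rectint G x0 x1 y0 c + rectint G x0 x1 c y1.
Proof.
move=> h1 h2 h3; rewrite /rectint [in LHS](cint_split h1 h2); last first.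
  by apply: ccontB; exact: ccont_vert.
rewrite (_ : (fun x => G (x +i* y0) - G (x +i* y1)) =
  fun x => (G (x +i* y0) - G (x +i* c)) + (G (x +i* c) - G (x +i* y1))).
  rewrite (@cintD _ x0 x1 (fun x => G (x +i* y0) - G (x +i* c)) (fun x => G (x +i* c) - G (x +i* y1))).
  - ring.
  - by apply: ccontB; exact: ccont_horiz.
  - by apply: ccontB; exact: ccont_horiz.
by apply/funext => y; ring.
Qed.

Lemma rectintB (F H : R[i] -> R[i]) x0 x1 y0 y1 : entire F -> entire H ->
  rectint (fun z => F z - H z) x0 x1 y0 y1 = rectint F x0 x1 y0 y1 - rectint H x0 x1 y0 y1.
Proof.
move=> eF eH; rewrite /rectint.
have ch (E : R[i] -> R[i]) : entire E -> ccont (fun x => E (x +i* y0) - E (x +i* y1)).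
  by move=> eE; apply: ccontB; exact: ccont_horiz.
have cv (E : R[i] -> R[i]) : entire E -> ccont (fun y => E (x1 +i* y) - E (x0 +i* y)).
  by move=> eE; apply: ccontB; exact: ccont_vert.
rewrite (_ : (fun x => (F (x +i* y0) - H (x +i* y0)) - _) =
  fun x => (F (x +i* y0) - F (x +i* y1)) - (H (x +i* y0) - H (x +i* y1))); last first.
  by apply/funext => x; ring.
rewrite (_ : (fun y => (F (x1 +i* y) - H (x1 +i* y)) - _) =
  fun y => (F (x1 +i* y) - F (x0 +i* y)) - (H (x1 +i* y) - H (x0 +i* y))); last first.
  by apply/funext => x; ring.
rewrite (cintB x0 x1 (ch F eF) (ch H eH)) (cintB y0 y1 (cv F eF) (cv H eH)).
move: (cint _ _ _) (cint _ _ _) (cint _ _ _) (cint _ _ _) => c1 c2 c3 c4; ring.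
Qed.

Lemma rectint_affine (p q : R[i]) x0 x1 y0 y1 : x0 <= x1 -> y0 <= y1 ->
  rectint (fun z => p + q * z) x0 x1 y0 y1 = 0.
Proof.
move=> hx hy; rewrite /rectint.
rewrite (_ : (fun x => _ - _) = fun=> q * (0 +i* (y0 - y1))); last first.
  apply/funext => x.
  rewrite (_ : 0 +i* (y0 - y1) = (x +i* y0) - (x +i* y1)); last first.
    by apply/eqP; rewrite eq_complex/= !subrr !eqxx.
  ring.
rewrite (_ : (fun y => _ - _) = fun=> q * (x1 - x0)%:C); last first.
  apply/funext => y.
  rewrite (_ : (x1 - x0)%:C = (x1 +i* y) - (x0 +i* y)); last first.
    by apply/eqP; rewrite eq_complex/= !subrr !eqxx.
  ring.
rewrite !cint_cst//.
have -> : 0 +i* (y0 - y1) = - ('i * (y1 - y0)%:C) :> R[i].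
  by apply/eqP; rewrite eq_complex/=; apply/andP; split; apply/eqP; ring.
ring.
Qed.

(** An affine function has integral 0 over the boundary, so only the deviation of [G] from it
    counts. *)
Lemma rectint_bound (p q : R[i]) x0 x1 y0 y1 M : x0 <= x1 -> y0 <= y1 ->
  (forall x y, x0 <= x <= x1 -> y0 <= y <= y1 ->
    normc (G (x +i* y) - (p + q * (x +i* y))) <= M) ->
  normc (rectint G x0 x1 y0 y1) <= 4 * M * ((x1 - x0) + (y1 - y0)).
Proof.
move=> hx hy HM.
have eA : entire (fun z => p + q * z) := entireD (entire_cst p) (entireM (entire_cst q) entire_id).
have eE := entireB eG eA.
rewrite -[rectint G _ _ _ _]subr0 -(rectint_affine p q hx hy) -(rectintB _ _ _ _ eG eA).
have B2 (u v : R[i]) : normc u <= M -> normc v <= M -> normc (u - v) <= 2 * M.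
  move=> hu hv; apply: le_trans (normc_triangle _ _) _.
  by rewrite normcN mulr_natl mulr2n; exact: lerD.
rewrite /rectint; apply: le_trans (normc_triangle _ _) _.
rewrite [normc ('i * _)]normcM (_ : normc 'i = 1) ?mul1r; last first.
  by rewrite /normc/= expr0n/= add0r expr1n sqrtr1.
rewrite (_ : 4 * M = 2 * (2 * M)); last by ring.
rewrite [leRHS]mulrDr.
apply: lerD; apply: cint_bound => //.
- exact: (ccontB (ccont_horiz y0 eE) (ccont_horiz y1 eE)).
- by move=> x hx'; apply: B2; apply: HM => //; rewrite lexx hy.
- exact: (ccontB (ccont_vert x1 eE) (ccont_vert x0 eE)).
- by move=> y hy'; apply: B2; apply: HM => //; rewrite lexx hx.
Qed.

Let rect := (R * R * (R * R))%type.
Let wf (Q : rect) := Q.1.1 <= Q.1.2 /\ Q.2.1 <= Q.2.2.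
Let big (e : R) (Q : rect) :=
  e * (Q.1.2 - Q.1.1) * (Q.2.2 - Q.2.1) < normc (rectint G Q.1.1 Q.1.2 Q.2.1 Q.2.2).

(** Integral and area are additive under bisection, so one half of a rectangle that violates the
    bound violates it too. Bisecting in both directions keeps the shape, and the diameter stays
    comparable to the square root of the area. *)
Let halve (e : R) (Q : rect) : wf Q -> big e Q -> { Q' : rect |
  [/\ wf Q', big e Q', Q.1.1 <= Q'.1.1, Q'.1.2 <= Q.1.2 &
   [/\ Q.2.1 <= Q'.2.1, Q'.2.2 <= Q.2.2,
     Q'.1.2 - Q'.1.1 = (Q.1.2 - Q.1.1) / 2 & Q'.2.2 - Q'.2.1 = (Q.2.2 - Q.2.1) / 2]]}.
Proof.
move: Q => [[x0 x1] [y0 y1]] [/= hx hy] B; apply/cid.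
pose c := (x0 + x1) / 2; pose d := (y0 + y1) / 2.
have c0 : x0 <= c by rewrite /c; lra.
have c1 : c <= x1 by rewrite /c; lra.
have d0 : y0 <= d by rewrite /d; lra.
have d1 : d <= y1 by rewrite /d; lra.
have [a [b [h1 h2 h3 h4 h5]]] : exists a b, [/\ x0 <= a, a <= b, b <= x1, b - a = (x1 - x0) / 2 &
    e * (b - a) * (y1 - y0) < normc (rectint G a b y0 y1)].
  have [H|H] := ltP (e * (c - x0) * (y1 - y0)) (normc (rectint G x0 c y0 y1)).
    by exists x0, c; split => //; rewrite /c; lra.
  exists c, x1; split => //; first by rewrite /c; lra.
  have {}B : e * (x1 - x0) * (y1 - y0) < normc (rectint G x0 x1 y0 y1) := B.
  move: B; rewrite (rectint_splitx c0 c1 hy) => /lt_le_trans/(_ (normc_triangle _ _)) B.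
  have : e * (x1 - x0) * (y1 - y0) = e * (c - x0) * (y1 - y0) + e * (x1 - c) * (y1 - y0) by ring.
  move: H B; move: (normc _) (normc _) => n1 n2; lra.
have [p [q [g1 g2 g3 g4 g5]]] : exists a' b', [/\ y0 <= a', a' <= b', b' <= y1, b' - a' = (y1 - y0) / 2 &
    e * (b - a) * (b' - a') < normc (rectint G a b a' b')].
  have [H|H] := ltP (e * (b - a) * (d - y0)) (normc (rectint G a b y0 d)).
    by exists y0, d; split => //; rewrite /d; lra.
  exists d, y1; split => //; first by rewrite /d; lra.
  move: h5; rewrite (rectint_splity d0 d1 h2) => /lt_le_trans/(_ (normc_triangle _ _)) B'.
  have : e * (b - a) * (y1 - y0) = e * (b - a) * (d - y0) + e * (b - a) * (y1 - d) by ring.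
  move: H B'; move: (normc _) (normc _) => n1 n2; lra.
by exists ((a, b), (p, q)).
Qed.

Let state e := { Q : rect | wf Q /\ big e Q }.

Let next e (s : state e) : state e :=
  let: exist Q (conj w b) := s in
  let: exist Q' (And5 w' b' _ _ _) := halve w b in exist _ Q' (conj w' b').

(** Nested rectangles that all violate the bound shrink to a point. Near it [G] is affine up to
    [eta] times the distance, so [rectint_bound] gives an integral of the order of the squared
    diameter, with a factor small enough for a contradiction. *)
Lemma goursat_lt x0 x1 y0 y1 (e : R) : 0 < e -> x0 <= x1 -> y0 <= y1 ->
  normc (rectint G x0 x1 y0 y1) <= e * (x1 - x0) * (y1 - y0).
Proof.
move=> e0 hx hy; rewrite leNgt; apply/negP => B.
pose s0 : state e := exist _ ((x0, x1), (y0, y1)) (conj (conj hx hy) B).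
pose Q n := sval (iter n (@next e) s0).
have wfQ n : wf (Q n) by rewrite /Q; case: (iter _ _ _) => ? [].
have bQ n : big e (Q n) by rewrite /Q; case: (iter _ _ _) => ? [].
have Qs n : [/\ (Q n).1.1 <= (Q n.+1).1.1, (Q n.+1).1.2 <= (Q n).1.2 &
   [/\ (Q n).2.1 <= (Q n.+1).2.1, (Q n.+1).2.2 <= (Q n).2.2,
     (Q n.+1).1.2 - (Q n.+1).1.1 = ((Q n).1.2 - (Q n).1.1) / 2 &
     (Q n.+1).2.2 - (Q n.+1).2.1 = ((Q n).2.2 - (Q n).2.1) / 2]].
  rewrite /Q iterS; case: (iter _ _ _) => P [w b] /=.
  by case: halve => P' /= [w' b' ? ? [? ? ? ?]].
have lim2 (lo hi : nat -> R) : (forall n, lo n <= lo n.+1) -> (forall n, hi n.+1 <= hi n) ->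
    (forall n, lo n <= hi n) -> exists c, forall n, lo n <= c <= hi n.
  move=> h1 h2 h3.
  have lo_h : {homo lo : n m / (n <= m)%N >-> n <= m} by apply: homo_leq => //; exact: le_trans.
  have hi_h : {homo hi : n m / (n <= m)%N >-> m <= n}.
    by apply: (@homo_leq _ hi (fun x y => y <= x)) => // ? ? ? h4 h5; exact: le_trans h5 h4.
  have lh n m : lo n <= hi m.
    apply: (le_trans (lo_h _ _ (leq_maxl n m))).
    exact: le_trans (h3 _) (hi_h _ _ (leq_maxr n m)).
  exists (sup (range lo)) => n; apply/andP; split.
    by apply: ub_le_sup; [exists (hi 0%N) => _ [m _ <-]|exists n].
  by apply: ge_sup; [exists (lo 0%N), 0%N|move=> _ [m _ <-]].
have [cx cxP] := lim2 (fun n => (Q n).1.1) (fun n => (Q n).1.2)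
  (fun n => let: And3 h _ _ := Qs n in h) (fun n => let: And3 _ h _ := Qs n in h)
  (fun n => (wfQ n).1).
have [cy cyP] := lim2 (fun n => (Q n).2.1) (fun n => (Q n).2.2)
  (fun n => let: And3 _ _ (And4 h _ _ _) := Qs n in h)
  (fun n => let: And3 _ _ (And4 _ h _ _) := Qs n in h)
  (fun n => (wfQ n).2).
have Wx n : (Q n).1.2 - (Q n).1.1 = (x1 - x0) * 2^-1 ^+ n.
  elim: n => [|n IH]; first by rewrite expr0 mulr1.
  by have [_ _ [_ _ -> _]] := Qs n; rewrite IH exprSr mulrA.
have Wy n : (Q n).2.2 - (Q n).2.1 = (y1 - y0) * 2^-1 ^+ n.
  elim: n => [|n IH]; first by rewrite expr0 mulr1.
  by have [_ _ [_ _ _ ->]] := Qs n; rewrite IH exprSr mulrA.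
have [l /= lP] := (entire_cderiv G).1 eG (cx +i* cy).
pose w := x1 - x0; pose h := y1 - y0.
have w0 : 0 <= w by rewrite subr_ge0.
have h0 : 0 <= h by rewrite subr_ge0.
(* A degenerate rectangle has integral 0 and cannot violate the bound strictly. Positive area is
   what makes [eta] positive. *)
have wh : 0 < w * h.
  rewrite lt_neqAle mulr_ge0// andbT eq_sym; apply/eqP => wh.
  have := B; rewrite -mulrA wh mulr0 ltNge; move/negP; apply.
  have := @rectint_bound 0 0 x0 x1 y0 y1; rewrite -/w -/h.
  move/eqP: wh; rewrite mulf_eq0 => /orP[/eqP w00|/eqP h00].
  - move=> _; rewrite (_ : x1 = x0); last by apply/eqP; rewrite -subr_eq0 -/w w00.
    rewrite /rectint (_ : cint x0 x0 _ = 0); last first.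
      by rewrite /cint /rint set_itv1 !Rintegral_set1.
    rewrite add0r (_ : (fun y => _) = fun=> 0); last by apply/funext => y; rewrite subrr.
    by rewrite cint_cst// mul0r mulr0 normc0.
  - move=> _; rewrite (_ : y1 = y0); last by apply/eqP; rewrite -subr_eq0 -/h h00.
    rewrite /rectint (_ : cint y0 y0 _ = 0); last first.
      by rewrite /cint /rint set_itv1 !Rintegral_set1.
    rewrite mulr0 addr0 (_ : (fun y => _) = fun=> 0); last by apply/funext => y; rewrite subrr.
    by rewrite cint_cst// mul0r normc0.
(* Chosen so that [4 * eta * (w + h) ^+ 2] equals [e * (w * h)]. *)
pose eta := e * (w * h) / (4 * (w + h) ^+ 2).
have whp : 0 < w + h.
  rewrite lt_neqAle addr_ge0// andbT eq_sym; apply/eqP => H.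
  by move: wh; rewrite (_ : w = 0) ?mul0r ?ltxx//; lra.
have eta0 : 0 < eta by rewrite divr_gt0// mulr_gt0// exprn_gt0.
have [dl dl0 dlP] := lP _ eta0.
have [n nP] : exists n, (w + h) * 2^-1 ^+ n < dl.
  have /cvgrPdist_lt/(_ _ (divr_gt0 dl0 whp)) : (2^-1 : R) ^+ n @[n --> \oo] --> (0 : R).
    by apply: cvg_expr; rewrite ger0_norm ?invr_ge0// invf_lt1// ltr1n.
  move=> [n _ /(_ n (leqnn n))]; rewrite sub0r normrN ger0_norm ?exprn_ge0 ?invr_ge0//.
  by rewrite ltr_pdivlMr// mulrC => H; exists n.
have := bQ n; rewrite /big ltNge => /negP; apply.
have [wx wy] := wfQ n.
apply: le_trans (@rectint_bound (G (cx +i* cy) - l * (cx +i* cy)) l _ _ _ _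
  (eta * ((w + h) * 2^-1 ^+ n)) wx wy _) _.
  move=> x y hx' hy'.
  rewrite (_ : _ - _ = G ((cx +i* cy) + ((x +i* y) - (cx +i* cy))) - G (cx +i* cy)
    - l * ((x +i* y) - (cx +i* cy))); last first.
    by rewrite [_ + (_ - (cx +i* cy))]addrC subrK; ring.
  have nb : normc ((x +i* y) - (cx +i* cy)) <= (w + h) * 2^-1 ^+ n.
    apply: le_trans (normc_leRI _) _; rewrite ReB ImB/= mulrDl -Wx -Wy.
    move: (cxP n) (cyP n) hx' hy' => /andP[? ?] /andP[? ?] /andP[? ?] /andP[? ?].
    by apply: lerD; rewrite ler_norml; lra.
  apply: le_trans (dlP _ (le_lt_trans nb nP)) _.
  by rewrite ler_wpM2l// ltW.
rewrite Wx Wy -/w -/h -mulrDl.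
rewrite (_ : 4 * _ * _ = (eta * (4 * (w + h) ^+ 2)) * (2^-1 ^+ n * 2^-1 ^+ n)); last by ring.
rewrite /eta divfK ?gt_eqF ?mulr_gt0 ?exprn_gt0//.
by rewrite le_eqVlt; apply/orP; left; apply/eqP; ring.
Qed.

Lemma goursat x0 x1 y0 y1 : x0 <= x1 -> y0 <= y1 -> rectint G x0 x1 y0 y1 = 0.
Proof.
move=> hx hy; apply: normc_small0 => e e0.
pose A := (x1 - x0) * (y1 - y0) + 1.
have A0 : 0 < A by rewrite ltr_wpDl// mulr_ge0// subr_ge0.
apply: le_trans (goursat_lt (divr_gt0 e0 A0) hx hy) _.
rewrite -mulrA -[leRHS]mulr1 -mulrA ler_wpM2l ?(ltW e0)//.
by rewrite mulrC ler_pdivrMr// mul1r lerDl.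
Qed.

End goursat.

Opaque cint.

(** * Integrals over circles and Cauchy's estimates *)

Section circle_means.
Context {R : realType}.
Implicit Types (f g h : R[i] -> R[i]) (r s t : R).
Local Notation pi2 := (2 * pi : R).

Definition cis t : R[i] := cexp (0 +i* t).

Lemma pi2_gt0 : 0 < pi2.
Proof. by rewrite mulr_gt0// pi_gt0. Qed.

Lemma normc_cis t : normc (cis t) = 1.
Proof. by rewrite normc_cexp/= expR0. Qed.

Lemma cisE t : cis t = cos t +i* sin t.
Proof. by rewrite /cis /cexp/= expR0 !mul1r. Qed.

Lemma cexp_polar s t : cexp (s +i* t) = (expR s)%:C * cis t.
Proof.
by rewrite cisE /cexp/=; apply/eqP; rewrite eq_complex/= !mul0r subr0 addr0 !eqxx.
Qed.

Lemma cisN t : cis t * cis (- t) = 1.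
Proof.
by rewrite /cis -cexpD -cexp0; congr cexp; apply/eqP; rewrite eq_complex/= addr0 subrr !eqxx.
Qed.

Lemma cis2pi : cis pi2 = 1.
Proof.
rewrite cisE mulr_natl mulr2n cosDpi sinDpi cospi sinpi opprK oppr0.
by apply/eqP; rewrite eq_complex/= !eqxx.
Qed.

Lemma cis0 : cis 0 = 1.
Proof. by rewrite /cis -cexp0; congr cexp. Qed.

Lemma ccont_cis : ccont cis.
Proof. apply: ccont_comp; [exact cexp_entire|exact: ccont_y]. Qed.

Lemma ccont_cisN : ccont (fun t => cis (- t)).
Proof.
apply: ccont_comp; [exact cexp_entire|].
move=> y e e0; exists e => // y' H; apply: le_lt_trans (normc_leRI _) _.
by rewrite ReB ImB/= subrr normr0 add0r -opprD normrN.
Qed.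

Lemma ccontM (h k : R -> R[i]) : ccont h -> ccont k -> ccont (fun x => h x * k x).
Proof.
move=> H K x e e0.
pose A := normc (h x) + normc (k x) + 1.
have A0 : 0 < A by rewrite ltr_wpDl// addr_ge0// normc_ge0.
have eA : 0 < Num.min 1 (e / (2 * A)) by rewrite lt_min ltr01 divr_gt0// mulr_gt0.
have [d d0 dP] := H x _ eA; have [d' d'0 d'P] := K x _ eA.
exists (Num.min d d'); first by rewrite lt_min d0.
move=> y; rewrite lt_min => /andP[/dP h1 /d'P h2].
rewrite (_ : _ - _ = (h y - h x) * k x + h x * (k y - k x) + (h y - h x) * (k y - k x)); last by ring.
move: h1 h2; rewrite !lt_min => /andP[a1 a2] /andP[b1 b2].
apply: (@le_lt_trans _ _ (e / (2 * A) * (normc (k x) + normc (h x) + 1))).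
  set q := e / (2 * A); rewrite [leRHS]mulrDr [q * (_ + _)]mulrDr mulr1; apply: le_trans (normc_triangle _ _) _; apply: lerD; last first.
    rewrite normcM -[leRHS]mul1r; apply: ler_pM; rewrite ?normc_ge0// ltW//.
  apply: le_trans (normc_triangle _ _) _; rewrite !normcM; apply: lerD.
    by apply: ler_pM; rewrite ?normc_ge0// ltW.
  by rewrite mulrC; apply: ler_pM; rewrite ?normc_ge0// ltW.
rewrite [X in _ * (X + 1)]addrC -/A.
rewrite (_ : e / (2 * A) * A = e / 2); last by field; rewrite gt_eqF.
by rewrite ltr_pdivrMr// mulr_natr mulr2n ltrDl.
Qed.

Lemma ccontX (h : R -> R[i]) n : ccont h -> ccont (fun x => h x ^+ n).
Proof. by move=> H; apply: (ccont_comp (f := fun z => z ^+ n)) H; exact (entireX n). Qed.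

(** By periodicity the two horizontal sides cancel, and Cauchy's theorem compares the two vertical
    ones. Applied to functions of [cexp z], this compares integrals over concentric circles without
    any contour other than a rectangle. *)
Lemma period_const f : entire f -> (forall x, f (x +i* 0) = f (x +i* pi2)) ->
  forall s t, cint 0 pi2 (fun y => f (s +i* y)) = cint 0 pi2 (fun y => f (t +i* y)).
Proof.
move=> ef fp; suff H s t : s <= t -> cint 0 pi2 (fun y => f (s +i* y)) = cint 0 pi2 (fun y => f (t +i* y)).
  by move=> s t; have [/H//|/ltW/H] := leP s t.
move=> st; have := goursat ef st (ltW pi2_gt0); rewrite /rectint.
rewrite (_ : (fun x => _ - _) = fun=> 0); last by apply/funext => x; rewrite fp subrr.
rewrite cint_cst// mul0r add0r cintB; try exact: ccont_vert.
move/eqP; rewrite mulf_eq0 => /orP[/eqP|]; last by rewrite subr_eq0 => /eqP.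
by move/(congr1 (@complex.Im R)) => /= /eqP; rewrite oner_eq0.
Qed.

Lemma entire_shift f (c : R[i]) : entire f -> entire (fun z => f (c + z)).
Proof. by move=> ef; exact (entire_comp ef (entireD (entire_cst c) entire_id)). Qed.

Lemma ccont_circle f (c : R[i]) : entire f -> ccont (fun t => f (c * cis t)).
Proof.
move=> ef; apply: (ccont_comp (f := f)) ef _; apply: ccontZ; exact: ccont_cis.
Qed.

(** The mean does not depend on the radius by [period_const], and it tends to [f 0] for small radii
    by continuity. *)
Lemma circle_mean f r : entire f -> 0 < r ->
  cint 0 pi2 (fun t => f (r%:C * cis t)) = pi2%:C * f 0.
Proof.
move=> ef r0; pose F z := f (cexp z).
have eF : entire F by exact (entire_comp ef cexp_entire).
have Fp x : F (x +i* 0) = F (x +i* pi2).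
  by rewrite /F !cexp_polar cis2pi cis0.
have FE s : cint 0 pi2 (fun t => F (s +i* t)) = cint 0 pi2 (fun t => f ((expR s)%:C * cis t)).
  by congr (cint _ _ _); apply/funext => t; rewrite /F cexp_polar.
apply/eqP; rewrite -subr_eq0; apply/eqP/normc_small0 => e e0.
have pi0 := pi2_gt0.
have e1 : 0 < e / (2 * pi2) by rewrite divr_gt0// mulr_gt0.
have [d d0 dP] := entire_continuous ef 0 e1.
pose s := ln (d / 2).
have -> : cint 0 pi2 (fun t => f (r%:C * cis t)) = cint 0 pi2 (fun t => f ((d / 2)%:C * cis t)).
  have := period_const eF Fp (ln r) s; rewrite !FE !lnK//.
  by rewrite posrE divr_gt0.
rewrite (_ : pi2%:C * f 0 = cint 0 pi2 (fun=> f 0)); last by rewrite cint_cst ?(ltW pi0)// subr0 mulrC.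
rewrite -cintB; [|exact: ccont_circle|exact: ccont_cst].
apply: le_trans (cint_bound (M := e / (2 * pi2)) (ltW pi0) _ _) _.
- by apply: ccontB; [exact: ccont_circle|exact: ccont_cst].
- move=> t _; apply/ltW/dP; rewrite subr0 normcM normc_cis mulr1 normcR ger0_norm ?divr_ge0 ?(ltW d0)//.
  by rewrite ltr_pdivrMr// mulr_natr mulr2n ltrDl.
- rewrite subr0 le_eqVlt; apply/orP; left; apply/eqP.
  by move: (2 * pi) pi0 => P /lt0r_neq0 P0; field.
Qed.

Lemma mean_le f (c : R[i]) r : entire f -> 0 < r ->
  pi2 * normc (f c) <= 2 * rint 0 pi2 (fun t => normc (f (c + r%:C * cis t))).
Proof.
move=> ef r0; have e1 := entire_shift (c := c) ef.
have := circle_mean e1 r0; rewrite addr0 => H.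
rewrite -[X in X * _](normc_real_ge0 (ltW pi2_gt0)) -normcM -H; apply: cint_norm.
exact: (ccont_circle (f := fun z => f (c + z))).
Qed.

(** Cauchy's formula for the Taylor coefficient, on the unit circle. *)
Definition coef f n : R[i] := (pi2%:C)^-1 * cint 0 pi2 (fun t => f (cis t) * cis (- t) ^+ n).

Lemma invCr r : r != 0 -> (r^-1)%:C * r%:C = 1 :> R[i].
Proof.
by move=> r0; apply/eqP; rewrite eq_complex/= mulVf// !mulr0 mul0r subr0 addr0 !eqxx.
Qed.

(** Apply [period_const] to [f (cexp z) * cexp (- z) ^+ n]: the radius enters only through
    [r ^+ n]. *)
Lemma coef_circle f r n : entire f -> 0 < r ->
  cint 0 pi2 (fun t => f (r%:C * cis t) * cis (- t) ^+ n) = pi2%:C * coef f n * r%:C ^+ n.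
Proof.
move=> ef r0; rewrite /coef mulVKf; last first.
  by rewrite -normc_eq0 normc_real_ge0 ?gt_eqF ?(ltW pi2_gt0)// pi2_gt0.
pose F z := f (cexp z) * (cexp ((-1) * z)) ^+ n.
have eF : entire F.
  apply: entireM; first exact (entire_comp ef cexp_entire).
  exact (entire_comp (entireX n) (entire_comp cexp_entire (entireM (entire_cst (-1)) entire_id))).
have NE s t : (-1) * (s +i* t) = (- s) +i* (- t) :> R[i].
  by rewrite mulN1r.
have Fp x : F (x +i* 0) = F (x +i* pi2).
  rewrite /F !NE !cexp_polar cis2pi cis0 oppr0 cis0 mulr1.
  by have := cisN pi2; rewrite cis2pi mul1r => ->; rewrite mulr1.
have FE s t : F (s +i* t) = (expR (- s))%:C ^+ n * (f ((expR s)%:C * cis t) * cis (- t) ^+ n).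
  by rewrite /F NE !cexp_polar exprMn mulrCA.
have E1 : cint 0 pi2 (fun y => F (ln r +i* y)) =
    cint 0 pi2 (fun t => (r^-1)%:C ^+ n * (f (r%:C * cis t) * cis (- t) ^+ n)).
  by congr (cint _ _ _); apply/funext => t; rewrite FE expRN lnK.
have E2 : cint 0 pi2 (fun y => F (0 +i* y)) = cint 0 pi2 (fun t => f (cis t) * cis (- t) ^+ n).
  by congr (cint _ _ _); apply/funext => t; rewrite FE oppr0 expR0 expr1n !mul1r.
have := etrans (esym E1) (etrans (period_const eF Fp (ln r) 0) E2).
have cc : ccont (fun t => f (r%:C * cis t) * cis (- t) ^+ n).
  by apply: ccontM; [exact: ccont_circle|apply: ccontX; exact: ccont_cisN].
have aux (X Y : R[i]) : (r^-1)%:C ^+ n * X = Y -> X = Y * r%:C ^+ n.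
  have rr := invCr (lt0r_neq0 r0).
  by move=> <-; rewrite mulrAC -exprMn rr expr1n mul1r.
by rewrite (cintZ _ _ _ cc) => /aux.
Qed.

(** These are the Fourier coefficients of negative index; they are means of [f z * z ^+ n.+1], which
    vanishes at 0. *)
Lemma circle_pos f r n : entire f -> 0 < r ->
  cint 0 pi2 (fun t => f (r%:C * cis t) * cis t ^+ n.+1) = 0.
Proof.
move=> ef r0; have eg : entire (fun z => f z * z ^+ n.+1) := entireM ef (entireX n.+1).
have := circle_mean eg r0; rewrite expr0n/= !mulr0.
rewrite (_ : (fun t => _) = fun t => r%:C ^+ n.+1 * (f (r%:C * cis t) * cis t ^+ n.+1)); last first.
  by apply/funext => t; rewrite exprMn; ring.
rewrite cintZ; last by apply: ccontM; [exact: ccont_circle|apply: ccontX; exact: ccont_cis].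
move/eqP; rewrite mulf_eq0 expf_eq0/= -normc_eq0 normc_real_ge0 ?(ltW r0)// gt_eqF//=.
by move/eqP.
Qed.

Lemma coef_bound f r n M : entire f -> 0 < r -> (forall z, normc z = r -> normc (f z) <= M) ->
  normc (coef f n) * r ^+ n <= 2 * M.
Proof.
move=> ef r0 fM; have pi0 := pi2_gt0.
have cc : ccont (fun t => f (r%:C * cis t) * cis (- t) ^+ n).
  by apply: ccontM; [exact: ccont_circle|apply: ccontX; exact: ccont_cisN].
have := @cint_bound _ 0 pi2 _ M (ltW pi0) cc; rewrite coef_circle//; move: (coef f n) => c.
move=> H; rewrite -(ler_pM2r pi0); move: H.
rewrite normcM normcM normcX !normc_real_ge0 ?(ltW pi0) ?(ltW r0)// subr0.
rewrite -[X in X <= _]mulrA [X in X <= _]mulrC; apply.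
move=> t _; rewrite normcM normcX !normc_cis expr1n mulr1; apply: fM.
by rewrite normcM normc_cis mulr1 normc_real_ge0// ltW.
Qed.

Lemma arg_exists (z : R[i]) : normc z = 1 -> exists2 t, 0 <= t <= pi2 & cis t = z.
Proof.
move=> z1; have xi' : -1 <= complex.Re z <= 1 by rewrite -ler_norml -z1 normc_Re.
have xi : complex.Re z \in `[-1, 1] by rewrite in_itv.
have xy : complex.Re z ^+ 2 + complex.Im z ^+ 2 = 1.
  by move: z1; case: z {xi xi'} => a b /= /(congr1 (fun x => x ^+ 2)); rewrite expr1n sqr_sqrtr// addr_ge0// sqr_ge0.
have sE : sin (acos (complex.Re z)) = `|complex.Im z|.
  by rewrite sin_acos// -sqrtr_sqr; congr Num.sqrt; rewrite -xy addrC addKr.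
have a0 : 0 <= acos (complex.Re z) by exact: acos_ge0.
have a1 : acos (complex.Re z) <= pi by exact: acos_lepi.
have pi0 : 0 <= pi :> R := pi_ge0 _.
have [y0|y0] := leP 0 (complex.Im z).
  exists (acos (complex.Re z)); first by rewrite a0/=; lra.
  by rewrite cisE acosK// sE ger0_norm// -complexEta.
exists (pi2 - acos (complex.Re z)); first by lra.
rewrite cisE mulr_natl mulr2n -addrA addrC cosDpi sinDpi addrC cosDpi sinDpi !opprK.
by rewrite cosN sinN acosK// sE ltr0_norm// opprK -complexEta.
Qed.

Lemma polar_exists (z : R[i]) : exists2 t, 0 <= t <= pi2 & z = (normc z)%:C * cis t.
Proof.
have [->|z0] := eqVneq z 0.
  by exists 0; rewrite ?lexx ?(ltW pi2_gt0)// normc0 mul0r.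
have n0 : (normc z)%:C != 0 by rewrite -normc_eq0 normc_real_ge0 ?normc_ge0// normc_eq0.
have [|t tb tE] := @arg_exists (((normc z)%:C)^-1 * z).
  by rewrite normcM normcV normc_real_ge0 ?normc_ge0// mulVf// normc_eq0.
by exists t => //; rewrite tE mulVKf.
Qed.

Lemma circle_bounded f r : entire f -> 0 <= r ->
  exists2 M, 0 <= M & forall z, normc z = r -> normc (f z) <= M.
Proof.
move=> ef r0.
have cf : {within `[0, pi2], continuous (fun t => normc (f (r%:C * cis t)))}.
  by apply: continuous_subspaceT; apply: ccont_normc; exact: ccont_circle.
have [c cb cP] := EVT_max (ltW pi2_gt0) cf.
exists (normc (f (r%:C * cis c))); first exact: normc_ge0.
move=> z zr; have [t tb ->] := polar_exists z; rewrite zr; apply: cP.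
by rewrite in_itv.
Qed.

Lemma coef_rapid f : entire f -> rapid (coef f).
Proof.
move=> ef r r0; have [M M0 MP] := circle_bounded ef (ltW r0).
by exists (2 * M); [rewrite mulr_ge0|move=> m; exact: coef_bound].
Qed.

Lemma ccont_coef f n : entire f -> ccont (fun t => f (cis t) * cis (- t) ^+ n).
Proof.
move=> ef; apply: ccontM; last by apply: ccontX; exact: ccont_cisN.
exact: (ccont_comp ef ccont_cis).
Qed.

Lemma coefB f g n : entire f -> entire g ->
  coef (fun z => f z - g z) n = coef f n - coef g n.
Proof.
move=> ef eg; rewrite /coef -mulrBr -(cintB _ _ (h := fun t => f (cis t) * cis (- t) ^+ n)); last 2 first.
- exact: (ccont_coef n ef).
- exact: (ccont_coef n eg).
by congr (_ * cint _ _ _); apply/funext => t; rewrite mulrBl.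
Qed.

Lemma coefX k n : coef (fun z => z ^+ k) n = (k == n)%:R.
Proof.
have pi0 : pi2%:C != 0 by rewrite -normc_eq0 normc_real_ge0 ?gt_eqF ?(ltW pi2_gt0)// pi2_gt0.
have [kn|nk] := leqP n k.
  rewrite /coef (_ : (fun t => _) = fun t => (1%:C * cis t) ^+ (k - n)); last first.
    apply/funext => t; rewrite mul1r -{1}(subnK kn) exprD -mulrA -exprMn cisN expr1n.
    by rewrite mulr1.
  have := @circle_mean (fun z => z ^+ (k - n)) 1 (entireX _) ltr01 => ->.
  rewrite mulKf// expr0n subn_eq0; congr ((_ : bool)%:R).
  by apply/idP/eqP => [?|->//]; apply/eqP; rewrite eqn_leq kn andbT.
(* Comparing the circles of radius 2 and 1 gives [2 ^+ k * c = 2 ^+ n * c] for the coefficient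
   [c]. *)
have := @coef_circle (fun z => z ^+ k) 2 n (entireX k) (ltr0Sn _ 1).
rewrite (_ : (fun t => _) = fun t => 2%:C ^+ k * ((1%:C * cis t) ^+ k * cis (- t) ^+ n)); last first.
  by apply/funext => t; rewrite mul1r exprMn mulrA.
rewrite cintZ; last first.
  apply: ccontM; last by apply: ccontX; exact: ccont_cisN.
  by apply: (ccont_circle (f := fun z => z ^+ k)); exact (entireX k).
rewrite (@coef_circle (fun z => z ^+ k) 1 n (entireX k) ltr01) expr1n mulr1 mulrC.
move: (coef (fun z => z ^+ k) n) => c.
move/eqP; rewrite -subr_eq0 -mulrBr !mulf_eq0 (negbTE pi0)/=.
rewrite (_ : (k == n) = false); last by rewrite ltn_eqF.
case/orP => [/eqP//|]; rewrite subr_eq0 -!rmorphXn/= => /eqP/(congr1 (@complex.Re R))/=.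
by move/eqP; rewrite eqr_nat eqn_exp2l// ltn_eqF.
Qed.

Lemma coef_cst_eq0 n : coef (fun=> 0) n = 0.
Proof.
rewrite /coef (_ : (fun t => _) = fun=> 0) ?cint_cst ?(ltW pi2_gt0)// ?mul0r ?mulr0//.
by apply/funext => t; rewrite mul0r.
Qed.

Lemma entireZ (c : R[i]) f : entire f -> entire (fun z => c * f z).
Proof. by move=> ef; exact (entireM (entire_cst c) ef). Qed.

Lemma coefZ (c : R[i]) f n : entire f -> coef (fun z => c * f z) n = c * coef f n.
Proof.
move=> ef; rewrite /coef mulrCA; congr (_ * _); rewrite -cintZ; last first.
  exact: (ccont_coef n ef).
by congr (cint _ _ _); apply/funext => t; rewrite mulrA.
Qed.

Lemma coefD f g n : entire f -> entire g ->
  coef (fun z => f z + g z) n = coef f n + coef g n.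
Proof.
move=> ef eg; rewrite /coef -mulrDr -(cintD _ _ (h := fun t => f (cis t) * cis (- t) ^+ n)); last 2 first.
- exact: (ccont_coef n ef).
- exact: (ccont_coef n eg).
by congr (_ * cint _ _ _); apply/funext => t; rewrite mulrDl.
Qed.

Arguments entireZ c {f}.

Lemma entire_partial (a : nat -> R[i]) N : entire (fun z => partial (fun m => a m * z ^+ m) N).
Proof.
rewrite /partial.
exact (@entire_sum R N (fun m z => a m * z ^+ m) (fun m => entireZ (a m) (entireX m))).
Qed.

Arguments entire_partial a N : clear implicits.

Lemma coef_partial (a : nat -> R[i]) N n : (n < N)%N ->
  coef (fun z => partial (fun m => a m * z ^+ m) N) n = a n.
Proof.
move=> nN; have -> : a n = \sum_(m < N) a m * (m == n :> nat)%:R.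
  rewrite (bigD1 (Ordinal nN))//= eqxx mulr1 big1 ?addr0// => i.
  by rewrite -val_eqE/= => /negbTE ->; rewrite mulr0.
elim: N {nN} => [|N IH].
  rewrite big_ord0 (_ : (fun z => _) = fun=> 0) ?coef_cst_eq0//.
  by apply/funext => z; rewrite /partial big_ord0.
rewrite (_ : (fun z => _) = fun z => partial (fun m => a m * z ^+ m) N + a N * z ^+ N); last first.
  by apply/funext => z; rewrite partialS.
rewrite coefD; [|exact (entire_partial a N)|exact (entireZ (a N) (entireX N))].
by rewrite IH big_ord_recr/= coefZ ?coefX//; exact (entireX N).
Qed.

(** A partial sum of sufficient length has the right coefficient, and the remainder is small on the
    unit circle, hence has a small coefficient by [coef_bound]. *)
Lemma coef_psum (a : nat -> R[i]) n : rapid a -> coef (psum a) n = a n.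
Proof.
move=> ra; apply/eqP; rewrite -subr_eq0; apply/eqP/normc_small0 => e e0.
have h2 : 0 < 2^-1 :> R by rewrite invr_gt0.
have half : 0 <= (2^-1 : R) < 1 by rewrite invr_ge0 ler0n invf_lt1 ?ltr1n.
have [C C0 CP] := rapid_geo ra (ler01) h2.
have tail N z : normc z = 1 -> normc (psum a z - partial (fun m => a m * z ^+ m) N) <= C / (1 - 2^-1) * 2^-1 ^+ N.
  move=> z1; apply: geo_tail => // m; rewrite normcM normcX z1; exact: CP.
pose D := C / (1 - 2^-1) + 1.
have D0 : 0 < D by rewrite ltr_wpDl// divr_ge0// subr_ge0; case/andP: half => _ /ltW.
have [N NP] : exists N, 2^-1 ^+ N < e / (2 * D).
  have /cvgrPdist_lt/(_ (e / (2 * D))) : (2^-1 : R) ^+ n @[n --> \oo] --> (0 : R).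
    by apply: cvg_expr; rewrite ger0_norm ?invr_ge0//; case/andP: half.
  move=> /(_ (divr_gt0 e0 (mulr_gt0 (ltr0Sn _ 1) D0)))[N _ /(_ N (leqnn N))].
  by rewrite sub0r normrN ger0_norm ?exprn_ge0 ?invr_ge0// => H; exists N.
pose M := (N + n.+1)%N.
have ep := psum_entire ra; have eP := entire_partial a M.
have eB := entireB ep eP.
have nM : (n < M)%N by rewrite /M; lia.
rewrite -(coef_partial a nM) -coefB//.
have := @coef_bound _ 1 n (C / (1 - 2^-1) * 2^-1 ^+ M) eB ltr01 (tail M).
rewrite expr1n mulr1 => H; apply: le_trans H _.
have : (2^-1 : R) ^+ M <= 2^-1 ^+ N.
  by apply: ler_wiXn2l; rewrite ?invr_ge0// ?invf_le1 ?ler1n// leq_addr.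
move=> HM; have HMe := le_lt_trans HM NP.
apply: (@le_trans _ _ (2 * (D * (e / (2 * D))))).
  rewrite ler_wpM2l//; apply: ler_pM; rewrite ?exprn_ge0 ?invr_ge0// ?(ltW HMe)//.
    by rewrite divr_ge0// subr_ge0; case/andP: half => _ /ltW.
  by rewrite lerDl.
by rewrite le_eqVlt; apply/orP; left; apply/eqP; field; rewrite gt_eqF.
Qed.

End circle_means.

(** * Taylor expansion of entire functions *)

Section taylor.
Context {R : realType}.
Implicit Types (f g h : R[i] -> R[i]) (r s t : R).
Local Notation pi2 := (2 * pi : R).

Lemma rint_ge0 a b (f : R -> R) : (forall x, a <= x <= b -> 0 <= f x) -> 0 <= rint a b f.
Proof. by move=> f0; apply: Rintegral_ge0 => x; rewrite /= in_itv/=; exact: f0. Qed.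

Lemma rint_sub a b c d (f : R -> R) : a <= c -> c <= d -> d <= b -> continuous f ->
  (forall x, 0 <= f x) -> rint c d f <= rint a b f.
Proof.
move=> ac cd db cf f0; rewrite (rint_split ac (le_trans cd db) cf) (rint_split cd db cf).
rewrite addrCA lerDl addr_ge0//; apply: rint_ge0 => x _; exact: f0.
Qed.

Lemma cint_real a b (f : R -> R) : cint a b (fun t => (f t)%:C) = (rint a b f)%:C.
Proof.
Transparent cint.
apply/eqP; rewrite eq_complex/= eqxx/= /rint /Rintegral integral0 //.
Opaque cint.
Qed.

Lemma expr_ratio_contra (a b c d : R) : 0 < a -> 0 <= b -> b < c ->
  (forall m, a * c ^+ m <= d * b ^+ m) -> False.
Proof.
move=> a0 b0 bc H; have c0 : 0 < c by exact: le_lt_trans bc.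
have d0 : a <= d by have := H 0%N; rewrite !expr0 !mulr1.
have k1 : `|b / c| < 1 by rewrite ger0_norm ?divr_ge0 ?(ltW c0)// ltr_pdivrMr// mul1r.
have d0' : 0 < d by exact: lt_le_trans d0.
have /cvgrPdist_lt/(_ _ (divr_gt0 a0 d0')) := cvg_expr k1.
move=> [N _ /(_ N (leqnn N))]; rewrite sub0r normrN ger0_norm; last first.
  by rewrite exprn_ge0// divr_ge0// ltW.
rewrite ltr_pdivlMr// expr_div_n -mulrA mulrC -mulrA ltr_pdivrMl ?exprn_gt0//.
by move=> hlt; move: (H N); rewrite [a * _]mulrC leNgt hlt.
Qed.

(** All Fourier coefficients of [h] on the circle vanish, so [h] is orthogonal to the trigonometric
    polynomials [K ^+ m], which concentrate at [t0]. If [h] were not 0 there, the integral of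
    [K ^+ m], which is at least of order [rho' ^+ m], would be at most of order [rho ^+ m] with
    [rho < rho']. *)
Lemma coef_eq0_zero h r (t0 : R) : entire h -> (forall n, coef h n = 0) -> 0 < r ->
  0 <= t0 <= pi2 -> h (r%:C * cis t0) = 0.
Proof.
move=> eh h0 r0 t0b; pose H t := h (r%:C * cis t).
have cH : ccont H by exact: ccont_circle.
have pi20 := @pi2_gt0 R.
have mom i j : cint 0 pi2 (fun t => H t * (cis t ^+ i * cis (- t) ^+ j)) = 0.
  have [ij|ji] := leqP i j.
    rewrite (_ : (fun t => _) = fun t => h (r%:C * cis t) * cis (- t) ^+ (j - i)).
      by rewrite coef_circle// h0 mulr0 mul0r.
    apply/funext => t; congr (_ * _); rewrite -{1}(subnK ij) exprD mulrCA -exprMn cisN.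
    by rewrite expr1n mulr1.
  rewrite (_ : (fun t => _) = fun t => h (r%:C * cis t) * cis t ^+ (i - j.+1).+1).
    by rewrite circle_pos.
  apply/funext => t; congr (_ * _); rewrite -subSn// subSS -{1}(subnK (ltnW ji)) exprD -mulrA -exprMn cisN.
  by rewrite expr1n mulr1.
pose w := cis t0; pose wc := cis (- t0).
have wwc : w * wc = 1 by exact: cisN.
(* This is [(1 + cos (t - t0)) / 2], with values between 0 and 1; the distance form gives the bounds
   and [KE] the trigonometric polynomial. *)
pose K t := 1 - normc (cis t - w) ^+ 2 / 4.
have KE t : (K t)%:C = 2^-1 + (4^-1 * wc) * cis t + (4^-1 * w) * cis (- t).
  rewrite /K /w /wc !cisE !cosN !sinN /= sqr_sqrtr ?addr_ge0 ?sqr_ge0//.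
  have c2 x := cos2Dsin2 (x : R).
  have e4 : (4^-1 : R[i]) = (4^-1)%:C by rewrite (_ : 4 = (4 : R)%:C) ?fmorphV// rmorph_nat.
  have e2 : (2^-1 : R[i]) = (2^-1)%:C by rewrite (_ : 2 = (2 : R)%:C) ?fmorphV// rmorph_nat.
  apply/eqP; rewrite e4 e2 eq_complex/=; apply/andP; split; apply/eqP.
    move: (c2 t) (c2 t0); move: (cos t) (sin t) (cos t0) (sin t0) => a b c d h1 h2.
    have -> : (a - c) ^+ 2 + (b - d) ^+ 2 = (a ^+ 2 + b ^+ 2) + (c ^+ 2 + d ^+ 2) - 2 * (a * c + b * d) by ring.
    by rewrite h1 h2; lra.
  by ring.
have span m : ccont (fun t => ((K t) ^+ m)%:C) /\ forall i j,
    cint 0 pi2 (fun t => H t * (cis t ^+ i * cis (- t) ^+ j) * ((K t) ^+ m)%:C) = 0.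
  elim: m => [|m [c1 IH]].
    split; first by under eq_fun do rewrite expr0; exact: ccont_cst.
    by move=> i j; under eq_fun do rewrite expr0 mulr1; exact: mom.
  have kE t : ((K t) ^+ m.+1)%:C = (2^-1 + (4^-1 * wc) * cis t + (4^-1 * w) * cis (- t)) * ((K t) ^+ m)%:C.
    by rewrite exprS rmorphM/= KE.
  have c2 : ccont (fun t => ((K t) ^+ m.+1)%:C).
    under eq_fun do rewrite kE; apply: ccontM => //.
    apply: ccontD; last by apply: ccontZ; exact: ccont_cisN.
    by apply: ccontD; [exact: ccont_cst|apply: ccontZ; exact: ccont_cis].
  split => // i j.
  have cg i' j' : ccont (fun t => H t * (cis t ^+ i' * cis (- t) ^+ j') * ((K t) ^+ m)%:C).
    apply: ccontM => //; apply: ccontM => //.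
    by apply: ccontM; apply: ccontX; [exact: ccont_cis|exact: ccont_cisN].
  rewrite (_ : (fun t => _) = fun t =>
    2^-1 * (H t * (cis t ^+ i * cis (- t) ^+ j) * ((K t) ^+ m)%:C) +
    4^-1 * wc * (H t * (cis t ^+ i.+1 * cis (- t) ^+ j) * ((K t) ^+ m)%:C) +
    4^-1 * w * (H t * (cis t ^+ i * cis (- t) ^+ j.+1) * ((K t) ^+ m)%:C)).
    have z1 := ccontZ (2^-1) (cg i j).
    have z2 := ccontZ (4^-1 * wc) (cg i.+1 j).
    have z3 := ccontZ (4^-1 * w) (cg i j.+1).
    rewrite (cintD _ _ (ccontD z1 z2) z3) (cintD _ _ z1 z2).
    by rewrite (cintZ _ _ _ (cg i j)) (cintZ _ _ _ (cg i.+1 j)) (cintZ _ _ _ (cg i j.+1)) !IH !mulr0 !addr0.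
  by apply/funext => t; rewrite kE !exprS; ring.
apply/eqP; rewrite -normc_eq0 eq_le normc_ge0 andbT leNgt; apply/negP => hpos.
set h' := h _ in hpos *.
have h'E : h' = H t0 by [].
have cHd : ccont (fun t => H t - h') by apply: ccontB => //; exact: ccont_cst.
have cK : continuous K.
  have := ccont_Re (span 1%N).1; rewrite (_ : (fun x : R => _) = K)//.
have cKm m : continuous (fun t => K t ^+ m).
  by move=> t; apply: (@continuous_comp _ _ _ K (fun x => x ^+ m)); [exact: cK|exact: exprn_continuous].
have e0 : 0 < normc h' / 4 by rewrite divr_gt0.
have [d d0 dP] := entire_continuous eh (r%:C * w) e0.
pose eta := Num.min 1 (d / r).
have eta0 : 0 < eta by rewrite lt_min ltr01 divr_gt0.
have eta1 : eta <= 1 by rewrite ge_min lexx.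
have etad : eta <= d / r by rewrite ge_min lexx orbT.
have [M M0 MP] := circle_bounded eh (ltW r0).
pose B := M + normc h'.
have nHB t : normc (H t - h') <= B.
  apply: le_trans (normc_triangle _ _) _; rewrite normcN lerD2r; apply: MP.
  by rewrite normcM normc_cis mulr1 normc_real_ge0// ltW.
have K0 t : 0 <= K t.
  rewrite subr_ge0 ler_pdivrMr// mul1r (_ : 4 = 2 ^+ 2); last by ring.
  apply: lerXn2r; rewrite ?nnegrE ?normc_ge0//.
  by apply: le_trans (normc_triangle _ _) _; rewrite normcN !normc_cis.
(* [rho] bounds [K] from above where [cis t] is at distance at least [eta] from [w], and [rho']
   bounds it from below within distance [eta / 2]. *)
pose rho := 1 - eta ^+ 2 / 4; pose rho' := 1 - eta ^+ 2 / 16.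
have eta2 : 0 < eta ^+ 2 <= 1 by rewrite exprn_gt0//= exprn_ile1// ltW.
have rho0 : 0 <= rho by rewrite /rho; move: eta2; move: (eta ^+ 2) => x /andP[]; lra.
have rr : rho < rho' by rewrite /rho /rho'; move: eta2; move: (eta ^+ 2) => x /andP[]; lra.
have bnd m t : normc (H t - h') * K t ^+ m <= normc h' / 4 * K t ^+ m + B * rho ^+ m.
  have [nt|nt] := ltP (normc (cis t - w)) eta.
    rewrite -[leLHS]addr0; apply: lerD; last first.
      by rewrite mulr_ge0 ?exprn_ge0// (le_trans _ (nHB t))// normc_ge0.
    rewrite ler_wpM2r ?exprn_ge0//; apply/ltW/dP; rewrite -mulrBr normcM normc_real_ge0 ?(ltW r0)//.
    by rewrite mulrC -ltr_pdivlMr//; exact: lt_le_trans etad.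
  rewrite -[leLHS]add0r; apply: lerD; first by rewrite mulr_ge0 ?exprn_ge0// ltW.
  apply: ler_pM; rewrite ?normc_ge0 ?exprn_ge0//.
  apply: lerXn2r; rewrite ?nnegrE// /K /rho lerD2l lerN2 ler_pM2r//.
  by apply: lerXn2r; rewrite ?nnegrE ?normc_ge0 ?(ltW eta0).
pose J m := rint 0 pi2 (fun t => K t ^+ m).
have Jle m : normc h' * J m <= 2 * (normc h' / 4 * J m + B * rho ^+ m * pi2).
  have sm := (span m).1.
  have E : cint 0 pi2 (fun t => (H t - h') * ((K t) ^+ m)%:C) = - (h' * (J m)%:C).
    rewrite (_ : (fun t => _) = fun t => H t * (cis t ^+ 0 * cis (- t) ^+ 0) * ((K t) ^+ m)%:C - h' * ((K t) ^+ m)%:C).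
      rewrite cintB; [|by under eq_fun do rewrite !expr0 !mulr1; exact: ccontM|exact: ccontZ].
      by rewrite (span m).2 (cintZ _ _ _ sm) cint_real sub0r.
    by apply/funext => t; rewrite !expr0; ring.
  have J0 : 0 <= J m by apply: rint_ge0 => t _; rewrite exprn_ge0.
  rewrite -[X in _ * X <= _](normc_real_ge0 J0) -normcM -normcN -E.
  apply: le_trans (cint_norm _ _ (ccontM cHd sm)) _.
  rewrite ler_wpM2l//.
  have cc1 : continuous (fun t => normc h' / 4 * K t ^+ m) by move=> t; apply: cvgMr; exact: cKm.
  have cc2 : continuous (fun t : R => B * rho ^+ m) by exact: cst_continuous.
  rewrite (_ : _ + _ = rint 0 pi2 (fun t => normc h' / 4 * K t ^+ m + B * rho ^+ m)); last first.
    by rewrite (rintD _ _ cc1 cc2) (rintZ _ _ _ (cKm m)) (rint_cst _ (ltW pi20)) subr0.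
  apply: rint_le.
  - exact: ccont_normc (ccontM cHd sm).
  - by move=> t; apply: cvgD; [exact: cc1|exact: cc2].
  - by move=> t _; rewrite normcM normc_real_ge0 ?exprn_ge0//; exact: bnd.
have [dl dl0 dlP] := ccont_cis t0 (divr_gt0 eta0 (ltr0Sn R 1)).
pose del := Num.min (dl / 2) pi.
have del0 : 0 < del by rewrite lt_min divr_gt0// pi_gt0.
have del_pi : del <= pi by rewrite ge_min lexx orbT.
have deldl : del < dl.
  by apply: (@le_lt_trans _ _ (dl / 2)); [rewrite ge_min lexx|rewrite ltr_pdivrMr// mulr_natr mulr2n ltrDl].
(* An interval on one side of [t0] only, since [t0] may be an end point of the range of angles. *)
have [c [c0 c1 c2]] : exists c, [/\ 0 <= c, c + del <= pi2 & forall t, c <= t <= c + del -> `|t - t0| < dl].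
  case/andP: t0b => t00 t01; have [tp|tp] := leP t0 pi.
    exists t0; split => //; first by rewrite mulr_natl mulr2n lerD.
    by move=> t /andP[h1 h2]; rewrite ger0_norm ?subr_ge0//; lra.
  exists (t0 - del); split; rewrite ?subrK//; first by rewrite subr_ge0 ltW// (le_lt_trans del_pi).
  by move=> t /andP[h1 h2]; rewrite ltr_norml; lra.
have Jge m : del * rho' ^+ m <= J m.
  apply: (@le_trans _ _ (rint c (c + del) (fun t => K t ^+ m))); last first.
    by apply: rint_sub => //; [rewrite lerDl ltW|move=> x; rewrite exprn_ge0].
  rewrite (_ : del * _ = rint c (c + del) (fun=> rho' ^+ m)); last first.
    by rewrite rint_cst ?lerDl ?(ltW del0)// addrAC subrr add0r mulrC.
  apply: rint_le => //; first by move=> x; exact: cst_continuous.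
  move=> t tc; apply: lerXn2r; rewrite ?nnegrE// ?(le_trans rho0 (ltW rr))//.
  rewrite /K /rho' lerD2l lerN2 ler_pdivrMr// (_ : _ / 16 * 4 = (eta / 2) ^+ 2); last by field.
  by apply: lerXn2r; rewrite ?nnegrE ?normc_ge0 ?divr_ge0 ?(ltW eta0)//; apply/ltW/dlP/c2.
apply: (@expr_ratio_contra (normc h' / 2 * del) rho rho' (2 * B * pi2)) => //.
  by rewrite mulr_gt0// divr_gt0.
move=> m; have := Jle m; have := ler_wpM2l (ltW (divr_gt0 hpos (ltr0Sn R 1))) (Jge m).
rewrite mulrA; move: (J m) (normc h') (rho ^+ m) (rho' ^+ m) => j n x y h1 h2.
apply: le_trans h1 _; rewrite -(lerD2r (n / 2 * j)).
rewrite (_ : n / 2 * j + n / 2 * j = n * j); last by field.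
by apply: le_trans h2 _; rewrite le_eqVlt; apply/orP; left; apply/eqP; field.
Qed.

(** The difference of both sides has zero coefficients and vanishes on every circle of positive
    radius by [coef_eq0_zero]; the origin is treated by [circle_mean]. *)
Lemma taylor f z : entire f -> f z = psum (coef f) z.
Proof.
move=> ef; have ra := coef_rapid ef; have ep := psum_entire ra.
have [->|z0] := eqVneq z 0.
  have -> : psum (coef f) 0 = coef f 0.
    apply: csum_eq; first exact: rapid_summable.
    move=> e e0; exists 1%N => -[//|n] _; rewrite /partial big_ord_recl/= expr0 mulr1.
    by rewrite big1 ?addr0 ?subrr ?normc0 ?(ltW e0)// => i _; rewrite expr0n/= mulr0.
  have pi0 : (2 * pi)%:C != 0 :> R[i].
    by have P := @pi2_gt0 R; rewrite -normc_eq0 (normc_real_ge0 (ltW P)) lt0r_neq0.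
  rewrite /coef (_ : (fun t => _) = fun t => f (1%:C * cis t)); last first.
    by apply/funext => t; rewrite expr0 mulr1 mul1r.
  by rewrite (circle_mean ef ltr01) mulKf.
have [t tb tE] := polar_exists z.
have n0 : 0 < normc z by rewrite normc_gt0.
have eh := entireB ef ep.
have := @coef_eq0_zero _ _ t eh _ n0 tb; rewrite -tE => H.
apply/eqP; rewrite -subr_eq0 H// => n.
by rewrite coefB// coef_psum// subrr.
Qed.

End taylor.

(** * Integration over the plane *)

Section affine_change.
Context {R : realType}.
Local Notation mu := (@lebesgue_measure R).
Local Notation MR := (measurableTypeR R).
Local Open Scope ereal_scope.

Lemma measurable_affine (r a : R) : measurable_fun [set: MR] (fun x : MR => (r * x + a)%R : MR).
Proof. by apply: measurable_funD => //; apply: measurable_funM. Qed.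

(** The scaled pushforward agrees with Lebesgue measure on half-open intervals, and this determines
    the measure. *)
Lemma lebesgue_measure_affine (r a : R) (A : set MR) : (0 < r)%R -> measurable A ->
  mu ((fun x : MR => (r * x + a)%R : MR) @^-1` A) = (r^-1)%:E * mu A.
Proof.
move=> r0 mA; pose phi (x : MR) : MR := (r * x + a)%R.
have mphi : measurable_fun setT phi by exact: measurable_affine.
have H : mu A = mscale (NngNum (ltW r0)) (pushforward mu phi) A.
  move=> m; apply: lebesgue_measure_unique => // _ [[u v] _ <-].
  transitivity (r%:E * mu `]((u - a) / r)%R, ((v - a) / r)%R]%classic); last first.
    rewrite /=/mscale/=; congr (_ * mu _); apply/seteqP; split => x; rewrite /phi/= !in_itv/=.
      by rewrite ltr_pdivrMr// ler_pdivlMr// ltrBlDr lerBrDr mulrC.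
    by rewrite ltr_pdivrMr// ler_pdivlMr// ltrBlDr lerBrDr mulrC.
  rewrite /=.
  rewrite !lebesgue_measure_itv/= !lte_fin ltr_pM2r ?invr_gt0// ltrD2r.
  case: ifPn => _; rewrite ?mule0// -!EFinB -EFinM; congr EFin.
  rewrite -mulrBl mulrCA divff ?gt_eqF// mulr1; ring.
rewrite (H mphi) /mscale/= muleA -EFinM mulVf ?gt_eqF// mul1e.
by [].
Qed.

Lemma ge0_integral_affine (r a : R) (f : MR -> \bar R) : (0 < r)%R ->
  measurable_fun setT f -> (forall x, 0 <= f x) ->
  \int[mu]_x f (r * x + a)%R = (r^-1)%:E * \int[mu]_x f x.
Proof.
move=> r0 mf f0; pose phi (x : MR) : MR := (r * x + a)%R.
have mphi : measurable_fun setT phi by exact: measurable_affine.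
rewrite (_ : (fun x => _) = f \o phi)//.
rewrite -[in LHS](preimage_setT phi) -ge0_integral_pushforward//.
have ri : (0 <= r^-1)%R by rewrite invr_ge0 ltW.
rewrite -(@ge0_integral_mscale _ _ _ mu setT measurableT (NngNum ri) f mf)//.
apply: eq_measure_integral => A mA _ /=.
exact: lebesgue_measure_affine.
Qed.

End affine_change.

Section plane_change.
Context {R : realType}.
Local Notation mu := (@lebesgue_measure R).
Local Notation MR := (measurableTypeR R).
Local Notation plane := (MR * MR)%type.
Local Open Scope ereal_scope.
Implicit Types (g : plane -> \bar R).

Lemma measurable_plane_affine (a b c : R) :
  measurable_fun [set: plane] (fun z : plane => (a * z.1 + b * z.2 + c)%R : MR).
Proof.
apply: measurable_funD => //; apply: measurable_funD; apply: measurable_funM => //.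
Qed.

Lemma area_tonelli1 g : measurable_fun setT g -> (forall z, 0 <= g z) ->
  \int[area]_z g z = \int[mu]_x \int[mu]_y g (x, y).
Proof. by move=> mg g0; exact: (@fubini_tonelli1 _ _ _ _ _ mu mu). Qed.

Lemma area_tonelli2 g : measurable_fun setT g -> (forall z, 0 <= g z) ->
  \int[area]_z g z = \int[mu]_y \int[mu]_x g (x, y).
Proof. by move=> mg g0; exact: (@fubini_tonelli2 _ _ _ _ _ mu mu). Qed.

Lemma area_affine_x (r k a : R) g : (0 < r)%R -> measurable_fun setT g -> (forall z, 0 <= g z) ->
  \int[area]_z g ((r * z.1 + k * z.2 + a)%R, z.2) = (r^-1)%:E * \int[area]_z g z.
Proof.
move=> r0 mg g0.
have mS : measurable_fun [set: plane] (fun z : plane => ((r * z.1 + k * z.2 + a)%R, z.2) : plane).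
  by apply: measurable_fun_pair; [exact: measurable_plane_affine|exact: measurable_snd].
rewrite area_tonelli2//; last exact: (measurableT_comp mg mS).
have mg2 y : measurable_fun setT (fun x : MR => g (x, y)).
  by apply: (measurable_fun_pair1 (f := g)).
rewrite area_tonelli2// -ge0_integralZl//; last 3 first.
- exact: measurable_fun_fubini_tonelli_G.
- by move=> y _; exact: integral_ge0.
- by rewrite lee_fin invr_ge0 ltW.
apply: eq_integral => y _.
under eq_integral do rewrite /= -addrA.
exact: (@ge0_integral_affine R r (k * y + a)%R (fun x => g (x, y)) r0 (mg2 y)).
Qed.

Lemma area_affine_y (r k a : R) g : (0 < r)%R -> measurable_fun setT g -> (forall z, 0 <= g z) ->
  \int[area]_z g (z.1, (r * z.2 + k * z.1 + a)%R) = (r^-1)%:E * \int[area]_z g z.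
Proof.
move=> r0 mg g0.
have mS : measurable_fun [set: plane] (fun z : plane => (z.1, (r * z.2 + k * z.1 + a)%R) : plane).
  apply: measurable_fun_pair; first exact: measurable_fst.
  under eq_fun do rewrite [(r * _ + _)%R]addrC; exact: measurable_plane_affine.
rewrite area_tonelli1//; last exact: (measurableT_comp mg mS).
have mg2 x : measurable_fun setT (fun y : MR => g (x, y)).
  by apply: (measurable_fun_pair2 (f := g)).
rewrite area_tonelli1// -ge0_integralZl//; last 3 first.
- exact: measurable_fun_fubini_tonelli_F.
- by move=> y _; exact: integral_ge0.
- by rewrite lee_fin invr_ge0 ltW.
apply: eq_integral => x _.
under eq_integral do rewrite /= -addrA.
exact: (@ge0_integral_affine R r (k * x + a)%R (fun y => g (x, y)) r0 (mg2 x)).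
Qed.

(** A rotation by [theta] is a product of three shears, with [k = - tan (theta / 2)], and each shear
    preserves area by Tonelli's theorem and translation invariance. The half turn has no such
    decomposition. *)
Lemma area_rot0 (c s : R) g : (c ^+ 2 + s ^+ 2 = 1)%R -> (1 + c != 0)%R ->
  measurable_fun setT g -> (forall z, 0 <= g z) ->
  \int[area]_z g ((c * z.1 - s * z.2)%R, (s * z.1 + c * z.2)%R) = \int[area]_z g z.
Proof.
move=> cs c1 mg g0; pose k := (- s / (1 + c))%R.
have ks : (1 + k * s = c)%R.
  have s2 : (s ^+ 2 = 1 - c ^+ 2)%R by rewrite -cs; ring.
  rewrite /k (_ : (1 + - s / (1 + c) * s = 1 - s ^+ 2 / (1 + c))%R); last by field.
  by rewrite s2; field.
have kk : (k * (1 + c) = - s)%R by rewrite /k; field.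
pose Sx (z : plane) : plane := ((1 * z.1 + k * z.2 + 0)%R, z.2).
pose Sy (z : plane) : plane := (z.1, (1 * z.2 + s * z.1 + 0)%R).
have mSx : measurable_fun [set: plane] Sx.
  by apply: measurable_fun_pair; [exact: measurable_plane_affine|exact: measurable_snd].
have mSy : measurable_fun [set: plane] Sy.
  apply: measurable_fun_pair; first exact: measurable_fst.
  under eq_fun do rewrite [(1 * _ + _)%R]addrC; exact: measurable_plane_affine.
rewrite (_ : (fun z => _) = fun z => g (Sx (Sy (Sx z)))); last first.
  apply/funext => -[x y]; rewrite /Sx /Sy/=; congr (g (_, _)); last first.
    by rewrite -[in LHS]ks; ring.
  rewrite -[in LHS](opprK s) -kk -[in LHS]ks; ring.
have e1 : (1^-1)%:E = 1 :> \bar R by rewrite invr1.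
rewrite (@area_affine_x 1 k 0 (fun z => g (Sx (Sy z))))//; last first.
  exact: (measurableT_comp mg (measurableT_comp mSx mSy)).
rewrite (@area_affine_y 1 s 0 (fun z => g (Sx z)))//; last exact: (measurableT_comp mg mSx).
by rewrite (@area_affine_x 1 k 0 g)// e1 !mul1e.
Qed.

Lemma measurable_rot (c s : R) : measurable_fun [set: plane]
  (fun z : plane => ((c * z.1 - s * z.2)%R, (s * z.1 + c * z.2)%R) : plane).
Proof.
apply: measurable_fun_pair.
  have := measurable_plane_affine c (- s) 0; congr measurable_fun.
  by apply/funext => z; rewrite addr0 mulNr.
have := measurable_plane_affine s c 0; congr measurable_fun.
by apply/funext => z; rewrite addr0.
Qed.

Lemma area_rot (c s : R) g : (c ^+ 2 + s ^+ 2 = 1)%R ->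
  measurable_fun setT g -> (forall z, 0 <= g z) ->
  \int[area]_z g ((c * z.1 - s * z.2)%R, (s * z.1 + c * z.2)%R) = \int[area]_z g z.
Proof.
move=> cs mg g0; have [c1|] := eqVneq (1 + c)%R 0%R; last by move=> c1; exact: area_rot0.
have cE : (c = -1)%R by apply/eqP; rewrite -subr_eq0 opprK addrC c1.
have s0 : (s = 0)%R.
  by move: cs; rewrite cE sqrrN expr1n => /eqP; rewrite -subr_eq0 addrAC subrr add0r sqrf_eq0 => /eqP.
(* The half turn, excluded in [area_rot0], is a quarter turn applied twice. *)
have q : (0 ^+ 2 + 1 ^+ 2 = 1 :> R)%R by rewrite expr0n expr1n add0r.
have q1 : (1 + 0 != 0 :> R)%R by rewrite addr0 oner_eq0.
pose g1 (z : plane) := g ((0 * z.1 - 1 * z.2)%R, (1 * z.1 + 0 * z.2)%R).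
have mg1 : measurable_fun setT g1 by exact: (measurableT_comp mg (measurable_rot 0 1)).
rewrite -(area_rot0 q q1 mg g0) -/g1 -(area_rot0 q q1 mg1 (fun z => g0 _)).
apply: eq_integral => z _; rewrite /g1/= cE s0; congr (g (_, _)); ring.
Qed.

Definition cpl (z : plane) : R[i] := z.1 +i* z.2.

Lemma ge0_area_rotation (a : R[i]) (G : R[i] -> \bar R) : normc a = 1%R ->
  measurable_fun [set: plane] (G \o cpl) -> (forall z, 0 <= G z) ->
  \int[area]_z G (a * cpl z)%R = \int[area]_z G (cpl z).
Proof.
case: a => c s a1 mG G0.
have cs : (c ^+ 2 + s ^+ 2 = 1)%R.
  by move: a1 => /= /(congr1 (fun x => x ^+ 2)%R); rewrite expr1n sqr_sqrtr// addr_ge0// sqr_ge0.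
rewrite -(area_rot cs mG (fun z => G0 _)); apply: eq_integral => -[x y] _ /=.
by rewrite /cpl/=; congr (G (_ +i* _)); rewrite addrC.
Qed.

Lemma ge0_area_affine (r : R) (b : R[i]) (G : R[i] -> \bar R) : (0 < r)%R ->
  measurable_fun [set: plane] (G \o cpl) -> (forall z, 0 <= G z) ->
  \int[area]_z G (r%:C * cpl z + b)%R = (r^-1 ^+ 2)%:E * \int[area]_z G (cpl z).
Proof.
case: b => u v r0 mG G0.
rewrite (_ : (fun z => _) = fun z : plane => (G \o cpl) ((r * z.1 + 0 * z.2 + u)%R, (r * z.2 + 0 * z.1 + v)%R)); last first.
  by apply/funext => -[x y]; rewrite /cpl/=; congr (G (_ +i* _)); ring.
have mS : measurable_fun [set: plane] (fun z : plane => (z.1, (r * z.2 + 0 * z.1 + v)%R) : plane).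
  apply: measurable_fun_pair; first exact: measurable_fst.
  under eq_fun do rewrite [(r * _ + _)%R]addrC; exact: measurable_plane_affine.
rewrite (_ : (fun z => _) = fun z : plane => (fun w : plane => (G \o cpl) (w.1, (r * w.2 + 0 * w.1 + v)%R)) ((r * z.1 + 0 * z.2 + u)%R, z.2)); last first.
  by apply/funext => -[x y] /=; rewrite !mul0r.
pose g2 (w : plane) := (G \o cpl) (w.1, (r * w.2 + 0 * w.1 + v)%R).
have mg2 : measurable_fun setT g2 by exact: (measurableT_comp mG mS).
rewrite (@area_affine_x r 0 u g2 r0 mg2 (fun z => G0 _)).
rewrite (@area_affine_y r 0 v (G \o cpl) r0 mG (fun z => G0 _)).
by rewrite muleA -EFinM expr2.
Qed.

End plane_change.

Section area_sigma_finite.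
Context {R : realType}.
Local Notation mu := (@lebesgue_measure R).
Local Notation MR := (measurableTypeR R).

(** Required by Tonelli's theorem for the product of the plane with the angles. *)
Lemma area_sigma_finite : sigma_finite setT (@area R).
Proof.
pose I n : set MR := `[- n%:R, n%:R]%classic.
exists (fun n => I n `*` I n).
  apply/seteqP; split => // -[x y] _.
  exists (Num.truncn (`|x| + `|y|)).+1 => //.
  have H : `|x| + `|y| <= (Num.truncn (`|x| + `|y|)).+1%:R by exact/ltW/truncnS_gt.
  split; rewrite /I/= in_itv/= -ler_norml; apply: le_trans H.
    by rewrite lerDl.
  by rewrite lerDr.
move=> n; have mI : measurable (I n) by exact: measurable_itv.
split; first exact: measurableX.
rewrite (_ : area (I n `*` I n) = mu (I n) * mu (I n))%E; last exact: product_measure1E.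
by rewrite lebesgue_measure_itv/=; case: ifP => _; rewrite ?mule0 ?ltry// -EFinD -EFinM ltry.
Qed.

HB.instance Definition _ := Measure_isSigmaFinite.Build _ _ _ (@area R) area_sigma_finite.

End area_sigma_finite.

(** * Averaging over rotations *)

Section rotation_average.
Context {R : realType}.
Local Notation mu := (@lebesgue_measure R).
Local Notation MR := (measurableTypeR R).
Local Notation plane := (MR * MR)%type.
Local Notation pi2 := (2 * pi : R)%R.
Local Open Scope ereal_scope.
Implicit Types (G : R[i] -> \bar R).

Lemma measurable_cis_mul : measurable_fun [set: plane * MR]
  (fun w : plane * MR => ((cos w.2 * w.1.1 - sin w.2 * w.1.2)%R,
     (sin w.2 * w.1.1 + cos w.2 * w.1.2)%R) : plane).
Proof.
have mc : measurable_fun [set: plane * MR] (fun w : plane * MR => cos w.2 : MR).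
  apply: (measurableT_comp (f := (@cos R : MR -> MR))); last exact: measurable_snd.
  by apply: continuous_measurable_fun; exact: continuous_cos.
have ms : measurable_fun [set: plane * MR] (fun w : plane * MR => sin w.2 : MR).
  apply: (measurableT_comp (f := (@sin R : MR -> MR))); last exact: measurable_snd.
  by apply: continuous_measurable_fun; exact: continuous_sin.
have m1 : measurable_fun [set: plane * MR] (fun w : plane * MR => w.1.1 : MR).
  exact: (measurableT_comp measurable_fst measurable_fst).
have m2 : measurable_fun [set: plane * MR] (fun w : plane * MR => w.1.2 : MR).
  exact: (measurableT_comp measurable_snd measurable_fst).
by apply: measurable_fun_pair; [apply: measurable_funB|apply: measurable_funD]; exact: measurable_funM.
Qed.

Lemma cis_mul_cpl t (z : plane) :
  (cis t * cpl z)%R = cpl ((cos t * z.1 - sin t * z.2)%R, (sin t * z.1 + cos t * z.2)%R).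
Proof. by case: z => x y; rewrite cisE /cpl/=; congr (_ +i* _); rewrite addrC. Qed.

Definition rot_kernel G (w : plane * MR) : \bar R :=
  G (cis w.2 * cpl w.1)%R * (\1_(`[0%R, pi2]%classic : set MR) w.2)%:E.

Lemma measurable_rot_kernel G : measurable_fun [set: plane] (G \o cpl) ->
  measurable_fun setT (rot_kernel G).
Proof.
move=> mG; apply: emeasurable_funM.
  rewrite (_ : (fun _ => _) = (G \o cpl) \o (fun w : plane * MR => ((cos w.2 * w.1.1 - sin w.2 * w.1.2)%R,
   (sin w.2 * w.1.1 + cos w.2 * w.1.2)%R) : plane)).
    exact: (measurableT_comp mG measurable_cis_mul).
  by apply/funext => w /=; rewrite cis_mul_cpl.
apply/measurable_EFinP; apply: (measurableT_comp (f := (\1_(`[0%R, pi2]%classic : set MR) : MR -> R))).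
  exact: measurable_indic.
exact: measurable_snd.
Qed.

Lemma rot_kernelE G z : \int[mu]_(t in `[0%R, pi2]) G (cis t * cpl z)%R = \int[mu]_t rot_kernel G (z, t).
Proof.
rewrite integral_mkcond; apply: eq_integral => t _.
by rewrite /rot_kernel patchE indicE/=; case: ifPn; rewrite ?mule1 ?mule0.
Qed.

Lemma measurable_rotation_average G : measurable_fun [set: plane] (G \o cpl) -> (forall z, 0 <= G z) ->
  measurable_fun [set: plane] (fun z => \int[mu]_(t in `[0%R, pi2]) G (cis t * cpl z)%R).
Proof.
move=> mG G0; under eq_fun do rewrite rot_kernelE.
apply: (@measurable_fun_fubini_tonelli_F _ _ _ _ _ mu (rot_kernel G)).
  exact: measurable_rot_kernel.
by move=> w; rewrite mule_ge0// lee_fin.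
Qed.

(** Takes the place of polar coordinates: an inequality between means over every circle becomes one
    between area integrals. It holds because each single rotation preserves area. *)
Lemma rotation_average G : measurable_fun [set: plane] (G \o cpl) -> (forall z, 0 <= G z) ->
  \int[area]_z \int[mu]_(t in `[0%R, pi2]) G (cis t * cpl z)%R = pi2%:E * \int[area]_z G (cpl z).
Proof.
move=> mG G0; pose f := rot_kernel G.
have mf := measurable_rot_kernel mG.
have f0 w : 0 <= f w by rewrite mule_ge0// lee_fin.

transitivity (\int[area]_z \int[mu]_t f (z, t)).
  by apply: eq_integral => z _; rewrite rot_kernelE.
rewrite (@fubini_tonelli _ _ _ _ _ area mu f mf f0).
transitivity (\int[mu]_t (\int[area]_z G (cpl z) * (\1_(`[0%R, pi2]%classic : set MR) t)%:E)).
  apply: eq_integral => t _; rewrite /f /rot_kernel/=.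
  rewrite -(@ge0_area_rotation _ (cis t) G (normc_cis t) mG G0).
  rewrite -ge0_integralZr//.
  rewrite (_ : (fun _ => _) = (G \o cpl) \o (fun z : plane => ((cos t * z.1 - sin t * z.2)%R, (sin t * z.1 + cos t * z.2)%R) : plane)).
    exact: (measurableT_comp mG (measurable_rot _ _)).
  by apply/funext => z /=; rewrite cis_mul_cpl.
have I0 : 0 <= \int[area]_z G (cpl z) by apply: integral_ge0.
rewrite ge0_integralZl//; last exact/measurable_EFinP/measurable_indic.
rewrite integral_indic// setIT /=.
rewrite (_ : mu `[0%R, pi2]%classic = pi2%:E) 1?muleC//.
by rewrite lebesgue_measure_itv/= lte_fin pi2_gt0 -EFinB subr0.
Qed.

End rotation_average.

Section disc_indicator.
Context {R : realType}.
Local Notation mu := (@lebesgue_measure R).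
Local Notation MR := (measurableTypeR R).
Local Notation plane := (MR * MR)%type.

Definition disc (r : R) (z : R[i]) : R := (normc z < r)%R%:R.

Lemma measurable_normc : measurable_fun [set: plane] (fun z : plane => normc (cpl z) : MR).
Proof. exact: (continuous_measurable_plane normc_plane_continuous). Qed.

Lemma measurable_radial (f : R -> R) : measurable_fun [set: MR] (f : MR -> MR) ->
  measurable_fun [set: plane] (fun z : plane => f (normc (cpl z)) : MR).
Proof. by move=> mf; exact: (measurableT_comp mf measurable_normc). Qed.

Lemma measurable_disc r : measurable_fun [set: plane] (fun z : plane => disc r (cpl z) : MR).
Proof.
apply: (measurable_radial (f := fun x => (x < r)%R%:R)).
rewrite (_ : (fun _ => _) = \1_(`]-oo, r[%classic : set MR)).
  exact: measurable_indic.
by apply/funext => x; rewrite indicE mem_setE in_itv.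
Qed.

Lemma disc_ge0 r z : 0 <= disc r z. Proof. exact: ler0n. Qed.

Lemma disc_area_ge (r : R) : 0 < r ->
  ((r ^+ 2 / 4)%:E <= \int[area]_z (disc r (cpl z))%:E)%E.
Proof.
(* A square of side [r / 2] inside the disc gives enough area. *)
move=> r0; pose I : set MR := `[0, (r / 2)]%classic.
have mI : measurable I by exact: measurable_itv.
have -> : ((r ^+ 2 / 4)%:E = \int[area]_z (\1_(I `*` I) z)%:E)%E.
  rewrite integral_indic//; last exact: measurableX.
  rewrite setIT (_ : _ (I `*` I) = mu I * mu I)%E; last exact: product_measure1E.
  rewrite lebesgue_measure_itv/= lte_fin divr_gt0//.
  by rewrite -EFinB subr0 -EFinM; congr EFin; field.
apply: ge0_le_integral => //.
- by apply/measurable_EFinP; apply: measurable_indic; exact: measurableX.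
- by apply/measurable_EFinP; exact: measurable_disc.
- move=> [x y] _; rewrite lee_fin indicE; case: (boolP (_ \in _)) => [/set_mem[]|_]; last exact: disc_ge0.
  rewrite /I/= !in_itv/= => /andP[x0 x1] /andP[y0 y1].
  rewrite /disc (_ : (_ < r) = true)// /cpl /=.
  rewrite -[ltRHS](ger0_norm (ltW r0)) -sqrtr_sqr ltr_sqrt ?exprn_gt0//.
  have : x ^+ 2 <= (r / 2) ^+ 2 by apply: lerXn2r; rewrite ?nnegrE ?divr_ge0 ?(ltW r0).
  have : y ^+ 2 <= (r / 2) ^+ 2 by apply: lerXn2r; rewrite ?nnegrE ?divr_ge0 ?(ltW r0).
  have : 0 < r ^+ 2 by rewrite exprn_gt0.
  rewrite (_ : (r / 2) ^+ 2 = r ^+ 2 / 4); last by field.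
  lra.
Qed.

End disc_indicator.

(** * Sub-mean value inequalities *)

Section sub_mean.
Context {R : realType}.
Local Notation mu := (@lebesgue_measure R).
Local Notation MR := (measurableTypeR R).
Local Notation plane := (MR * MR)%type.
Local Notation pi2 := (2 * pi : R)%R.
Implicit Types (f : R[i] -> R[i]).

Lemma measurable_normc_entire f : entire f ->
  measurable_fun [set: plane] (fun z : plane => normc (f (cpl z)) : MR).
Proof. by move=> ef; exact: (continuous_measurable_plane (entire_plane_continuous ef)). Qed.

Lemma sub_mean1 f (c : R[i]) (r : R) : entire f -> 0 < r ->
  ((normc (f c) * r ^+ 2 / 8)%:E <=
    \int[area]_z (normc (f (cpl z + c)) * disc r (cpl z))%:E)%E.
Proof.
move=> ef r0; have eg : entire (fun z => f (z + c)) := entire_comp ef (entireD entire_id (entire_cst c)).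
pose G (z : R[i]) := (normc (f (z + c)) * disc r z)%:E.
have G0 z : (0 <= G z)%E by rewrite lee_fin mulr_ge0 ?normc_ge0 ?disc_ge0.
have mG : measurable_fun [set: plane] (G \o cpl).
  apply/measurable_EFinP; apply: measurable_funM; last exact: measurable_disc.
  exact: (measurable_normc_entire eg).
have pi0 := @pi2_gt0 R.
rewrite -(@lee_pmul2l _ pi2%:E)// ?lte_fin// -[leRHS](rotation_average mG G0).
apply: (@le_trans _ _ (\int[area]_z ((pi * normc (f c)) * disc r (cpl z))%:E)%E).
  under [leRHS]eq_integral do rewrite EFinM.
  rewrite ge0_integralZl//; last first.
  - by rewrite lee_fin mulr_ge0 ?pi_ge0 ?normc_ge0.
  - by move=> z _; rewrite lee_fin disc_ge0.
  - by apply/measurable_EFinP; exact: measurable_disc.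
  apply: le_trans (lee_wpmul2l _ (disc_area_ge r0)); last by rewrite lee_fin mulr_ge0 ?pi_ge0 ?normc_ge0.
  by rewrite -!EFinM lee_fin le_eqVlt; apply/orP; left; apply/eqP; field.
have GT : forall z : plane, (\int[mu]_(t in `[0%R, pi2]) G (cis t * cpl z)%R =
    (rint 0 pi2 (fun t => normc (f (cpl z * cis t + c)%R)) * disc r (cpl z))%:E)%E.
  move=> z; rewrite /G.
  have cc : ccont (fun t => f (cpl z * cis t + c)).
    exact: (ccont_circle (f := fun z => f (z + c))).
  have dE t : disc r (cis t * cpl z) = disc r (cpl z) by rewrite /disc normcM normc_cis mul1r.
  under eq_integral do rewrite dE EFinM.
  rewrite ge0_integralZr//; last first.
  - by rewrite lee_fin disc_ge0.
  - by move=> t _; rewrite lee_fin normc_ge0.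
  - apply/measurable_EFinP; apply: measurable_funTS.
    apply: continuous_measurable_fun; under eq_fun do rewrite mulrC; exact: (ccont_normc cc).
  rewrite EFinM; congr (_ * _)%E; rewrite /rint /Rintegral fineK.
    by apply: eq_integral => t _; rewrite mulrC.
  apply: integrable_fin_num => //; exact: cont_integrable (ccont_normc cc).
apply: ge0_le_integral => //.
- by move=> z _; rewrite lee_fin mulr_ge0 ?disc_ge0// mulr_ge0 ?pi_ge0 ?normc_ge0.
- by apply/measurable_EFinP; apply: measurable_funM => //; exact: measurable_disc.
- exact: measurable_rotation_average.
- move=> z _; rewrite GT lee_fin ler_wpM2r ?disc_ge0//.
  have e2 : entire (fun w => f (cpl z * w + c)) := entire_comp eg (entireM (entire_cst (cpl z)) entire_id).
  have := @mean_le _ _ 0 _ e2 ltr01; rewrite mulr0 add0r -mulrA ler_pM2l//.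
  by under eq_rint do rewrite add0r mul1r.
Qed.

End sub_mean.

Section sub_mean_p.
Context {R : realType}.
Local Notation mu := (@lebesgue_measure R).
Local Notation MR := (measurableTypeR R).
Local Notation plane := (MR * MR)%type.
Implicit Types (f : R[i] -> R[i]).

Lemma entire_bounded f (r : R) : entire f -> 0 <= r ->
  exists2 B, 0 <= B & forall z, normc z <= r -> normc (f z) <= B.
Proof.
move=> ef r0; have ra := coef_rapid ef.
have h2 : 0 < 2^-1 :> R by rewrite invr_gt0.
have half : 0 <= (2^-1 : R) < 1 by rewrite invr_ge0 ler0n invf_lt1 ?ltr1n.
have [C C0 CP] := rapid_geo ra r0 h2.
exists (C / (1 - 2^-1)); first by rewrite divr_ge0// subr_ge0; case/andP: half => _ /ltW.
move=> z zr; rewrite (taylor z ef); apply: csum_le => n.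
apply: le_trans (geo_sum n C0 half); apply: ler_sum => m _.
rewrite normcM normcX; apply: le_trans (CP m).
by rewrite ler_wpM2l ?normc_ge0// lerXn2r ?nnegrE ?normc_ge0.
Qed.

Lemma area_translate (b : R[i]) (G : R[i] -> \bar R) :
  measurable_fun [set: plane] (G \o cpl) -> (forall z, (0 <= G z)%E) ->
  (\int[area]_z G (cpl z + b)%R = \int[area]_z G (cpl z))%E.
Proof.
move=> mG G0; have := @ge0_area_affine R 1 b G ltr01 mG G0.
rewrite invr1 expr1n mul1e => <-; apply: eq_integral => z _.
by congr (G (_ + _)); rewrite mul1r.
Qed.

Lemma measurable_powR_entire f (p : R) : entire f ->
  measurable_fun [set: plane] (fun z : plane => normc (f (cpl z)) `^ p : MR).
Proof.
move=> ef; apply: (measurableT_comp (measurable_powR p)).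
exact: measurable_normc_entire.
Qed.

Lemma measurable_disc_shift (c : R[i]) r :
  measurable_fun [set: plane] (fun z : plane => disc r (cpl z - c) : MR).
Proof.
have ec : entire (fun z : R[i] => z - c) := entireB entire_id (entire_cst c).
have := measurable_normc_entire ec => mc.
apply: (measurableT_comp (f := (fun x => (x < r)%R%:R) : MR -> MR)) mc.
rewrite (_ : (fun _ => _) = \1_(`]-oo, r[%classic : set MR)).
  exact: measurable_indic.
by apply/funext => x; rewrite indicE mem_setE in_itv.
Qed.

(** For exponents below 1 the mean value inequality is applied at a point [c1] that nearly maximises
    [D z ^ al * normc (f z)], where [D] is the distance to the boundary of the disc. Within half
    that distance of [c1], [normc (f z)] is at most [L * normc (f c1)], so its power [1 - p] can be
    split off, and maximality carries the estimate back to [c]. *)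
Lemma sub_mean_le1 (p : R) : 0 < p -> p <= 1 -> exists2 K : R, 0 < K &
  forall f (c : R[i]) (r : R), entire f -> 0 < r ->
  ((normc (f c) `^ p * r ^+ 2)%:E <=
    K%:E * \int[area]_z (normc (f (cpl z)) `^ p * disc r (cpl z - c))%:E)%E.
Proof.
(* With this exponent the power [p] of [D z ^ al] is [D z ^+ 2], which matches the area. *)
move=> p0 p1; pose al := 2 / p.
have al0 : 0 < al by rewrite divr_gt0.
pose L : R := 2 * 2 `^ al.
have L0 : 0 < L by rewrite mulr_gt0// powR_gt0.
pose K := 2 `^ p * 4 * (8 * L `^ (1 - p)).
have K0 : 0 < K by rewrite !mulr_gt0// powR_gt0.
exists K => // f c r ef r0.
have [fc0|fc0] := eqVneq (normc (f c)) 0.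
  rewrite fc0 powR0 ?gt_eqF// mul0r mule_ge0 ?lee_fin ?(ltW K0)//.
  by apply: integral_ge0 => z _; rewrite lee_fin mulr_ge0 ?powR_ge0 ?disc_ge0.
set I := (\int[area]_z _)%E.
have I0 : (0 <= I)%E by apply: integral_ge0 => z _; rewrite lee_fin mulr_ge0 ?powR_ge0 ?disc_ge0.
pose D z := r - normc (z - c).
have [B B0 BP] := entire_bounded ef (addr_ge0 (normc_ge0 c) (ltW r0)).
pose S : set R := [set D z `^ al * normc (f z) | z in [set z | normc (z - c) < r]].
have Dc : D c = r by rewrite /D subrr normc0 subr0.
have Sc : S (r `^ al * normc (f c)).
  by exists c; rewrite ?Dc//= subrr normc0.
have ubS : has_ubound S.
  exists (r `^ al * B) => _ [z /= zr <-].
  apply: ler_pM; rewrite ?powR_ge0 ?normc_ge0//.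
    by apply: ge0_ler_powR; rewrite ?nnegrE ?(ltW al0) ?(ltW r0) ?subr_ge0 ?(ltW zr)// gerBl normc_ge0.
  apply: BP; rewrite -(subrK c z); apply: le_trans (normc_triangle _ _) _.
  by rewrite addrC lerD2l ltW.
have hS : has_sup S by split => //; exists (r `^ al * normc (f c)).
pose M := sup S.
have McM : r `^ al * normc (f c) <= M by exact: ub_le_sup.
have fcpos : 0 < normc (f c) by rewrite lt_neqAle eq_sym fc0 normc_ge0.
have M0 : 0 < M by apply: lt_le_trans McM; rewrite mulr_gt0// powR_gt0.
have [_ [c1 /= c1r <-] HM] := sup_adherent (divr_gt0 M0 (ltr0Sn _ 1)) hS.
pose rho := D c1 / 2.
have D10 : 0 < D c1 by rewrite subr_gt0.
have rho0 : 0 < rho by rewrite divr_gt0.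
have D1E : D c1 = 2 * rho by rewrite /rho; field.
have HM2 : M <= 2 * ((2 * rho) `^ al * normc (f c1)).
  rewrite -D1E; move: HM; rewrite -/M; move: (D c1 `^ al * _) => x; lra.
have f1 : 0 < normc (f c1).
  rewrite lt_neqAle normc_ge0 andbT; apply/eqP => H; move: HM2.
  by rewrite -H !mulr0 leNgt M0.
have near z : normc z < rho -> normc (f (z + c1)) <= L * normc (f c1).
  move=> zr; have zc : normc (z + c1 - c) < r - rho.
    rewrite -addrA; apply: le_lt_trans (normc_triangle _ _) _.
    by move: zr D1E; rewrite /D; lra.
  have zS : S (D (z + c1) `^ al * normc (f (z + c1))).
    by exists (z + c1) => //=; apply: lt_trans zc _; rewrite gtrBl.
  have := ub_le_sup ubS zS; rewrite -/M => /le_trans/(_ HM2) H.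
  have rD : rho <= D (z + c1) by rewrite /D; lra.
  have ra0 : 0 < rho `^ al by rewrite powR_gt0.
  rewrite -(ler_pM2l ra0); apply: le_trans (_ : _ <= D (z + c1) `^ al * normc (f (z + c1))) _.
    rewrite ler_wpM2r ?normc_ge0//; apply: ge0_ler_powR; rewrite ?nnegrE ?(ltW al0) ?(ltW rho0)//.
    exact: le_trans (ltW rho0) rD.
  apply: le_trans H _; rewrite powRM ?(ltW rho0)// /L.
  by rewrite le_eqVlt; apply/orP; left; apply/eqP; ring.
have e1 : entire (fun z => f (z + c1)) := entire_comp ef (entireD entire_id (entire_cst c1)).
have key : ((normc (f c1) `^ p * rho ^+ 2)%:E <= (8 * L `^ (1 - p))%:E * I)%E.
  have := sub_mean1 c1 ef rho0.
  pose J := (\int[area]_z (normc (f (cpl z + c1)) `^ p * disc rho (cpl z))%:E)%E.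
  have JI : (J <= I)%E.
    pose G z := (normc (f z) `^ p * disc rho (z - c1))%:E.
    rewrite (_ : J = \int[area]_z G (cpl z))%E; last first.
      rewrite -(@area_translate c1 G); first by apply: eq_integral => z _; rewrite /G addrK.
        apply/measurable_EFinP; apply: measurable_funM; first exact: measurable_powR_entire.
        exact: measurable_disc_shift.
      by move=> z; rewrite lee_fin mulr_ge0 ?powR_ge0 ?disc_ge0.
    apply: ge0_le_integral => //.
    - by move=> z _; rewrite lee_fin mulr_ge0 ?powR_ge0 ?disc_ge0.
    - apply/measurable_EFinP; apply: measurable_funM; first exact: measurable_powR_entire.
      exact: measurable_disc_shift.
    - apply/measurable_EFinP; apply: measurable_funM; first exact: measurable_powR_entire.
      exact: measurable_disc_shift.
    - move=> z _; rewrite lee_fin ler_wpM2l ?powR_ge0// /disc ler_nat.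
      case: ltP => //= H; rewrite (_ : (_ < r) = true)//.
      rewrite (_ : cpl z - c = (cpl z - c1) + (c1 - c)); last by rewrite addrA subrK.
      by apply: le_lt_trans (normc_triangle _ _) _; move: H D1E rho0; rewrite /D; lra.
  have Lf0 : 0 < L * normc (f c1) by rewrite mulr_gt0.
  have H2 : (\int[area]_z (normc (f (cpl z + c1)) * disc rho (cpl z))%:E <=
      ((L * normc (f c1)) `^ (1 - p))%:E * J)%E.
    rewrite -ge0_integralZl//; last 3 first.
    - apply/measurable_EFinP; apply: measurable_funM; first exact: (measurable_powR_entire p e1).
      exact: measurable_disc.
    - by move=> z _; rewrite lee_fin mulr_ge0 ?powR_ge0 ?disc_ge0.
    - by rewrite lee_fin powR_ge0.
    apply: ge0_le_integral => //.
    - by move=> z _; rewrite lee_fin mulr_ge0 ?normc_ge0 ?disc_ge0.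
    - apply/measurable_EFinP; apply: measurable_funM; first exact: (measurable_normc_entire e1).
      exact: measurable_disc.
    - apply: measurable_funeM.
      apply/measurable_EFinP; apply: measurable_funM; first exact: (measurable_powR_entire p e1).
      exact: measurable_disc.
    - move=> z _; rewrite -EFinM lee_fin mulrA.
      rewrite /disc; case: ltP => H; last by rewrite !mulr0.
      rewrite !mulr1; have [->|fz] := eqVneq (normc (f (cpl z + c1))) 0.
        by rewrite mulr_ge0 ?powR_ge0.
      have fz0 : 0 < normc (f (cpl z + c1)) by rewrite lt_neqAle eq_sym fz normc_ge0.
      rewrite -[leLHS]powRr1 ?normc_ge0// -{1}(subrK p 1) powRD ?fz ?implybT//.
      rewrite ler_wpM2r ?powR_ge0//; apply: ge0_ler_powR; rewrite ?nnegrE ?subr_ge0 ?normc_ge0 ?(ltW Lf0)//.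
      exact: near.
  move=> /le_trans/(_ H2)/le_trans/(_ (lee_wpmul2l _ JI)) => /(_ _).
  rewrite lee_fin powR_ge0 => /(_ isT).
  rewrite powRM ?(ltW L0) ?normc_ge0//.
  have f1p : 0 < normc (f c1) `^ (1 - p) by rewrite powR_gt0.
  rewrite -(@lee_pmul2l _ (8 / normc (f c1) `^ (1 - p))%:E)//; last by rewrite lte_fin divr_gt0.
  rewrite -EFinM muleA -EFinM => H; apply: le_trans (le_trans H _); rewrite ?lee_fin.
    have n1E : normc (f c1) = normc (f c1) `^ (1 - p) * normc (f c1) `^ p.
      by rewrite -powRD ?subrK ?powRr1 ?normc_ge0// (gt_eqF f1) implybT.
    rewrite [X in _ <= _ * (X * _ / _)]n1E.
    move: f1p; move: (normc (f c1) `^ (1 - p)) (normc (f c1) `^ p) => a b a0.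
    by rewrite le_eqVlt; apply/orP; left; apply/eqP; field; rewrite gt_eqF.
  apply: lee_wpmul2r => //; rewrite lee_fin le_eqVlt; apply/orP; left; apply/eqP; field.
  by rewrite gt_eqF.
have cE : r ^+ 2 * normc (f c) `^ p <= 2 `^ p * 4 * (normc (f c1) `^ p * rho ^+ 2).
  have : (r `^ al * normc (f c)) `^ p <= (2 * ((2 * rho) `^ al * normc (f c1))) `^ p.
    apply: ge0_ler_powR; rewrite ?nnegrE ?mulr_ge0 ?powR_ge0 ?normc_ge0 ?(ltW p0)//.
    exact: le_trans McM HM2.
  have pw x : 0 <= x -> (x `^ al) `^ p = x ^+ 2.
    by move=> x0; rewrite -powRrM /al divfK ?gt_eqF// powR_mulrn.
  have rr0 : 0 <= 2 * rho by rewrite mulr_ge0// ltW.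
  rewrite (powRM _ (powR_ge0 _ _) (normc_ge0 _)) (pw _ (ltW r0)).
  rewrite powRM ?mulr_ge0 ?powR_ge0 ?normc_ge0//.
  rewrite (powRM _ (powR_ge0 _ _) (normc_ge0 _)) (pw _ rr0).
  move=> H; apply: le_trans H _; rewrite le_eqVlt; apply/orP; left; apply/eqP; ring.
rewrite mulrC; apply: (@le_trans _ _ (2 `^ p * 4 * (normc (f c1) `^ p * rho ^+ 2))%:E).
  by rewrite lee_fin.
rewrite /K (EFinM (2 `^ p * 4) (normc (f c1) `^ p * _)) (EFinM (2 `^ p * 4) (8 * _)) -muleA.
apply: lee_wpmul2l => //.
Qed.

(** A power of an entire function is entire: the case above, applied to [f ^+ k] with exponent
    [p / k], covers every [p]. *)
Lemma sub_mean (p : R) : 0 < p -> exists2 K : R, 0 < K &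
  forall f (c : R[i]) (r : R), entire f -> 0 < r ->
  ((normc (f c) `^ p * r ^+ 2)%:E <=
    K%:E * \int[area]_z (normc (f (cpl z)) `^ p * disc r (cpl z - c))%:E)%E.
Proof.
move=> p0; pose k := (Num.truncn p).+1.
have pk : p <= k%:R by exact/ltW/truncnS_gt.
have k0 : 0 < k%:R :> R by rewrite ltr0n.
have pk1 : p / k%:R <= 1 by rewrite ler_pdivrMr// mul1r.
have [K K0 KP] := sub_mean_le1 (divr_gt0 p0 k0) pk1.
exists K => // f c r ef r0.
have ek : entire (fun z => f z ^+ k) := entire_comp (entireX k) ef.
have E z : normc (f z ^+ k) `^ (p / k%:R) = normc (f z) `^ p.
  by rewrite normcX -powR_mulrn ?normc_ge0// -powRrM mulrC divfK ?gt_eqF.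
have := KP _ c r ek r0; rewrite E.
by under eq_integral do rewrite E.
Qed.

End sub_mean_p.

(** * The weight as a function of the logarithm of the modulus *)

Section weight_facts.
Context {R : realType}.
Implicit Types (f g : R -> R) (w : weight R) (x y B : R).

Lemma has_deriv_ge0_is_derive f f' (x : R) : has_deriv_ge0 f f' -> 0 < x ->
  is_derive x 1 f (f' x).
Proof.
move=> ff' x0; have /cvgrPdist_le H := ff' x (ltW x0).
have K : h^-1 *: (f (h *: 1 + x) - f x) @[h --> (0 : R)^'] --> f' x.
  apply/cvgrPdist_le => e e0; have := H e e0.
  rewrite !near_withinE => /nbhs_ballP[d /= d0 dP].
  apply/nbhs_ballP; exists (Num.min d x) => /=; first by rewrite lt_min d0 x0.
  move=> h; rewrite /ball/= sub0r normrN lt_min => /andP[hd hx] h0.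
  have E : h *: 1 + x = x + h by rewrite [h *: 1]mulr1 addrC.
  have := dP (x + h); rewrite /ball/= opprD addrA subrr sub0r normrN => /(_ hd).
  have -> : x + h - x = h by rewrite addrAC subrr add0r.
  rewrite E [h^-1 *: _]mulrC; apply.
    by rewrite -subr_eq0 addrAC subrr add0r.
  have := ler_norm (- h); rewrite normrN; lra.
apply: DeriveDef.
  by apply/cvg_ex; exists (f' x).
by rewrite /derive; apply: cvg_lim.
Qed.

Lemma derive1n2 f g (h x : R) : (\near x, is_derive (x : R) 1 f (g x)) -> is_derive x 1 g h ->
  derive1n 2 f x = h.
Proof.
move=> fg [dg <-]; rewrite /derive1n /= !derive1E; apply: near_eq_derive.
by near=> y; rewrite derive1E; apply: derive_val; near: y.
Unshelve. all: end_near. Qed.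

(** Along the real axis the second derivative is [f'']. Across it the modulus is
    [sqrt (x ^+ 2 + y ^+ 2)], whose first derivative vanishes and whose second derivative is [1 / x]
    at [y = 0]; this leaves [f' x / x]. *)
Lemma laplacian_radial (f f' f'' : R -> R) (x : R) :
  has_deriv_ge0 f f' -> has_deriv_ge0 f' f'' -> 0 < x ->
  laplacian (f \o @normc R) x%:C = f'' x + f' x / x.
Proof.
move=> H1 H2 x0; rewrite /laplacian /=; congr (_ + _).
  apply: (@derive1n2 _ f'); last exact: has_deriv_ge0_is_derive.
  near=> y; have y0 : 0 < y by near: y; exact: lt_nbhsr.
  apply: (near_eq_is_derive _ (has_deriv_ge0_is_derive H1 y0)).
  near=> s; rewrite expr0n/= addr0 sqrtr_sqr ger0_norm//; apply: ltW.
  by near: s; exact: lt_nbhsr.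
pose q (y : R) := x ^+ 2 + y ^+ 2.
have q0 y : 0 < q y by rewrite ltr_pwDl ?exprn_gt0// sqr_ge0.
have dq y : is_derive y 1 q (2 * y).
  have H := is_deriveD (is_derive_cst (x ^+ 2) y 1) (is_deriveX 2 (is_derive_id y 1)).
  by apply: is_derive_eq H _; rewrite add0r /GRing.scale/= mulr1 expr1.
have ds y : is_derive y 1 (fun y => Num.sqrt (q y)) ((Num.sqrt (q y))^-1 * y).
  have s0 : Num.sqrt (q y) != 0 by rewrite gt_eqF// sqrtr_gt0.
  have := is_derive1_comp (is_derive1_sqrt (q0 y)) (dq y).
  rewrite (_ : _ * (2 * y) = (Num.sqrt (q y))^-1 * y)//.
  by field.
have df y : is_derive y 1 (fun y => f (Num.sqrt (q y))) (f' (Num.sqrt (q y)) * ((Num.sqrt (q y))^-1 * y)).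
  apply: (@is_derive1_comp _ f (fun y => Num.sqrt (q y))) => //.
  by apply: has_deriv_ge0_is_derive => //; rewrite sqrtr_gt0.
apply: (derive1n2 (g := fun y => f' (Num.sqrt (q y)) * ((Num.sqrt (q y))^-1 * y))); first by near=> y; exact: df.
have q00 : Num.sqrt (q 0) = x by rewrite /q expr0n/= addr0 sqrtr_sqr gtr0_norm.
have df' : is_derive (0 : R) 1 (fun y => f' (Num.sqrt (q y))) (f'' (Num.sqrt (q 0)) * ((Num.sqrt (q 0))^-1 * 0)).
  apply: (@is_derive1_comp _ f' (fun y => Num.sqrt (q y))) => //.
  by apply: has_deriv_ge0_is_derive => //; rewrite sqrtr_gt0.
have s0 : Num.sqrt (q 0) != 0 by rewrite gt_eqF// sqrtr_gt0.
have di := is_deriveV (f := fun y => Num.sqrt (q y)) s0 (ds 0).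
have dm := is_deriveM df' (is_deriveM di (is_derive_id (0 : R) 1)).
apply: is_derive_eq dm _; rewrite q00 /GRing.scale/= !mulr0 ?mul0r ?mulr1 ?addr0.
by [].

Unshelve. all: end_near. Qed.

(* The derivative of [w] with respect to [ln x]. *)
Definition wD w (x : R) : R := x * derive1 w x.

Lemma wD_derive w x : 0 < x -> is_derive (x : R) 1 w (wD w x / x).
Proof.
move=> x0; have [_ [f' [f'' [H1 _ _]]] _ _] := weightP w.
have [d1 d2] := has_deriv_ge0_is_derive H1 x0.
by apply: DeriveDef => //; rewrite /wD derive1E mulrAC divff ?gt_eqF// mul1r.
Qed.

(** Here [L] is the Laplacian on the positive axis; its radial form says that the derivative of
    [x w'(x)] is [x L(x)]. Since [tau] tends to 0 and is comparable to the power [-1/2] of the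
    Laplacian, [L] tends to infinity. *)
Lemma wD_lap w : exists L : R -> R,
  [/\ forall x : R, 0 < x -> is_derive x 1 (wD w) (x * L x),
      forall x : R, 0 < x -> 0 < L x &
      forall B : R, exists2 r, 1 <= r & forall x : R, r <= x -> B <= L x].
Proof.
have [_ [f' [f'' [H1 H2 _]]] lap [tau [[t0 _] _ [st _] [tlim _] _]]] := weightP w.
pose L x := laplacian (w \o @normc R) x%:C; exists L.
split; last 2 first.
- by move=> x _; exact: lap.
- move=> B; have [c c0 cP] := st.
  pose B' := Num.max B 1.
  have B'0 : 0 < B' by rewrite lt_max ltr01 orbT.
  (* With [tau] below this value the inverse square root of [L x] is at most [1 / B'], so
     [L x >= B' ^+ 2], which is at least [B'] because [B' >= 1]. *)
  pose e := (c * B')^-1.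
  have e0 : 0 < e by rewrite invr_gt0 mulr_gt0.
  move/cvgrPdist_lt: tlim => /(_ _ e0)[r [_ rP]].
  exists (Num.max (r + 1) 1); first by rewrite le_max lexx orbT.
  move=> x; rewrite ge_max => /andP[xr x1].
  have x0 : 0 < x := lt_le_trans ltr01 x1.
  have rx : r < x by rewrite (lt_le_trans _ xr)// ltrDl.
  have := rP x rx; rewrite sub0r normrN gtr0_norm ?t0// => te.
  have nx : normc (x%:C) = x by rewrite normc_real_ge0 ?ltW.
  have [|_ P] := cP x%:C; first by change (is_true (1 <= normc x%:C)); rewrite nx.
  apply: le_trans (_ : B' <= _); first by rewrite le_max lexx.
  have L0 : 0 < L x by exact: lap.
  have {P} : L x `^ (- 2^-1) <= B'^-1.
    apply: (le_trans P); apply: ltW; rewrite (_ : B'^-1 = c * e); first by rewrite ltr_pM2l.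
    by rewrite /e invfM mulrA divff ?gt_eqF// mul1r.
  move=> P; have P2 : (L x)^-1 <= B'^-1 ^+ 2.
    rewrite -powR_inv1 ?(ltW L0)// (_ : -1 = (- 2^-1) * 2%:R :> R); last by field.
    rewrite powRrM powR_mulrn ?powR_ge0// lerXn2r ?nnegrE ?powR_ge0//.
    by rewrite invr_ge0 ltW.
  rewrite -lef_pV2 ?posrE//; apply: le_trans P2 _.
  rewrite -[leRHS]mul1r expr2 ler_pM2r ?invr_gt0// invf_le1//.
  by rewrite le_max lexx orbT.
- move=> x x0.
  have E : \near x, x * f' x = wD w x.
    near=> y; rewrite /wD derive1E; congr (_ * _); apply/esym/derive_val.
    apply: has_deriv_ge0_is_derive => //; near: y; exact: lt_nbhsr.
  apply: (near_eq_is_derive E).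
  have := is_deriveM (is_derive_id x 1) (has_deriv_ge0_is_derive H2 x0).
  move=> H; apply: is_derive_eq H _.
  rewrite /L (laplacian_radial H1 H2 x0) /GRing.scale/= mulr1 mulrDr.
  by congr (_ + _); rewrite mulrCA divff ?gt_eqF// mulr1.
Unshelve. all: end_near. Qed.

Lemma is_derive_cont f (x l : R) : is_derive x 1 f l -> {for x, continuous f}.
Proof. by move=> [/derivable1_diffP/differentiable_continuous]. Qed.

Lemma MVT_pos f g (x y : R) : (forall x : R, 0 < x -> is_derive x 1 f (g x)) ->
  0 < x -> x <= y -> exists2 c, x <= c <= y & f y - f x = g c * (y - x).
Proof.
move=> H x0 xy; have [z] : exists2 z, z \in `[x, y]%R & f y - f x = g z * (y - x).
  apply: (MVT_segment xy).
    by move=> z; rewrite in_itv/= => /andP[xz _]; apply: H; exact: lt_trans xz.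
  apply: continuous_in_subspaceT => z; rewrite inE/= in_itv/= => /andP[xz _].
  by apply: is_derive_cont; apply: H; exact: lt_le_trans xz.
by rewrite in_itv/= => xz E; exists z.
Qed.

Lemma wD_incr w x y : 0 < x -> x < y -> wD w x < wD w y.
Proof.
move=> x0 xy; have [L [L1 L2 _]] := wD_lap w.
have [c /andP[xc _]] := MVT_pos L1 x0 (ltW xy).
rewrite -subr_gt0 => ->; have c0 := lt_le_trans x0 xc.
by rewrite !mulr_gt0 ?subr_gt0// L2.
Qed.

Lemma wD_ndecr w x y : 0 < x -> x <= y -> wD w x <= wD w y.
Proof. by move=> x0; rewrite le_eqVlt => /predU1P[->//|/(wD_incr w x0)/ltW]. Qed.

Lemma wD_cont w x : 0 < x -> {for x, continuous (wD w)}.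
Proof. by move=> x0; have [L [L1 _ _]] := wD_lap w; exact: is_derive_cont (L1 x x0). Qed.

Lemma wD_growth w (B : R) : exists2 r, 1 <= r &
  forall x y, r <= x -> x <= y -> B * (y ^+ 2 - x ^+ 2) / 2 <= wD w y - wD w x.
Proof.
have [L [L1 L2 LB]] := wD_lap w; have [r r1 rP] := LB B; exists r => // x y rx xy.
have x0 : 0 < x by apply: lt_le_trans rx; exact: lt_le_trans r1.
pose h (x : R) := wD w x - B / 2 * x ^+ 2.
have dh (s : R) : 0 < s -> is_derive s 1 h (s * L s - B * s).
  move=> s0; have := is_deriveB (L1 s s0) (is_deriveM (is_derive_cst (B / 2) s 1) (is_deriveX 2 (is_derive_id s 1))).
  move=> H; apply: is_derive_eq H _.
  rewrite /cst /GRing.scale/= mulr1; congr (_ - _); by rewrite mulr0 addr0 expr1; field.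
have [c /andP[xc cy]] := MVT_pos dh x0 xy.
have c0 : 0 < c := lt_le_trans x0 xc.
have : 0 <= (c * L c - B * c) * (y - x).
  by rewrite mulr_ge0 ?subr_ge0// mulrC ler_pM2l// rP// (le_trans rx).
move=> /[swap] <-; rewrite /h; lra.
Qed.

(** [wD w] is strictly increasing, and at the origin its lower limit is at least 0 because the
    derivative of [w] is bounded near 0. *)
Lemma wD_gt0 w x : 0 < x -> 0 < wD w x.
Proof.
have [_ [f' [f'' [H1 H2 _]]] _ _] := weightP w.
have [M [d d0 dP]] : exists M, exists2 d, 0 < d & forall x : R, 0 < x -> x < d -> - M <= wD w x / x.
  have /cvgrPdist_lt/(_ _ ltr01) := H2 0 (lexx 0).
  rewrite !near_withinE => /nbhs_ballP[d /= d0 dP].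
  exists (`|f' 0| + (`|f'' 0| + 1) * d), d => // s s0 sd.
  have [_ E1] := has_deriv_ge0_is_derive H1 s0; have [_ E2] := wD_derive w s0.
  rewrite -E2 E1; have := dP s; rewrite /ball/= sub0r normrN (gtr0_norm s0).
  move=> /(_ sd); rewrite gt_eqF// => /(_ isT (ltW s0)); rewrite subr0.
  set q := _ / s => q1.
  have -> : f' s = f' 0 + q * s by rewrite /q divfK ?gt_eqF// addrC subrK.
  have q2 : `|q| <= `|f'' 0| + 1.
    rewrite -lerBlDl; apply/ltW/(le_lt_trans _ q1).
    by rewrite distrC (le_trans _ (lerB_dist _ _)).
  rewrite opprD; apply: lerD; first by rewrite lerNl ler_normr lexx orbT.
  rewrite lerNl; apply: le_trans (ler_norm _) _; rewrite normrN normrM (gtr0_norm s0).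
  by apply: ler_pM => //; exact: ltW.
have M0 : 0 <= `|M| by [].
have D0 s : 0 < s -> 0 <= wD w s.
  move=> s0; rewrite leNgt; apply/negP => Ds.
  (* A point so close to 0 that [- M * t] is at least half of the negative value [wD w s]; this
     contradicts monotonicity. *)
  pose t := Num.min (Num.min s (d / 2)) (- wD w s / (2 * (`|M| + 1))).
  have t0 : 0 < t.
    by rewrite !lt_min s0 divr_gt0//= divr_gt0 ?oppr_gt0// mulr_gt0// ltr_wpDl.
  have td : t < d.
    apply: (@le_lt_trans _ _ (d / 2)); first by rewrite !ge_min lexx orbT.
    by rewrite gtr_pMr// invf_lt1 ?ltr1n.
  have ts : t <= s by rewrite !ge_min lexx.
  have tM : t <= - wD w s / (2 * (`|M| + 1)) by rewrite !ge_min lexx orbT.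
  have M10 : 0 < 2 * (`|M| + 1) by rewrite mulr_gt0// ltr_wpDl.
  move: tM; rewrite ler_pdivlMr// => tM.
  have := dP t t0 td; rewrite ler_pdivlMr// => H.
  have := wD_ndecr w t0 ts; have := ler_norm M; nra.
move=> x0; have h0 : 0 < x / 2 by rewrite divr_gt0.
by apply: le_lt_trans (D0 _ h0) (wD_incr w h0 _); rewrite ltr_pdivrMr// ltr_pMr// ltr1n.
Qed.

Lemma weight_cont w : continuous (fun r : R => w `|r|).
Proof.
have [_ [f' [f'' [H1 _ _]]] _ _] := weightP w; exact: has_deriv_ge0_continuous H1.
Qed.

(** The case [x = 0] is included, although [w] is differentiable only inside: the even extension is
    continuous up to the end point. *)
Lemma weight_MVT w x y : 0 <= x -> x < y ->
  exists2 c, x < c < y & w y - w x = wD w c / c * (y - x).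
Proof.
move=> x0 xy; pose g (r : R) := w `|r|.
have dg (s : R) : s \in `]x, y[%R -> is_derive s 1 g (wD w s / s).
  rewrite in_itv/= => /andP[xs _]; have s0 := le_lt_trans x0 xs.
  apply: near_eq_is_derive (wD_derive w s0).
  by near=> t; rewrite /g gtr0_norm//; near: t; exact: lt_nbhsr.
have [|c] := MVT xy dg; first by apply: continuous_subspaceT; exact: weight_cont.
rewrite in_itv/= => xcy; rewrite /g !ger0_norm//; last exact: le_trans (ltW xy).
by exists c.
Unshelve. all: end_near. Qed.

Lemma weight_ndecr w x y : 0 <= x -> x <= y -> w x <= w y.
Proof.
move=> x0; rewrite le_eqVlt => /predU1P[->//|xy].
have [c /andP[xc _]] := weight_MVT w x0 xy; have c0 := le_lt_trans x0 xc.
rewrite -subr_ge0 => ->; rewrite mulr_ge0 ?subr_ge0 ?(ltW xy)//.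
by rewrite divr_ge0 ?(ltW c0)// ltW// wD_gt0.
Qed.

Lemma wD_quad w (K : R) : exists2 r, 1 <= r & forall x, r <= x -> K * x ^+ 2 <= wD w x.
Proof.
have [r r1 rP] := wD_growth w (4 * `|K|); exists (2 * r).
  lra.
move=> x rx; have r0 : 0 < r by apply: lt_le_trans r1.
have rlex : r <= x by apply: le_trans rx; rewrite ler_peMl ?ler1n// ltW.
have := rP _ _ (lexx r) rlex; have := wD_gt0 w r0; have := ler_norm K.
have : 0 <= `|K| by []; move: (`|K|) => k k0 Kk.
have : (2 * r) ^+ 2 <= x ^+ 2 by rewrite lerXn2r ?nnegrE// ?mulr_ge0 ?(ltW r0) ?(le_trans _ rlex)// ltW.
have : 0 <= x ^+ 2 by exact: sqr_ge0.
move: (wD w r) (wD w x) => a b; rewrite exprMn; move: (x ^+ 2) (r ^+ 2) => X Y.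
nra.
Qed.

Lemma weight_drop w (K d : R) : 0 < d ->
  exists2 r, 1 + d <= r & forall x, r <= x -> w (x - d) <= w x - K * x.
Proof.
move=> d0; have [r r1 rP] := wD_quad w (2 * `|K| / d).
exists (Num.max (r + d) (2 * d)); first by rewrite le_max lerD2r r1.
move=> x; rewrite ge_max => /andP[rx dx].
have xd0 : 0 <= x - d by rewrite subr_ge0; apply: le_trans dx; rewrite ler_peMl ?ler1n// ltW.
have xdx : x - d < x by rewrite gtrBl.
have [c /andP[xc cx]] := weight_MVT w xd0 xdx.
rewrite opprB addrCA subrr addr0 => E.
have rc : r <= c by apply: le_trans (ltW xc); rewrite lerBrDr.
have c0 : 0 < c by apply: lt_le_trans rc; exact: lt_le_trans r1.
have := rP c rc; rewrite -(ler_pM2r (_ : 0 < d / c)); last by rewrite divr_gt0.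
rewrite (_ : wD w c * (d / c) = w x - w (x - d)); last first.
  by rewrite E mulrA mulrAC.
rewrite (_ : _ * (d / c) = 2 * `|K| * c); last by field; rewrite !gt_eqF.
have := ler_norm K; have : 0 <= `|K| by []; move: (w x) (w (x - d)) (`|K|) => a b k.
nra.
Qed.

Lemma weight_contract w (K k b : R) : 0 <= k < 1 -> 0 <= b ->
  exists2 r, 1 <= r & forall x, r <= x -> w (k * x + b) <= w x - K * x ^+ 2.
Proof.
move=> /andP[k0 k1] b0; have k10 : 0 < 1 - k by rewrite subr_gt0.
have [r r1 rP] := wD_quad w (8 * `|K| / (1 - k)).
exists (Num.max (2 * r) (2 * (b + 1) / (1 - k))).
  by rewrite le_max; apply/orP; left; lra.
move=> x; rewrite ge_max ler_pdivrMr// => /andP[rx bx].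
(* Only the upper half of the interval is used: there the mean value point [c] is at least [x / 2],
   so that [wD_quad] gives a derivative of order [x]. *)
pose y := (x + (k * x + b)) / 2.
have x0 : 0 < x by lra.
have kx : 0 <= k * x by rewrite mulr_ge0// ltW.
have y0 : 0 <= y by rewrite divr_ge0// !addr_ge0// ltW.
have yx : y < x by rewrite /y; lra.
have [c /andP[yc cx] E] := weight_MVT w y0 yx.
have yl : w (k * x + b) <= w y by apply: weight_ndecr; rewrite /y; lra.
have xy : (1 - k) * x / 4 <= x - y by rewrite /y; lra.
have xc : x / 2 <= c by apply: le_trans (ltW yc); rewrite /y; lra.
have rc : r <= c by apply: le_trans xc; lra.
have c0 : 0 < c by lra.
apply: (le_trans yl); rewrite lerBrDr -lerBrDl E.
have W : 8 * `|K| / (1 - k) * c <= wD w c / c.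
  rewrite ler_pdivlMr// (_ : _ * c = 8 * `|K| / (1 - k) * c ^+ 2); first exact: rP.
  by move: (_ / _) => q; ring.
apply: (@le_trans _ _ (8 * `|K| / (1 - k) * c * ((1 - k) * x / 4))); last first.
  apply: ler_pM => //; rewrite ?divr_ge0 ?mulr_ge0 ?invr_ge0 ?(ltW k10) ?(ltW x0)//.
  exact: ltW.
rewrite (_ : _ * (_ * x / 4) = 2 * `|K| * c * x); last by field; rewrite gt_eqF.
have h1 : 0 <= `|K| * x * (c - x / 2) by rewrite !mulr_ge0 ?subr_ge0 ?(ltW x0).
have h2 : 0 <= (`|K| - K) * x ^+ 2 by rewrite mulr_ge0 ?subr_ge0 ?ler_norm ?sqr_ge0.
move: h1 h2; rewrite expr2; lra.
Qed.

Lemma gap_MVT w (n x y : R) : 0 < x -> x <= y -> exists2 c, x <= c <= y &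
  (w y - n * ln y) - (w x - n * ln x) = (wD w c - n) / c * (y - x).
Proof.
move=> x0 xy.
have H (s : R) : 0 < s -> is_derive s 1 (fun s => w s - n * ln s) ((wD w s - n) / s).
  move=> s0; have := is_deriveB (wD_derive w s0) (is_deriveM (is_derive_cst n s 1) (is_derive1_ln s0)).
  move=> K; apply: is_derive_eq K _.
  by rewrite /GRing.scale/= mulr0 addr0 mulrBl.
exact: MVT_pos H x0 xy.
Qed.

Lemma wD_IVT w (n x : R) : 0 < x -> wD w x <= n -> exists2 y, x <= y & wD w y = n.
Proof.
move=> x0 xn; have [r r1 rP] := wD_quad w `|n|.
pose z := Num.max x r.
have xz : x <= z by rewrite le_max lexx.
have rz : r <= z by rewrite le_max lexx orbT.
have nz : n <= wD w z.
  apply: le_trans (rP z rz); apply: le_trans (ler_norm n) _.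
  by apply: ler_peMr => //; apply: exprn_ege1; exact: le_trans r1 rz.
have [||c] := @IVT _ (wD w) x z n xz.
- apply: continuous_in_subspaceT => s; rewrite inE/= in_itv/= => /andP[xs _].
  by apply: wD_cont; exact: lt_le_trans xs.
- by rewrite ge_min xn le_max nz orbT.
- by rewrite in_itv/= => /andP[xc _] E; exists c.
Qed.

(** Quantitative convexity of [w] in [ln x]: the left side is subtracted, twice, from the height
    above the tangent, and the difference still has a derivative with the sign of [y - x]. *)
Lemma gap_quad w (B : R) : 0 < B -> exists2 r, 1 <= r & forall x y, r <= x -> 0 < y ->
  B * (y - x) ^+ 2 <= w y - w x - wD w x * (ln y - ln x).
Proof.
move=> B0; have [r r1 rP] := wD_growth w (16 * B); exists (2 * r); first by lra.
move=> x y rx y0.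
have x0 : 0 < x by lra.
have S1 s : x <= s -> 4 * B * (s - x) <= (wD w s - wD w x) / s.
  move=> xs; have s0 : 0 < s by lra.
  rewrite ler_pdivlMr//; have rx' : r <= x by lra.
  have := rP x s rx' xs; have : 0 <= B * ((s - x) * x) by rewrite !mulr_ge0 ?subr_ge0// ltW.
  nra.
have S2 s : 0 < s -> s <= x -> 4 * B * (x - s) <= (wD w x - wD w s) / s.
  move=> s0 sx; rewrite ler_pdivlMr//.
  (* Below [r] growth is unknown, but [x] is at least [2 * r], and the growth between [r] and [x]
     suffices. *)
  have [rs|/ltW sr] := leP r s; first last.
    have rx' : r <= x by lra.
    have := rP r x (lexx r) rx'; have := wD_ndecr w s0 sr.
    have h1 : s * (x - s) <= x ^+ 2 by nra.
    have h2 : 4 * r ^+ 2 <= x ^+ 2 by nra.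
    have h3 : 0 <= B * x ^+ 2 by rewrite mulr_ge0 ?sqr_ge0// ltW.
    nra.
  have := rP s x rs sx; have : 0 <= B * ((x - s) * x) by rewrite !mulr_ge0 ?subr_ge0 ?(ltW x0)// ltW.
  nra.
pose h (s : R) := w s - wD w x * ln s - 2 * B * (s - x) ^+ 2.
have dh (s : R) : 0 < s -> is_derive s 1 h ((wD w s - wD w x) / s - 4 * B * (s - x)).
  move=> s0.
  have d1 := is_deriveB (wD_derive w s0) (is_deriveM (is_derive_cst (wD w x) s 1) (is_derive1_ln s0)).
  have d2 := is_deriveX 2 (is_deriveB (is_derive_id s 1) (is_derive_cst x s 1)).
  have := is_deriveB d1 (is_deriveM (is_derive_cst (2 * B) s 1) d2).
  move=> H; apply: is_derive_eq H _.
  rewrite /cst /GRing.scale/= !mulr0 !addr0 expr1 subr0 mulr1 mulrBl.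
  rewrite (_ : (id - _) s = s - x)//; congr (_ - _); ring.
have : h x <= h y.
  rewrite -subr_ge0; have [xy|/ltW yx] := leP x y.
    have [c /andP[xc cy] ->] := MVT_pos dh x0 xy.
    by rewrite mulr_ge0 ?subr_ge0// S1.
  have [c /andP[yc cx] E] := MVT_pos dh y0 yx.
  rewrite -oppr_le0 opprB E mulr_le0_ge0 ?subr_ge0//.
  have := S2 c (lt_le_trans y0 yc) cx; lra.
rewrite /h subrr expr0n/= mulr0 subr0.
have : 0 <= B * (y - x) ^+ 2 by rewrite mulr_ge0 ?sqr_ge0// ltW.
lra.
Qed.

End weight_facts.

(** * Estimates in Fock spaces *)

Section fock_estimates.
Context {R : realType} (w : weight R).
Local Notation MR := (measurableTypeR R).
Local Notation plane := (MR * MR)%type.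
Implicit Types (p q : {posnum R}).

Definition gauss (c : R) (z : plane) : \bar R := (expR (- c * normc (cpl z) ^+ 2))%:E.

Lemma normc_sqr (x y : R) : normc (x +i* y) ^+ 2 = x ^+ 2 + y ^+ 2.
Proof. by rewrite /= sqr_sqrtr// addr_ge0 ?sqr_ge0. Qed.

Lemma measurable_gauss (c : R) : measurable_fun [set: plane] (gauss c).
Proof.
apply/measurable_EFinP; apply: (measurableT_comp (@measurable_expR R)).
apply: measurable_funM => //; apply: (measurableT_comp (f := fun x : MR => x ^+ 2 : MR)).
  exact: exprn_measurable.
exact: measurable_normc.
Qed.

Lemma gauss_fin (c : R) : 0 < c -> (\int[area]_z gauss c z < +oo)%E.
Proof.
move=> c0; have s0 : 0 < Num.sqrt c by rewrite sqrtr_gt0.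
pose G (z : R[i]) := (expR (- (normc z ^+ 2)))%:E.
have mG : measurable_fun [set: plane] (G \o cpl).
  have := measurable_gauss 1; rewrite (_ : gauss 1 = G \o cpl)//.
  by apply/funext => z; rewrite /gauss /G /= mulN1r.
have G0 z : (0 <= G z)%E by rewrite lee_fin expR_ge0.
have := @ge0_area_affine R (Num.sqrt c) 0 G s0 mG G0.
rewrite (_ : (fun z => _) = gauss c); last first.
  apply/funext => z; rewrite /G /gauss addr0 normcM normcR ger0_norm ?(ltW s0)//.
  by rewrite exprMn sqr_sqrtr ?mulNr// ltW.
move=> ->; rewrite lte_mul_pinfty ?lee_fin ?sqr_ge0//.
rewrite (@area_tonelli1 R (G \o cpl))//; last by move=> z; exact: G0.
have E : (fun x : MR => \int[lebesgue_measure]_y (G \o cpl) (x, y))%E =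
  fun x : MR => ((Num.sqrt pi)%:E * (gauss_fun x)%:E)%E.
  apply/funext => x; rewrite -integralT_gauss muleC -ge0_integralZl//; first last.
  - by rewrite lee_fin gauss_fun_ge0.
  - by move=> y _; rewrite lee_fin gauss_fun_ge0.
  - by apply/measurable_EFinP; exact: measurable_gauss_fun.
  apply: eq_integral => y _; rewrite /gauss_fun -EFinM -expRD -opprD.
  by congr ((expR (- _))%:E); exact: normc_sqr.
rewrite E ge0_integralZl ?lee_fin ?sqrtr_ge0//.
- by rewrite integralT_gauss -EFinM ltry.
- by apply/measurable_EFinP; exact: measurable_gauss_fun.
- by move=> y _; rewrite lee_fin gauss_fun_ge0.
Qed.

Definition gauss_int (c : R) : R := fine (\int[area]_z gauss c z).

Lemma gauss_intE (c : R) : 0 < c -> (\int[area]_z gauss c z = (gauss_int c)%:E)%E.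
Proof.
move=> c0; rewrite fineK// ge0_fin_numE ?gauss_fin//.
by apply: integral_ge0 => z _; rewrite lee_fin expR_ge0.
Qed.

Lemma gauss_int_ge0 (c : R) : 0 <= gauss_int c.
Proof. by apply/fine_ge0/integral_ge0 => z _; rewrite lee_fin expR_ge0. Qed.

(** The Gaussian factor in the pointwise bound makes the integral finite for every exponent, so all
    norm estimates for contractions become pointwise ones. *)
Lemma fock_dominated q : exists2 C : R, 0 < C & forall g (A : R), entire g -> 0 <= A ->
  (forall z, normc (g z) <= A * expR (w (normc z) - normc z ^+ 2)) ->
  (fock_norm w q g <= (C * A)%:E)%E.
Proof.
have q0 : 0 < q%:num :> R by [].
exists (gauss_int q%:num `^ q%:num^-1 + 1); first by rewrite ltr_wpDl// powR_ge0.
move=> g A eg A0 gA.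
have H : (fock_integral w q g <= (A `^ q%:num)%:E * \int[area]_z gauss q%:num z)%E.
  rewrite -ge0_integralZl//; first last.
  - by rewrite lee_fin powR_ge0.
  - by move=> z _; rewrite lee_fin expR_ge0.
  - exact: measurable_gauss.
  apply: ge0_le_integral => //.
  - by move=> z _; rewrite lee_fin mulr_ge0 ?powR_ge0 ?expR_ge0.
  - exact: fock_integrand_measurable.
  - by apply: measurable_funeM; exact: measurable_gauss.
  move=> z _; rewrite -EFinM lee_fin -/(cpl z).
  apply: (@le_trans _ _ ((A * expR (w (normc (cpl z)) - normc (cpl z) ^+ 2)) `^ q%:num * expR (- q%:num * w (normc (cpl z))))).
    by rewrite ler_wpM2r ?expR_ge0//; apply: ge0_ler_powR; rewrite ?nnegrE ?normc_ge0 ?mulr_ge0 ?expR_ge0 ?(ltW q0).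
  rewrite powRM ?expR_ge0// -expRM -mulrA -expRD.
  by rewrite ler_wpM2l ?powR_ge0// ler_expR le_eqVlt; apply/orP; left; apply/eqP; ring.
rewrite gauss_intE// -EFinM in H.
apply: (@le_trans _ _ ((A `^ q%:num * gauss_int q%:num)%:E `^ q%:num^-1)%E).
  by apply: gt0_ler_poweR => //; rewrite in_itv/= ?leey ?fock_integral_ge0 ?lee_fin ?mulr_ge0 ?powR_ge0 ?gauss_int_ge0.
rewrite poweR_EFin lee_fin powRM ?powR_ge0 ?gauss_int_ge0// -powRrM mulfV ?gt_eqF//.
by rewrite powRr1// mulrC ler_wpM2r// lerDl.
Qed.

Lemma mem_fock p g : entire g -> (fock_norm w p g < +oo)%E -> g \in fock_pred w p.
Proof. by move=> eg ng; apply/mem_set. Qed.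

Lemma fock_norm_fin p (f : fock w p) : (fnorm f < +oo)%E.
Proof. by have /set_mem[] := fockP f. Qed.

Lemma fent p (f : fock w p) : entire f.
Proof. exact (@fock_entire R w p f). Qed.

Arguments fent {p} f.

Definition fn p (f : fock w p) : R := fine (fnorm f).

Lemma fnE p (f : fock w p) : fnorm f = (fn f)%:E.
Proof. by rewrite fineK// ge0_fin_numE ?fock_norm_fin ?fock_norm_ge0. Qed.

Lemma fn_ge0 p (f : fock w p) : 0 <= fn f.
Proof. by apply: fine_ge0; exact: fock_norm_ge0. Qed.

Lemma fn_integral p (f : fock w p) : fock_integral w p f = (fn f `^ p%:num)%:E.
Proof.
have := fnE f; rewrite /fnorm /fock_norm; move: (fn_ge0 f) (fock_integral_ge0 w p f).
move: (fock_integral w p f) (fn f) => I x x0 I0 H.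
rewrite -poweR_EFin -H -poweRrM mulVf ?gt_eqF// poweRe1//.
Qed.

(** Sub-mean value inequality on the disc of radius [d], where the weight is at most
    [w (normc z + d)] by monotonicity. *)
Lemma fock_eval p (d : R) : 0 < d -> exists2 C : R, 0 < C & forall (f : fock w p) z,
  normc (f z) <= C * expR (w (normc z + d)) * fn f.
Proof.
move=> d0; have p0 : 0 < p%:num :> R by [].
have [K K0 KP] := @sub_mean R p%:num p0.
exists ((K / d ^+ 2) `^ p%:num^-1); first by rewrite powR_gt0// divr_gt0// exprn_gt0.
move=> f z; have ef : entire f := fent f.
have := KP f z d ef d0.
pose E := expR (p%:num * w (normc z + d)).
have mdisc := @measurable_disc_shift R z d.
have mf := measurable_powR_entire p%:num ef.
have mI := fock_integrand_measurable w p ef.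
have H : (\int[area]_y (normc (f (cpl y)) `^ p%:num * disc d (cpl y - z))%:E <=
          E%:E * fock_integral w p f)%E.
  rewrite -ge0_integralZl//; first last.
  - by rewrite lee_fin expR_ge0.
  - by move=> y _; rewrite lee_fin mulr_ge0 ?powR_ge0 ?expR_ge0.
  apply: ge0_le_integral => //.
  - by move=> y _; rewrite lee_fin mulr_ge0 ?powR_ge0 ?disc_ge0.
  - by apply/measurable_EFinP; apply: measurable_funM.
  - exact: measurable_funeM.
  move=> y _; rewrite -EFinM lee_fin -/(cpl y) mulrCA ler_wpM2l ?powR_ge0//.
  rewrite -expRD mulNr -mulrBr /disc; case: ltP => h /=; last by rewrite expR_ge0.
  rewrite -[leLHS]expR0 ler_expR mulr_ge0 ?(ltW p0)// subr_ge0; apply: weight_ndecr; rewrite ?normc_ge0//.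
  change (is_true (normc (cpl y) <= normc z + d)).
  rewrite -[cpl y](subrK z) addrC (le_trans (normc_triangle _ _))// lerD2l.
  exact: ltW.
move=> /le_trans/(_ (lee_wpmul2l _ H)); rewrite lee_fin (ltW K0) fn_integral => /(_ isT).
rewrite -!EFinM lee_fin => H2.
have d20 : 0 < d ^+ 2 by rewrite exprn_gt0.
have H3 : normc (f z) `^ p%:num <= (K / d ^+ 2) * E * fn f `^ p%:num.
  rewrite -(ler_pM2r d20); apply: le_trans H2 _.
  by rewrite le_eqVlt; apply/orP; left; apply/eqP; field; rewrite gt_eqF.
have pp : p%:num * p%:num^-1 = 1 :> R by rewrite mulfV ?gt_eqF.
rewrite -[leLHS](powRr1 (normc_ge0 _)) -pp powRrM.
have -> : (K / d ^+ 2) `^ p%:num^-1 * expR (w (normc z + d)) * fn f =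
  ((K / d ^+ 2) * E * fn f `^ p%:num) `^ p%:num^-1.
  have : 0 <= K / d ^+ 2 by rewrite divr_ge0 ?(ltW K0) ?(ltW d20).
  move: (K / d ^+ 2) => Q Q0; rewrite (powRM _ (mulr_ge0 Q0 (expR_ge0 _)) (powR_ge0 _ _)).
  rewrite (powRM _ Q0 (expR_ge0 _)) -powRrM pp (powRr1 (fn_ge0 f)) -expRM.
  by rewrite [_ * w _ / _]mulrAC pp mul1r.
apply: ge0_ler_powR; rewrite ?nnegrE ?powR_ge0 ?invr_ge0 ?(ltW p0)//.
by rewrite !mulr_ge0 ?powR_ge0 ?expR_ge0 ?invr_ge0 ?(ltW d20) ?(ltW K0).
Qed.

(** Cauchy's estimates for the coefficients of a function in a Fock space. In contrast to the norm,
    the condition does not mention the exponent, and it is visibly closed under coefficientwise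
    limits. *)
Definition tame (N : R) (al : nat -> R[i]) := forall n (r : R), 0 < r ->
  normc (al n) * r ^+ n <= N * expR (w (r + 1)).

Lemma fock_tame p : exists2 C : R, 0 < C & forall f : fock w p, tame (C * fn f) (coef f).
Proof.
have [C C0 CP] := fock_eval p ltr01; exists (2 * C); first by rewrite mulr_gt0.
move=> f n r r0; have := @coef_bound R f r n (C * expR (w (r + 1)) * fn f) (fent f) r0.
rewrite (_ : 2 * (C * _ * _) = 2 * C * fn f * expR (w (r + 1))); last by ring.
by apply; move=> z zr; have := CP f z; rewrite zr.
Qed.

Lemma tame_rapid N al : 0 <= N -> tame N al -> rapid al.
Proof.
move=> N0 H r r0; exists (N * expR (w (r + 1))); first by rewrite mulr_ge0 ?expR_ge0.
by move=> m; exact: H.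
Qed.

Definition bump (z : R[i]) : R := expR (w (normc z) - normc z ^+ 2).

Lemma bump_ge0 z : 0 <= bump z. Proof. exact: expR_ge0. Qed.

(** The estimate [tame] is used at a radius [rr] with [normc (a * z + b) <= k * rr], which gains
    [k ^+ n]. Since [normc a < k], the radius [rr + 1] is still a contraction of [normc z], so
    [weight_contract] yields the Gaussian factor of [bump]. *)
Lemma affine_tame (a b : R[i]) : normc a < 1 -> exists k C : R,
  [/\ 0 < k < 1, 0 < C & forall N al, 0 <= N -> tame N al -> forall n z,
    normc (al n) * normc (a * z + b) ^+ n <= C * N * bump z * k ^+ n].
Proof.
move=> a1.
pose k := (1 + normc a) / 2.
have k0 : 0 < k by rewrite divr_gt0// ltr_pwDl ?normc_ge0.
have k1 : k < 1 by rewrite ltr_pdivrMr// mul1r; move: a1; lra.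
have ak : 0 <= normc a / k < 1.
  rewrite divr_ge0 ?normc_ge0 ?(ltW k0)//= ltr_pdivrMr// mul1r /k.
  by move: a1; lra.
pose be := (normc b + 1) / k + 1.
have be0 : 0 <= be by rewrite addr_ge0// divr_ge0 ?addr_ge0 ?normc_ge0 ?(ltW k0).
have [r r1 rP] := weight_contract w 1 ak be0.
(* Accounts for [normc z < r], where [weight_contract] says nothing. *)
pose M := w (normc a / k * r + be) + r ^+ 2.
exists k, (expR `|M|); split; [by rewrite k0|by rewrite expR_gt0|].
move=> N al N0 HN n z; pose rr := (normc a * normc z + normc b + 1) / k.
have rr0 : 0 < rr by rewrite divr_gt0// ltr_wpDl// addr_ge0 ?mulr_ge0 ?normc_ge0.
have zr : normc (a * z + b) <= k * rr.
  rewrite (_ : k * rr = normc a * normc z + normc b + 1); last by rewrite /rr; field; rewrite gt_eqF.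
  apply: le_trans (normc_triangle _ _) _.
  by rewrite normcM; move: (normc a * _) (normc b) => x y; lra.
have Pk : 0 <= k ^+ n by rewrite exprn_ge0 ?(ltW k0).
apply: (@le_trans _ _ (k ^+ n * (normc (al n) * rr ^+ n))).
  rewrite mulrCA -exprMn ler_wpM2l ?normc_ge0//.
  by apply: lerXn2r => //; rewrite nnegrE ?normc_ge0// mulr_ge0 ?(ltW k0) ?(ltW rr0).
apply: le_trans (ler_wpM2l Pk (HN n rr rr0)) _.
rewrite /bump (_ : expR `|M| * N * _ * _ = k ^+ n * (N * (expR `|M| * expR (w (normc z) - normc z ^+ 2)))); last by ring.
rewrite ler_wpM2l// ler_wpM2l// -expRD ler_expR.
have -> : rr + 1 = normc a / k * normc z + be by rewrite /rr /be; field; rewrite gt_eqF.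
have [rz|/ltW zr'] := leP r (normc z).
  by apply: le_trans (rP _ rz) _; rewrite mul1r lerDr.
have W0 : 0 <= w (normc z) by have [H _ _ _] := weightP w; apply: H; exact: normc_ge0.
have H1 : w (normc a / k * normc z + be) <= w (normc a / k * r + be).
  apply: weight_ndecr.
    by rewrite addr_ge0// mulr_ge0 ?normc_ge0//; case/andP: ak.
  by rewrite lerD2r ler_wpM2l//; case/andP: ak.
have H2 : normc z ^+ 2 <= r ^+ 2 by rewrite lerXn2r ?nnegrE ?normc_ge0// (le_trans _ r1).
have := ler_norm M; rewrite {1}/M; lra.
Qed.

End fock_estimates.

Arguments fent {R w p} f.

(** * Symbols of bounded composition operators *)

Section monomials.
Context {R : realType} (w : weight R).
Local Notation MR := (measurableTypeR R).
Local Notation plane := (MR * MR)%type.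
Implicit Types (p q : {posnum R}) (x r : R).

Lemma weight_quad (K : R) : exists2 c : R, 0 <= c & forall x, 0 <= x -> K * x ^+ 2 - c <= w x.
Proof.
have [r r1 rP] := @weight_contract R w K 0 0 (introT andP (conj (lexx 0) ltr01)) (lexx 0).
have w0 x : 0 <= x -> 0 <= w x by have [H _ _ _] := weightP w; exact: H.
exists (`|K| * r ^+ 2); first by rewrite mulr_ge0// sqr_ge0.
move=> x x0; have [rx|/ltW xr] := leP r x.
  have := rP x rx; rewrite mul0r addr0; have := w0 0 (lexx 0).
  have : 0 <= `|K| * r ^+ 2 by rewrite mulr_ge0// sqr_ge0.
  lra.
have H : x ^+ 2 <= r ^+ 2 by apply: lerXn2r => //; rewrite nnegrE// (le_trans x0).
have H1 : K * x ^+ 2 <= `|K| * x ^+ 2 by rewrite ler_wpM2r ?sqr_ge0// ler_norm.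
have H2 : `|K| * x ^+ 2 <= `|K| * r ^+ 2 by rewrite ler_wpM2l.
have := w0 x x0; lra.
Qed.

Lemma mono_mem p n : (fun z : R[i] => z ^+ n) \in fock_pred w p.
Proof.
have [C C0 CP] := fock_dominated w p; have [c c0 cP] := weight_quad 2.
apply: mem_fock; first exact (entireX n).
apply: le_lt_trans (CP _ (expR (n%:R ^+ 2 + c)) (entireX n) (expR_ge0 _) _) (ltry _).
move=> z; rewrite normcX; move: (normc z) (normc_ge0 z) => x x0.
rewrite -expRD; apply: (@le_trans _ _ (expR (n%:R * x))).
  rewrite mulrC expRM_natr; apply: lerXn2r; rewrite ?nnegrE ?expR_ge0//.
  by apply: le_trans (expR_ge1Dx x); rewrite lerDr.
rewrite ler_expR; have := cP x x0; have : 0 <= (n%:R - x) ^+ 2 by exact: sqr_ge0.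
rewrite sqrrB; have : 0 <= n%:R :> R by [].
move: (n%:R : R) => m m0; nra.
Qed.

Definition mono p n : fock w p := Fock (mono_mem p n).

(** At the radius [x] the monomial times the weight is maximal, and [gap_quad] gives Gaussian decay
    on both sides. The ring is measured crudely, by dilating the plane by [x]; the resulting power
    of [x] is harmless against exponentials. *)
Lemma mono_norm p : exists C r0 : R, [/\ 0 < C, 1 <= r0 & forall n x, r0 <= x ->
  wD w x = n%:R -> fn (mono p n) <= C * x `^ (2 / p%:num) * expR (n%:R * ln x - w x)].
Proof.
have p0 : 0 < p%:num :> R by [].
have B0 : 0 < 2 / p%:num by rewrite divr_gt0.
have [r0 r1 rP] := gap_quad w B0.
have J1 := gauss_int_ge0 (1 : R).
pose X := expR 2 * gauss_int (1 : R) + 1.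
have X0 : 0 < X by rewrite ltr_wpDl// mulr_ge0 ?expR_ge0.
exists (X `^ p%:num^-1), r0; split => //; first by rewrite powR_gt0.
move=> n x rx Dx; have x0 : 0 < x by apply: lt_le_trans rx; exact: lt_le_trans r1.
pose E := expR (n%:R * ln x - w x).
have E0 : 0 < E by exact: expR_gt0.
have Dx0 := wD_gt0 w x0.
have key y : 0 <= y -> y ^+ n * expR (- w y) <= E * expR (- (2 / p%:num) * (y - x) ^+ 2).
  rewrite le_eqVlt => /predU1P[<-|y0].
    have [n0|n0] := eqVneq n 0%N; first by move: Dx0; rewrite Dx n0 ltxx.
    by rewrite expr0n (negbTE n0) mul0r mulr_ge0 ?expR_ge0.
  rewrite -{1}(lnK (x := y)) ?posrE// -expRM_natl -!expRD ler_expR.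
  by have := rP x y rx y0; rewrite Dx; lra.
pose G (z : R[i]) : \bar R := (expR (- 2 * (normc z - x) ^+ 2))%:E.
have mG : measurable_fun [set: plane] (G \o cpl).
  apply/measurable_EFinP; apply: (measurableT_comp (@measurable_expR R)).
  apply: measurable_funM => //; apply: (measurableT_comp (f := fun t : MR => t ^+ 2 : MR)).
    exact: exprn_measurable.
  by apply: measurable_funB => //; exact: measurable_normc.
have G0 z : (0 <= G z)%E by rewrite lee_fin expR_ge0.
have IG : (\int[area]_z G (cpl z) <= (x ^+ 2 * X)%:E)%E.
  have := @ge0_area_affine R x 0 G x0 mG G0 => H.
  have -> : (\int[area]_z G (cpl z) = (x ^+ 2)%:E * \int[area]_z G (x%:C * cpl z + 0)%R)%E.
    by rewrite H muleA -EFinM exprVn mulfV ?mul1e// gt_eqF// exprn_gt0.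
  rewrite (EFinM (x ^+ 2)); apply: lee_wpmul2l; first by rewrite lee_fin sqr_ge0.
  apply: (@le_trans _ _ ((expR 2)%:E * \int[area]_z gauss 1 z)%E); last first.
    by rewrite gauss_intE// -EFinM lee_fin lerDl.
  rewrite -ge0_integralZl ?lee_fin ?expR_ge0//; first last.
  - by move=> z _; rewrite lee_fin expR_ge0.
  - exact: measurable_gauss.
  apply: ge0_le_integral => //.
  - have := measurable_gauss 1 => _.
    apply/measurable_EFinP; apply: (measurableT_comp (@measurable_expR R)).
    apply: measurable_funM => //; apply: (measurableT_comp (f := fun t : MR => t ^+ 2 : MR)).
      exact: exprn_measurable.
    apply: measurable_funB => //.
    rewrite (_ : (fun z : plane => normc (x%:C * cpl z + 0)) = fun z : plane => x * normc (cpl z)).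
      by apply: measurable_funM => //; exact: measurable_normc.
    by apply/funext => z; rewrite addr0 normcM normcR ger0_norm// ltW.
  - by apply: measurable_funeM; exact: measurable_gauss.
  move=> z _; rewrite /G /gauss -EFinM lee_fin addr0 normcM normcR ger0_norm ?(ltW x0)//.
  move: (normc (cpl z)) => y; rewrite -expRD ler_expR.
  have x1 : 1 <= x by exact: le_trans rx.
  have h1 : (y - 1) ^+ 2 <= x ^+ 2 * (y - 1) ^+ 2.
    by rewrite ler_peMl ?sqr_ge0//; apply: exprn_ege1.
  have -> : (x * y - x) ^+ 2 = x ^+ 2 * (y - 1) ^+ 2 by ring.
  have h2 : 0 <= (y - 2) ^+ 2 by exact: sqr_ge0.
  by move: h1 h2; move: (x ^+ 2 * _) => t; rewrite !sqrrB; lra.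
have IE : (fock_integral w p (mono p n) <= (E `^ p%:num * (x ^+ 2 * X))%:E)%E.
  rewrite (EFinM (E `^ _)); apply: le_trans (lee_wpmul2l _ IG); last by rewrite lee_fin powR_ge0.
  rewrite -ge0_integralZl ?lee_fin ?powR_ge0//.
  apply: ge0_le_integral => //.
  - by move=> z _; rewrite lee_fin mulr_ge0 ?powR_ge0 ?expR_ge0.
  - have em : entire (fun z : R[i] => z ^+ n) := entireX n.
    exact: (fock_integrand_measurable w p em).
  - by apply: measurable_funeM.
  move=> z _; rewrite -EFinM lee_fin -/(cpl z) normcX.
  move: (normc (cpl z)) (normc_ge0 (cpl z)) => y y0.
  have -> : (y ^+ n) `^ p%:num * expR (- p%:num * w y) = (y ^+ n * expR (- w y)) `^ p%:num.
    by rewrite powRM ?exprn_ge0 ?expR_ge0// -expRM; congr (_ * expR _); ring.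
  have -> : expR (- 2 * (y - x) ^+ 2) = expR (- (2 / p%:num) * (y - x) ^+ 2) `^ p%:num.
    by rewrite -expRM; congr expR; field; rewrite gt_eqF.
  rewrite -(powRM _ (ltW E0) (expR_ge0 _)).
  apply: ge0_ler_powR; rewrite ?nnegrE ?mulr_ge0 ?exprn_ge0 ?expR_ge0 ?(ltW p0) ?(ltW E0)//.
  exact: key.
rewrite fn_integral lee_fin in IE.
have pp : p%:num * p%:num^-1 = 1 :> R by rewrite mulfV ?gt_eqF.
have x20 : 0 <= x ^+ 2 by exact: sqr_ge0.
have -> : fn (mono p n) = (fn (mono p n) `^ p%:num) `^ p%:num^-1 by rewrite -powRrM pp powRr1 ?fn_ge0.
rewrite -/E.
have -> : X `^ p%:num^-1 * x `^ (2 / p%:num) * E = (E `^ p%:num * (x ^+ 2 * X)) `^ p%:num^-1.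
  rewrite (powRM _ (powR_ge0 E _) (mulr_ge0 x20 (ltW X0))) -powRrM pp (powRr1 (ltW E0)).
  by rewrite (powRM _ x20 (ltW X0)) -powR_mulrn ?(ltW x0)// -powRrM; ring.
apply: ge0_ler_powR; rewrite ?nnegrE ?powR_ge0 ?invr_ge0 ?(ltW p0)//.
by rewrite mulr_ge0 ?powR_ge0// mulr_ge0// ltW.
Qed.

Lemma comp_operE p q psi (f : fock w p) : bounded_symbol w p q psi ->
  fock_fun (comp_oper w p q psi f) = f \o psi.
Proof. by move=> [_ H _]; rewrite /comp_oper; exact: (insubdK _ (H f)). Qed.

Lemma bounded_fn p q psi : bounded_symbol w p q psi -> exists2 M : R, 0 <= M &
  forall f, fn (comp_oper w p q psi f) <= M * fn f.
Proof.
move=> [_ _ [M MP]]; exists `|M| => // f; have := MP f.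
rewrite !fnE -EFinM lee_fin => /le_trans; apply.
by rewrite ler_wpM2r ?fn_ge0// ler_norm.
Qed.

(* Test the operator on [z ^+ n] with [n] the integer part of [wD w (normc (psi z))]. *)
Lemma symbol_growth p q psi (d : R) : bounded_symbol w p q psi -> 0 < d ->
  exists2 r : R, 1 <= r & forall z, r <= normc (psi z) -> normc (psi z) <= normc z + 2 * d.
Proof.
move=> bs d0; have [M M0 MP] := bounded_fn bs.
have [C C0 CP] := fock_eval w q d0.
have [C' [r0 [C'0 r01 rP]]] := mono_norm p.
(* Of the drop [K * x] of the weight, the gap between [s] and [x] uses [x], the power of [s] in
   [mono_norm] uses [2 / p * x], and what is left exceeds [ln A]. *)
pose K := 3 + 2 / p%:num.
have p0 : 0 < p%:num :> R by [].
have [r2 r21 r2P] := weight_drop w K d0.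
have r00 : 0 < r0 by exact: lt_le_trans r01.
pose A := C * M * C' + 1.
have A0 : 0 < A by rewrite ltr_wpDl// !mulr_ge0// ltW.
have [r3 r31 r3P] := wD_quad w (wD w r0 + 1).
pose rr := Num.max (Num.max r0 r2) (Num.max r3 (1 + `|ln A|)).
have rr0 : r0 <= rr by rewrite !le_max lexx.
have rr2 : r2 <= rr by rewrite !le_max lexx ?orbT.
have rr3 : r3 <= rr by rewrite !le_max lexx ?orbT.
have rr4 : 1 + `|ln A| <= rr by rewrite !le_max lexx ?orbT.
exists rr; first exact: le_trans rr0.
move=> z; have := CP (comp_oper w p q psi (mono p (Num.truncn (wD w (normc (psi z)))))) z.
rewrite comp_operE// /= -/(normc _) normcX; move: (normc (psi z)) (normc z) (normc_ge0 z) => x y y0.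
set n := Num.truncn _ => H rrx; rewrite leNgt; apply/negP => yx.
have x0 : 0 < x by apply: lt_le_trans r00 _; exact: le_trans rrx.
have x1 : 1 <= x by apply: le_trans rrx; exact: le_trans rr0.
have Dx0 := wD_gt0 w x0.
have /andP[nD Dn] := truncn_itv (ltW Dx0).
have nr0 : wD w r0 <= n%:R.
  have := r3P x (le_trans rr3 rrx).
  have h1 : 1 <= x ^+ 2 by exact: exprn_ege1.
  have h2 := wD_gt0 w r00; move: Dn; rewrite -/n -natr1; nra.
(* The peak [s] of the monomial lies slightly below [x], because [n] was rounded down; [gap] bounds
   the loss. *)
have [s r0s Ds] := wD_IVT r00 nr0.
have s0 : 0 < s by exact: lt_le_trans r0s.
have s1 : 1 <= s by exact: le_trans r0s.
have sx : s <= x.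
  rewrite leNgt; apply/negP => xs; have := wD_incr w x0 xs; rewrite Ds.
  by move=> /lt_le_trans/(_ nD); rewrite ltxx.
have [c /andP[sc cx] gE] := gap_MVT w n%:R s0 sx.
have c0 : 0 < c by exact: lt_le_trans sc.
have gap : (w x - n%:R * ln x) - (w s - n%:R * ln s) <= x.
  rewrite gE; have Dc : wD w c - n%:R <= 1.
    by have := wD_ndecr w c0 cx; move: Dn; rewrite -/n -natr1; lra.
  apply: (@le_trans _ _ (1 * (x - s))); last by lra.
  by rewrite ler_wpM2r ?subr_ge0// ler_pdivrMr// mul1r (le_trans Dc)// (le_trans s1).
have := rP n s r0s Ds => H1.
have {H} H := le_trans H (ler_wpM2l _ (MP _)).
have E0 : 0 <= C * expR (w (y + d)) by rewrite mulr_ge0 ?expR_ge0 ?(ltW C0).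
have {H} := H E0; move=> /le_trans/(_ (ler_wpM2l E0 (ler_wpM2l M0 H1))).
rewrite -{1}(lnK (x := x)) ?posrE// -expRM_natl => H.
have sp : s `^ (2 / p%:num) <= expR (2 / p%:num * x).
  rewrite /powR gt_eqF// ler_expR ler_wpM2l ?divr_ge0//.
  by have := expR_ge1Dx (ln s); rewrite lnK ?posrE//; lra.
have wyx : w (y + d) <= w x - K * x.
  apply: le_trans (r2P x (le_trans rr2 rrx)); apply: weight_ndecr; first by rewrite addr_ge0// ltW.
  by move: yx; lra.
have {H} : expR (n%:R * ln x) <= A * (expR (w (y + d)) * expR (2 / p%:num * x) * expR (n%:R * ln s - w s)).
  apply: le_trans H _.
  rewrite (_ : _ * (M * _) = (C * M * C') * (expR (w (y + d)) * s `^ (2 / p%:num) * expR (n%:R * ln s - w s))); last by ring.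
  apply: ler_pM; rewrite ?mulr_ge0 ?expR_ge0 ?powR_ge0 ?(ltW C0) ?(ltW C'0)//; first by rewrite lerDl.
  by rewrite ler_wpM2r ?expR_ge0// ler_wpM2l ?expR_ge0.
rewrite -(lnK (x := A)) ?posrE// -!expRD ler_expR.
have := ler_norm (ln A); move: rrx rr4 gap wyx; rewrite /K.
move: (2 / p%:num) (`|ln A|) (ln A) (w x) (w s) (w (y + d)) (n%:R * ln x) (n%:R * ln s) => *.
lra.
Qed.

Lemma taylor_affine (psi : R[i] -> R[i]) : entire psi -> (forall n, (2 <= n)%N -> coef psi n = 0) ->
  psi = fun z : R[i] => coef psi 1 * z + coef psi 0.
Proof.
move=> e H; apply/funext => z; rewrite (taylor z e); apply/eqP; rewrite -subr_eq0; apply/eqP.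
apply/eqP; rewrite -normc_eq0 eq_le normc_ge0 andbT.
rewrite (_ : coef psi 1 * z + coef psi 0 = partial (fun m => coef psi m * z ^+ m) 2); last first.
  by rewrite /partial !big_ord_recl big_ord0 expr0 expr1 mulr1 addr0 addrC.
apply: csum_tail => k; rewrite big1// => i _.
by rewrite H ?addn2// mul0r normc0.
Qed.

(** Linear growth removes the coefficients from order 2 on, by Cauchy's estimates. The slope 1 of
    the growth bound gives [normc a <= 1]. If [normc a = 1], a point where [a * z] and [b] have the
    same direction has an image of modulus [normc z + normc b], too large for small [d]. *)
Lemma symbol_affine p q psi : bounded_symbol w p q psi -> exists a b : R[i],
  [/\ psi = (fun z => a * z + b), normc a <= 1 & normc a = 1 -> b = 0].
Proof.
move=> bs; have [e _ _] := bs.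
have [r r1 rP] := symbol_growth bs ltr01.
have bnd z : normc (psi z) <= r + normc z + 2.
  have := normc_ge0 z; have [/rP|/ltW] := leP r (normc (psi z)); lra.
have c0 n : (2 <= n)%N -> coef psi n = 0.
  move=> n2; apply: normc_small0 => d d0.
  pose s := Num.max 1 (2 * (r + 3) / d).
  have s1 : 1 <= s by rewrite le_max lexx.
  have s0 : 0 < s by exact: lt_le_trans s1.
  have sd : 2 * (r + 3) / d <= s by rewrite le_max lexx orbT.
  have := @coef_bound R psi s n (r + s + 2) e s0 => /(_ _).
  have Hs z : normc z = s -> normc (psi z) <= r + s + 2 by move=> <-; exact: bnd.
  move=> /(_ Hs) H; move: sd; rewrite ler_pdivrMr// => sd.
  have ss : s ^+ 2 <= s ^+ n by apply: ler_weXn2l.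
  have s20 : 0 < s ^+ 2 by rewrite exprn_gt0.
  rewrite -(ler_pM2r s20); apply: le_trans (ler_wpM2l (normc_ge0 _) ss) _.
  by apply: le_trans H _; nra.
exists (coef psi 1), (coef psi 0).
have E := taylor_affine e c0.
move: (coef psi 1) (coef psi 0) E => a b E.
split => //.
  rewrite leNgt; apply/negP => a1.
  pose t := (r + 3 + normc b) / (normc a - 1).
  have t0 : 0 <= t by rewrite divr_ge0 ?subr_ge0 ?(ltW a1)// !addr_ge0 ?normc_ge0// (le_trans ler01).
  have := bnd t%:C; rewrite E normc_real_ge0//.
  have := normc_triangle (a * t%:C + b) (- b); rewrite addrK normcN normcM normc_real_ge0//.
  have tE : t * (normc a - 1) = r + 3 + normc b by rewrite /t divfK// gt_eqF// subr_gt0.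
  move: tE; rewrite mulrBr mulr1 [t * _]mulrC; move: (normc a * t) (normc b) (normc _) => *; lra.
move=> a1; apply/eqP; rewrite -normc_eq0; apply/negP => /negP b0.
have bp : 0 < normc b by rewrite lt_neqAle eq_sym b0 normc_ge0.
(* The growth bound then allows an excess of [normc b / 2], half of what occurs. *)
have d0 : 0 < normc b / 4 by rewrite divr_gt0.
have [s s1 sP] := symbol_growth bs d0.
have az : a != 0 by rewrite -normc_eq0 a1 oner_eq0.
pose t := s / normc b.
have t0 : 0 <= t by rewrite divr_ge0 ?(ltW bp)// (le_trans ler01).
have E1 : psi (t%:C * (b / a)) = (t + 1)%:C * b.
  rewrite E (_ : (t + 1)%:C = t%:C + 1); last by rewrite rmorphD.
  by field.
have n1 : normc (psi (t%:C * (b / a))) = s + normc b.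
  by rewrite E1 normcM (normc_real_ge0 (addr_ge0 t0 ler01)) mulrDl mul1r /t divfK.
have n2 : normc (t%:C * (b / a)) = s.
  by rewrite !normcM normcV// a1 invr1 mulr1 normc_real_ge0// /t divfK.
have := sP (t%:C * (b / a)); rewrite n1 n2 => /(_ _); rewrite lerDl (ltW bp) => /(_ isT).
by move: bp; lra.
Qed.

End monomials.

(** * Contractions *)

Section contraction_symbols.
Context {R : realType} (w : weight R).
Implicit Types (p q : {posnum R}) (al : nat -> R[i]).

Lemma psum_affine_tail (a b : R[i]) : normc a < 1 -> exists k C : R,
  [/\ 0 < k < 1, 0 < C & forall N al, 0 <= N -> tame w N al -> forall n z,
    normc (psum al (a * z + b) - partial (fun m => al m * (a * z + b) ^+ m) n) <=
    C * N * k ^+ n * bump w z].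
Proof.
move=> a1; have [k [C [/andP[k0 k1] C0 CP]]] := affine_tame w b a1.
have k10 : 0 < 1 - k by rewrite subr_gt0.
have k01 : 0 <= k < 1 by rewrite (ltW k0).
exists k, (C / (1 - k)); split; [by rewrite k0|by rewrite divr_gt0|].
move=> N al N0 HN n z.
have := @geo_tail R (fun m => al m * (a * z + b) ^+ m) (C * N * bump w z) k n _ k01.
move=> /(_ _ _)/le_trans; apply.
- by rewrite !mulr_ge0 ?bump_ge0 ?(ltW C0).
- by move=> m; rewrite normcM normcX; exact: CP.
- by rewrite le_eqVlt; apply/orP; left; apply/eqP; field; rewrite gt_eqF.
Qed.

Lemma fock_taylor p (f : fock w p) z : f z = psum (coef f) z.
Proof. exact (taylor z (fent f)). Qed.

Lemma affine_comp_bound p q (a b : R[i]) : normc a < 1 -> exists2 C : R, 0 < C &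
  forall f : fock w p, (fock_norm w q (fun z => f (a * z + b)%R) <= (C * fn f)%:E)%E.
Proof.
move=> a1; have [C1 C10 C1P] := fock_tame w p; have [C2 C20 C2P] := fock_dominated w q.
have [k [C [/andP[k0 k1] C0 CP]]] := psum_affine_tail b a1.
exists (C2 * (C * C1)); first by rewrite !mulr_gt0.
move=> f; have e : entire (fun z => f (a * z + b)) := entire_comp (fent f) (entire_affine a b).
rewrite -mulrA; apply: C2P => //; first by rewrite !mulr_ge0 ?fn_ge0 ?(ltW C0) ?(ltW C10).
move=> z; have := CP _ _ (mulr_ge0 (ltW C10) (fn_ge0 f)) (C1P f) 0%N z.
by rewrite /partial big_ord0 subr0 -fock_taylor expr0 mulr1 /bump !mulrA.
Qed.

Lemma affine_bounded_symbol p q (a b : R[i]) : normc a < 1 ->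
  bounded_symbol w p q (fun z => a * z + b).
Proof.
move=> a1; have [C C0 CP] := affine_comp_bound p q b a1.
have mem (f : fock w p) : (f \o (fun z => a * z + b)) \in fock_pred w q.
  apply: mem_fock; first exact (entire_comp (fent f) (entire_affine a b)).
  exact: le_lt_trans (CP f) (ltry _).
split; [exact (entire_affine a b)|exact: mem|].
exists C => f; rewrite [in leRHS]fnE -EFinM /fnorm /comp_oper.
by have := CP f; rewrite (insubdK _ (mem f)).
Qed.

Lemma sub_pow_le (s t : R) m : 0 <= s <= 1 -> 0 <= t <= 1 ->
  `|t ^+ m - s ^+ m| <= m%:R * `|t - s|.
Proof.
move=> s01 t01; elim: m => [|m IH]; first by rewrite !expr0 subrr normr0 mul0r.
case/andP: s01 => s0 s1; case/andP: t01 => t0 t1.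
have -> : t ^+ m.+1 - s ^+ m.+1 = t * (t ^+ m - s ^+ m) + (t - s) * s ^+ m.
  by rewrite !exprS; ring.
apply: le_trans (ler_normD _ _) _; rewrite !normrM -natr1 mulrDl mul1r (ger0_norm t0).
apply: lerD; first by apply: le_trans IH; rewrite ler_piMl.
by rewrite ler_piMr// ger0_norm ?exprn_ge0// exprn_ile1.
Qed.

Lemma nat_geo_le (k : R) : 0 < k < 1 -> exists k' C : R, [/\ 0 < k' < 1, 0 < C &
  forall m, m%:R * k ^+ m <= C * k' ^+ m].
Proof.
move=> /andP[k0 k1]; pose k' := (1 + k) / 2; pose x := k' / k - 1.
have k'0 : 0 < k' by rewrite divr_gt0// ltr_wpDl// ltW.
have x0 : 0 < x by rewrite subr_gt0 ltr_pdivlMr// mul1r ltr_pdivlMr//; lra.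
exists k', x^-1; split; [|by rewrite invr_gt0|].
  by rewrite k'0 ltr_pdivrMr//; lra.
move=> m; rewrite ler_pdivlMl//.
have -> : k' = (1 + x) * k by rewrite /x; field; rewrite gt_eqF.
rewrite exprMn mulrA ler_wpM2r ?exprn_ge0 ?(ltW k0)//.
elim: m => [|m IH]; first by rewrite mulr0 expr0.
have h : 1 <= (1 + x) ^+ m by rewrite exprn_ege1// lerDl ltW.
by rewrite -natr1 exprS; move: IH h; move: ((1 + x) ^+ m) (m%:R : R) => u v *; nra.
Qed.

Lemma csumB u v : summable u -> summable v ->
  csum (fun m => u m - v m) = csum u - csum v :> R[i].
Proof.
move=> su sv; have sv' : summable (fun m => -1 * v m).
  by have [B BP] := sv; exists B => n; under eq_bigr do rewrite mulN1r normcN.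
rewrite -[RHS](_ : csum u + csum (fun m => -1 * v m) = _); last by rewrite csumZ// mulN1r.
by rewrite -csumD//; congr csum; apply/funext => m; rewrite mulN1r.
Qed.

Lemma psum_rapidB al be z : rapid al -> rapid be ->
  psum al z - psum be z = psum (fun m => al m - be m) z :> R[i].
Proof.
move=> ra rb; rewrite /psum -csumB; try exact: rapid_summable.
by congr csum; apply/funext => m; rewrite mulrBl.
Qed.

(** The difference [t ^+ m - s ^+ m] costs a factor [m], which [nat_geo_le] absorbs by a slightly
    slower geometric decay. *)
Lemma affine_path_lipschitz p q (a b : R[i]) : normc a < 1 -> exists2 C : R, 0 < C &
  forall (f : fock w p) (s t : R), 0 <= s <= 1 -> 0 <= t <= 1 ->
  (fock_norm w q (fun z => f (t%:C * (a * z + b)) - f (s%:C * (a * z + b)))%R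
    <= (C * `|t - s| * fn f)%:E)%E.
Proof.
move=> a1; have [C1 C10 C1P] := fock_tame w p; have [C2 C20 C2P] := fock_dominated w q.
have [k [C [k01 C0 CP]]] := affine_tame w b a1.
have [k' [C' [/andP[k'0 k'1] C'0 C'P]]] := nat_geo_le k01.
have k10 : 0 < 1 - k' by rewrite subr_gt0.
exists (C2 * (C * C1 * C' / (1 - k'))); first by rewrite !mulr_gt0 ?invr_gt0.
move=> f s t s01 t01.
have ee (u : R) : entire (fun z => f (u%:C * (a * z + b))).
  have e1 : entire (fun z => u%:C * (a * z + b)) := @entireZ R u%:C _ (entire_affine a b).
  exact (entire_comp (fent f) e1).
rewrite -!mulrA; apply: C2P.
- exact (entireB (ee t) (ee s)).
- by rewrite !mulr_ge0 ?fn_ge0 ?(ltW C0) ?(ltW C10) ?(ltW C'0) ?invr_ge0 ?(ltW k10).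
move=> z; set ze := a * z + b.
have rf := coef_rapid (fent f).
rewrite !fock_taylor /psum -csumB; try exact: rapid_summable.
apply: csum_le => n.
have := CP _ _ (mulr_ge0 (ltW C10) (fn_ge0 f)) (C1P f) => {}CP.
pose B := C * (C1 * fn f) * bump w z.
have B0 : 0 <= B by rewrite !mulr_ge0 ?fn_ge0 ?bump_ge0 ?(ltW C0) ?(ltW C10).
apply: (@le_trans _ _ (\sum_(m < n) (B * `|t - s| * C') * k' ^+ m)).
  apply: ler_sum => m _; rewrite !exprMn.
  rewrite (_ : _ - _ = ((t ^+ m - s ^+ m)%:C) * (coef f m * ze ^+ m)); last first.
    by rewrite rmorphB !rmorphXn/=; ring.
  rewrite normcM normcR normcM normcX.
  have h := CP m z; have h2 := sub_pow_le m s01 t01.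
  apply: le_trans (ler_pM _ _ h2 h) _; rewrite ?normr_ge0 ?mulr_ge0 ?normc_ge0 ?exprn_ge0 ?normc_ge0//.
  rewrite -/B (_ : _ * (B * _) = B * `|t - s| * (m%:R * k ^+ m)); last by ring.
  by rewrite -[leRHS]mulrA ler_wpM2l// mulr_ge0.
apply: le_trans (geo_sum _ _ _) _; rewrite ?(ltW k'0)//.
  by apply: mulr_ge0; rewrite ?(ltW C'0)// mulr_ge0.
by rewrite /B -/(bump w z) le_eqVlt; apply/orP; left; apply/eqP; field; rewrite gt_eqF.
Qed.

End contraction_symbols.

(** * Neighbourhoods in Fock spaces and spaces of operators *)

Section fock_topology.
Context {R : realType} (w : weight R).
Implicit Types (p q : {posnum R}) (al : nat -> R[i]).

Lemma fockBE p (f g : fock w p) z : (f - g) z = f z - g z.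
Proof. by []. Qed.

Lemma fockDE p (f g : fock w p) z : (f + g) z = f z + g z.
Proof. by []. Qed.

Lemma fockZE p c (f : fock w p) z : (c *: f) z = c * f z.
Proof. by []. Qed.

Lemma fock_ext p (f g : fock w p) : (forall z, f z = g z) -> f = g.
Proof. by move=> H; apply: val_inj; apply/funext. Qed.

Lemma fn_eq0 p (f : fock w p) : fn f = 0 -> f = 0.
Proof.
move=> f0; apply: fock_ext => z; have [C C0 CP] := fock_eval w p ltr01.
have := CP f z; rewrite f0 mulr0 => H.
by apply/eqP; rewrite -normc_eq0 eq_le normc_ge0 andbT.
Qed.

Lemma fn0 p : fn (0 : fock w p) = 0.
Proof. by rewrite /fn fnorm0. Qed.

Lemma fnN p (f : fock w p) : fn (- f) = fn f.
Proof. by rewrite /fn fnormN. Qed.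

Lemma fnB_sym p (f g : fock w p) : fn (f - g) = fn (g - f).
Proof. by rewrite -fnN opprB. Qed.

Lemma fn_quasi p (f g : fock w p) : fn (f + g) <= fock_const p * Num.max (fn f) (fn g).
Proof.
have := fnormD f g; rewrite !fnE => H.
by rewrite -lee_fin; apply: le_trans H _; rewrite -EFin_max -EFinM.
Qed.

Lemma fnZ p c (f : fock w p) : fn (c *: f) = normc c * fn f.
Proof.
have p0 : p%:num != 0 :> R by rewrite gt_eqF.
have pw x : 0 <= x -> x = (x `^ p%:num) `^ p%:num^-1 :> R.
  by move=> x0; rewrite -powRrM mulfV// powRr1.
have H : fock_integral w p (c *: f) = ((normc c `^ p%:num)%:E * fock_integral w p f)%E.
  exact (fock_integralZ w p c (fent f)).
move: H; rewrite !fn_integral -EFinM => -[] H.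
rewrite (pw _ (fn_ge0 _)) H -powRM ?normc_ge0 ?fn_ge0//.
by rewrite -pw// mulr_ge0 ?normc_ge0 ?fn_ge0.
Qed.

Lemma fock_nbhs p (f : fock w p) (A : set (fock w p)) :
  nbhs f A <-> exists2 e : R, 0 < e & forall g, fn (f - g) < e -> A g.
Proof.
split=> [/nbhsP[E [e /= e0 eE] EA]|[e e0 eA]].
  exists e => // g ge; apply: EA; apply/xsectionP; apply: eE => /=.
  by rewrite fnE lte_fin.
apply/nbhsP; exists [set xy : fock w p * fock w p | (fnorm (xy.1 - xy.2)%R < e%:E)%E].
  by exists e.
by move=> g /xsectionP/=; rewrite fnE lte_fin; exact: eA.
Qed.

(** Needed because compact sets must be known to be closed; it rests on point evaluations being
    bounded. *)
Lemma fock_hausdorff p : hausdorff_space (fock w p).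
Proof.
move=> f g fg; apply/eqP; rewrite -subr_eq0; apply/eqP/fn_eq0.
apply/eqP; rewrite eq_le fn_ge0 andbT; apply/ler_addgt0Pl => e e0; rewrite addr0.
have K0 := fock_const_gt0 p; have eK : 0 < e / fock_const p by rewrite divr_gt0.
have [h [/= fh gh]] : [set h | fn (f - h) < e / fock_const p] `&` [set h | fn (g - h) < e / fock_const p] !=set0.
  by apply: fg; apply/fock_nbhs; exists (e / fock_const p).
rewrite -[f - g](subrKA h); apply: le_trans (fn_quasi _ _) _.
have gh' : fn (h - g) < e / fock_const p by rewrite fnB_sym.
move: fh gh' K0; move: (fn _) (fn _) (fock_const p) => s t u su tu u0.
by rewrite -ler_pdivlMl// mulrC ge_max (ltW su) (ltW tu).
Qed.

Lemma oper_nbhs p q (T : oper w p q) (A : set (oper w p q)) :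
  nbhs T A <-> exists2 e : R, 0 < e & forall S, (opnorm (T - S)%R < e%:E)%E -> A S.
Proof.
split=> [/nbhsP[E [e /= e0 eE] EA]|[e e0 eA]].
  by exists e => // g ge; apply: EA; apply/xsectionP; apply: eE.
apply/nbhsP; exists [set xy : oper w p q * oper w p q | (opnorm (xy.1 - xy.2)%R < e%:E)%E].
  by exists e.
by move=> g /xsectionP/=; exact: eA.
Qed.

Lemma opnorm_le p q (T : oper w p q) (C : R) : 0 <= C -> (forall f, fn f <= 1 -> fn (T f) <= C) ->
  (opnorm T <= C%:E)%E.
Proof.
move=> C0 H; apply: ge_ereal_sup => _ [f f1 <-]; move: f1; rewrite /unit_ball/= fnE lee_fin => f1.
by rewrite fnE lee_fin H.
Qed.

Lemma opnorm_ge p q (T : oper w p q) f : fn f <= 1 -> ((fn (T f))%:E <= opnorm T)%E.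
Proof.
move=> f1; rewrite -fnE; apply: ereal_sup_ubound; exists f => //.
by rewrite /unit_ball/= fnE lee_fin.
Qed.

End fock_topology.

(* Sequences of complex numbers, as real functions so that the compactness of
   products of real segments applies. *)
Notation coefs R := (prod_topology (fun _ : nat * bool => (R : realType))).

Section coefficient_space.
Context {R : realType} (w : weight R).
Local Notation coefs := (coefs R).

Definition cf (x : coefs) (m : nat) : R[i] := x (m, true) +i* x (m, false).

Definition to_coefs (al : nat -> R[i]) : coefs :=
  fun i => if i.2 then complex.Re (al i.1) else complex.Im (al i.1).

Lemma to_coefsK al : cf (to_coefs al) = al.
Proof. by apply/funext => m; rewrite /cf /to_coefs /=; case: (al m). Qed.

Lemma coord_continuous i : continuous (fun x : coefs => x i : R).
Proof. exact: (@proj_continuous _ (fun _ : nat * bool => R) i). Qed.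

Lemma cf_near (x : coefs) m (d : R) : 0 < d -> \forall y \near x, normc (cf y m - cf x m) <= d.
Proof.
move=> d0; have d20 : 0 < d / 2 by rewrite divr_gt0.
have /cvgrPdist_le/(_ _ d20) c1 := @coord_continuous (m, true) x.
have /cvgrPdist_le/(_ _ d20) c2 := @coord_continuous (m, false) x.
near=> y; apply: (@le_trans _ _ (`|y (m, true) - x (m, true)| + `|y (m, false) - x (m, false)|)).
  exact: (normc_le (y (m, true) - x (m, true)) (y (m, false) - x (m, false))).
rewrite (splitr d); apply: lerD; rewrite distrC; near: y; [exact: c1|exact: c2].
Unshelve. all: end_near. Qed.

Lemma coefs_continuous (f : coefs -> R) :
  (forall x (d : R), 0 < d -> \forall y \near x, `|f x - f y| <= d) -> continuous f.
Proof.
move=> H x A /nbhs_ballP[d /= d0 dA].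
have d20 : 0 < d / 2 by rewrite divr_gt0.
apply: (filterS _ (H x _ d20)) => y fy; apply: dA; rewrite /ball/=.
by apply: le_lt_trans fy _; rewrite ltr_pdivrMr// ltr_pMr// ltr1n.
Qed.

Lemma normc_cf_continuous (c : R[i]) m : continuous (fun x : coefs => normc (cf x m - c)).
Proof.
apply: coefs_continuous => x d d0; near=> y.
apply: le_trans (normc_dist _ _) _.
rewrite opprB addrA subrK normcB; near: y; exact: cf_near.
Unshelve. all: end_near. Qed.

Lemma closed_sublevel (f : coefs -> R) (c : R) : continuous f -> closed [set x | f x <= c].
Proof.
move=> cof; apply: (@closed_comp _ _ f [set t | t <= c]); last exact: closed_le.
by move=> x _; exact: cof.
Qed.

Definition tame_set (N : R) : set coefs := [set x | tame w N (cf x)].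

Lemma closed_tame N : closed (tame_set N).
Proof.
have -> : tame_set N = \bigcap_(i in [set i : nat * R | 0 < i.2])
    [set x | normc (cf x i.1 - 0) <= N * expR (w (i.2 + 1)) / i.2 ^+ i.1].
  apply/seteqP; split => [x H [m r] r0|x H m r r0].
    change (is_true (normc (cf x m - 0) <= N * expR (w (r + 1)) / r ^+ m)).
    by rewrite subr0 ler_pdivlMr ?exprn_gt0//; exact: H.
  by rewrite -[cf x m]subr0 -ler_pdivlMr ?exprn_gt0//; exact: (H (m, r) r0).
apply: closed_bigI => i _; apply: closed_sublevel; exact: normc_cf_continuous.
Qed.

(** The counterpart of Montel's theorem: the estimate at radius 1 confines all coordinates to one
    segment, and Tychonoff's theorem applies to the product. *)
Lemma compact_tame N : compact (tame_set N).
Proof.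
pose M := N * expR (w 2).
have := @tychonoff _ (fun _ : nat * bool => R) (fun _ => `[- M, M]%classic) (fun _ => @segment_compact R (- M) M).
move=> K; apply: (subclosed_compact (@closed_tame N) K).
move=> x H [m b] /=; rewrite in_itv/= -ler_norml.
have := H m 1 ltr01; rewrite expr1n mulr1 (_ : 1 + 1 = 2 :> R)// => h.
apply: le_trans h; case: b; [exact: (normc_Re (cf x m))|exact: (normc_Im (cf x m))].
Qed.

Lemma pow_le_weight m : exists2 Q : R, 0 <= Q & forall r, 0 <= r -> r ^+ m <= Q * expR (w (r + 1)).
Proof.
have [c c0 cP] := weight_quad w 1; exists (expR (m%:R ^+ 2 + c)); first exact: expR_ge0.
move=> r r0; rewrite -expRD; apply: (@le_trans _ _ (expR (m%:R * r))).
  rewrite mulrC expRM_natr; apply: lerXn2r; rewrite ?nnegrE ?expR_ge0//.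
  by apply: le_trans (expR_ge1Dx r); rewrite lerDr.
have r10 : 0 <= r + 1 by rewrite addr_ge0.
rewrite ler_expR; have := cP (r + 1) r10; have : 0 <= (m%:R - r) ^+ 2 by exact: sqr_ge0.
rewrite sqrrB; have : 0 <= m%:R :> R by [].
by move: (m%:R : R) => u u0; nra.
Qed.

(** [affine_tame] for the coefficient sequence of a single monomial. *)
Lemma affine_pow_bump (a b : R[i]) m : normc a < 1 ->
  exists2 D : R, 0 < D & forall z, normc (a * z + b) ^+ m <= D * bump w z.
Proof.
move=> a1; have [k [C [/andP[k0 k1] C0 CP]]] := affine_tame w b a1.
have [Q Q0 QP] := pow_le_weight m.
exists (C * Q * k ^+ m + 1); first by rewrite ltr_wpDl// !mulr_ge0 ?exprn_ge0// ltW.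
move=> z; have := CP Q (fun n => (n == m)%:R) Q0 => /(_ _ m z); rewrite eqxx normc1 mul1r.
move=> /(_ _)/le_trans; apply.
  move=> n r r0; case: eqP => [->|_]; first by rewrite normc1 mul1r QP// ltW.
  by rewrite normc0 mul0r mulr_ge0 ?expR_ge0.
by rewrite mulrAC ler_wpM2r ?bump_ge0// lerDl.
Qed.

Lemma normcB_le (a b : R[i]) : normc (a - b) <= normc a + normc b.
Proof. by apply: le_trans (normc_triangle _ _) _; rewrite normcN. Qed.

Lemma tameB N al be : tame w N al -> tame w N be -> tame w (2 * N) (fun m => al m - be m).
Proof.
move=> Ha Hb m r r0; have := Ha m r r0; have := Hb m r r0.
have rm : 0 <= r ^+ m by rewrite exprn_ge0// ltW.
move=> hb ha; apply: (le_trans (ler_wpM2r rm (normcB_le _ _))).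
by rewrite mulrDl -mulrA mulr_natl mulr2n lerD.
Qed.

(** The tails are small uniformly on [tame_set], relative to [bump], and the finitely many remaining
    coefficients are controlled by the product topology. *)
Lemma psum_affine_near (a b : R[i]) N (x : coefs) (e : R) : normc a < 1 -> tame_set N x -> 0 < e ->
  \forall y \near x, tame_set N y ->
    forall z, normc (psum (cf y) (a * z + b) - psum (cf x) (a * z + b)) <= e * bump w z.
Proof.
move=> a1 Nx e0.
have N0 : 0 <= N.
  have := Nx 0%N 1 ltr01; rewrite expr0 mulr1 => h.
  by have := le_trans (normc_ge0 _) h; rewrite pmulr_lge0 ?expR_gt0.
have [k [C [/andP[k0 k1] C0 CP]]] := psum_affine_tail w b a1.
have N20 : 0 <= 2 * N by rewrite mulr_ge0.
have [n nP] : exists n, C * (2 * N) * k ^+ n <= e / 2.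
  have cv : (C * (2 * N) * k ^+ n) @[n --> \oo] --> (C * (2 * N) * 0 : R).
    by apply: cvgM; [exact: cvg_cst|apply: cvg_expr; rewrite ger0_norm// ltW].
  have e20 : 0 < e / 2 by rewrite divr_gt0.
  move/cvgrPdist_lt/(_ _ e20) : cv => [n _ nP]; exists n.
  have := nP n (leqnn n); rewrite mulr0 sub0r normrN => h.
  exact: le_trans (ler_norm _) (ltW h).
have [D D0 DP] : exists2 D : R, 0 < D & forall m z, (m < n)%N -> normc (a * z + b) ^+ m <= D * bump w z.
  elim: n {nP} => [|n [D D0 DP]]; first by exists 1.
  have [D' D'0 D'P] := affine_pow_bump b n a1.
  exists (D + D') => [|m z]; first by rewrite addr_gt0.
  rewrite ltnS leq_eqVlt => /orP[/eqP ->|/DP/le_trans]; last first.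
    by apply; rewrite ler_wpM2r ?bump_ge0// lerDl ltW.
  by apply: le_trans (D'P z) _; rewrite ler_wpM2r ?bump_ge0// lerDr ltW.
pose d := e / (2 * (D * n.+1%:R)).
have d0 : 0 < d by rewrite divr_gt0// !mulr_gt0.
have H : \forall y \near x, forall m, (m < n)%N -> normc (cf y m - cf x m) <= d.
  move: d d0 => d d0; elim: n {nP DP} => [|n IH]; first by near=> y.
  have := cf_near x n d0 => H2; near=> y => m; rewrite ltnS leq_eqVlt => /orP[/eqP ->|].
    by near: y; exact: H2.
  by move: m; near: y; exact: IH.
near=> y => Ny z.
have Hy : forall m, (m < n)%N -> normc (cf y m - cf x m) <= d by near: y; exact: H.
rewrite (psum_rapidB _ (tame_rapid N0 Ny) (tame_rapid N0 Nx)).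
pose u m := cf y m - cf x m.
have tu : tame w (2 * N) u := tameB Ny Nx.
have T1 := CP _ _ N20 tu n z.
rewrite -/u -[X in normc X](subrK (partial (fun m => u m * (a * z + b) ^+ m) n)).
apply: le_trans (normc_triangle _ _) _; rewrite (splitr e) mulrDl; apply: lerD.
  by apply: le_trans T1 _; rewrite ler_wpM2r ?bump_ge0.
rewrite /partial; apply: le_trans (normc_sum _ _ _) _.
apply: (@le_trans _ _ (\sum_(m < n) d * (D * bump w z))).
  apply: ler_sum => m _; rewrite normcM normcX; apply: ler_pM; rewrite ?normc_ge0 ?exprn_ge0 ?normc_ge0//.
    exact: Hy.
  exact: DP.
rewrite sumr_const card_ord -[leLHS]mulr_natr /d.
rewrite (_ : _ * n%:R = e / 2 * bump w z * (n%:R / n.+1%:R)); last first.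
  have n0 : n.+1%:R != 0 :> R by rewrite pnatr_eq0.
  by move: n0; move: (n.+1%:R : R) => n1 n0; field; rewrite (gt_eqF D0) n0.
by rewrite ler_piMr ?mulr_ge0 ?bump_ge0 ?(ltW e0)// ler_pdivrMr// mul1r ler_nat.
Unshelve. all: end_near. Qed.


(** Composition with an affine symbol as a function of coefficient sequences, including those of no
    function in the source space. If [normc a < 1], the default 0 does not interfere on tame
    sequences. *)
Definition psum_comp (a b : R[i]) q (x : coefs) : fock w q :=
  insubd 0 (fun z => psum (cf x) (a * z + b)).

Lemma psum_compE (a b : R[i]) q N (x : coefs) : normc a < 1 -> tame_set N x ->
  fock_fun (psum_comp a b q x) = fun z => psum (cf x) (a * z + b).
Proof.
move=> a1 Nx; have [C1 C10 C1P] := fock_dominated w q.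
have N0 : 0 <= N.
  have := Nx 0%N 1 ltr01; rewrite expr0 mulr1 => h.
  by have := le_trans (normc_ge0 _) h; rewrite pmulr_lge0 ?expR_gt0.
have [k [C [/andP[k0 k1] C0 CP]]] := psum_affine_tail w b a1.
have e : entire (fun z => psum (cf x) (a * z + b)).
  exact (entire_comp (psum_entire (tame_rapid N0 Nx)) (entire_affine a b)).
apply: insubdK; apply: mem_fock => //.
have CN : 0 <= C * N by rewrite mulr_ge0// ltW.
apply: le_lt_trans (C1P _ (C * N) e CN _) (ltry _).
by move=> z; have := CP _ _ N0 Nx 0%N z; rewrite /partial big_ord0 subr0 expr0 mulr1.
Qed.

Lemma fn_le q (f : fock w q) (C : R) : (fnorm f <= C%:E)%E -> fn f <= C.
Proof. by rewrite fnE lee_fin. Qed.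

Lemma psum_comp_near (a b : R[i]) q N (x : coefs) (e : R) : normc a < 1 -> tame_set N x -> 0 < e ->
  \forall y \near x, tame_set N y -> fn (psum_comp a b q y - psum_comp a b q x) < e.
Proof.
move=> a1 Nx e0; have [C C0 CP] := fock_dominated w q.
have d0 : 0 < e / (2 * C) by rewrite divr_gt0// mulr_gt0.
have H := psum_affine_near b a1 Nx d0.
near=> y => Ny; apply: (@le_lt_trans _ _ (C * (e / (2 * C)))); last first.
  by rewrite (_ : C * _ = e / 2) ?ltr_pdivrMr// ?ltr_pMr// ?ltr1n//; field; rewrite gt_eqF.
have Hy : forall z, normc (psum (cf y) (a * z + b) - psum (cf x) (a * z + b)) <= e / (2 * C) * bump w z.
  by move: Ny; near: y; exact: H.
have := psum_compE b q a1 Nx; have := psum_compE b q a1 Ny.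
move: (psum_comp a b q y) (psum_comp a b q x) => g f gE fE.
apply: fn_le; apply: (CP _ _ (fent (g - f)) (ltW d0)) => z.
by have := Hy z; rewrite -[(g - f) z]/(g z - f z) gE fE.
Unshelve. all: end_near. Qed.

Lemma psum_comp_continuous (a b : R[i]) q N : normc a < 1 ->
  {within tame_set N, continuous (psum_comp a b q)}.
Proof.
move=> a1; apply/subspace_continuousP => x Nx A /fock_nbhs[e e0 eA].
have := psum_comp_near b q a1 Nx e0; rewrite /within/=.
apply: filterS => y Hy Ny; apply: eA; rewrite fnB_sym; exact: Hy.
Qed.

Lemma comp_oper_psum (a b : R[i]) p q (f : fock w p) : normc a < 1 ->
  comp_oper w p q (fun z => a * z + b) f = psum_comp a b q (to_coefs (coef f)).
Proof.
move=> a1; apply: fock_ext => z.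
have [C C0 CP] := fock_tame w p.
have t : tame_set (C * fn f) (to_coefs (coef f)) by rewrite /tame_set/= to_coefsK.
have := psum_compE b q a1 t; have := comp_operE f (affine_bounded_symbol w p q b a1).
move: (psum_comp a b q _) (comp_oper _ _ _ _ f) => g h -> ->; rewrite to_coefsK.
exact: fock_taylor.
Qed.

Lemma tame_ball p : exists2 N : R, 0 < N &
  forall f : fock w p, fn f <= 1 -> tame_set N (to_coefs (coef f)).
Proof.
have [C C0 CP] := fock_tame w p; exists C => // f f1; rewrite /tame_set/= to_coefsK.
move=> n r r0; apply: le_trans (CP f n r r0) _.
by rewrite ler_wpM2r ?expR_ge0// ler_piMr// ltW.
Qed.

(** The image of the unit ball lies in a continuous image of the compact set of tame sequences. *)
Lemma affine_compact p q (a b : R[i]) : normc a < 1 ->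
  compact_oper (comp_oper w p q (fun z => a * z + b)).
Proof.
move=> a1; have [N N0 NP] := tame_ball p.
exists (psum_comp a b q @` tame_set N).
  move=> _ [f f1 <-]; move: f1; rewrite /unit_ball/= fnE lee_fin => f1.
  by exists (to_coefs (coef f)); [exact: NP|rewrite comp_oper_psum].
have K : compact (psum_comp a b q @` tame_set N).
  apply: continuous_compact; [exact: psum_comp_continuous|exact: compact_tame].
split => //; apply: compact_closed => //; exact: fock_hausdorff.
Qed.

End coefficient_space.

(** * Rotations *)

Section rotations.
Context {R : realType} (w : weight R).
Local Notation MR := (measurableTypeR R).
Local Notation plane := (MR * MR)%type.
Implicit Types (p q : {posnum R}) (a b c : R[i]).

Definition aff a b := fun z : R[i] => a * z + b.

Lemma fock_integral_rotation p f a : entire f -> normc a = 1 ->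
  fock_integral w p (fun z => f (a * z)%R) = fock_integral w p f.
Proof.
move=> ef a1.
pose G (z : R[i]) := (normc (f z) `^ p%:num * expR (- p%:num * w (normc z)))%:E.
have mG : measurable_fun [set: plane] (G \o cpl) := fock_integrand_measurable w p ef.
have G0 z : (0 <= G z)%E by rewrite lee_fin mulr_ge0 ?powR_ge0 ?expR_ge0.
have := ge0_area_rotation a1 mG G0; rewrite /fock_integral => <-.
by apply: eq_integral => z _; rewrite /G normcM a1 mul1r.
Qed.

Lemma rotation_norm p (f : fock w p) a : normc a = 1 ->
  fock_norm w p (fun z => f (a * z)%R) = fnorm f.
Proof. by move=> a1; rewrite /fock_norm (fock_integral_rotation p (fent f) a1). Qed.

Lemma rotation_bounded p a : normc a = 1 -> bounded_symbol w p p (aff a 0).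
Proof.
move=> a1.
have E (f : R[i] -> R[i]) : f \o aff a 0 = fun z => f (a * z).
  by apply/funext => z; rewrite /aff /= addr0.
have mem (f : fock w p) : f \o aff a 0 \in fock_pred w p.
  apply: mem_fock; first exact (entire_comp (fent f) (entire_affine a 0)).
  by rewrite E rotation_norm// fock_norm_fin.
split; [exact (entire_affine a 0)|exact: mem|].
exists 1 => f; rewrite mul1e {1}/fnorm /comp_oper (insubdK _ (mem f)) E.
by rewrite rotation_norm.
Qed.

Lemma rotation_fn p (f : fock w p) a : normc a = 1 ->
  fn (comp_oper w p p (aff a 0) f) = fn f.
Proof.
move=> a1; rewrite /fn /fnorm (comp_operE f (rotation_bounded p a1)).
rewrite (_ : f \o aff a 0 = fun z => f (a * z)%R); first by rewrite rotation_norm.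
by apply/funext => z; rewrite /aff /= addr0.
Qed.

Lemma symbol_cases p q psi : bounded_symbol w p q psi ->
  (exists a b, psi = aff a b /\ normc a < 1) \/ (exists2 a, psi = aff a 0 & normc a = 1).
Proof.
move=> /symbol_affine[a [b [-> a1 b0]]].
have [E|N] := eqVneq (normc a) 1; first by right; exists a => //; rewrite b0.
by left; exists a, b; rewrite lt_neqAle N.
Qed.

Lemma aff_bounded p q a b : normc a < 1 -> bounded_symbol w p q (aff a b).
Proof. exact: affine_bounded_symbol. Qed.

(** If [normc (1 - x) < 1] on the unit circle, then [normc (1 + x) ^+ 2 >= 3], so squaring [x] at
    least triples [normc (1 - x) ^+ 2]. Repeated squaring cannot stay below 1. *)
Lemma unit_pow_far c : normc c = 1 -> c != 1 -> forall N, exists2 n, (N <= n)%N & 1 <= normc (1 - c ^+ n).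
Proof.
move=> c1 cn1 N; apply: contrapT => H.
have small n : (N <= n)%N -> normc (1 - c ^+ n) < 1.
  by move=> Nn; rewrite ltNge; apply/negP => h; apply: H; exists n.
(* Squaring must start from a power different from 1; two consecutive powers cannot both be 1. *)
have [m Nm cm] : exists2 m, (N <= m)%N & c ^+ m != 1.
  have [E|?] := eqVneq (c ^+ N) 1; last by exists N.
  by exists N.+1 => //; rewrite exprS E mulr1.
pose y j := normc (1 - (c ^+ m) ^+ (2 ^ j)) ^+ 2.
have key (x : R[i]) : normc x = 1 -> normc (1 - x) < 1 -> 3 * normc (1 - x) ^+ 2 <= normc (1 - x ^+ 2) ^+ 2.
  move=> x1 x2; rewrite (_ : 1 - x ^+ 2 = (1 - x) * (1 + x)); last by ring.
  have P : normc (1 - x) ^+ 2 + normc (1 + x) ^+ 2 = 4.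
    case: x x1 x2 => u v h _; have {}h : u ^+ 2 + v ^+ 2 = 1 by rewrite -normc_sqr h expr1n.
    rewrite (_ : 1 - (u +i* v) = (1 - u) +i* (0 - v))// (_ : 1 + (u +i* v) = (1 + u) +i* (0 + v))//.
    by rewrite !normc_sqr; move: h; rewrite !expr2; lra.
  have h1 : normc (1 - x) ^+ 2 <= 1.
    by apply: exprn_ile1; rewrite ?normc_ge0// ltW.
  by rewrite normcM exprMn mulrC ler_wpM2l ?sqr_ge0//; lra.
have cn k : normc (c ^+ k) = 1 by rewrite normcX c1 expr1n.
have mj j : (N <= m * 2 ^ j)%N by rewrite (leq_trans Nm)// leq_pmulr// expn_gt0.
have yj j : 3 ^+ j * y 0%N <= y j.
  elim: j => [|j IH]; first by rewrite expr0 mul1r.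
  rewrite exprS -mulrA; apply: (@le_trans _ _ (3 * y j)); first by rewrite ler_wpM2l.
  rewrite /y expnSr exprM; apply: key; first by rewrite -exprM.
  by rewrite -exprM; apply: small.
have y0 : 0 < y 0%N.
  rewrite exprn_gt0// expn0 expr1 lt_neqAle eq_sym normc_ge0 andbT normc_eq0 subr_eq0 eq_sym.
  exact: cm.
have y1 j : y j <= 1.
  rewrite /y -exprM; have h := small _ (mj j).
  by apply: exprn_ile1; rewrite ?normc_ge0// ltW.
have g j : j%:R <= 3 ^+ j :> R.
  elim: j => [|j IH]; first by rewrite expr0.
  rewrite -natr1 exprS; have : 1 <= 3 ^+ j :> R by apply: exprn_ege1; rewrite ler1n.
  by move: IH; move: (3 ^+ j : R) => u; lra.
have h := truncnS_gt (y 0%N)^-1.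
have := le_trans (le_trans (ler_wpM2r (ltW y0) (g (Num.truncn (y 0%N)^-1).+1)) (yj _)) (y1 _).
by rewrite -ler_pdivlMr// mul1r leNgt h.
Qed.

Lemma fn_mono_gt0 p n : 0 < fn (mono w p n).
Proof.
rewrite lt_neqAle eq_sym fn_ge0 andbT; apply/eqP => /fn_eq0 H.
have := congr1 (fun f : fock w p => f 1) H; rewrite /= expr1n => /eqP.
by rewrite oner_eq0.
Qed.

Definition umono p n : fock w p := ((fn (mono w p n))^-1)%:C *: mono w p n.

Lemma umonoE p n z : umono p n z = ((fn (mono w p n))^-1)%:C * z ^+ n.
Proof. by []. Qed.

Lemma fn_umono p n : fn (umono p n) = 1.
Proof.
by rewrite fnZ normc_real_ge0 ?invr_ge0 ?fn_ge0// mulVf// gt_eqF// fn_mono_gt0.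
Qed.

Lemma umono_tame p : exists2 C : R, 0 < C & forall n,
  tame w C (fun m => if m == n then ((fn (mono w p n))^-1)%:C else 0).
Proof.
have [C C0 CP] := fock_tame w p; exists C => // n m r r0.
have N0 := fn_mono_gt0 p n.
case: eqP => [->|_]; last by rewrite normc0 mul0r mulr_ge0 ?expR_ge0 ?ltW.
have := CP (mono w p n) n r r0; rewrite (_ : coef _ n = 1); last first.
  by rewrite [LHS]coefX eqxx.
rewrite normc1 mul1r normc_real_ge0 ?invr_ge0 ?fn_ge0// ler_pdivrMl//.
by rewrite mulrCA mulrA.
Qed.

(** Cauchy's estimate at a radius greater than [2 * normc z] gives decay like [2^-1 ^+ n]. *)
Lemma umono_pointwise p z (e : R) : 0 < e ->
  exists N, forall n, (N <= n)%N -> normc (umono p n z) <= e.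
Proof.
move=> e0; have [C C0 CP] := umono_tame p.
pose r := 2 * normc z + 1; have r0 : 0 < r by rewrite ltr_wpDl// mulr_ge0 ?normc_ge0.
pose A := C * expR (w (r + 1)).
have cv : (A * 2^-1 ^+ n) @[n --> \oo] --> (A * 0 : R).
  by apply: cvgM; [exact: cvg_cst|apply: cvg_expr; rewrite ger0_norm ?invf_lt1 ?ltr1n].
move/cvgrPdist_lt/(_ _ e0) : cv => [N _ NP]; exists N => n Nn.
have := NP n Nn; rewrite mulr0 sub0r normrN => h.
apply: le_trans (le_trans (ler_norm _) (ltW h)).
have := CP n n r r0; rewrite eqxx => H.
rewrite umonoE normcM normcX.
apply: (@le_trans _ _ (normc ((fn (mono w p n))^-1)%:C * (2^-1 * r) ^+ n)).
  rewrite ler_wpM2l ?normc_ge0//; apply: lerXn2r; rewrite ?nnegrE ?normc_ge0 ?mulr_ge0 ?(ltW r0)//.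
  by rewrite /r; lra.
by rewrite exprMn mulrCA mulrC ler_wpM2r ?exprn_ge0.
Qed.

Lemma umono_contract p q a b (e : R) : normc a < 1 -> 0 < e ->
  exists N, forall n, (N <= n)%N -> fn (comp_oper w p q (aff a b) (umono p n)) <= e.
Proof.
move=> a1 e0; have [C C0 CP] := umono_tame p.
have [k [C' [/andP[k0 k1] C'0 C'P]]] := affine_tame w b a1.
have [C2 C20 C2P] := fock_dominated w q.
pose A := C2 * (C' * C).
have cv : (A * k ^+ n) @[n --> \oo] --> (A * 0 : R).
  by apply: cvgM; [exact: cvg_cst|apply: cvg_expr; rewrite ger0_norm// ltW].
move/cvgrPdist_lt/(_ _ e0) : cv => [N _ NP]; exists N => n Nn.
have := NP n Nn; rewrite mulr0 sub0r normrN => h.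
apply: le_trans (le_trans (ler_norm _) (ltW h)).
have gE := comp_operE (umono p n) (aff_bounded p q b a1).
move: (comp_oper w p q (aff a b) (umono p n)) gE => g gE.
apply: fn_le; rewrite /A -!mulrA; apply: (C2P _ _ (fent g)).
  by rewrite !mulr_ge0 ?exprn_ge0 ?(ltW C'0) ?(ltW C0) ?(ltW k0).
move=> z; rewrite gE -[(_ \o _) z]/(umono p n (aff a b z)) umonoE normcM normcX.
have := C'P _ _ (ltW C0) (CP n) n z; rewrite eqxx => /le_trans; apply.
by rewrite /bump le_eqVlt; apply/orP; left; apply/eqP; ring.
Qed.

(** A cluster point would be 0 at every point, since evaluations are bounded, yet every [v n] has
    distance at least [c] from 0. *)
Lemma no_cluster q (v : nat -> fock w q) (K : set (fock w q)) (c : R) : 0 < c ->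
  (forall z (e : R), 0 < e -> exists N, forall n, (N <= n)%N -> normc (v n z) <= e) ->
  (forall n, c <= fn (v n)) -> (forall n, K (v n)) -> ~ precompact K.
Proof.
move=> c0 v0 vc vK [U KU [cU _]].
have [|g [_ gcl]] := cU (v @ \oo) _.
  by exists 0%N => // n _; exact: (KU _ (vK n)).
have cl N (d : R) : 0 < d -> exists2 n, (N <= n)%N & fn (g - v n) < d.
  move=> d0; have [_ [[n /= Nn <-] h]] := gcl (v @` [set n | (N <= n)%N]) [set h | fn (g - h) < d]
     ltac:(exists N => // n Nn; exists n => //) ((fock_nbhs g _).2 (ex_intro2 _ _ d d0 (fun _ h => h))).
  by exists n.
have g0 : g = 0.
  apply: fock_ext => z; apply: normc_small0 => e e0.
  have [C C0 CP] := fock_eval w q ltr01.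
  pose E := C * expR (w (normc z + 1)).
  have E0 : 0 < E by rewrite mulr_gt0// expR_gt0.
  have e20 : 0 < e / 2 by rewrite divr_gt0.
  have [N NP] := v0 z _ e20.
  have [n Nn h] := cl N _ (divr_gt0 e20 E0).
  have := CP (g - v n) z; rewrite -/E fockBE => H.
  rewrite -(subrK (v n z) (g z)); apply: le_trans (normc_triangle _ _) _.
  rewrite [leRHS]splitr; apply: lerD; last exact: NP.
  apply: le_trans H _; rewrite -ler_pdivlMl// mulrC.
  exact: ltW.
have [n _] := cl 0%N c c0; rewrite g0 sub0r fnN => h.
by have := lt_le_trans h (vc n); rewrite ltxx.
Qed.

(** If [f] has norm 1 and [g] has norm at most this, the quasi-triangle inequality for
    [f = (f - g) + g] forces [f - g] to have at least this norm. *)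
Definition far_const p : R := (2 * fock_const p)^-1.

Lemma far_const_gt0 p : 0 < far_const p.
Proof. by rewrite invr_gt0 mulr_gt0// fock_const_gt0. Qed.

Lemma quasi_aux (K x y : R) : 0 < K -> 1 <= K * Num.max x y -> y <= (2 * K)^-1 -> (2 * K)^-1 <= x.
Proof.
move=> K0 H yc; rewrite leNgt; apply/negP => xc.
have : K * Num.max x y <= K * (2 * K)^-1 by rewrite ler_wpM2l ?(ltW K0)// ge_max yc ltW.
rewrite (_ : K * (2 * K)^-1 = 2^-1); last by field; rewrite gt_eqF.
by move=> /(le_trans H); rewrite leNgt invf_lt1 ?ltr1n.
Qed.

Lemma rotation_far p a psi : normc a = 1 -> bounded_symbol w p p psi -> psi <> aff a 0 ->
  forall N, exists2 n, (N <= n)%N & far_const p <=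
    fn (comp_oper w p p (aff a 0) (umono p n) - comp_oper w p p psi (umono p n)).
Proof.
move=> a1 bs ne N.
have K0 := fock_const_gt0 p.
have K1 : 1 <= fock_const p.
  rewrite /fock_const; have : 1 <= 2 `^ p%:num^-1 :> R.
    have E1 : 1 = 1 `^ p%:num^-1 :> R by rewrite powR1.
    by rewrite {1}E1; apply: ge0_ler_powR; rewrite ?nnegrE ?ler1n.
  lra.
have c1 : far_const p <= 1 by rewrite /far_const invf_le1 ?mulr_gt0//; lra.
have ba := rotation_bounded p a1.
have [[b [d [E b1]]]|[b E b1]] := symbol_cases bs.
  have [M MP] := umono_contract p p d b1 (far_const_gt0 p).
  exists (maxn N M); first exact: leq_maxl.
  have {MP} := MP (maxn N M) (leq_maxr _ _); rewrite -E; move: (maxn N M) => n.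
  have := rotation_fn (umono p n) a1; rewrite fn_umono.
  move: (comp_oper w p p psi _) (comp_oper w p p (aff a 0) _) => g f.
  have := fn_quasi (f - g) g; rewrite subrK => + f1 gM; rewrite f1 => H.
  exact: quasi_aux K0 H gM.
have az : a != 0 by rewrite -normc_eq0 a1 oner_eq0.
have c1' : normc (b / a) = 1 by rewrite normcM normcV a1 b1 invr1 mulr1.
have cn1 : b / a != 1.
  apply/eqP => h; apply: ne; rewrite E; congr (aff _ 0).
  by rewrite -(divfK az b) h mul1r.
have [n Nn hn] := unit_pow_far c1' cn1 N.
exists n => //; apply: le_trans c1 _.
have -> : comp_oper w p p (aff a 0) (umono p n) - comp_oper w p p psi (umono p n) =
  (a ^+ n - b ^+ n) *: umono p n.
  have := comp_operE (umono p n) bs; have := comp_operE (umono p n) ba; rewrite E.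
  move: (comp_oper w p p (aff a 0) _) (comp_oper w p p (aff b 0) _) => f g fE gE.
  apply: fock_ext => z; rewrite -[(f - g) z]/(f z - g z) fE gE.
  change (umono p n (a * z + 0) - umono p n (b * z + 0) = (a ^+ n - b ^+ n) * umono p n z).
  by rewrite !addr0 !umonoE !exprMn; move: (_ %:C) => u; ring.
rewrite fnZ fn_umono mulr1 (_ : a ^+ n - b ^+ n = a ^+ n * (1 - (b / a) ^+ n)); last first.
  rewrite mulrBr mulr1 -exprMn mulrCA divff// mulr1//.
by rewrite normcM normcX a1 expr1n mul1r.
Qed.

End rotations.

(** * The space of composition operators *)

Opaque comp_oper opnorm fn.

Section components.
Context {R : realType} (w : weight R).
Implicit Types (p q : {posnum R}) (a b c : R[i]).

Lemma operBE p q (S T : oper w p q) f : (S - T) f = S f - T f.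
Proof. by []. Qed.

Lemma fn_operBE p q (S T : oper w p q) f : fn ((S - T) f) = fn (S f - T f).
Proof. by []. Qed.

Lemma fn_operB_sym p q (S T : oper w p q) f : fn ((S - T) f) = fn ((T - S) f).
Proof. by rewrite !fn_operBE fnB_sym. Qed.

Lemma comp_opersI p q psi : bounded_symbol w p q psi -> comp_opers w p q (comp_oper w p q psi).
Proof. by move=> bs; exact: (ex_intro2 _ _ psi bs erefl). Qed.

Lemma rotation_opnorm p a psi : normc a = 1 -> bounded_symbol w p p psi -> psi <> aff a 0 ->
  ((far_const p)%:E <= opnorm (comp_oper w p p (aff a 0) - comp_oper w p p psi)%R)%E.
Proof.
move=> a1 bs ne; have [n _ H] := rotation_far a1 bs ne 0%N.
have u1 : fn (umono w p n) <= 1 by rewrite fn_umono.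
by apply: le_trans (opnorm_ge _ u1); rewrite lee_fin operBE.
Qed.

Lemma umono_comp_pointwise p psi z (e : R) : bounded_symbol w p p psi -> 0 < e ->
  exists N, forall n, (N <= n)%N -> normc (comp_oper w p p psi (umono w p n) z) <= e.
Proof.
move=> bs e0; have [N NP] := umono_pointwise w p (psi z) e0.
by exists N => n /NP; rewrite (comp_operE _ bs).
Qed.

Lemma far_noncompact p (T : oper w p p) (c : R) : 0 < c ->
  (forall z (e : R), 0 < e -> exists N, forall n, (N <= n)%N -> normc (T (umono w p n) z) <= e) ->
  (forall N, exists2 n, (N <= n)%N & c <= fn (T (umono w p n))) -> ~ compact_oper T.
Proof.
move=> c0 Tz Tf.
have H N : exists n, (N <= n)%N /\ c <= fn (T (umono w p n)) by have [n ? ?] := Tf N; exists n.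
have [m mP] := choice H.
pose v k := T (umono w p (m k)).
apply: (@no_cluster _ w p v _ c c0).
- move=> z e e0; have [N NP] := Tz z e e0; exists N => k Nk; apply: NP.
  by apply: leq_trans Nk _; case: (mP k).
- by move=> k; case: (mP k).
- by move=> k; exists (umono w p (m k)) => //; rewrite /unit_ball/= fnE lee_fin fn_umono.
Qed.

Lemma rotation_noncompact p a : normc a = 1 -> ~ compact_oper (comp_oper w p p (aff a 0)).
Proof.
move=> a1; apply: (@far_noncompact p _ 1) => //.
  by move=> z e e0; apply: umono_comp_pointwise => //; exact: rotation_bounded.
by move=> N; exists N => //; rewrite rotation_fn// fn_umono.
Qed.

Lemma diff_noncompact p a psi : normc a = 1 -> bounded_symbol w p p psi -> psi <> aff a 0 ->
  ~ compact_oper (comp_oper w p p (aff a 0) - comp_oper w p p psi) /\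
  ~ compact_oper (comp_oper w p p psi - comp_oper w p p (aff a 0)).
Proof.
move=> a1 bs ne; have c0 := far_const_gt0 p.
have ba := rotation_bounded w p a1.
have pt psi1 psi2 z (e : R) : bounded_symbol w p p psi1 -> bounded_symbol w p p psi2 -> 0 < e ->
    exists N, forall n, (N <= n)%N ->
    normc ((comp_oper w p p psi1 - comp_oper w p p psi2) (umono w p n) z) <= e.
  move=> b1 b2 e0; have e20 : 0 < e / 2 by rewrite divr_gt0.
  have [N1 N1P] := umono_comp_pointwise z b1 e20.
  have [N2 N2P] := umono_comp_pointwise z b2 e20.
  exists (maxn N1 N2) => n; rewrite geq_max => /andP[n1 n2].
  rewrite operBE fockBE (splitr e); apply: le_trans (normcB_le _ _) _.
  by apply: lerD; [exact: N1P|exact: N2P].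
split; apply: (far_noncompact c0).
- by move=> z e; exact: pt.
- by move=> N; have [n Nn H] := rotation_far a1 bs ne N; exists n.
- by move=> z e; exact: pt.
- move=> N; have [n Nn H] := rotation_far a1 bs ne N; exists n; first exact: Nn.
  by rewrite fn_operB_sym fn_operBE; exact: H.
Qed.

Definition ray p q a b (t : R) : oper w p q := comp_oper w p q (aff (t%:C * a) (t%:C * b)).
Arguments ray : clear implicits.

Lemma scaled_contract a (t : R) : normc a < 1 -> 0 <= t <= 1 -> normc (t%:C * a) < 1.
Proof.
move=> a1 /andP[t0 t1]; rewrite normcM normc_real_ge0//; apply: le_lt_trans a1.
by rewrite ler_piMl ?normc_ge0.
Qed.

Lemma ray_lipschitz p q a b : normc a < 1 -> exists2 C : R, 0 < C &
  forall s t : R, 0 <= s <= 1 -> 0 <= t <= 1 ->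
  (opnorm (ray p q a b t - ray p q a b s)%R <= (C * `|t - s|)%:E)%E.
Proof.
move=> a1; have [C C0 CP] := affine_path_lipschitz w p q b a1.
exists C => // s t s01 t01.
apply: opnorm_le; first by rewrite mulr_ge0// ltW.
move=> f f1; have H := CP f s t s01 t01.
have := comp_operE f (aff_bounded w p q (t%:C * b) (scaled_contract a1 t01)).
have := comp_operE f (aff_bounded w p q (s%:C * b) (scaled_contract a1 s01)).
rewrite operBE /ray; move: (comp_oper w p q _ f) (comp_oper w p q _ f) => h g gE hE.
apply: (@le_trans _ _ (C * `|t - s| * fn f)); last first.
  by rewrite ler_piMr// mulr_ge0// ltW.
apply: fn_le; apply: le_trans H; rewrite /fnorm le_eqVlt; apply/orP; left; apply/eqP.
congr fock_norm; apply/funext => z; rewrite -[(h - g) z]/(h z - g z) hE gE /aff /=.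
by congr (f _ - f _); rewrite mulrDr mulrA.
Qed.

Lemma ray_continuous p q a b : normc a < 1 -> {within `[(0 : R), 1], continuous (ray p q a b)}.
Proof.
move=> a1; apply/subspace_continuousP => t /=; rewrite in_itv/= => t01 A /oper_nbhs[e e0 eA].
have [C C0 CP] := ray_lipschitz p q b a1.
have d0 : 0 < e / C by rewrite divr_gt0.
rewrite /within/=; apply/nbhs_ballP; exists (e / C) => // s ts.
rewrite in_itv/= => s01; apply: eA; apply: le_lt_trans (CP _ _ s01 t01) _.
by rewrite lte_fin -ltr_pdivlMl// mulrC.
Qed.

Definition contractions p q : set (oper w p q) :=
  [set comp_oper w p q (aff ab.1 ab.2) | ab in [set ab : R[i] * R[i] | normc ab.1 < 1]].
Arguments contractions : clear implicits.

Lemma ray0 p q a b : ray p q a b 0 = comp_oper w p q (aff 0 0).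
Proof. by rewrite /ray !mul0r. Qed.

Lemma ray1 p q a b : ray p q a b 1 = comp_oper w p q (aff a b).
Proof. by rewrite /ray !mul1r. Qed.

Lemma contractionsI p q a b : normc a < 1 -> contractions p q (comp_oper w p q (aff a b)).
Proof. by move=> a1; exact: (ex_intro2 _ _ (a, b) a1 erefl). Qed.

Lemma contractions_connected p q : connected (contractions p q).
Proof.
have -> : contractions p q = \bigcup_(ab in [set ab : R[i] * R[i] | normc ab.1 < 1])
    (ray p q ab.1 ab.2 @` `[(0 : R), 1]).
  apply/seteqP; split => [_ [ab ab1 <-]|_ [ab ab1 [t t01 <-]]].
    by exists ab => //; exists 1; rewrite ?ray1//= in_itv/= ler01 lexx.
  exists (t%:C * ab.1, t%:C * ab.2) => //=; apply: scaled_contract => //.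
apply: bigcup_connected; last first.
  move=> ab ab1; apply: connected_continuous_connected; first exact: segment_connected.
  exact: ray_continuous.
exists (comp_oper w p q (aff 0 0)) => ab _; exists 0; last exact: ray0.
by rewrite /= in_itv/= lexx ler01.
Qed.

Lemma contractions_sub p q : contractions p q `<=` comp_opers w p q.
Proof. by move=> _ [ab ab1 <-]; exists (aff ab.1 ab.2) => //; exact: aff_bounded. Qed.

Lemma zero_contraction p q : contractions p q (comp_oper w p q (aff 0 0)).
Proof. by exists (0, 0) => //; change (is_true (normc (0 : R[i]) < 1)); rewrite normc0 ltr01. Qed.

Lemma contractionsE p : contractions p p = [set K | comp_opers w p p K /\ compact_oper K].
Proof.
apply/seteqP; split => [_ [ab ab1 <-]|_ [[psi bs <-] cK]].
  by split; [exists (aff ab.1 ab.2) => //; exact: aff_bounded|exact: affine_compact].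
have [[a [b [E a1]]]|[a E a1]] := symbol_cases bs; first by exists (a, b); rewrite ?E.
by case: (rotation_noncompact a1 (p := p)); rewrite -E.
Qed.

Lemma rotation_isolated p a S : normc a = 1 -> comp_opers w p p S ->
  (opnorm (comp_oper w p p (aff a 0) - S)%R < (far_const p)%:E)%E -> S = comp_oper w p p (aff a 0).
Proof.
move=> a1 [psi bs <-] H; have [->//|/eqP ne] := pselect (psi = aff a 0).
have := rotation_opnorm a1 bs ltac:(by move/eqP: ne).
move=> H2; have := le_lt_trans H2 H => h; exfalso; move: h; rewrite ltxx.
by [].
Qed.

Lemma comp_oper_inj p psi1 psi2 : bounded_symbol w p p psi1 -> bounded_symbol w p p psi2 ->
  comp_oper w p p psi1 = comp_oper w p p psi2 -> psi1 = psi2.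
Proof.
move=> b1 b2 E; apply/funext => z.
have := comp_operE (mono w p 1) b1; have := comp_operE (mono w p 1) b2; rewrite E => -> /(congr1 (@^~ z)).
by rewrite /= !expr1.
Qed.

Lemma contraction_not_isolated p a b : normc a < 1 ->
  ~ isolated (comp_opers w p p) (comp_oper w p p (aff a b)).
Proof.
move=> a1 [_ [V VC VE]].
suff [S [CS VS nS]] : exists S, [/\ comp_opers w p p S, V S & S <> comp_oper w p p (aff a b)].
  by have : [set comp_oper w p p (aff a b)] S by rewrite -VE.
have [e e0 eV] := (oper_nbhs _ _).1 VC.
(* The ray of the constant symbol 0 is stationary, so small nonzero constants are used next to it.
   Any other symbol is scaled down slightly along its ray. *)
have [[a0 b0]|nz] := pselect (a = 0 /\ b = 0).
  have n01 : normc (0 : R[i]) < 1 by rewrite normc0.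
  have [C C0 CP] := ray_lipschitz p p 1 n01.
  pose t := Num.min 1 (e / (2 * C)).
  have t0 : 0 < t by rewrite lt_min ltr01 divr_gt0// mulr_gt0.
  have t1 : 0 <= t <= 1 by rewrite (ltW t0) ge_min lexx.
  have bt : bounded_symbol w p p (aff (t%:C * 0) (t%:C * 1)) by apply: aff_bounded; rewrite mulr0.
  exists (ray p p 0 1 t); split.
  - by exists (aff (t%:C * 0) (t%:C * 1)).
  - apply: eV; rewrite a0 b0 -(ray0 p p 0 1).
    have h01 : 0 <= (0 : R) <= 1 by rewrite lexx ler01.
    apply: le_lt_trans (CP _ _ t1 h01) _; rewrite lte_fin sub0r normrN gtr0_norm//.
    rewrite -ltr_pdivlMl//; apply: (@le_lt_trans _ _ (e / (2 * C))); first by rewrite ge_min lexx orbT.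
    by rewrite invfM mulrA mulrC ltr_pM2l ?invr_gt0// ltr_pdivrMr// ltr_pMr// ltr1n.
  - move=> /(comp_oper_inj bt (aff_bounded w p p b a1))/(congr1 (@^~ 0)).
    rewrite /aff a0 b0 !mulr0 !add0r mulr1 => /eqP.
    by rewrite -normc_eq0 normc_real_ge0 ?(ltW t0)// gt_eqF.
have [C C0 CP] := ray_lipschitz p p b a1.
pose d := Num.min 1 (e / (2 * C)).
have d0 : 0 < d by rewrite lt_min ltr01 divr_gt0// mulr_gt0.
have d1 : d <= 1 by rewrite ge_min lexx.
have t1 : 0 <= 1 - d <= 1 by rewrite subr_ge0 d1 gerBl ltW.
have bt := aff_bounded w p p ((1 - d)%:C * b) (scaled_contract a1 t1).
exists (ray p p a b (1 - d)); split.
- by exists (aff ((1 - d)%:C * a) ((1 - d)%:C * b)).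
- apply: eV; rewrite -(ray1 p p a b).
  have h01 : 0 <= (1 : R) <= 1 by rewrite lexx ler01.
  apply: le_lt_trans (CP _ _ t1 h01) _; rewrite lte_fin opprB addrCA subrr addr0 gtr0_norm//.
  rewrite -ltr_pdivlMl//; apply: (@le_lt_trans _ _ (e / (2 * C))); first by rewrite ge_min lexx orbT.
  by rewrite invfM mulrA mulrC ltr_pM2l ?invr_gt0// ltr_pdivrMr// ltr_pMr// ltr1n.
move=> /(comp_oper_inj bt (aff_bounded w p p b a1)) E; apply: nz.
have dC : d%:C != 0 by rewrite -normc_eq0 normc_real_ge0 ?(ltW d0)// gt_eqF.
have Z z : a * z + b = 0.
  have := congr1 (@^~ z) E; rewrite /aff rmorphB rmorph1 => h.
  have : d%:C * (a * z + b) = 0.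
    by rewrite -(subrr (a * z + b)) -{3}h; ring.
  by move/eqP; rewrite mulf_eq0 (negbTE dC)/= => /eqP.
have b0 : b = 0 by have := Z 0; rewrite mulr0 add0r.
by split => //; have := Z 1; rewrite mulr1 b0 addr0.
Qed.

Lemma isolated_iff p psi : bounded_symbol w p p psi ->
  isolated (comp_opers w p p) (comp_oper w p p psi) <-> ~ compact_oper (comp_oper w p p psi).
Proof.
move=> bs; have [[a [b [-> a1]]]|[a -> a1]] := symbol_cases bs.
  split => [/contraction_not_isolated|] h; first by case: (h a1).
  by case: h; exact: affine_compact.
split => [_|_]; first exact: rotation_noncompact.
have CA : comp_opers w p p (comp_oper w p p (aff a 0)).
  exact: comp_opersI (rotation_bounded w p a1).
split; first exact/mem_set.
exists [set S | (opnorm (comp_oper w p p (aff a 0) - S)%R < (far_const p)%:E)%E].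
  by apply/oper_nbhs; exists (far_const p) => //; exact: far_const_gt0.
apply/seteqP; split => [S [/= h CS]|S /= ->]; first exact: rotation_isolated.
by split => //; rewrite subrr opnorm0 lte_fin far_const_gt0.
Qed.

(** A connected set that contains a rotation consists of it alone, because [rotation_isolated] makes
    the singleton open and closed in the set. Hence a connected set through the constant symbol 0
    contains contractions only. *)
Lemma compact_component p :
  connected_component (comp_opers w p p) (comp_oper w p p (aff 0 0)) =
  [set K | comp_opers w p p K /\ compact_oper K].
Proof.
rewrite -contractionsE; apply/seteqP; split; last first.
  apply: connected_component_max; [exact: zero_contraction|exact: contractions_sub|].
  exact: contractions_connected.
move=> S [A [A0 AC cA] AS]; have CS := AC _ AS.
have [psi bs ES] := CS; have [[a [b [E a1]]]|[a E a1]] := symbol_cases bs.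
  by rewrite -ES E; exact: contractionsI.
have far T : A T -> (opnorm (S - T)%R < (far_const p)%:E)%E -> T = S.
  by move=> AT; rewrite -ES E; apply: rotation_isolated => //; exact: AC.
have c0 := far_const_gt0 p.
pose U := [set T | (opnorm (S - T)%R < (far_const p)%:E)%E].
have nU : nbhs S U by apply/oper_nbhs; exists (far_const p).
have : [set S] = A.
  apply: cA; first by exists S.
    exists (interior U); first exact: open_interior.
    apply/seteqP; split => [_ ->|T [AT /interior_subset]]; last by move=> /far; exact.
    by split => //; exact: nU.
  exists (closure [set S]); first exact: closed_closure.
  apply/seteqP; split => [_ ->|T [AT cT]]; first by split => //; exact: subset_closure.
  apply: far => //; have nT : nbhs T [set X | (opnorm (T - X)%R < (far_const p)%:E)%E].
    by apply/oper_nbhs; exists (far_const p).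
  by have [_ [-> /=]] := cT _ nT; rewrite -opnormN opprB.
move=> SA; have S0 : [set S] (comp_oper w p p (aff 0 0)) by rewrite SA.
by rewrite -S0; exact: zero_contraction.
Qed.

Lemma psum_comp_diff_near q a1 b1 a2 b2 N x (e : R) : normc a1 < 1 -> normc a2 < 1 ->
  tame_set w N x -> 0 < e -> \forall y \near x, tame_set w N y ->
  fn ((psum_comp w a1 b1 q y - psum_comp w a2 b2 q y) - (psum_comp w a1 b1 q x - psum_comp w a2 b2 q x)) < e.
Proof.
move=> h1 h2 Nx e0.
have K0 := fock_const_gt0 q; have d0 : 0 < e / fock_const q by rewrite divr_gt0.
have n1 := psum_comp_near b1 q h1 Nx d0; have n2 := psum_comp_near b2 q h2 Nx d0.
apply: (filterS _ (filterI n1 n2)) => y [H1 H2] Ny.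
move: (H1 Ny) (H2 Ny) => {H1 H2}; move: (psum_comp w a1 b1 q y) (psum_comp w a1 b1 q x).
move: (psum_comp w a2 b2 q y) (psum_comp w a2 b2 q x) => g g' f f'.
rewrite -(fnN (g - g')) => H1 H2; rewrite (_ : _ - _ = (f - f') + - (g - g')); last first.
  by rewrite !opprB addrACA [RHS]addrACA; congr (_ + _); rewrite addrC.
apply: le_lt_trans (fn_quasi _ _) _; move: H1 H2 K0.
move: (fn _) (fn _) (fock_const q) => u v k uk vk k0.
by rewrite -ltr_pdivlMl// mulrC gt_max uk vk.
Qed.

(** Both operators act on the same coefficient sequences, so the difference again factors through
    the compact set [tame_set]. *)
Lemma psum_comp_diff_compact p q a1 b1 a2 b2 : normc a1 < 1 -> normc a2 < 1 ->
  compact_oper (comp_oper w p q (aff a1 b1) - comp_oper w p q (aff a2 b2)).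
Proof.
move=> h1 h2; have [N N0 NP] := tame_ball w p.
pose F x := psum_comp w a1 b1 q x - psum_comp w a2 b2 q x.
exists (F @` tame_set w N).
  move=> _ [f f1 <-]; move: f1; rewrite /unit_ball/= fnE lee_fin => f1.
  exists (to_coefs (coef f)); first exact: NP.
  by rewrite /F operBE /aff !comp_oper_psum.
have K : compact (F @` tame_set w N).
  apply: continuous_compact; last exact: compact_tame.
  apply/subspace_continuousP => x Nx A /fock_nbhs[e e0 eA].
  change (nbhs x (fun y => tame_set w N y -> A (F y))).
  apply: (filterS _ (psum_comp_diff_near q b1 b2 h1 h2 Nx e0)) => y H Ny; apply: eA.
  by rewrite fnB_sym; exact: H.
split => //; apply: compact_closed => //; exact: fock_hausdorff.
Qed.

Lemma compact_diff_iff p psi1 psi2 : bounded_symbol w p p psi1 -> bounded_symbol w p p psi2 ->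
  psi1 <> psi2 ->
  compact_oper (comp_oper w p p psi1 - comp_oper w p p psi2) <->
  compact_oper (comp_oper w p p psi1) /\ compact_oper (comp_oper w p p psi2).
Proof.
move=> b1 b2 ne.
have [[a [b [E1 a1]]]|[a E1 a1]] := symbol_cases b1; last first.
  split => [h|[h _]]; exfalso; last by apply: (rotation_noncompact a1 (p := p)); rewrite -E1.
  have ne' : psi2 <> aff a 0 by rewrite -E1 => /esym.
  by have [H _] := diff_noncompact a1 b2 ne'; apply: H; rewrite -E1.
have [[a' [b' [E2 a'1]]]|[a' E2 a'1]] := symbol_cases b2; last first.
  split => [h|[_ h]]; exfalso; last by apply: (rotation_noncompact a'1 (p := p)); rewrite -E2.
  have ne' : psi1 <> aff a' 0 by rewrite -E2.
  by have [_ H] := diff_noncompact a'1 b1 ne'; apply: H; rewrite -E2.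
rewrite E1 E2; split => _; first by split; exact: affine_compact.
exact: psum_comp_diff_compact.
Qed.

End components.

Arguments contractions {R} w p q _.

(** * Spaces with different exponents *)

Section gap.
Context {R : realType} (w : weight R).
Implicit Types (x y r B : R).

(* The height of the convex function [w] of [ln x] above its tangent at [ln r]; if
   [wD w r = n], then [expR (- gap r (normc z))] is [normc (z ^+ n) * expR (- w (normc z))]
   divided by its maximum. *)
Definition gap r x : R := w x - w r - wD w r * (ln x - ln r).

Lemma gap0 r : gap r r = 0.
Proof. by rewrite /gap !subrr mulr0 subr0. Qed.

(** The factor after [B * r] is the height of [y], as a convex function of [ln y], above its tangent
    at [ln r]. The inequality pays for the exponential in [spike_fun] as long as [la] is at most
    [B * r / 2]. *)
Lemma gap_log B : 0 < B -> exists2 r0, 1 <= r0 & forall r y, r0 <= r -> 0 < y ->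
  B * r * (y - r - r * (ln y - ln r)) <= gap r y.
Proof.
move=> B0; have [r r1 rP] := wD_growth w (8 * B); exists (2 * r); first by lra.
move=> x y rx y0; have x0 : 0 < x by lra.
have S1 s : x <= s -> B * x * (s - x) <= wD w s - wD w x.
  move=> xs; have rx' : r <= x by lra.
  have := rP x s rx' xs; have : 0 <= B * (s * (s - x)) by rewrite !mulr_ge0 ?subr_ge0 ?(ltW B0)//; lra.
  have : 0 <= B * (x * (s - x)) by rewrite !mulr_ge0 ?subr_ge0 ?(ltW B0)//; lra.
  nra.
have S2 s : 0 < s -> s <= x -> B * x * (x - s) <= wD w x - wD w s.
  move=> s0 sx; have h : 0 <= B * (s * (x - s)) by rewrite !mulr_ge0 ?subr_ge0 ?(ltW B0) ?(ltW s0).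
  have h' : 0 <= B * (x * (x - s)) by rewrite !mulr_ge0 ?subr_ge0 ?(ltW B0) ?(ltW x0).
  have [rs|/ltW sr] := leP r s; first by have := rP s x rs sx; nra.
  have rx' : r <= x by lra.
  have := rP r x (lexx r) rx'; have := wD_ndecr w s0 sr.
  have h2 : 4 * r ^+ 2 <= x ^+ 2 by nra.
  have h3 : 0 <= B * (x ^+ 2 - 4 * r ^+ 2) by rewrite mulr_ge0 ?subr_ge0 ?(ltW B0).
  have h4 : 0 <= B * (x * s) by rewrite !mulr_ge0 ?(ltW B0) ?(ltW x0) ?(ltW s0).
  have h5 : 0 <= B * x ^+ 2 by rewrite mulr_ge0 ?(ltW B0) ?sqr_ge0.
  move: h3 h4 h5; rewrite !expr2; nra.
pose h (s : R) := w s - wD w x * ln s - B * x * (s - x * ln s).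
have dh (s : R) : 0 < s -> is_derive s 1 h ((wD w s - wD w x - B * x * (s - x)) / s).
  move=> s0.
  have d1 := is_deriveB (wD_derive w s0) (is_deriveM (is_derive_cst (wD w x) s 1) (is_derive1_ln s0)).
  have d2 := is_deriveB (is_derive_id s 1) (is_deriveM (is_derive_cst x s 1) (is_derive1_ln s0)).
  have := is_deriveB d1 (is_deriveM (is_derive_cst (B * x) s 1) d2).
  move=> H; apply: is_derive_eq H _.
  rewrite /cst /GRing.scale/= !mulr0 !addr0; field; rewrite gt_eqF//.
have : h x <= h y.
  rewrite -subr_ge0; have [xy|/ltW yx] := leP x y.
    have [c /andP[xc cy] ->] := MVT_pos dh x0 xy.
    rewrite mulr_ge0 ?subr_ge0// divr_ge0 ?subr_ge0 ?S1//.
    exact: le_trans (ltW x0) xc.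
  have [c /andP[yc cx] E] := MVT_pos dh y0 yx.
  have c0 := lt_le_trans y0 yc.
  rewrite -oppr_le0 opprB E mulr_le0_ge0 ?subr_ge0//.
  rewrite mulr_le0_ge0 ?invr_ge0 ?(ltW c0)//.
  have := S2 c c0 cx; lra.
rewrite /h /gap; move: (ln y) (ln x) (w y) (w x) (wD w x) => a b c d e.
move=> H; rewrite -subr_ge0; move: H; rewrite -subr_ge0; congr (_ <= _); ring.
Qed.

Lemma weight_log_convex x y k : 0 < x -> x <= y -> 1 <= k ->
  w (k * x) - w x <= w (k * y) - w y.
Proof.
move=> x0 xy k1; have k0 : 0 < k by lra.
pose h (s : R) := w (k * s) - w s.
have dh (s : R) : 0 < s -> is_derive s 1 h ((wD w (k * s) - wD w s) / s).
  move=> s0; have ks0 : 0 < k * s by rewrite mulr_gt0.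
  have d0 := is_deriveM (is_derive_cst k s 1) (is_derive_id s 1).
  have d1 := is_derive1_comp (wD_derive w ks0) d0.
  have := is_deriveB d1 (wD_derive w s0).
  move=> H; apply: is_derive_eq H _.
  by rewrite /cst /GRing.scale/= mulr0 addr0; field; rewrite !gt_eqF.
have [c /andP[xc cy]] := MVT_pos dh x0 xy.
have c0 := lt_le_trans x0 xc.
rewrite -subr_ge0 /h => ->; rewrite mulr_ge0 ?subr_ge0// divr_ge0 ?(ltW c0)// subr_ge0.
by apply: wD_ndecr; rewrite // ler_peMl// ltW.
Qed.

(** Superadditivity of a convex function that vanishes with its derivative at [ln r]: dilating
    beyond [r] adds at least the height gained from [r] to [k * r]. *)
Lemma gap_shift_up r x k : 0 < r -> r <= x -> 1 <= k -> gap r x + gap r (k * r) <= gap r (k * x).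
Proof.
move=> r0 rx k1; have x0 := lt_le_trans r0 rx; have k0 : 0 < k by lra.
have := weight_log_convex r0 rx k1.
by rewrite /gap !lnM ?posrE//; move: (ln k) (ln r) (ln x) (wD w r) => *; lra.
Qed.

Lemma gap_shift_down r x k : 0 < r -> 0 < x -> x <= r -> 0 < k -> k <= 1 ->
  gap r x + gap r (k * r) <= gap r (k * x).
Proof.
move=> r0 x0 xr k0 k1; have kx0 : 0 < k * x by rewrite mulr_gt0.
have kr : k * x <= k * r by rewrite ler_pM2l.
have ki : 1 <= k^-1 by rewrite invf_ge1.
have := weight_log_convex kx0 kr ki; rewrite !mulKf ?gt_eqF//.
by rewrite /gap !lnM ?posrE//; move: (ln k) (ln r) (ln x) (wD w r) => *; lra.
Qed.

Lemma gap_up r x y : 0 < r -> r <= x -> x <= y -> gap r x <= gap r y.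
Proof.
move=> r0 rx xy; have x0 := lt_le_trans r0 rx.
have [c /andP[xc cy]] := gap_MVT w (wD w r) x0 xy; have c0 := lt_le_trans x0 xc.
have : 0 <= (wD w c - wD w r) / c * (y - x).
  by rewrite mulr_ge0 ?subr_ge0// divr_ge0 ?(ltW c0)// subr_ge0 wD_ndecr// (le_trans rx).
by move=> /[swap] <-; rewrite /gap; move: (ln x) (ln y) (ln r) => *; lra.
Qed.

Lemma gap_down r x y : 0 < x -> x <= y -> y <= r -> gap r y <= gap r x.
Proof.
move=> x0 xy yr.
have [c /andP[xc cy]] := gap_MVT w (wD w r) x0 xy; have c0 := lt_le_trans x0 xc.
have : (wD w c - wD w r) / c * (y - x) <= 0.
  rewrite mulr_le0_ge0 ?subr_ge0// mulr_le0_ge0 ?invr_ge0 ?(ltW c0)//.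
  by rewrite subr_le0 wD_ndecr// (le_trans cy).
by move=> /[swap] <-; rewrite /gap; move: (ln x) (ln y) (ln r) => *; lra.
Qed.

Lemma gap_ge0 r x : 0 < r -> 0 < x -> 0 <= gap r x.
Proof.
move=> r0 x0; rewrite -(gap0 r); have [rx|/ltW xr] := leP r x; first exact: gap_up.
exact: gap_down.
Qed.

Lemma gap_cont r x : 0 < x -> {for x, continuous (gap r)}.
Proof.
move=> x0; apply: cvgB.
  by apply: cvgB; [exact: is_derive_cont (wD_derive w x0)|exact: cvg_cst].
apply: cvgM; first exact: cvg_cst.
by apply: cvgB; [exact: continuous_ln|exact: cvg_cst].
Qed.

Lemma gap_IVT r x y L : 0 < x -> x <= y -> 0 < r ->
  Num.min (gap r x) (gap r y) <= L <= Num.max (gap r x) (gap r y) ->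
  exists2 c, x <= c <= y & gap r c = L.
Proof.
move=> x0 xy r0 H; have [|c] := @IVT _ (gap r) x y L xy _ H.
  apply: continuous_in_subspaceT => s; rewrite inE/= in_itv/= => /andP[xs _].
  by apply: gap_cont; exact: lt_le_trans xs.
by rewrite in_itv/= => xc E; exists c.
Qed.

End gap.

(** * Exponentials on circles *)

Section doubling.
Context {R : realType}.
Local Notation mu := (@lebesgue_measure R).
Local Notation MR := (measurableTypeR R).
Local Notation plane := (MR * MR)%type.
Local Notation pi2 := (2 * pi : R).
Implicit Types (f : R -> R).

Lemma rint_affine f (k s a b : R) : 0 < k -> continuous f -> (forall t, 0 <= f t) ->
  rint a b (fun t => f (k * t + s)) = k^-1 * rint (k * a + s) (k * b + s) f.
Proof.
move=> k0 cof f0; rewrite /rint /Rintegral.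
pose g : MR -> \bar R := (EFin \o f) \_ (`[k * a + s, k * b + s]%classic : set MR).
have mg : measurable_fun setT g.
  apply/(measurable_restrictT _ _).1 => //; apply/measurable_EFinP.
  exact: measurable_funTS (continuous_measurable_fun cof).
have g0 t : (0 <= g t)%E by rewrite /g patchE; case: ifPn => // _; rewrite lee_fin.
have := @ge0_integral_affine R k s g k0 mg g0.
move=> H; have Eg : (\int[mu]_x g x = \int[mu]_(x in `[(k * a + s)%R, (k * b + s)%R]) (f x)%:E)%E.
  by rewrite [RHS]integral_mkcond.
have -> : (\int[mu]_(x in `[a, b]) (f (k * x + s))%:E = \int[mu]_x g (k * x + s)%R)%E.
  rewrite integral_mkcond; apply: eq_integral => t _; rewrite /g !patchE.
  rewrite !mem_setE !in_itv/= !lerD2r !ler_pM2l//.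
rewrite H Eg fineM//; apply: integrable_fin_num; first exact: measurable_itv.
exact: cont_integrable.
Qed.

Lemma rint_period_aux f (a b : R) : continuous f -> (forall t, 0 <= f t) -> (forall t, f (t + pi2) = f t) ->
  a <= b -> b <= a + pi2 -> rint a (a + pi2) f = rint b (b + pi2) f.
Proof.
move=> cof f0 fp ab ba.
rewrite (rint_split ab ba cof) (@rint_split _ b (b + pi2) (a + pi2)) ?lerD2r// addrC.
congr (_ + _); rewrite -(@eq_rint _ a b (fun t => f (1 * t + pi2))).
  by rewrite rint_affine// invr1 !mul1r.
by move=> t _; rewrite mul1r fp.
Qed.

Lemma rint_period f (s : R) : continuous f -> (forall t, 0 <= f t) -> (forall t, f (t + pi2) = f t) ->
  0 <= s <= pi2 -> rint 0 pi2 (fun t => f (t + s)) = rint (- pi) pi f.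
Proof.
move=> cof f0 fp /andP[s0 s2].
rewrite (@eq_rint _ 0 pi2 _ (fun t => f (1 * t + s))); last by move=> t _; rewrite mul1r.
rewrite rint_affine// invr1 !mul1r add0r [pi2 + s]addrC.
have pi0 := pi_gt0 R; have p2E : - pi + pi2 = pi by lra.
rewrite -(@rint_period_aux f 0 s) ?add0r//.
have := @rint_period_aux f (- pi) 0 cof f0 fp; rewrite p2E add0r => -> //; lra.
Qed.

(** For [y >= 0] the modulus of [cexp (y%:C * cis t)], divided by its maximum over [t]. *)
Definition circ (y t : R) : R := expR (- y * (1 - cos t)).

Lemma circ_cont y : continuous (circ y).
Proof.
move=> t; apply: continuous_comp; last exact: continuous_expR.
apply: cvgM; first exact: cvg_cst.
by apply: cvgB; [exact: cvg_cst|exact: continuous_cos].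
Qed.

Lemma circ_ge0 y t : 0 <= circ y t. Proof. exact: expR_ge0. Qed.

(** With [u = t / 2] one has [1 - cos t = 2 * (1 - cos u) * (1 + cos u) >= 2 * (1 - cos u)], so
    halving the angle compares the two integrands, and the substitution costs the factor 2. *)
Lemma circ_doubling y : 0 <= y -> rint (- pi) pi (circ y) <= 2 * rint (- pi) pi (circ (2 * y)).
Proof.
move=> y0; have pi0 := pi_gt0 R.
have c2 : continuous (fun t : R => circ (2 * y) (2^-1 * t + 0)).
  move=> t; apply: (@continuous_comp _ _ _ (fun t : R => 2^-1 * t + 0) (circ (2 * y))); last exact: circ_cont.
  by apply: cvgD; [apply: cvgM; [exact: cvg_cst|exact: cvg_id]|exact: cvg_cst].
apply: (@le_trans _ _ (rint (- pi) pi (fun t => circ (2 * y) (2^-1 * t + 0)))).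
  apply: rint_le => //; first exact: circ_cont.
  move=> t /andP[t1 t2]; rewrite ler_expR !mulNr lerN2 -mulrA mulrCA ler_wpM2l//.
  set u := 2^-1 * t + 0; have -> : t = u *+ 2 by rewrite /u addr0 -mulr_natr; field.
  rewrite cos_mulr2n; have u1 : 0 <= cos u.
    apply: cos_ge0_pihalf; rewrite /u addr0; apply/andP; split; lra.
  have u2 := cos_le1 u.
  by rewrite -mulr_natr; nra.
rewrite (rint_affine _ _ _ _ (@circ_cont _) (circ_ge0 _)) ?invr_gt0//.
rewrite invrK ler_wpM2l// !addr0.
have h1 : - pi <= 2^-1 * - pi :> R by lra.
have h2 : 2^-1 * - pi <= 2^-1 * pi :> R by lra.
have h3 : 2^-1 * pi <= pi :> R by lra.
rewrite (rint_split h1 (le_trans h2 h3) (@circ_cont _)) (rint_split h2 h3 (@circ_cont _)).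
have nn a b : a <= b -> 0 <= rint a b (circ (2 * y)).
  by move=> ab; apply: rint_ge0 => t _; exact: circ_ge0.
by have := nn _ _ h1; have := nn _ _ h3; lra.
Qed.

End doubling.

Section angular.
Context {R : realType}.
Local Notation mu := (@lebesgue_measure R).
Local Notation MR := (measurableTypeR R).
Local Notation plane := (MR * MR)%type.
Local Notation pi2 := (2 * pi : R).
Implicit Types (g : R -> R) (c x : R).

(** Zero exactly on the nonnegative half-line. For [x >= 0], [expR (- x * tilt z)] is the modulus of
    [cexp (x%:C * z)] divided by its maximum on the circle through [z]. *)
Definition tilt (z : R[i]) : R := normc z - complex.Re z.

Lemma tilt_ge0 z : 0 <= tilt z.
Proof. by rewrite subr_ge0; apply: le_trans (ler_norm _) (normc_Re z). Qed.

Definition ang g (x : R) (z : R[i]) : \bar R := (g (normc z) * expR (- x * tilt z))%:E.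

Definition angI g (x : R) : \bar R := (\int[area]_z ang g x (cpl z))%E.

Definition nice g := measurable_fun [set: MR] (g : MR -> MR) /\ forall y, 0 <= g y.

Lemma measurable_ang g x : nice g -> measurable_fun [set: plane] (ang g x \o cpl).
Proof.
move=> [mg _]; apply/measurable_EFinP; apply: measurable_funM; first exact: measurable_radial.
apply: (measurableT_comp (@measurable_expR R)); apply: measurable_funM => //.
by apply: measurable_funB; [exact: measurable_normc|exact: measurable_fst].
Qed.

Lemma ang_ge0 g x z : nice g -> (0 <= ang g x z)%E.
Proof. by move=> [_ g0]; rewrite lee_fin mulr_ge0 ?expR_ge0. Qed.

Lemma angI_ge0 g x : nice g -> (0 <= angI g x)%E.
Proof. by move=> ng; apply: integral_ge0 => z _; exact: ang_ge0. Qed.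

Lemma angI_le g g' x x' : nice g -> nice g' -> (forall y, 0 <= y -> g y <= g' y) -> x' <= x ->
  (angI g x <= angI g' x')%E.
Proof.
move=> ng ng' gg xx; apply: ge0_le_integral => //.
- by move=> z _; exact: ang_ge0.
- exact: (measurable_ang x ng).
- exact: (measurable_ang x' ng').
move=> z _; rewrite lee_fin; apply: ler_pM; rewrite ?expR_ge0//; first by case: ng.
  by apply: gg; exact: normc_ge0.
by rewrite ler_expR !mulNr lerN2 ler_wpM2r// tilt_ge0.
Qed.

Lemma angI_add g g' x : nice g -> nice g' ->
  (angI (fun y => g y + g' y)%R x = angI g x + angI g' x)%E.
Proof.
move=> ng ng'; rewrite /angI -ge0_integralD//.
- by apply: eq_integral => z _; rewrite /ang -EFinD mulrDl.
- by move=> z _; exact: ang_ge0.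
- exact: (measurable_ang x ng).
- by move=> z _; exact: ang_ge0.
- exact: (measurable_ang x ng').
Qed.

Lemma niceZ c g : 0 <= c -> nice g -> nice (fun y => c * g y).
Proof.
move=> c0 [mg g0]; split => [|y]; last exact: mulr_ge0.
exact: measurable_funM.
Qed.

Lemma angI_scale c g x : 0 <= c -> nice g -> (angI (fun y => c * g y)%R x = c%:E * angI g x)%E.
Proof.
move=> c0 ng; rewrite /angI -ge0_integralZl//.
- by apply: eq_integral => z _; rewrite /ang -EFinM mulrA.
- exact: (measurable_ang x ng).
- by move=> z _; exact: ang_ge0.
Qed.

Lemma tilt_scale (k : R) z : 0 <= k -> tilt (k%:C * z) = k * tilt z.
Proof.
by move=> k0; rewrite /tilt normcM normc_real_ge0//; case: z => u v; rewrite /= mul0r subr0 mulrBr.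
Qed.

Lemma nice_comp (k : R) g : nice g -> nice (fun y => g (k * y)).
Proof.
move=> [mg g0]; split => [|y]; last exact: g0.
by apply: (measurableT_comp mg); apply: measurable_funM.
Qed.

Lemma angI_dilate (k : R) g x : 0 < k -> nice g ->
  (angI g x = (k ^+ 2)%:E * angI (fun y => g (k * y)%R) (k * x)%R)%E.
Proof.
move=> k0 ng; have := @ge0_area_affine R k 0 (ang g x) k0 (measurable_ang x ng) (fun z => ang_ge0 x z ng).
have -> : (fun z : plane => ang g x (k%:C * cpl z + 0)) = fun z : plane => ang (fun y => g (k * y)) (k * x) (cpl z).
  apply/funext => z; rewrite /ang addr0 tilt_scale ?(ltW k0)// normcM normc_real_ge0 ?(ltW k0)//.
  by congr (_ * expR _)%:E; ring.
by rewrite /angI => ->; rewrite muleA -EFinM exprVn mulfV ?mul1e// gt_eqF// exprn_gt0.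
Qed.

Lemma cisD (s t : R) : cis s * cis t = cis (s + t).
Proof. by rewrite /cis -cexpD; congr cexp; rewrite -[RHS](addr0 (0 +i* (s + t))) addr0; congr (_ +i* _); rewrite addr0. Qed.

Lemma ang_circle g x z : nice g -> 0 <= x -> exists s : R, 0 <= s <= pi2 /\
  (\int[mu]_(t in `[0%R, pi2]) ang g x (cis t * cpl z)%R =
   (g (normc (cpl z)) * rint 0 pi2 (fun t => circ (x * normc (cpl z)) (t + s)))%:E)%E.
Proof.
move=> [mg g0] x0; have [s s02 E] := polar_exists (cpl z); exists s; split => //.
move: E; move: (cpl z) => u; set rho := normc u => E.
have cc : continuous (fun t : R => circ (x * rho) (t + s)).
  move=> t; apply: (@continuous_comp _ _ _ (fun t : R => t + s) (circ (x * rho))); last exact: circ_cont.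
  by apply: cvgD; [exact: cvg_id|exact: cvg_cst].
have -> : (fun t : MR => ang g x (cis t * u)) = fun t : MR => ((g rho)%:E * (circ (x * rho) (t + s))%:E)%E.
  apply/funext => t; rewrite -EFinM /ang normcM normc_cis mul1r -/rho /circ; congr (_ * expR _)%:E.
  rewrite /tilt normcM normc_cis mul1r -/rho {1}E mulrCA cisD cisE /=.
  by ring.
rewrite ge0_integralZl//; last 3 first.
- apply/measurable_EFinP; exact: measurable_funTS (continuous_measurable_fun cc).
- by move=> t _; rewrite lee_fin circ_ge0.
- by rewrite lee_fin.
rewrite EFinM; congr (_ * _)%E; rewrite /rint /Rintegral fineK//.
apply: integrable_fin_num; first exact: measurable_itv.
exact: cont_integrable.
Qed.

Lemma circ_period y t : circ y (t + pi2) = circ y t.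
Proof. by rewrite /circ (_ : t + pi2 = t + pi *+ 2) ?cosD2pi// mulr_natl. Qed.

(** [circ_doubling] on every circle, integrated by [rotation_average]. It makes angular integrals
    with different exponents comparable. *)
Lemma angI_double g x : nice g -> 0 <= x -> (angI g x <= 2%:E * angI g (2 * x)%R)%E.
Proof.
move=> ng x0.
have pi0 : 0 < pi2 by rewrite mulr_gt0// pi_gt0.
have x20 : 0 <= 2 * x by rewrite mulr_ge0.
have ra y := rotation_average (measurable_ang y ng) (fun z => ang_ge0 y z ng).
rewrite -(@lee_pmul2l _ pi2%:E)// muleCA -!ra -ge0_integralZl//; last 2 first.
- exact: measurable_rotation_average (measurable_ang _ ng) (fun z => ang_ge0 _ z ng).
- by move=> z _; apply: integral_ge0 => t _; exact: ang_ge0.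
apply: ge0_le_integral => //.
- by move=> z _; apply: integral_ge0 => t _; exact: ang_ge0.
- exact: measurable_rotation_average (measurable_ang _ ng) (fun z => ang_ge0 _ z ng).
- by apply: measurable_funeM; exact: measurable_rotation_average (measurable_ang _ ng) (fun z => ang_ge0 _ z ng).
move=> z _.
have [s [s02 ->]] := ang_circle z ng x0; have [s' [s'02 ->]] := ang_circle z ng x20.
rewrite -EFinM lee_fin mulrCA ler_wpM2l//; first by case: ng.
rewrite !rint_period//; try (by move=> t; exact: circ_period); try exact: circ_cont; try exact: circ_ge0.
rewrite -mulrA; apply: circ_doubling; rewrite mulr_ge0 ?normc_ge0//.
Qed.

Lemma angI_doublen g x n : nice g -> 0 <= x -> (angI g x <= (2 ^+ n)%:E * angI g (2 ^+ n * x)%R)%E.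
Proof.
move=> ng x0; elim: n => [|n IH]; first by rewrite expr0 mul1e mul1r.
apply: le_trans IH _; rewrite exprS [2 * _ ^+ n]mulrC EFinM -muleA; apply: lee_wpmul2l.
  by rewrite lee_fin exprn_ge0.
have := angI_double ng (mulr_ge0 (exprn_ge0 n (ler0n R 2)) x0).
by rewrite [2 ^+ n * 2]mulrC !mulrA.
Qed.

Lemma gauss_int_scale (c : R) : 0 < c -> gauss_int c = c^-1 * gauss_int (1 : R).
Proof.
move=> c0; have s0 : 0 < Num.sqrt c by rewrite sqrtr_gt0.
pose G (z : R[i]) := (expR (- 1 * normc z ^+ 2))%:E.
have mG : measurable_fun [set: plane] (G \o cpl) by exact: measurable_gauss.
have G0 z : (0 <= G z)%E by rewrite lee_fin expR_ge0.
have := @ge0_area_affine R (Num.sqrt c) 0 G s0 mG G0.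
rewrite (_ : (fun z => _) = gauss c); last first.
  apply/funext => z; rewrite /G /gauss addr0 normcM normcR ger0_norm ?(ltW s0)//.
  by rewrite exprMn sqr_sqrtr ?(ltW c0)// !mulNr mul1r.
rewrite gauss_intE// (_ : (\int[area]_z G (cpl z) = (gauss_int (1 : R))%:E)%E); last exact: gauss_intE.
by rewrite exprVn sqr_sqrtr ?(ltW c0)// -EFinM => -[].
Qed.

Lemma gauss_shift (c : R) (b : R[i]) : 0 < c ->
  (\int[area]_z (expR (- c * normc (cpl z - b) ^+ 2))%:E = (gauss_int c)%:E)%E.
Proof.
move=> c0; rewrite -gauss_intE//.
pose G (z : R[i]) := (expR (- c * normc z ^+ 2))%:E.
have mG : measurable_fun [set: plane] (G \o cpl) by exact: measurable_gauss.
have G0 z : (0 <= G z)%E by rewrite lee_fin expR_ge0.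
exact: (area_translate (- b) mG G0).
Qed.

End angular.

(** * Functions that peak at one point *)

Section spike.
Context {R : realType} (w : weight R).
Local Notation MR := (measurableTypeR R).
Local Notation plane := (MR * MR)%type.
Implicit Types (p q : {posnum R}) (r x y B k c L : R).

(** Finiteness of [X] is what allows half of it to be absorbed. *)
Lemma ereal_half (X X1 : \bar R) : (0 <= X)%E -> (0 <= X1)%E -> (X < +oo)%E ->
  (X <= X1 + (2^-1)%:E * X)%E -> (X <= 2%:E * X1)%E.
Proof.
move: X X1 => [x| |] [y| |] //=; rewrite ?lee_fin => x0 y0 _.
  by rewrite /= ?lee_fin; lra.
by move=> _; rewrite gt0_muley ?lte_fin// leey.
Qed.

(** The absolute value makes the function measurable on the whole line, whatever [w] does at
    negative arguments. *)
Definition rdecay c r y : R := expR (- (c * (w `|y| - w r - wD w r * (ln y - ln r)))).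

Lemma rdecayE c r y : 0 < y -> rdecay c r y = expR (- (c * gap w r y)).
Proof. by move=> y0; rewrite /rdecay gtr0_norm. Qed.

Lemma nice_rdecay c r : nice (rdecay c r).
Proof.
split=> [|y]; last exact: expR_ge0.
apply: (measurableT_comp (@measurable_expR R)); apply: measurableT_comp => //.
apply: measurable_funM => //; apply: measurable_funB.
  apply: measurable_funB => //.
  have cw := @weight_cont R w; exact: (continuous_measurable_fun cw).
by apply: measurable_funM => //; apply: measurable_funB => //; exact: measurable_ln.
Qed.

Definition band (i : interval R) y : R := \1_[set` i] y.

Lemma bandE i y : band i y = (y \in i)%:R.
Proof. by rewrite /band indicE mem_setE. Qed.

Lemma band_split a r b y : a <= r -> r <= b ->
  band `[r, b[ y + band `[a, r[ y <= band `[a, b[ y.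
Proof.
move=> ar rb; rewrite !bandE !in_itv/=.
have [ry|yr] := leP r y; first by rewrite (le_trans ar ry) andbF addr0.
by rewrite (lt_le_trans yr rb) !andbT add0r.
Qed.

Lemma nice_band i : nice (band i).
Proof.
split=> [|y]; last by rewrite bandE.
exact: measurable_indic (measurable_itv i).
Qed.

Lemma niceM (g h : R -> R) : nice g -> nice h -> nice (fun y => g y * h y).
Proof.
move=> [mg g0] [mh h0]; split=> [|y]; last exact: mulr_ge0.
exact: measurable_funM.
Qed.

Definition bdecay i c r y := band i y * rdecay c r y.

Lemma nice_bdecay i c r : nice (bdecay i c r).
Proof. by apply: niceM; [exact: nice_band|exact: nice_rdecay]. Qed.

Lemma bdecay_le_band i c r : 0 <= c -> 0 < r -> (forall y, y \in i -> 0 < y) ->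
  forall y, bdecay i c r y <= band i y.
Proof.
move=> c0 r0 ip y; rewrite /bdecay bandE; case: (boolP (y \in i)) => [yi|_]; last by rewrite mul0r.
have y0 := ip y yi; rewrite mul1r rdecayE// -[leRHS]expR0 ler_expR oppr_le0.
by rewrite mulr_ge0// gap_ge0.
Qed.

(* Dilation by [k] maps the half-line beyond [r] onto the complement of the band
   and shrinks the integrand by [expR (- c * L)], so the band carries half of the integral. *)
Lemma outer_bound c r k L x : 0 < c -> 0 < r -> 1 <= k <= 2 -> 0 <= x -> gap w r (k * r) = L ->
  expR (- (c * L)) <= 8^-1 -> (angI (bdecay `[r, +oo[%R c r) x < +oo)%E ->
  (angI (bdecay `[r, +oo[%R c r) x <= 2%:E * angI (band `[r, (k * r)%R[%R) x)%E.
Proof.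
move=> c0 r0 /andP[k1 k2] x0 gL eL fin.
have k0 : 0 < k by lra.
have rkr : r <= k * r by rewrite ler_peMl// ltW.
have nX := nice_bdecay `[r, +oo[ c r.
have nI := nice_bdecay `[r, k * r[ c r; have nO := nice_bdecay `[k * r, +oo[ c r.
have E : bdecay `[r, +oo[ c r = fun y => bdecay `[r, k * r[ c r y + bdecay `[k * r, +oo[ c r y.
  apply/funext => y; rewrite /bdecay -mulrDl !bandE !in_itv/= !andbT; congr (_ * _).
  have [ry|yr] := leP r y; have [ky|yk] := leP (k * r) y; rewrite /= ?addr0 ?add0r//.
  by move: (lt_le_trans yr (le_trans rkr ky)); rewrite ltxx.
apply: le_trans (_ : 2%:E * angI (bdecay `[r, (k * r)%R[%R c r) x <= _)%E; last first.
  apply: lee_wpmul2l => //; apply: angI_le => //; first exact: nice_band.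
  move=> y _; apply: bdecay_le_band => //; first exact: ltW.
  by move=> u; rewrite in_itv/= => /andP[ru _]; exact: lt_le_trans ru.
apply: ereal_half => //; try exact: angI_ge0.
rewrite {1}E angI_add//; apply: leeD => //.
rewrite (angI_dilate x k0 nO).
have e0 : 0 <= expR (- (c * L)) := expR_ge0 _.
apply: (@le_trans _ _ ((k ^+ 2)%:E * ((expR (- (c * L)))%:E * angI (bdecay `[r, +oo[%R c r) x))%E).
  apply: lee_wpmul2l; first by rewrite lee_fin sqr_ge0.
  rewrite -angI_scale//; apply: angI_le.
  - exact: nice_comp nO.
  - exact: niceZ.
  - move=> y y0; rewrite /bdecay !bandE !in_itv/= !andbT ler_pM2l//.
    case: (leP r y) => [ry|_]; last by rewrite !mul0r mulr0.
    have y1 := lt_le_trans r0 ry.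
    rewrite !mul1r !rdecayE ?mulr_gt0// -expRD ler_expR -opprD lerN2 -mulrDr ler_pM2l//.
    by have := gap_shift_up w r0 ry k1; rewrite gL; lra.
  - by rewrite ler_peMl.
rewrite muleA -EFinM; apply: lee_wpmul2r; first exact: angI_ge0.
rewrite lee_fin; have k4 : k ^+ 2 <= 4 by rewrite (_ : 4 = 2 ^+ 2 :> R); [apply: lerXn2r; rewrite ?nnegrE// ltW|ring].
by move: eL e0; move: (expR _) => e; nra.
Qed.

(** As in [outer_bound], but dilation by [k <= 1] also weakens the angular decay to [k * x]. One
    doubling restores it, since [2 * k >= 1]; its factor 2 is affordable because here
    [k ^+ 2 <= 1]. *)
Lemma inner_bound c r k L x : 0 < c -> 0 < r -> 2^-1 <= k <= 1 -> 0 <= x -> gap w r (k * r) = L ->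
  expR (- (c * L)) <= 8^-1 -> (angI (bdecay `]0%R, r[%R c r) x < +oo)%E ->
  (angI (bdecay `]0%R, r[%R c r) x <= 2%:E * angI (band `[(k * r)%R, r[%R) x)%E.
Proof.
move=> c0 r0 /andP[k2 k1] x0 gL eL fin.
have k0 : 0 < k by apply: lt_le_trans k2; rewrite invr_gt0.
have rkr : k * r <= r by rewrite ler_piMl// ltW.
have kr0 : 0 < k * r by rewrite mulr_gt0.
have nX := nice_bdecay `]0, r[ c r.
have nI := nice_bdecay `[k * r, r[ c r; have nO := nice_bdecay `]0, k * r[ c r.
have E : bdecay `]0, r[ c r = fun y => bdecay `[k * r, r[ c r y + bdecay `]0, k * r[ c r y.
  apply/funext => y; rewrite /bdecay -mulrDl !bandE !in_itv/=; congr (_ * _).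
  have [y0|y0] := ltP 0 y; have [ky|yk] := leP (k * r) y; have [ry|yr] := ltP y r; rewrite /= ?addr0 ?add0r//.
  - by move: (lt_le_trans yk (le_trans rkr yr)); rewrite ltxx.
  - by move: (lt_le_trans kr0 (le_trans ky y0)); rewrite ltxx.
apply: le_trans (_ : 2%:E * angI (bdecay `[(k * r)%R, r[%R c r) x <= _)%E; last first.
  apply: lee_wpmul2l => //; apply: angI_le => //; first exact: nice_band.
  move=> y _; apply: bdecay_le_band => //; first exact: ltW.
  by move=> u; rewrite in_itv/= => /andP[ru _]; exact: lt_le_trans ru.
apply: ereal_half => //; try exact: angI_ge0.
rewrite {1}E angI_add//; apply: leeD => //.
rewrite (angI_dilate x k0 nO).
have e0 : 0 <= expR (- (c * L)) := expR_ge0 _.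
have kx : 0 <= k * x by rewrite mulr_ge0// ltW.
apply: (@le_trans _ _ ((k ^+ 2)%:E * ((expR (- (c * L)))%:E * (2%:E * angI (bdecay `]0%R, r[%R c r) x)))%E).
  apply: lee_wpmul2l; first by rewrite lee_fin sqr_ge0.
  apply: (@le_trans _ _ (angI (fun y => expR (- (c * L)) * bdecay `]0, r[ c r y)%R (k * x))).
    apply: angI_le => //; [exact: nice_comp nO|exact: niceZ|].
    move=> y y0; rewrite /bdecay !bandE !in_itv/= ltr_pM2l// pmulr_rgt0//.
    case: (ltP 0 y) => [y1|_] /=; last by rewrite !mul0r mulr0.
    case: (ltP y r) => [yr|_]; last by rewrite !mul0r mulr0.
    rewrite !mul1r !rdecayE ?mulr_gt0// -expRD ler_expR -opprD lerN2 -mulrDr ler_pM2l//.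
    by have := gap_shift_down w r0 y1 (ltW yr) k0 k1; rewrite gL; lra.
  rewrite angI_scale//; apply: lee_wpmul2l; first by rewrite lee_fin.
  apply: le_trans (angI_double nX kx) _; apply: lee_wpmul2l => //.
  apply: angI_le => //; rewrite mulrA ler_peMl//; lra.
rewrite !muleA -!EFinM; apply: lee_wpmul2r; first exact: angI_ge0.
rewrite lee_fin; have k4 : k ^+ 2 <= 1 by apply: exprn_ile1 => //; exact: ltW.
have k5 : 0 <= k ^+ 2 by exact: sqr_ge0.
by move: eL e0 k4 k5; move: (expR _) (k ^+ 2) => e s; nra.
Qed.

Lemma ln_chord r y : 0 < r -> 0 < y -> 0 <= y - r - r * (ln y - ln r).
Proof.
move=> r0 y0; have := expR_ge1Dx (ln (y / r)); rewrite lnK ?posrE ?divr_gt0//.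
rewrite lnM ?posrE ?invr_gt0// lnV ?posrE// ler_pdivlMr//.
by move: (ln y) (ln r) => *; lra.
Qed.

(* Times [expR (- w)], this peaks at the single point [r] if [wD w r = n + la * r]:
   the radial decay is that of [gap w r], the angular decay that of [la * tilt]. *)
Definition spike_fun (n : nat) (la : R) (z : R[i]) : R[i] := z ^+ n * cexp (la%:C * z).

Lemma spike_entire n la : entire (spike_fun n la).
Proof.
have e1 : entire (fun z => la%:C * z) := @entireZ R la%:C _ entire_id.
exact (entireM (entireX n) (entire_comp cexp_entire e1)).
Qed.

Lemma spike_normc n la z : normc (spike_fun n la z) = normc z ^+ n * expR (la * complex.Re z).
Proof.
rewrite normcM normcX normc_cexp; congr (_ * expR _).
by case: z => u v; rewrite /= mul0r subr0.
Qed.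

Lemma spike_modulus n la r z : 0 < r -> la * r = wD w r - n%:R -> 0 < normc z ->
  normc (spike_fun n la z) * expR (- w (normc z)) =
  expR (n%:R * ln r + la * r - w r) *
  expR (- gap w r (normc z) + la * (normc z - r - r * (ln (normc z) - ln r)) - la * tilt z).
Proof.
move=> r0 E z0; rewrite spike_normc -{1}(lnK (x := normc z)) ?posrE// -expRM_natl -!expRD.
congr expR; rewrite /gap /tilt.
have -> : n%:R = wD w r - la * r by rewrite E; ring.
by move: (ln (normc z)) (ln r) (complex.Re z) => a b u; ring.
Qed.

Lemma normc_sub_real z r : normc (z - r%:C) ^+ 2 = (normc z - r) ^+ 2 + 2 * r * tilt z.
Proof.
case: z => u v; rewrite (_ : u +i* v - r%:C = (u - r) +i* v); last by apply/eqP; rewrite eq_complex /= subr0 !eqxx.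
rewrite normc_sqr [in RHS]sqrrB normc_sqr /tilt.
rewrite -[complex.Re _]/u; move: (normc _) => t; ring.
Qed.

Lemma gap_levels (B L r : R) : 0 < L -> 1 <= B -> 4 * L + 2 <= r ->
  (forall y, 0 < y -> B * (y - r) ^+ 2 <= gap w r y) ->
  (exists k, 1 <= k <= 2 /\ gap w r (k * r) = L) /\ (exists m, 2^-1 <= m <= 1 /\ gap w r (m * r) = L).
Proof.
move=> L0 B1 rL gq; have r0 : 0 < r by lra.
have Lr : 4 * L <= r ^+ 2.
  have h : 4 * L * 1 <= r * r by apply: ler_pM; lra.
  by move: h; rewrite mulr1 -expr2.
have Br : 1 * r ^+ 2 <= B * r ^+ 2 by rewrite ler_wpM2r ?sqr_ge0.
split.
  have g : L <= gap w r (2 * r).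
    by apply: le_trans (gq _ _); [rewrite (_ : 2 * r - r = r); lra|lra].
  have r2 : r <= 2 * r by lra.
  have [|c' c12 cL'] := @gap_IVT _ w r r (2 * r) L r0 r2 r0; first by rewrite gap0 ge_min (ltW L0) le_max g orbT.
  exists (c' / r); rewrite divfK ?gt_eqF//; split => //.
  by rewrite ler_pdivlMr// ler_pdivrMr// mul1r.
have h0 : 0 < 2^-1 * r by lra.
have g : L <= gap w r (2^-1 * r).
  by apply: le_trans (gq _ h0); rewrite (_ : (2^-1 * r - r) ^+ 2 = r ^+ 2 / 4); [lra|field].
have r2 : 2^-1 * r <= r by lra.
have [|c' c12 cL'] := @gap_IVT _ w r (2^-1 * r) r L h0 r2 r0; first by rewrite gap0 ge_min (ltW L0) le_max g orbT.
exists (c' / r); rewrite divfK ?gt_eqF//; split => //.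
by rewrite ler_pdivlMr// ler_pdivrMr// mul1r.
Qed.

(** Rounding [wD w r - B * r ^+ 2 / 4] down to [n] puts [la] between [B * r / 4] and [B * r / 2]:
    large enough for the angular decay to match the radial one, small enough for half of [gap] to
    absorb the exponential factor by [gap_log]. *)
Lemma spike_params (B L : R) : 0 < L -> 1 <= B -> exists (r la : R) (n : nat),
  [/\ 0 < r, (0 < n)%N, la * r = wD w r - n%:R & B * r / 4 <= la] /\
  [/\ forall y, 0 < y -> la * (y - r - r * (ln y - ln r)) <= gap w r y / 2,
      forall y, 0 < y -> B * (y - r) ^+ 2 <= gap w r y,
      exists k, 1 <= k <= 2 /\ gap w r (k * r) = L &
      exists m, 2^-1 <= m <= 1 /\ gap w r (m * r) = L].
Proof.
move=> L0 B1; have B0 : 0 < B by exact: lt_le_trans B1.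
have [ra ra1 raP] := gap_quad w B0; have [rb rb1 rbP] := gap_log w B0.
have [rc rc1 rcP] := wD_quad w B.
pose r := Num.max (Num.max ra rb) (Num.max rc (4 * L + 2)).
have rra : ra <= r by rewrite !le_max lexx.
have rrb : rb <= r by rewrite !le_max lexx ?orbT.
have rrc : rc <= r by rewrite !le_max lexx ?orbT.
have rrL : 4 * L + 2 <= r by rewrite !le_max lexx ?orbT.
have gq y : 0 < y -> B * (y - r) ^+ 2 <= gap w r y by exact: raP rra.
have gl y : 0 < y -> B * r * (y - r - r * (ln y - ln r)) <= gap w r y by exact: rbP rrb.
have Dr := rcP r rrc.
clear raP rbP rcP; move: r rra rrb rrc rrL gq gl Dr => r rra _ _ rrL gq gl Dr.
have r0 : 0 < r by lra.
have Br1 : 1 <= B * r ^+ 2 / 4.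
  have h : 1 * r ^+ 2 <= B * r ^+ 2 by rewrite ler_wpM2r ?sqr_ge0.
  have h2 : 2 * 2 <= r * r by apply: ler_pM; lra.
  by move: h h2; rewrite -expr2 mul1r; lra.
have D1 : 0 <= wD w r - B * r ^+ 2 / 4 by lra.
have /andP[n1 n2] := truncn_itv D1.
move: n1 n2; set n := Num.truncn _ => n1; rewrite -[n.+1%:R]natr1 => n2.
have n0 : (0 < n)%N by rewrite lt0n; apply/eqP => h; move: n2; rewrite h; lra.
exists r, ((wD w r - n%:R) / r), n.
have laE : (wD w r - n%:R) / r * r = wD w r - n%:R by rewrite divfK// gt_eqF.
have la1 : B * r / 4 <= (wD w r - n%:R) / r by rewrite ler_pdivlMr//; move: n1; rewrite expr2; lra.
have la2 : (wD w r - n%:R) / r <= B * r / 2 by rewrite ler_pdivrMr//; move: n2 Br1; rewrite expr2; lra.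
have [lk lm] := gap_levels L0 B1 rrL gq.
split; first by split.
split => // y y0; rewrite ler_pdivlMr//; apply: le_trans (gl y y0).
by rewrite mulrAC ler_wpM2r ?ln_chord//; lra.
Qed.

Lemma exponent_le (c L l t g : R) : 0 <= c -> g <= L -> - (c * L) + - (c * l) * t <= (- g - l * t) * c.
Proof. by move=> c0 h; have := ler_wpM2l c0 h; lra. Qed.

Lemma spike_bounds n la r z : 0 < r -> la * r = wD w r - n%:R -> 0 <= la ->
  (forall y, 0 < y -> la * (y - r - r * (ln y - ln r)) <= gap w r y / 2) -> 0 < normc z ->
  let ka := expR (n%:R * ln r + la * r - w r) in
  normc (spike_fun n la z) * expR (- w (normc z)) <= ka * expR (- (gap w r (normc z) / 2) - la * tilt z) /\
  ka * expR (- gap w r (normc z) - la * tilt z) <= normc (spike_fun n la z) * expR (- w (normc z)).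
Proof.
move=> r0 laE la0 hq z0 ka; have ka0 : 0 <= ka by exact: expR_ge0.
rewrite (spike_modulus r0 laE z0) -/ka; split; rewrite ler_wpM2l// ler_expR.
  by have := hq _ z0; move: (la * (_ - _ - _)) (gap _ _ _) (la * tilt z) => *; lra.
have := mulr_ge0 la0 (ln_chord r0 z0).
by move: (la * (_ - _ - _)) (gap _ _ _) (la * tilt z) => *; lra.
Qed.

(** By [normc_sub_real] the squared distance to the peak splits into a radial part and a multiple of
    [tilt], each covered by one kind of decay. *)
Lemma gauss_gap (P B r la : R) z : 0 < P -> 0 < B -> B * r / 4 <= la ->
  B * (normc z - r) ^+ 2 <= gap w r (normc z) ->
  - (P / 2 * gap w r (normc z)) - (P * la) * tilt z <= - (P * B / 8) * normc (z - r%:C) ^+ 2.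
Proof.
move=> P0 B0 la1 g; rewrite normc_sub_real; have t0 := tilt_ge0 z.
have h1 : 0 <= P * ((la - B * r / 4) * tilt z).
  by apply: mulr_ge0; [exact: ltW|apply: (mulr_ge0 _ t0); rewrite subr_ge0].
have h2 : 0 <= P * (B * (normc z - r) ^+ 2).
  by apply: mulr_ge0; [exact: ltW|apply: mulr_ge0; [exact: ltW|exact: sqr_ge0]].
have h4 := ler_wpM2l (ltW P0) g; move: h1 h2 h4 {g t0}.
move: ((normc z - r) ^+ 2) (gap w r _) (tilt _) => s g t; lra.
Qed.

(** After division by [ka], [f] times the weight behaves like the indicator of a small set: the
    integral for [p] is an area of at most [G / B], and the integral for [q] is at least [c] times
    the same area, with [c] and [G] independent of [B]. *)
Lemma spike p q : exists c G : R, [/\ 0 < c, 0 < G & forall B, 1 <= B ->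
  exists (f : fock w p) (ka : R), [/\ 0 < ka, 0 < fn f,
    fn f `^ p%:num <= ka `^ p%:num * (G / B) &
    ((c * ka `^ q%:num * (fn f `^ p%:num / ka `^ p%:num))%:E <= fock_integral w q f)%E]].
Proof.
have p0 : 0 < p%:num :> R by [].
have q0 : 0 < q%:num :> R by [].
(* The upper bound in [spike_bounds] keeps half of [gap], whence [cd = p / 2]; then [cd * L = 7],
   and [expR (- 7)] is at most one eighth. *)
pose L := 14 / p%:num; have L0 : 0 < L by rewrite divr_gt0.
pose cd := p%:num / 2; have cd0 : 0 < cd by rewrite divr_gt0.
have cL : cd * L = 7 by rewrite /cd /L; field; rewrite gt_eqF.
have eL : expR (- (cd * L)) <= 8^-1.
  by rewrite cL expRN lef_pV2 ?posrE ?expR_gt0//; have := expR_ge1Dx (7 : R); lra.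
(* The number of doublings that lead from the angular decay [p * la] to at least [q * la]. *)
pose j := (Num.truncn (q%:num / p%:num : R)).+1.
have jq : q%:num <= 2 ^+ j * p%:num :> R.
  rewrite -ler_pdivrMr//; apply: (@le_trans _ _ j%:R); first exact/ltW/truncnS_gt.
  by rewrite -natrX ler_nat ltnW// ltn_expl.
exists (expR (- (q%:num * L)) / (2 * 2 ^+ j)), (8 / p%:num * gauss_int (1 : R) + 1).
have j20 : 0 < 2 * 2 ^+ j :> R by rewrite mulr_gt0// exprn_gt0.
split; first by rewrite divr_gt0// expR_gt0.
  by rewrite ltr_wpDl// mulr_ge0 ?gauss_int_ge0// divr_ge0.
move=> B B1; have B0 : 0 < B by exact: lt_le_trans B1.
have [r [la [n [[r0 n0 laE la1] [hq gq lk lm]]]]] := spike_params L0 B1.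
have la0 : 0 <= la by apply: le_trans la1; rewrite divr_ge0// mulr_ge0// ltW.
pose ka := expR (n%:R * ln r + la * r - w r).
have ka0 : 0 < ka by exact: expR_gt0.
pose f0 := spike_fun n la; have ef : entire f0 := @spike_entire n la.
have UB z z0 := (@spike_bounds n la r z r0 laE la0 hq z0).1.
have LB z z0 := (@spike_bounds n la r z r0 laE la0 hq z0).2.
pose X := angI (bdecay `[r, +oo[ cd r) (p%:num * la).
pose Y := angI (bdecay `]0, r[ cd r) (p%:num * la).
have pl0 : 0 <= p%:num * la by rewrite mulr_ge0.
have nX := nice_bdecay `[r, +oo[ cd r; have nY := nice_bdecay `]0, r[ cd r.
have sumE y : 0 <= y -> bdecay `[r, +oo[ cd r y + bdecay `]0, r[ cd r y =
    (0 < y)%R%:R * rdecay cd r y.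
  move=> y0; rewrite /bdecay -mulrDl !bandE !in_itv/= andbT; congr (_ * _).
  have [ry|yr] := leP r y; rewrite ?andbF ?andbT ?addr0 ?add0r//.
  by rewrite (lt_le_trans r0 ry).
have c8 : 0 < p%:num * B / 8 by rewrite divr_gt0// mulr_gt0.
have XY : (X + Y <= (gauss_int (p%:num * B / 8))%:E)%E.
  rewrite /X /Y -angI_add// -(gauss_shift r%:C c8); apply: ge0_le_integral => //.
  - by move=> z _; rewrite lee_fin mulr_ge0 ?expR_ge0// addr_ge0//; case: nX; case: nY.
  - apply: (@measurable_ang R (fun y => bdecay `[r, +oo[ cd r y + bdecay `]0, r[ cd r y)).
    by case: nX => m1 g1; case: nY => m2 g2; split=> [|y]; [exact: measurable_funD|exact: addr_ge0].
  - apply/measurable_EFinP; apply: (measurableT_comp (@measurable_expR R)).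
    apply: measurable_funM => //; apply: (measurableT_comp (f := fun x : MR => x ^+ 2 : MR)).
      exact: exprn_measurable.
    exact: (measurable_normc_entire (entireB entire_id (entire_cst r%:C))).
  move=> z _; rewrite lee_fin sumE ?normc_ge0//.
  case: ltP => [z0|_]; last by rewrite !mul0r expR_ge0.
  rewrite mul1r rdecayE// -expRD ler_expR mulNr.
  exact: (gauss_gap p0 B0 la1 (gq _ z0)).
have X0 : (0 <= X)%E by exact: angI_ge0.
have Y0 : (0 <= Y)%E by exact: angI_ge0.
have Xfin : (X < +oo)%E by apply: le_lt_trans (ltry (gauss_int (p%:num * B / 8))); apply: le_trans XY; rewrite leeDl.
have Yfin : (Y < +oo)%E by apply: le_lt_trans (ltry (gauss_int (p%:num * B / 8))); apply: le_trans XY; rewrite leeDr.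
have pw (a b : R) : expR (- (a * b)) = expR (- b) `^ a by rewrite -expRM; congr expR; ring.
have kap : (ka `^ p%:num)%:E = (ka `^ p%:num)%:E :> \bar R by [].
have Ip : (fock_integral w p f0 <= (ka `^ p%:num)%:E * (X + Y))%E.
  rewrite /X /Y -angI_add// /angI -ge0_integralZl//; last 3 first.
  - apply: (@measurable_ang R (fun y => bdecay `[r, +oo[ cd r y + bdecay `]0, r[ cd r y)).
    by case: nX => m1 g1; case: nY => m2 g2; split=> [|y]; [exact: measurable_funD|exact: addr_ge0].
  - by move=> z _; rewrite lee_fin mulr_ge0 ?expR_ge0// addr_ge0//; case: nX; case: nY.
  - by rewrite lee_fin powR_ge0.
  apply: ge0_le_integral => //.
  - by move=> z _; rewrite lee_fin mulr_ge0 ?powR_ge0 ?expR_ge0.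
  - exact: fock_integrand_measurable.
  - apply: measurable_funeM.
    apply: (@measurable_ang R (fun y => bdecay `[r, +oo[ cd r y + bdecay `]0, r[ cd r y)).
    by case: nX => m1 g1; case: nY => m2 g2; split=> [|y]; [exact: measurable_funD|exact: addr_ge0].
  move=> z _; rewrite -EFinM lee_fin -/(cpl z) sumE ?normc_ge0//.
  case: ltP => [z0|z0]; last first.
    have nz : normc (cpl z) = 0 by apply/eqP; rewrite eq_le z0 normc_ge0.
    rewrite /f0 spike_normc nz expr0n eqn0Ngt n0 mul0r powR0 ?gt_eqF// !mul0r.
    by rewrite mulr0.
  rewrite mul1r rdecayE// -expRD mulNr pw -powRM ?normc_ge0 ?expR_ge0//.
  apply: le_trans (_ : (ka * expR (- (gap w r (normc (cpl z)) / 2) - la * tilt (cpl z))) `^ p%:num <= _).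
    by apply: ge0_ler_powR; rewrite ?nnegrE ?mulr_ge0 ?normc_ge0 ?expR_ge0 ?(ltW p0) ?(ltW ka0)//; exact: UB.
  rewrite powRM ?expR_ge0 ?(ltW ka0)// ler_wpM2l ?powR_ge0// -expRM ler_expR /cd.
  by rewrite le_eqVlt; apply/orP; left; apply/eqP; ring.
have mf : f0 \in fock_pred w p.
  apply: mem_fock => //; apply: poweR_lty; apply: le_lt_trans Ip _.
  apply: le_lt_trans (lee_wpmul2l _ XY) _; first by rewrite lee_fin powR_ge0.
  by rewrite -EFinM ltry.
pose f : fock w p := Fock mf.
have If : fock_integral w p f0 = (fn f `^ p%:num)%:E := fn_integral f.
exists f, ka; split; first exact: ka0.
- rewrite lt_neqAle eq_sym fn_ge0 andbT; apply/eqP => /fn_eq0 /(congr1 (fun g : fock w p => normc (g 1))).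
  rewrite -[f 1]/(f0 1) /f0 spike_normc normc1 expr1n mul1r normc0 => /eqP.
  by rewrite gt_eqF// expR_gt0.
- rewrite -lee_fin -If; apply: le_trans Ip _.
  apply: le_trans (lee_wpmul2l _ XY) _; first by rewrite lee_fin powR_ge0.
  rewrite -EFinM lee_fin ler_wpM2l ?powR_ge0// gauss_int_scale//.
  rewrite (_ : _^-1 * _ = 8 / p%:num * gauss_int (1 : R) / B); last by field; rewrite !gt_eqF.
  by rewrite ler_wpM2r ?invr_ge0 ?(ltW B0)// lerDl.
have [k [k12 kL]] := lk; have [m [m12 mL]] := lm.
have XB := outer_bound cd0 r0 k12 pl0 kL eL Xfin.
have YB := inner_bound cd0 r0 m12 pl0 mL eL Yfin.
have m0 : 0 < m by case/andP: m12 => h _; apply: lt_le_trans h; rewrite invr_gt0.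
have k0 : 0 < k by case/andP: k12 => h _; exact: lt_le_trans h.
have mr : m * r <= r by case/andP: m12 => _ h; rewrite ler_piMl// ltW.
have kr : r <= k * r by case/andP: k12 => h _; rewrite ler_peMl// ltW.
pose bd := band `[m * r, k * r[.
have nb : nice bd by exact: nice_band.
have n1' := nice_band `[r, k * r[; have n2' := nice_band `[m * r, r[.
have SB : (X + Y <= 2%:E * angI bd (p%:num * la))%E.
  apply: le_trans (leeD XB YB) _.
  rewrite -ge0_muleDr; [|exact: angI_ge0|exact: angI_ge0].
  apply: lee_wpmul2l; first by rewrite lee_fin.
  rewrite -(angI_add _ n1' n2'); apply: (angI_le _ nb _ (lexx _)).
    by case: n1' => m1 g1; case: n2' => m2 g2'; split=> [|y]; [exact: measurable_funD|exact: addr_ge0].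
  by move=> y _; rewrite /bd; exact: band_split.
have SB2 : (X + Y <= (2 * 2 ^+ j)%:E * angI bd (q%:num * la))%E.
  apply: le_trans SB _; rewrite EFinM -muleA; apply: lee_wpmul2l; first by rewrite lee_fin.
  apply: le_trans (angI_doublen j nb pl0) _; apply: lee_wpmul2l; first by rewrite lee_fin exprn_ge0.
  by apply: (angI_le nb nb (fun y _ => lexx _)); rewrite [leRHS]mulrA; exact: (ler_wpM2r la0 jq).
have Iq : ((ka `^ q%:num * expR (- (q%:num * L)))%:E * angI bd (q%:num * la) <= fock_integral w q f0)%E.
  rewrite /angI -ge0_integralZl; last 4 first.
  - exact: measurableT.
  - exact: (measurable_ang _ nb).
  - by move=> z _; exact: ang_ge0.
  - by rewrite lee_fin mulr_ge0 ?powR_ge0 ?expR_ge0.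
  apply: ge0_le_integral => //.
  - by move=> z _; apply: mule_ge0; [rewrite lee_fin mulr_ge0 ?powR_ge0 ?expR_ge0|exact: ang_ge0].
  - by apply: measurable_funeM; exact: (measurable_ang _ nb).
  - exact: fock_integrand_measurable.
  move=> z _; rewrite -EFinM lee_fin -/(cpl z) /bd bandE in_itv/=.
  case: andP => [[mz zk]|_]; last by rewrite mul0r mulr0 mulr_ge0 ?powR_ge0 ?expR_ge0.
  have z0 : 0 < normc (cpl z) by apply: lt_le_trans mz; rewrite mulr_gt0.
  rewrite mul1r [leRHS](_ : _ = (normc (f0 (cpl z)) * expR (- w (normc (cpl z)))) `^ q%:num); last first.
    by rewrite mulNr pw powRM ?normc_ge0 ?expR_ge0.
  have gL' : gap w r (normc (cpl z)) <= L.
    have [rz|/ltW zr] := leP r (normc (cpl z)); first by rewrite -kL; apply: gap_up => //; exact: ltW.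
    by rewrite -mL; apply: gap_down => //; rewrite mulr_gt0.
  apply: (@le_trans _ _ ((ka * expR (- gap w r (normc (cpl z)) - la * tilt (cpl z))) `^ q%:num)); last first.
    by apply: ge0_ler_powR; rewrite ?nnegrE ?mulr_ge0 ?normc_ge0 ?expR_ge0 ?(ltW q0) ?(ltW ka0)//; exact: LB.
  rewrite powRM ?expR_ge0 ?(ltW ka0)// -mulrA ler_wpM2l ?powR_ge0// -expRM -expRD ler_expR.
  exact: exponent_le (ltW q0) gL'.
apply: le_trans Iq.
have := le_trans Ip (lee_wpmul2l _ SB2); rewrite lee_fin powR_ge0 => /(_ isT); rewrite If.
have kp0 : 0 < ka `^ p%:num by rewrite powR_gt0.
have kq0 : 0 < ka `^ q%:num by rewrite powR_gt0.
move: (angI_ge0 (q%:num * la) nb); case: (angI _ _) => [A| |] //=; last first.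
  by move=> _ _; rewrite gt0_muley ?leey// lte_fin mulr_gt0 ?expR_gt0.
rewrite lee_fin => A0; rewrite -!EFinM !lee_fin => H.
rewrite [leLHS](_ : _ = (ka `^ q%:num * expR (- (q%:num * L))) * (fn f `^ p%:num / ka `^ p%:num / (2 * 2 ^+ j))); last first.
  by move: (ka `^ p%:num) kp0 (2 * 2 ^+ j) j20 => P P0 J J0; field; rewrite !gt_eqF.
rewrite ler_wpM2l ?mulr_ge0 ?expR_ge0 ?(ltW kq0)//.
rewrite !ler_pdivrMr//; apply: (le_trans H); rewrite le_eqVlt; apply/orP; left; apply/eqP; ring.
Qed.

(** With [t = fn f / ka], an embedding would give [c * t ^ p <= M * t ^ q], hence a lower bound for
    [t] as [p < q]; but [t ^ p <= G / B] is arbitrarily small. *)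
Lemma no_embedding_lt p q (M : R) : p%:num < q%:num ->
  ~ (forall f : fock w p, (fock_integral w q f <= (M * fn f `^ q%:num)%:E)%E).
Proof.
move=> pq H; have [c [G [c0 G0 HB]]] := spike p q.
have p0 : 0 < p%:num :> R by [].
pose s := (q%:num - p%:num) / p%:num.
have s0 : 0 < s by rewrite divr_gt0 ?subr_gt0.
have M0 : 0 < `|M| + 1 by rewrite ltr_wpDl.
pose D := ((`|M| + 1) / c) `^ s^-1.
have D0 : 0 < D by rewrite powR_gt0// divr_gt0.
pose B := Num.max 1 (2 * G * D).
have B1 : 1 <= B by rewrite le_max lexx.
have B0 : 0 < B by exact: lt_le_trans B1.
have [f [ka [ka0 f0 f1 f2]]] := HB B B1.
have := le_trans f2 (H f); rewrite lee_fin.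
pose t := fn f / ka; have t0 : 0 < t by rewrite divr_gt0.
have fE : fn f = t * ka by rewrite /t divfK// gt_eqF.
move: t t0 fE => t t0 fE.
have kp0 : 0 < ka `^ p%:num by rewrite powR_gt0.
have kq0 : 0 < ka `^ q%:num by rewrite powR_gt0.
rewrite fE !powRM ?(ltW t0) ?(ltW ka0)// mulfK ?gt_eqF// => H1.
have {f1} tp : t `^ p%:num <= G / B.
  by move: f1; rewrite fE powRM ?(ltW t0) ?(ltW ka0)// mulrC ler_pM2l.
have tq : t `^ q%:num = t `^ p%:num * (t `^ p%:num) `^ s.
  rewrite -powRrM -powRD; last by apply/implyP => _; rewrite gt_eqF.
  by congr (_ `^ _); rewrite /s; field; rewrite gt_eqF.
have tp0 : 0 < t `^ p%:num by rewrite powR_gt0.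
have H2 : c <= (`|M| + 1) * (t `^ p%:num) `^ s.
  have : c * t `^ p%:num <= M * t `^ q%:num.
    by rewrite -(ler_pM2r kq0); move: H1; rewrite -!mulrA [t `^ p%:num * ka `^ _]mulrC.
  rewrite tq => H3; rewrite -(ler_pM2r tp0); apply: le_trans H3 _.
  rewrite -mulrA [(_ `^ s) * _]mulrC ler_wpM2r ?mulr_ge0 ?powR_ge0//.
  by apply: le_trans (ler_norm M) _; rewrite lerDl.
have H3 : (t `^ p%:num) `^ s < c / (`|M| + 1).
  have GD : t `^ p%:num < D^-1.
    apply: le_lt_trans tp _; rewrite ltr_pdivrMr// ltr_pdivlMl//.
    have GD0 : 0 < G * D by rewrite mulr_gt0.
    apply: (@lt_le_trans _ _ (2 * G * D)); first by rewrite mulrC; lra.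
    by rewrite le_max lexx orbT.
  have -> : c / (`|M| + 1) = (D^-1) `^ s.
    rewrite -powR_inv1 ?(ltW D0)// -!powRrM mulN1r mulrN mulVf ?gt_eqF//.
    by rewrite powR_inv1 ?divr_ge0 ?(ltW M0) ?(ltW c0)// invf_div.
  by apply: gt0_ltr_powR; rewrite ?nnegrE ?powR_ge0 ?invr_ge0 ?(ltW D0).
move: H3; rewrite ltr_pdivlMr// mulrC ltNge H2.
by [].
Qed.

End spike.

(** * Lacunary sums of monomials *)

Section gap_series.
Context {R : realType} (w : weight R).
Local Notation mu := (@lebesgue_measure R).
Local Notation MR := (measurableTypeR R).
Local Notation plane := (MR * MR)%type.
Local Notation pi2 := (2 * pi : R).
Implicit Types (p q : {posnum R}) (r y eps : R) (f : R[i] -> R[i]).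

Lemma coef_dilate f (z : R[i]) n : entire f -> coef (fun u => f (z * u)) n = coef f n * z ^+ n.
Proof.
move=> ef; have ra := coef_rapid ef.
have rz : rapid (fun m => coef f m * z ^+ m).
  move=> r r0; have r1 : 0 < r * (normc z + 1) by rewrite mulr_gt0// ltr_wpDl ?normc_ge0.
  have [C C0 CP] := ra _ r1; exists C => // m; apply: le_trans (CP m).
  rewrite normcM normcX -mulrA ler_wpM2l ?normc_ge0// -exprMn.
  apply: lerXn2r; rewrite ?nnegrE ?mulr_ge0 ?normc_ge0 ?(ltW r0) ?addr_ge0 ?normc_ge0//.
  by rewrite mulrC ler_wpM2l ?(ltW r0)// lerDl.
have -> : (fun u => f (z * u)) = psum (fun m => coef f m * z ^+ m).
  apply/funext => u; rewrite (taylor _ ef) /psum; congr csum; apply/funext => m.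
  by rewrite exprMn mulrA.
exact (coef_psum n rz).
Qed.

Lemma coef_le_average f z n : entire f ->
  pi * (normc (coef f n) * normc z ^+ n) <= rint 0 pi2 (fun t => normc (f (cis t * z))).
Proof.
move=> ef; have eg : entire (fun u => f (z * u)) := entire_comp ef (entireM (entire_cst z) entire_id).
have cc : ccont (fun t => f (z * cis t) * cis (- t) ^+ n).
  by apply: ccontM; [exact: (ccont_comp eg ccont_cis)|apply: ccontX; exact: ccont_cisN].
have := @cint_norm _ 0 pi2 _ cc.
have := @coef_circle _ _ 1 n eg ltr01; rewrite coef_dilate// expr1n mulr1.
under [X in cint _ _ X = _]eq_fun do rewrite mul1r.
move=> ->; rewrite !normcM normcX normc_real_ge0 ?(ltW pi2_gt0)// => h.
rewrite -(@ler_pM2l _ 2)// mulrA; apply: (le_trans h); rewrite le_eqVlt; apply/orP; left; apply/eqP.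
congr (_ * rint _ _ _); apply/funext => t.
by rewrite normcM normcX normc_cis expr1n mulr1 mulrC.
Qed.

(** By [coef_le_average] the mean over each circle of the modulus times the weight, called [v], is
    at least [2 * eta], so the positive part of [v - eta] has mean at least [eta]. As [v] is at most
    4, this part bounds the power [q] of [v] from below up to a constant, also for [q < 1]. *)
Lemma average_lower q f (i : interval R) eps : entire f -> 0 < eps ->
  (forall z, normc z \in i -> normc (f z) * expR (- w (normc z)) <= 4) ->
  (forall r, r \in i -> exists n, eps <= normc (coef f n) * r ^+ n * expR (- w r)) ->
  (((eps / 4) `^ q%:num / 4 * (eps / 4))%:E * \int[area]_z (band i (normc (cpl z)))%:E <=
   fock_integral w q f)%E.
Proof.
move=> ef e0 f4 fe; set eta := eps / 4; have eta0 : 0 < eta by rewrite divr_gt0.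
(* Where [v > eta], its power [q] is at least that of [eta], and [(v - eta) / 4] is at most 1. *)
set ka := eta `^ q%:num / 4; have ka0 : 0 <= ka by rewrite divr_ge0 ?powR_ge0.
have q0 : 0 < q%:num :> R by [].
pose v (z : R[i]) := normc (f z) * expR (- w (normc z)).
have v0 z : 0 <= v z by rewrite mulr_ge0 ?normc_ge0 ?expR_ge0.
have mv : measurable_fun [set: plane] (fun z : plane => v (cpl z) : MR).
  apply: measurable_funM; first exact: measurable_normc_entire.
  apply: (measurableT_comp (@measurable_expR R)); apply: (measurableT_comp (@oppr_measurable R setT)).
  exact: weight_measurable.
pose G (z : R[i]) : \bar R := (band i (normc z) * (ka * Num.max (v z - eta) 0))%:E.
have [mb b0] := nice_band i.
have mG : measurable_fun [set: plane] (G \o cpl).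
  apply/measurable_EFinP; apply: measurable_funM; first exact: measurable_radial.
  apply: measurable_funM => //; apply: measurable_maxr => //.
  exact: measurable_funB.
have max0 z : 0 <= Num.max (v z - eta) 0 by rewrite le_max lexx orbT.
have G0 z : (0 <= G z)%E by rewrite lee_fin; apply: mulr_ge0; [exact: b0|exact: mulr_ge0].
have IG : (\int[area]_z G (cpl z) <= fock_integral w q f)%E.
  apply: ge0_le_integral => //.
  - exact: fock_integrand_measurable.
  move=> z _; rewrite lee_fin -/(cpl z) bandE.
  case: (boolP (_ \in _)) => [zi|_]; last by rewrite mul0r mulr_ge0 ?powR_ge0 ?expR_ge0.
  rewrite mul1r (_ : _ * expR _ = v (cpl z) `^ q%:num); last first.
    by rewrite powRM ?normc_ge0 ?expR_ge0// -expRM; congr (_ * expR _); ring.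
  have [h|h] := leP (v (cpl z) - eta) 0; first by rewrite mulr0 powR_ge0.
  rewrite /ka mulrAC ler_pdivrMr//; apply: ler_pM; rewrite ?powR_ge0 ?(ltW h)//.
    by apply: ge0_ler_powR; rewrite ?nnegrE ?(ltW q0) ?(ltW eta0)//; lra.
  by apply: le_trans (f4 _ zi); rewrite -/(v (cpl z)); lra.
apply: le_trans IG.
have pi0 : 0 < pi2 by rewrite mulr_gt0// pi_gt0.
have mB : measurable_fun [set: plane] (fun z : plane => (band i (normc (cpl z)))%:E).
  by apply/measurable_EFinP; exact: measurable_radial.
have ke0 : 0 <= ka * eta by rewrite mulr_ge0// ltW.
have pke0 : (0 <= (pi2 * (ka * eta))%:E :> \bar R)%E by rewrite lee_fin mulr_ge0// ltW.
rewrite -(@lee_pmul2l _ pi2%:E)// -(rotation_average mG G0) muleA -EFinM.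
rewrite -(ge0_integralZl _ measurableT mB _ pke0); last by move=> z _; rewrite lee_fin.
apply: ge0_le_integral => //.
- by move=> z _; rewrite -EFinM lee_fin mulr_ge0// -lee_fin.
- exact: measurable_funeM.
- exact: measurable_rotation_average mG G0.
move=> z _; rewrite bandE; case: (boolP (_ \in _)) => [zi|_]; last first.
  by rewrite mule0; apply: integral_ge0.
rewrite mule1.
have [n nP] := fe _ zi.
have cN : ccont (fun t => f (cis t * cpl z)).
  have -> : (fun t : R => f (cis t * cpl z)) = fun t => f (cpl z * cis t).
    by apply/funext => t; rewrite mulrC.
  exact: ccont_circle.
have rE t : normc (cis t * cpl z) = normc (cpl z) by rewrite normcM normc_cis mul1r.
have cv : continuous (fun t => v (cis t * cpl z)).
  have -> : (fun t => v (cis t * cpl z)) = fun t => normc (f (cis t * cpl z)) * expR (- w (normc (cpl z))).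
    by apply/funext => t; rewrite /v rE.
  by move=> t; apply: cvgM; [exact: ccont_normc|exact: cvg_cst].
have mvt : measurable_fun (`[0%R, pi2]%classic : set MR) (fun t : MR => v (cis t * cpl z) : MR).
  exact: measurable_funTS (continuous_measurable_fun cv).
have GE : (fun t : MR => G (cis t * cpl z)) = fun t : MR => (ka%:E * (Num.max (v (cis t * cpl z) - eta) 0)%:E)%E.
  by apply/funext => t; rewrite /G rE bandE zi mul1r.
rewrite GE ge0_integralZl//; last 2 first.
- apply/measurable_EFinP; apply: measurable_maxr => //; exact: measurable_funB.
- by move=> t _; rewrite lee_fin.
rewrite (_ : (pi2 * (ka * eta))%:E = ka%:E * (pi2 * eta)%:E)%E; last by rewrite -!EFinM; congr EFin; ring.
apply: lee_wpmul2l; first by rewrite lee_fin.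
have Iv : (\int[mu]_(t in `[0%R, pi2]) (v (cis t * cpl z))%:E = (rint 0 pi2 (fun t => v (cis t * cpl z)))%:E)%E.
  rewrite /rint /Rintegral fineK//; apply: integrable_fin_num; first exact: measurable_itv.
  exact: cont_integrable.
have vl : pi2 * eta * 2 <= rint 0 pi2 (fun t => v (cis t * cpl z)).
  have -> : (fun t => v (cis t * cpl z)) = fun t => expR (- w (normc (cpl z))) * normc (f (cis t * cpl z)).
    by apply/funext => t; rewrite /v rE mulrC.
  rewrite rintZ; last exact: ccont_normc.
  have := ler_wpM2l (expR_ge0 (- w (normc (cpl z)))) (coef_le_average (cpl z) n ef).
  apply: le_trans; have := ler_wpM2l (pi_ge0 R) nP.
  by rewrite /eta; move: (normc (coef f n)) (normc _ ^+ n) (expR _) => a b c h; lra.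
have : ((rint 0 pi2 (fun t => v (cis t * cpl z)))%:E <=
   \int[mu]_(t in `[0%R, pi2]) (Num.max (v (cis t * cpl z) - eta) 0)%:E + (pi2 * eta)%:E)%E.
  rewrite -Iv; have -> : (pi2 * eta)%:E = (\int[mu]_(t in `[0%R, pi2]) eta%:E)%E.
    rewrite integral_cst; last exact: measurable_itv.
    rewrite /= lebesgue_measure_itv/= lte_fin pi0 -EFinB subr0 -EFinM mulrC//.
  rewrite -ge0_integralD//; last 3 first.
  - by move=> t _; rewrite lee_fin.
  - apply/measurable_EFinP; apply: measurable_maxr => //; exact: measurable_funB.
  - by move=> t _; rewrite lee_fin ltW.
  apply: ge0_le_integral => //.
  - by move=> t _; rewrite lee_fin.
  - exact/measurable_EFinP.
  - apply/measurable_EFinP; apply: measurable_funD => //; apply: measurable_maxr => //; exact: measurable_funB.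
  by move=> t _; rewrite -EFinD lee_fin -lerBlDr le_max lexx.
case: (integral _ _ _) => [A| |]; first by rewrite -EFinD !lee_fin; lra.
  by rewrite addye ?leey.
by rewrite addNye.
Qed.

Lemma ln_diff_le (x y : R) : 1 <= x -> x <= y -> ln y - ln x <= y - x.
Proof.
move=> x1 xy; have x0 : 0 < x by lra.
have y0 : 0 < y by lra.
rewrite -ln_div ?posrE//; apply: le_trans (_ : y / x - 1 <= _).
  have yx0 : 0 < y / x by rewrite divr_gt0.
  by have := @le_ln1Dx _ (y / x - 1) ltac:(lra); rewrite addrC subrK.
rewrite -[X in _ - X](divff (lt0r_neq0 x0)) -mulrBl ler_pdivrMr// ler_peMr// subr_ge0//.
Qed.

(** [r n] is the radius where [z ^+ n] times the weight is maximal. Consecutive radii differ by at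
    most 1 because [wD w] grows at least like the square of the radius. *)
Lemma peaks : exists (n0 : nat) (r : nat -> R),
  [/\ forall n, (n0 <= n)%N -> [/\ 1 <= r n, wD w (r n) = n%:R &
        forall y, 0 < y -> (y - r n) ^+ 2 <= gap w (r n) y],
      forall n, (n0 <= n)%N -> r n <= r n.+1 <= r n + 1 &
      forall X, exists N, forall n, (N <= n)%N -> (n0 <= n)%N -> X <= r n].
Proof.
have [ra ra1 raP] := gap_quad w (ltr01 : (0 : R) < 1); have [rb rb1 rbP] := wD_growth w 2.
pose x0 := Num.max ra rb.
have ax0 : ra <= x0 by rewrite le_max lexx.
have bx0 : rb <= x0 by rewrite le_max lexx orbT.
have x00 : 0 < x0 by lra.
pose n0 := (Num.truncn (wD w x0)).+1.
have n0P n : (n0 <= n)%N -> wD w x0 <= n%:R.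
  by move=> nn; apply: le_trans (ltW (truncnS_gt _)) _; rewrite ler_nat.
have exr n : exists y, (n0 <= n)%N -> x0 <= y /\ wD w y = n%:R.
  have [nn|_] := boolP (n0 <= n)%N; last by exists 0.
  by have [y xy yE] := wD_IVT x00 (n0P _ nn); exists y.
have [r rP] := choice exr.
have mono x y : 0 < y -> wD w x < wD w y -> x <= y.
  move=> y0 h; rewrite leNgt; apply/negP => /ltW yx.
  by have := wD_ndecr w y0 yx; rewrite leNgt h.
exists n0, r; split.
- move=> n nn; have [r1 r2] := rP n nn; split => //; first lra.
  by move=> y y0; have := raP (r n) y (le_trans ax0 r1) y0; rewrite mul1r.
- move=> n nn; have [r1 r2] := rP n nn; have [s1 s2] := rP n.+1 (leqW nn).
  have rs : r n <= r n.+1 by apply: mono; [lra|rewrite r2 s2 ltr_nat].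
  have d1 : n.+1%:R - n%:R = 1 :> R by rewrite -natr1 addrAC subrr add0r.
  rewrite rs /=; have := rbP (r n) (r n.+1) (le_trans bx0 r1) rs; rewrite r2 s2 d1.
  have : (1 : R) <= r n by lra.
  by move: rs; move: (r n) (r n.+1) => a b ab a1 h; nra.
move=> X; exists (Num.truncn (wD w (Num.max X 1))).+1 => n nN nn.
have [r1 r2] := rP n nn; apply: (@le_trans _ _ (Num.max X 1)); first by rewrite le_max lexx.
apply: mono; first by lra.
by rewrite r2; apply: lt_le_trans (truncnS_gt _) _; rewrite ler_nat.
Qed.

Lemma gap_sym x y : gap w x y + gap w y x = (wD w y - wD w x) * (ln y - ln x).
Proof. by rewrite /gap; ring. Qed.

Lemma gap_change x y t : gap w y t = gap w x t - gap w x y + (wD w y - wD w x) * (ln y - ln t).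
Proof. by rewrite /gap; ring. Qed.

(* The peaks are far enough apart for the normalised monomials to decay geometrically
   past their neighbours, and close enough for them to cover the half-line. *)
Lemma gap_chain : exists (nn : nat -> nat) (s : nat -> R),
  [/\ forall k, 1 <= s k /\ wD w (s k) = (nn k)%:R,
      forall k, (nn k < nn k.+1)%N /\ s k <= s k.+1,
      forall k, 1 <= gap w (s k) (s k.+1) /\ 1 <= gap w (s k.+1) (s k),
      forall k y, s k <= y -> y <= s k.+1 -> gap w (s k) y <= 4 \/ gap w (s k.+1) y <= 4 &
      forall X, exists k, X <= s k].
Proof.
have [n0 [r [rP r1 rX]]] := peaks.
have rmono m n : (n0 <= m)%N -> (m <= n)%N -> r m <= r n.
  move=> nm; elim: n => [|n IH]; first by rewrite leqn0 => /eqP ->.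
  rewrite leq_eqVlt => /predU1P[->//|mn].
  by apply: le_trans (IH mn) _; have /andP[] := r1 n (leq_trans nm mn).
pose next m n := [/\ (m < n)%N, 1 <= gap w (r m) (r n), 1 <= gap w (r n) (r m) &
  forall y, r m <= y -> y <= r n -> gap w (r m) y <= 4 \/ gap w (r n) y <= 4].
have ex m : (n0 <= m)%N -> exists n, next m n.
  move=> nm; have [rm1 rmE rmG] := rP m nm.
  pose P n := [&& (m < n)%N, 1 <= gap w (r m) (r n) & 1 <= gap w (r n) (r m)].
  have exP : exists n, P n.
    have [N NP] := rX (r m + 1); pose n := maxn N m.+1.
    have mn : (m < n)%N by rewrite leq_max leqnn orbT.
    have nn := leq_trans nm (ltnW mn).
    have := NP n (leq_maxl _ _) nn; have [rn1 rnE rnG] := rP n nn => h.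
    have h2 : 1 <= (r n - r m) ^+ 2 by nra.
    exists n; rewrite /P mn /=; apply/andP; split.
      by apply: le_trans (rmG _ _) => //; lra.
    by apply: le_trans (rnG _ _); [rewrite -sqrrN opprB|lra].
  case: (ex_minnP exP) => n /and3P[mn g1 g2] min; exists n; split => //.
  case: n mn g1 g2 min => // n; rewrite ltnS => mn g1 g2 min.
  have nn := leq_trans nm mn; have [rn1 rnE rnG] := rP n nn.
  have [rs1 rsE rsG] := rP n.+1 (leqW nn); have /andP[rns rsn] := r1 n nn.
  (* By minimality the index just before the chosen one is not yet separated from [m]. *)
  have H : gap w (r m) (r n) < 1 \/ gap w (r n) (r m) < 1.
    apply/orP; rewrite -[_ || _]negbK negb_or -!leNgt; apply/negP => /andP[h1 h2].
    move: mn; rewrite leq_eqVlt => /predU1P[E|mn].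
      by move: h1; rewrite E gap0 ler10.
    by have := min n; rewrite /P mn h1 h2 ltnn => /(_ isT).
  have d1 : wD w (r n.+1) - wD w (r n) = 1 by rewrite rsE rnE -natr1 addrAC subrr add0r.
  move=> y my ys; have y1 : 1 <= y := le_trans rm1 my; have [ny|/ltW yn] := leP (r n) y.
    right; apply: le_trans (gap_down w _ ny ys) _; first by lra.
    have := gap_sym (r n) (r n.+1); have := gap_ge0 w (r := r n) (x := r n.+1).
    have := ln_diff_le rn1 rns; rewrite d1 mul1r => h1 h2 h3.
    by have := h2 ltac:(lra) ltac:(lra); lra.
  case: H => H; first by left; apply: le_trans (gap_up w _ my yn) _; lra.
  (* The height is moved from the peak [r n] to the next one; the degrees differ by 1, so the change
     is at most a difference of logarithms. *)
  right; rewrite (gap_change (r n)) d1 mul1r.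
  have := ln_diff_le y1 ys; have := gap_ge0 w (r := r n) (x := r n.+1) ltac:(lra) ltac:(lra).
  have : gap w (r n) y <= gap w (r n) (r m) by apply: gap_down => //; lra.
  have : r n - r m <= 1 by have := rnG (r m) ltac:(lra); nra.
  by lra.
have exn m : exists n, (n0 <= m)%N -> next m n.
  by have [/ex[n nP]|_] := boolP (n0 <= m)%N; [exists n|exists 0%N].
have [nx nxP] := choice exn.
pose nn k := iter k nx n0.
have nn0 k : (n0 <= nn k)%N.
  by elim: k => //= k IH; have [h _ _ _] := nxP _ IH; exact: leq_trans IH (ltnW h).
exists nn, (r \o nn); split.
- by move=> k; have [? ? _] := rP _ (nn0 k).
- by move=> k; have [h _ _ _] := nxP _ (nn0 k); split => //; exact: rmono (ltnW h).
- by move=> k; have [_ h h' _] := nxP _ (nn0 k).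
- by move=> k; have [_ _ _ h] := nxP _ (nn0 k).
have nnk k : (k <= nn k)%N.
  by elim: k => //= k IH; have [h _ _ _] := nxP _ (nn0 k); exact: leq_ltn_trans IH h.
by move=> X; have [N NP] := rX X; exists N; exact: NP (nnk N) (nn0 N).
Qed.

End gap_series.

Section gap_polynomials.
Context {R : realType} (w : weight R) (nn : nat -> nat) (s : nat -> R).
Context (sP : forall k, 1 <= s k /\ wD w (s k) = (nn k)%:R).
Context (nnP : forall k, (nn k < nn k.+1)%N /\ s k <= s k.+1).
Context (gP : forall k, 1 <= gap w (s k) (s k.+1) /\ 1 <= gap w (s k.+1) (s k)).
Implicit Types (y : R) (z : R[i]) (k K : nat).

Definition bell k y := expR (- gap w (s k) y).

Lemma expR_half (a b : R) : a + 1 <= b -> expR (- b) <= expR (- a) / 2.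
Proof.
move=> ab; rewrite !expRN -invfM lef_pV2 ?posrE ?mulr_gt0 ?expR_gt0//.
apply: (@le_trans _ _ (expR (a + 1))); last by rewrite ler_expR.
by rewrite expRD ler_pM2l ?expR_gt0//; have := expR_ge1Dx (1 : R); lra.
Qed.

Lemma bell_left k y : 0 < y -> y <= s k -> bell k.+1 y <= bell k y / 2.
Proof.
move=> y0 ys; apply: expR_half; have [s1 d1] := sP k; have [s2 d2] := sP k.+1.
have [g1 g2] := gP k; have [n1 s12] := nnP k.
have D0 : 0 <= wD w (s k.+1) - wD w (s k) by rewrite subr_ge0 d1 d2 ler_nat ltnW.
have l0 : ln y <= ln (s k) by rewrite ler_ln ?posrE//; lra.
have := mulr_ge0 D0 (eq_ind_r (fun b : bool => is_true b) l0 (subr_ge0 _ _)).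
have := gap_sym w (s k) (s k.+1); rewrite (gap_change w (s k) (s k.+1) y).
by move: (wD w (s k.+1) - wD w (s k)) => D; lra.
Qed.

Lemma bell_right k y : s k.+1 <= y -> bell k y <= bell k.+1 y / 2.
Proof.
move=> sy; apply: expR_half; have [s1 d1] := sP k; have [s2 d2] := sP k.+1.
have [g1 g2] := gP k; have [n1 s12] := nnP k.
have D0 : 0 <= wD w (s k.+1) - wD w (s k) by rewrite subr_ge0 d1 d2 ler_nat ltnW.
have l0 : ln (s k.+1) <= ln y by rewrite ler_ln ?posrE//; lra.
have := mulr_ge0 D0 (eq_ind_r (fun b : bool => is_true b) l0 (subr_ge0 _ _)).
have := gap_sym w (s k) (s k.+1); rewrite (gap_change w (s k) (s k.+1) y).
by move: (wD w (s k.+1) - wD w (s k)) => D; lra.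
Qed.

Lemma bell_le1 k y : 0 < y -> bell k y <= 1.
Proof.
move=> y0; have [s1 _] := sP k.
by rewrite -expR0 ler_expR oppr_le0 gap_ge0//; lra.
Qed.

(** Seen from [y], the terms grow geometrically up to the nearest peaks and then halve. Subtracting
    [2 * bell K y] leaves room for the next term, which is at most half of [bell K y] once [y] is to
    the left of [s K]. *)
Lemma bell_sum_aux K y : 0 < y ->
  (s K <= y -> \sum_(k < K) bell k y <= bell K y) /\
  (y < s K -> \sum_(k < K) bell k y <= 4 - 2 * bell K y).
Proof.
move=> y0; elim: K => [|K [IH1 IH2]].
  rewrite big_ord0; split => _; first exact: expR_ge0.
  by have := bell_le1 0 y0; lra.
rewrite big_ord_recr /=; split => h.
  have := bell_right h; have := IH1 (le_trans (nnP K).2 h).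
  by move: (\sum_(_ < _) _) => S; lra.
have := bell_le1 K.+1 y0; have := bell_le1 K y0.
have [sy|ys] := leP (s K) y.
  by have := IH1 sy; move: (\sum_(_ < _) _) => S; lra.
by have := bell_left y0 (ltW ys); have := IH2 ys; move: (\sum_(_ < _) _) => S; lra.
Qed.

Lemma bell_sum K y : 0 < y -> \sum_(k < K) bell k y <= 4.
Proof.
move=> y0; have [h1 h2] := bell_sum_aux K y0.
have := bell_le1 K y0; have : 0 <= bell K y by exact: expR_ge0.
have [/h1|/h2] := leP (s K) y; by move: (\sum_(_ < _) _) => S; lra.
Qed.

(** Normalises the monomial so that its product with the weight has maximum 1, attained at [s k]. *)
Definition gap_coef k : R := expR (w (s k) - (nn k)%:R * ln (s k)).

Definition gap_poly K z : R[i] := \sum_(k < K) (gap_coef k)%:C * z ^+ nn k.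

Lemma gap_coefE k y : 0 < y -> gap_coef k * y ^+ nn k * expR (- w y) = bell k y.
Proof.
move=> y0; rewrite -{1}(lnK (x := y)) ?posrE// -expRM_natl -!expRD; congr expR.
by have [_ d] := sP k; rewrite /gap d; ring.
Qed.

Lemma gap_poly_term k z : normc ((gap_coef k)%:C * z ^+ nn k) = gap_coef k * normc z ^+ nn k.
Proof. by rewrite normcM normcX normc_real_ge0 ?expR_ge0. Qed.

Lemma gap_poly_le K z : normc (gap_poly K z) * expR (- w (normc z)) <= 4.
Proof.
have [z0|] := ltP 0 (normc z); last first.
  move=> z0; have -> : z = 0 by apply/eqP; rewrite -normc_eq0 eq_le z0 normc_ge0.
  rewrite /gap_poly big1 ?normc0 ?mul0r// => k _; rewrite expr0n.
  (* The degree is positive because [wD w (s k)] is, so the polynomial vanishes at 0. *)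
  have [s1 d] := sP k; have := wD_gt0 w (x := s k) ltac:(lra).
  by rewrite d ltr0n lt0n => /negbTE ->; rewrite mulr0.
apply: le_trans (bell_sum K z0).
rewrite /gap_poly; elim: K => [|K IH]; first by rewrite !big_ord0 normc0 mul0r.
rewrite !big_ord_recr /=; apply: le_trans (_ : (normc (\sum_(k < K) (gap_coef k)%:C * z ^+ nn k) + normc ((gap_coef K)%:C * z ^+ nn K)) * expR (- w (normc z)) <= _).
  by rewrite ler_wpM2r ?expR_ge0// le_normcD.
by rewrite mulrDl gap_poly_term gap_coefE// lerD2r.
Qed.

Lemma nn_mono j k : (j < k)%N -> (nn j < nn k)%N.
Proof.
elim: k => // k IH; rewrite ltnS leq_eqVlt => /predU1P[->|/IH h]; first exact: (nnP k).1.
exact: ltn_trans h (nnP k).1.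
Qed.

Lemma gap_poly_mem p K : gap_poly K \in fock_pred w p.
Proof.
have -> : gap_poly K = \sum_(k < K) (gap_coef k)%:C *: (fun z : R[i] => z ^+ nn k).
  by apply/funext => z; rewrite /gap_poly fct_sumE; apply: eq_bigr.
by apply: rpred_sum => k _; apply: rpredZ; exact: mono_mem.
Qed.

Lemma gap_poly_entire K : entire (gap_poly K).
Proof. exact (@entire_sum R K _ (fun k => entireM (entire_cst (gap_coef k)%:C) (entireX (nn k)))). Qed.

Lemma coef_gap_poly K k : (k < K)%N -> coef (gap_poly K) (nn k) = (gap_coef k)%:C.
Proof.
have H J m : coef (gap_poly J) m = \sum_(j < J) (gap_coef j)%:C * (nn j == m)%:R.
  elim: J => [|J IH].
    have -> : gap_poly 0 = fun z => 0 * z.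
      by apply/funext => z; rewrite /gap_poly big_ord0 mul0r.
    by rewrite (coefZ 0 m entire_id) mul0r big_ord0.
  have -> : gap_poly J.+1 = fun z => gap_poly J z + (gap_coef J)%:C * z ^+ nn J.
    by apply/funext => z; rewrite /gap_poly big_ord_recr.
  have e2 : entire (fun z => (gap_coef J)%:C * z ^+ nn J) := entireM (entire_cst _) (entireX _).
  by rewrite (coefD _ (@gap_poly_entire J) e2) (coefZ _ _ (entireX (nn J))) coefX IH big_ord_recr.
move=> kK; rewrite H (bigD1 (Ordinal kK))//= eqxx mulr1 big1 ?addr0// => j; rewrite -val_eqE /= => jk.
have [/nn_mono h|/nn_mono h|E] := ltngtP j k; last by move: jk; rewrite E eqxx.
  by rewrite ltn_eqF ?mulr0.
by rewrite gtn_eqF ?mulr0.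
Qed.

End gap_polynomials.

(** * No embedding into spaces of smaller exponent *)

Section no_embedding_gt.
Context {R : realType} (w : weight R).
Local Notation mu := (@lebesgue_measure R).
Local Notation MR := (measurableTypeR R).
Local Notation plane := (MR * MR)%type.
Implicit Types (p q : {posnum R}).

Lemma annulus_area (a X : R) : 0 <= a ->
  (X%:E <= \int[area]_z (band `[a, a + 2 * X + 3[ (normc (cpl z)))%:E :> \bar R)%E \/ X < 0.
Proof.
move=> a0; have [X0|X0] := leP 0 X; last by right.
left; set b := a + 2 * X + 3.
(* The rectangle with sides [1 + X] and 1 lies in the annulus. *)
pose I : set MR := `[a, a + 1 + X]%classic; pose J : set MR := `[0, 1]%classic.
have mI : measurable I by exact: measurable_itv.
have mJ : measurable J by exact: measurable_itv.
apply: (@le_trans _ _ (\int[area]_z (\1_(I `*` J) z)%:E)%E).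
  rewrite integral_indic//; last exact: measurableX.
  rewrite setIT (_ : _ (I `*` J) = mu I * mu J)%E; last exact: product_measure1E.
  rewrite /I /J !lebesgue_measure_itv/= !lte_fin ltr01 -addrA ltrDl.
  rewrite (_ : 0 < 1 + X)//; last by lra.
  by rewrite -!EFinB -EFinM lee_fin; lra.
apply: ge0_le_integral => //.
- by apply/measurable_EFinP; apply: measurable_indic; exact: measurableX.
- by apply/measurable_EFinP; apply: (measurable_radial (f := band `[a, b[)); case: (nice_band `[a, b[).
move=> [u v] _; rewrite lee_fin bandE indicE.
case: (boolP (_ \in _)) => [|_]; last by [].
rewrite inE => -[]; rewrite /I /J /= !in_itv/= => /andP[u1 u2] /andP[v1 v2].
have h1 := normc_le u v; have h2 := normc_Re (u +i* v); move: h1 h2.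
rewrite -/(cpl (u, v)) ger0_norm ?(le_trans a0 u1)// (ger0_norm v1) => h1.
move=> h2; suff -> : (a <= normc (cpl (u, v)) < b) = true by [].
by rewrite (le_trans u1 h2) (le_lt_trans h1)//= /b; lra.
Qed.

Lemma annulus_mono (a b c : R) : b <= c ->
  (\int[area]_z (band `[a, b[ (normc (cpl z)))%:E <= \int[area]_z (band `[a, c[ (normc (cpl z)))%:E)%E.
Proof.
move=> bc; have m i : measurable_fun [set: plane] (fun z : plane => (band i (normc (cpl z)))%:E).
  by apply/measurable_EFinP; apply: (measurable_radial (f := band i)); case: (nice_band i).
apply: ge0_le_integral; [exact: measurableT| |exact: m|exact: m|].
  by move=> z _; rewrite lee_fin; case: (nice_band `[a, b[).
move=> z _; rewrite lee_fin !bandE !in_itv/=.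
case: (a <= _) => //=.
by have [h|] := ltP (normc (cpl z)) b; rewrite ?(lt_le_trans h bc).
Qed.

(** Let [I] be the integral for [q] of a lacunary sum. As the sum times the weight is at most 4, its
    integral for [p] is at most a constant times [I], so an embedding would give
    [I <= D * I ^ (q / p)], which bounds [I]. But [I] is at least [c] times the area of an
    arbitrarily large annulus. *)
Lemma no_embedding_gt p q (M : R) : q%:num < p%:num ->
  ~ (forall f : fock w p, (fock_integral w q f <= (M * fn f `^ q%:num)%:E)%E).
Proof.
move=> qp H; have [nn [s [sP nnP gP cov sX]]] := gap_chain w.
have p0 : 0 < p%:num :> R by []. have q0 : 0 < q%:num :> R by [].
have smono j k : (j <= k)%N -> s j <= s k.
  elim: k => [|k IH]; first by rewrite leqn0 => /eqP ->.
  by rewrite leq_eqVlt => /predU1P[->//|/IH h]; exact: le_trans h (nnP k).2.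
pose eps : R := expR (- 4); pose c := (eps / 4) `^ q%:num / 4 * (eps / 4).
have c0 : 0 < c by rewrite !mulr_gt0 ?powR_gt0 ?invr_gt0 ?mulr_gt0 ?expR_gt0 ?invr_gt0.
pose f K : fock w p := Fock (gap_poly_mem w nn s p K).
have fq K : exists2 I : R, 0 <= I & fock_integral w q (gap_poly w nn s K) = I%:E.
  exists (fn (Fock (gap_poly_mem w nn s q K)) `^ q%:num); first exact: powR_ge0.
  exact (fn_integral (Fock (gap_poly_mem w nn s q K))).
have low K : (c%:E * \int[area]_z (band `[s 0, s K[ (normc (cpl z)))%:E <= fock_integral w q (gap_poly w nn s K.+1))%E.
  apply: average_lower; [exact (@gap_poly_entire R w nn s K.+1)|exact: expR_gt0| |].
    by move=> z _; apply: (gap_poly_le sP nnP gP).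
  move=> y yi; have {yi} /andP[sy ys] : s 0%N <= y < s K by move: yi; rewrite in_itv.
  have y0 : 0 < y by have [h _] := sP 0%N; lra.
  have [k kK gk] : exists2 k, (k < K.+1)%N & gap w (s k) y <= 4.
    elim: K ys => [|K IH] ys; first by move: (le_lt_trans sy ys); rewrite ltxx.
    have [sKy|/IH[k kK gk]] := leP (s K) y; last by exists k => //; exact: leqW.
    by have [h|h] := cov K y sKy (ltW ys); [exists K|exists K.+1].
  exists (nn k); rewrite (coef_gap_poly w nnP kK) normc_real_ge0 ?expR_ge0// (gap_coefE sP)//.
  by rewrite ler_expR lerN2.
have up K I : fock_integral w q (gap_poly w nn s K) = I%:E -> fn (f K) `^ p%:num <= 4 `^ (p%:num - q%:num) * I.
  move=> IE; rewrite -lee_fin -fn_integral EFinM -IE -(ge0_integralZl _ measurableT (fock_integrand_measurable _ _ (@gap_poly_entire R w nn s K))) ?lee_fin ?powR_ge0//; last first.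
    by move=> z _; rewrite lee_fin mulr_ge0 ?powR_ge0 ?expR_ge0.
  apply: ge0_le_integral => //.
  - by move=> z _; rewrite lee_fin mulr_ge0 ?powR_ge0 ?expR_ge0.
  - exact: (fock_integrand_measurable _ _ (@gap_poly_entire R w nn s K)).
  - apply: measurable_funeM; exact: (fock_integrand_measurable _ _ (@gap_poly_entire R w nn s K)).
  move=> z _; rewrite -EFinM lee_fin -/(cpl z) -[f K _]/(gap_poly w nn s K (cpl z)).
  have E (r : {posnum R}) : normc (gap_poly w nn s K (cpl z)) `^ r%:num * expR (- r%:num * w (normc (cpl z))) =
      (normc (gap_poly w nn s K (cpl z)) * expR (- w (normc (cpl z)))) `^ r%:num.
    by rewrite powRM ?normc_ge0 ?expR_ge0// -expRM; congr (_ * expR _); ring.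
  rewrite !E.
  have v4 : normc (gap_poly w nn s K (cpl z)) * expR (- w (normc (cpl z))) <= 4.
    exact: (gap_poly_le sP nnP gP).
  have v0 : 0 <= normc (gap_poly w nn s K (cpl z)) * expR (- w (normc (cpl z))).
    by rewrite mulr_ge0 ?normc_ge0 ?expR_ge0.
  move: v0 v4; move: (_ * expR _) => v v0 v4.
  have -> : v `^ p%:num = v `^ (p%:num - q%:num) * v `^ q%:num.
    by rewrite -powRD subrK// (gt_eqF p0).
  rewrite ler_wpM2r ?powR_ge0//; apply: ge0_ler_powR; rewrite ?nnegrE//.
  by rewrite subr_ge0 ltW.
pose D := (`|M| + 1) * (4 `^ (p%:num - q%:num)) `^ (q%:num / p%:num).
have D0 : 0 < D by rewrite mulr_gt0 ?powR_gt0// ltr_wpDl.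
pose t := q%:num / p%:num : R.
have t0 : 0 < t by rewrite divr_gt0.
have t1 : 0 < 1 - t by rewrite subr_gt0 ltr_pdivrMr// mul1r.
have bd K I : fock_integral w q (gap_poly w nn s K) = I%:E -> 0 < I -> I <= D `^ (1 - t)^-1.
  move=> IE I0; have := H (f K); rewrite (IE : fock_integral w q (f K) = I%:E) lee_fin => h1.
  have h2 : fn (f K) `^ q%:num <= (4 `^ (p%:num - q%:num) * I) `^ t.
    have -> : fn (f K) `^ q%:num = (fn (f K) `^ p%:num) `^ t.
      by rewrite -powRrM /t mulrCA divff ?gt_eqF// mulr1.
    apply: ge0_ler_powR; rewrite ?nnegrE ?powR_ge0 ?mulr_ge0 ?powR_ge0 ?(ltW I0) ?(ltW t0)//.
    exact: up.
  have h3 : I <= D * I `^ t.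
    apply: le_trans h1 _; apply: le_trans (_ : (`|M| + 1) * fn (f K) `^ q%:num <= _).
      by rewrite ler_wpM2r ?powR_ge0//; apply: le_trans (ler_norm M) _; rewrite lerDl.
    rewrite /D -mulrA ler_wpM2l ?addr_ge0//; apply: le_trans h2 _.
    by rewrite powRM ?powR_ge0 ?(ltW I0).
  have h4 : I `^ (1 - t) <= D.
    rewrite -(ler_pM2r (powR_gt0 t I0)) -powRD ?subrK ?powRr1 ?(ltW I0)//.
    by apply/implyP => _; rewrite gt_eqF.
  have -> : I = (I `^ (1 - t)) `^ (1 - t)^-1 by rewrite -powRrM divff ?gt_eqF// powRr1// ltW.
  by apply: ge0_ler_powR; rewrite ?nnegrE ?powR_ge0 ?invr_ge0 ?(ltW D0) ?(ltW t1).
(* Makes [c * X] exceed the bound [bd] by [c]. *)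
pose X := D `^ (1 - t)^-1 / c + 1.
have X0 : 0 < X by rewrite ltr_wpDl// divr_ge0 ?powR_ge0// ltW.
have [K sK] := sX (s 0%N + 2 * X + 3).
have s00 : 0 <= s 0%N by have [h _] := sP 0%N; lra.
have [ar|] := annulus_area X s00; last by rewrite ltNge (ltW X0).
have [I I0 IE] := fq K.+1.
have cX : c * X <= I.
  rewrite -lee_fin -IE; apply: le_trans (low K); rewrite EFinM; apply: lee_wpmul2l.
    by rewrite lee_fin ltW.
  exact: le_trans ar (annulus_mono _ sK).
have Ipos : 0 < I by apply: lt_le_trans cX; rewrite mulr_gt0.
have := le_trans cX (bd _ _ IE Ipos).
rewrite /X mulrDr mulr1 mulrC divfK ?gt_eqF//; lra.
Qed.

End no_embedding_gt.

Section different_exponents.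
Context {R : realType} (w : weight R).
Implicit Types (p q : {posnum R}).

Lemma no_embedding p q (M : R) : p%:num <> q%:num ->
  ~ (forall f : fock w p, (fock_integral w q f <= (M * fn f `^ q%:num)%:E)%E).
Proof.
move=> /eqP; rewrite neq_lt => /orP[pq|qp]; first exact: (no_embedding_lt pq).
exact: (no_embedding_gt qp).
Qed.

Lemma rotation_unbounded p q a : p%:num <> q%:num -> normc a = 1 -> ~ bounded_symbol w p q (aff a 0).
Proof.
move=> pq a1 bs; have [M M0 MP] := bounded_fn bs.
apply: (no_embedding (M := M `^ q%:num) pq) => f.
have E : fock_integral w q (comp_oper w p q (aff a 0) f) = fock_integral w q f.
  rewrite (comp_operE f bs) -[RHS](fock_integral_rotation w q (fent f) a1); congr (fock_integral w q _).
  by apply/funext => z; rewrite /aff /= addr0.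
have q0 : 0 <= q%:num :> R by [].
rewrite -E fn_integral lee_fin -(powRM _ M0 (fn_ge0 f)).
have := MP f; have := fn_ge0 (comp_oper w p q (aff a 0) f); have := fn_ge0 f.
move: (fn _) (fn _) => x y x0 y0 h.
by apply: ge0_ler_powR; rewrite ?nnegrE ?mulr_ge0.
Qed.

Lemma connected_comp_opers p q : p%:num <> q%:num -> connected (comp_opers w p q).
Proof.
move=> pq; suff -> : comp_opers w p q = contractions w p q by exact: contractions_connected.
apply/seteqP; split => [_ [psi bs <-]|S]; last exact: contractions_sub.
have [[a [b [E a1]]]|[a E a1]] := symbol_cases bs; first by rewrite E; exact: contractionsI.
by exfalso; apply: (rotation_unbounded pq a1); rewrite -E.
Qed.

End different_exponents.

(** * Singular values *)

Section conjugation.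
Context {R : realType}.
Implicit Types (a b z : R[i]).

Lemma conjcD a b : conjc (a + b) = conjc a + conjc b. Proof. exact: rmorphD. Qed.

Lemma conjcM a b : conjc (a * b) = conjc a * conjc b. Proof. exact: rmorphM. Qed.

Lemma conjcN a : conjc (- a) = - conjc a. Proof. exact: rmorphN. Qed.

Lemma conjcR (x : R) : conjc x%:C = x%:C. Proof. by rewrite /= oppr0. Qed.

Lemma mul_conjc z : conjc z * z = (normc z ^+ 2)%:C.
Proof.
by case: z => u v; rewrite normc_sqr; apply/eqP; rewrite eq_complex /=; apply/andP; split; apply/eqP; ring.
Qed.

End conjugation.

(** * Hermitian forms *)

Section hermitian.
Context {R : realType} {V : lmodType R[i]} (b : V -> V -> R[i]).
Context (bl : forall a f g h, b (a *: f + g) h = a * b f h + b g h).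
Context (bC : forall f g, b g f = conjc (b f g)).

Lemma formD f g h : b (f + g) h = b f h + b g h.
Proof. by rewrite -[f]scale1r bl mul1r scale1r. Qed.

Lemma form0 h : b 0 h = 0.
Proof. by apply: (addrI (b 0 h)); rewrite -formD !addr0. Qed.

Lemma formZ a f h : b (a *: f) h = a * b f h.
Proof. by rewrite -[a *: f]addr0 bl form0 addr0. Qed.

Lemma formDr f g h : b h (f + g) = b h f + b h g.
Proof. by rewrite bC formD conjcD -!bC. Qed.

Lemma form0r h : b h 0 = 0.
Proof. by rewrite bC form0 (conjcR 0). Qed.

Lemma formZr a f h : b h (a *: f) = conjc a * b h f.
Proof. by rewrite bC formZ conjcM -bC. Qed.

Lemma formN f h : b (- f) h = - b f h.
Proof. by rewrite -scaleN1r formZ mulN1r. Qed.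

Lemma formNr f h : b h (- f) = - b h f.
Proof. by rewrite -scaleN1r formZr conjcN (conjcR 1) mulN1r. Qed.

Lemma form_suml (I : Type) (r : seq I) (P : pred I) (F : I -> V) h :
  b (\sum_(i <- r | P i) F i) h = \sum_(i <- r | P i) b (F i) h.
Proof. by apply: (big_morph (b^~ h)) => [f g|]; [exact: formD|exact: form0]. Qed.

Lemma form_sumr (I : Type) (r : seq I) (P : pred I) (F : I -> V) h :
  b h (\sum_(i <- r | P i) F i) = \sum_(i <- r | P i) b h (F i).
Proof. by apply: (big_morph (b h)) => [f g|]; [exact: formDr|exact: form0r]. Qed.

Lemma form_real f : b f f = (complex.Re (b f f))%:C.
Proof.
have := bC f f; case: (b f f) => u v /eqP; rewrite eq_complex /= => /andP[_ /eqP vv].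
by have -> : v = 0 by lra.
Qed.

(** A nonnegative quadratic function of [s] that vanishes at 0 has no linear term. It is tested at
    [s = - t * b e h], with [t] so small that the quadratic term cannot compensate. *)
Lemma form_vertex e h : complex.Re (b e e) = 0 ->
  (forall s, 0 <= complex.Re (b (e + s *: h) (e + s *: h))) -> b e h = 0.
Proof.
move=> e0 H; pose Q := complex.Re (b h h); pose t := (`|Q| + 1)^-1.
have t0 : 0 < t by rewrite invr_gt0 ltr_wpDl.
have tQ : t * Q <= 1.
  by rewrite mulrC ler_pdivrMr ?ltr_wpDl// mul1r; apply: le_trans (ler_norm _) _; rewrite lerDl.
have := H (- t%:C * b e h).
rewrite formD !formDr !formZ !formZr (bC e h) !conjcM !conjcN conjcR (form_real e) e0 (form_real h) -/Q.
have E := mul_conjc (b e h); move: (b e h) E => B E.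
have -> : 0%:C + - t%:C * conjc B * B + (- t%:C * B * conjc B + - t%:C * B * (- t%:C * conjc B * Q%:C)) =
   ((normc B ^+ 2) * (t * (t * Q - 2)))%:C.
  have CM x y : (x * y)%:C = x%:C * y%:C := rmorphM (real_complex R) x y.
  have CB x y : (x - y)%:C = x%:C - y%:C := rmorphB (real_complex R) x y.
  have -> : (normc B ^+ 2 * (t * (t * Q - 2)))%:C = conjc B * B * (t%:C * (t%:C * Q%:C) - t%:C - t%:C).
    by rewrite E -!CM -!CB -CM; congr (_%:C); ring.
  by rewrite (_ : 0%:C = 0)//; ring.
rewrite [complex.Re _]/=.
have neg : t * (t * Q - 2) < 0 by rewrite pmulr_rlt0//; lra.
rewrite nmulr_lge0// => h2; apply/eqP; rewrite -normc_eq0 -sqrf_eq0 eq_le h2 sqr_ge0//.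
Qed.

Lemma form_pythagoras n (x : 'I_n -> R[i]) (v : 'I_n -> V) (c : 'I_n -> R) :
  (forall i j, b (v i) (v j) = (i == j)%:R * (c i)%:C) ->
  complex.Re (b (\sum_i x i *: v i) (\sum_i x i *: v i)) = \sum_i normc (x i) ^+ 2 * c i.
Proof.
move=> H; rewrite form_suml.
have -> : \sum_i b (x i *: v i) (\sum_j x j *: v j) = (\sum_i normc (x i) ^+ 2 * c i)%:C.
  rewrite (raddf_sum (real_complex R)); apply: eq_bigr => i _.
  rewrite formZ form_sumr (bigD1 i)//= big1 => [|j ji]; last by rewrite formZr H eq_sym (negbTE ji) mul0r mulr0.
  by rewrite addr0 formZr H eqxx mul1r mulrA [x i * _]mulrC mul_conjc -rmorphM.
by [].
Qed.

End hermitian.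

Lemma homogeneous_solution (F : fieldType) n (A : 'M[F]_(n.+1, n)) : exists2 x : 'rV[F]_n.+1, x != 0 & x *m A = 0.
Proof.
have : kermx A != 0.
  by rewrite kermx_eq0 /row_free neq_ltn ltnS rank_leq_col.
by move=> /rowV0Pn[x /sub_kermxP xA x0]; exists x.
Qed.

(** * Singular vectors by successive maximisation *)

Section spectral.
Context {R : realType} {V : lmodType R[i]} (ip : V -> V -> R[i]) (T S : V -> V).
Context (ipl : forall a f g h, ip (a *: f + g) h = a * ip f h + ip g h).
Context (ipC : forall f g, ip g f = conjc (ip f g)).
Local Notation N f := (complex.Re (ip f f)).
Context (ip_ge0 : forall f, 0 <= N f).
Context (ip_eq0 : forall f, N f = 0 -> f = 0).
Context (Tl : forall a f g, T (a *: f + g) = a *: T f + T g).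
Context (TS : forall f g, ip (T f) g = ip f (S g)).
Context (maximizer : forall L : seq V, exists f, [/\ N f <= 1,
  forall g, g \in L -> ip (T f) (T g) = 0 &
  forall h, N h <= 1 -> (forall g, g \in L -> ip (T h) (T g) = 0) -> N (T h) <= N (T f)]).
Context (co : nat -> V -> R[i]) (C k : R).
Context (C0 : 0 <= C).
Context (col : forall n a f g, co n (a *: f + g) = a * co n f + co n g).
Context (k01 : 0 < k < 1).
Context (tail : forall n f, (forall m, (m < n)%N -> co m f = 0) -> N (T f) <= C * k ^+ n * N f).

Let pick := projT1 (choice maximizer).
Let pickP : forall L : seq V, [/\ N (pick L) <= 1,
  forall g, g \in L -> ip (T (pick L)) (T g) = 0 &
  forall h, N h <= 1 -> (forall g, g \in L -> ip (T h) (T g) = 0) -> N (T h) <= N (T (pick L))]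
  := projT2 (choice maximizer).

Let L := fix L n := if n is m.+1 then rcons (L m) (pick (L m)) else [::].
Let e n := pick (L n).
Let lam n := Num.sqrt (N (T (e n))).

Let bT f g := ip (T f) (T g).

Let T0 : T 0 = 0.
Proof. by have := Tl (-1) 0 0; rewrite scaler0 addr0 scaleN1r addNr. Qed.

Let bTl a f g h : bT (a *: f + g) h = a * bT f h + bT g h.
Proof. by rewrite /bT Tl ipl. Qed.

Let bTC f g : bT g f = conjc (bT f g).
Proof. exact: ipC. Qed.

Let mem_L n g : g \in L n <-> exists2 j, (j < n)%N & g = e j.
Proof.
elim: n => [|n IH]; first by split => // -[].
rewrite /= mem_rcons inE; split=> [/predU1P[->|/IH[j jn ->]]|[j]].
- by exists n.
- by exists j => //; exact: leqW.
rewrite ltnS leq_eqVlt => /predU1P[-> ->|jn gj]; first by rewrite eqxx.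
by apply/orP; right; apply/IH; exists j.
Qed.

(** The constraint is orthogonality of the images under [T]; orthogonality of the vectors themselves
    follows in [key]. *)
Let V_ n f := forall j, (j < n)%N -> bT f (e j) = 0.

Let e_V n : V_ n (e n).
Proof. by move=> j jn; have [_ h _] := pickP (L n); apply: h; apply/mem_L; exists j. Qed.

Let lam_sqr n : lam n ^+ 2 = N (T (e n)).
Proof. by rewrite sqr_sqrtr. Qed.

Let N_scale a f : N (a *: f) = normc a ^+ 2 * N f.
Proof.
rewrite (formZ ipl) (formZr ipl ipC) mulrA [a * _]mulrC mul_conjc (form_real ipC f) -rmorphM.
by [].
Qed.

Let T_scale a f : T (a *: f) = a *: T f.
Proof. by rewrite -[a *: f]addr0 Tl T0 addr0. Qed.

Let max_V n f : V_ n f -> N (T f) <= lam n ^+ 2 * N f.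
Proof.
move=> Vf; rewrite lam_sqr; have [f0|f0] := eqVneq (N f) 0.
  by rewrite (ip_eq0 f0) T0 (form0 ipl) mulr0.
have fp : 0 < N f by rewrite lt_neqAle eq_sym f0 ip_ge0.
pose c : R[i] := ((Num.sqrt (N f))^-1)%:C.
have c2 : normc c ^+ 2 = (N f)^-1.
  by rewrite normc_real_ge0 ?invr_ge0 ?sqrtr_ge0// exprVn sqr_sqrtr// ltW.
have [_ _ h] := pickP (L n); have := h (c *: f).
rewrite T_scale !N_scale c2 mulVf// lexx => /(_ isT).
rewrite mulrC ler_pdivrMr//; apply => g /mem_L[j jn ->].
by have := Vf j jn; rewrite /bT (formZ ipl) => ->; rewrite mulr0.
Qed.

Let e_norm n : 0 < lam n -> N (e n) = 1.
Proof.
move=> l0; apply/eqP; rewrite eq_le; have [-> _ _] := pickP (L n) => /=.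
have := max_V (@e_V n); rewrite -lam_sqr -{1}[lam n ^+ 2]mulr1 ler_pM2l ?exprn_gt0//.
Qed.

Let lam_ge0 n : 0 <= lam n. Proof. exact: sqrtr_ge0. Qed.

Let lam_step n : lam n.+1 <= lam n.
Proof.
apply: ler_wsqrtr; have [_ _ h] := pickP (L n); apply: h; first by have [] := pickP (L n.+1).
by move=> g /mem_L[j jn ->]; apply: (@e_V n.+1); exact: leqW.
Qed.

Let lam_mono m n : (m <= n)%N -> lam n <= lam m.
Proof.
elim: n => [|n IH]; first by rewrite leqn0 => /eqP ->.
rewrite leq_eqVlt => /predU1P[->//|/IH]; exact: le_trans (lam_step n).
Qed.

(** On [V_ n] the form [lam n ^+ 2 * ip - bT] is nonnegative and vanishes at [e n], so [form_vertex]
    gives the eigenvalue equation against [V_ n]. Any [h] enters [V_ n] after its components along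
    the earlier [e j] are removed, and these contribute 0 to both sides. *)
Let key n : 0 < lam n ->
  (forall h, bT (e n) h = (lam n ^+ 2)%:C * ip (e n) h) /\ (forall j, (j < n)%N -> ip (e n) (e j) = 0).
Proof.
elim/ltn_ind: n => n IH ln0.
have lj0 j : (j < n)%N -> 0 < lam j by move=> /ltnW/lam_mono; exact: lt_le_trans.
have l2 j : 0 < lam j -> (lam j ^+ 2)%:C != 0 :> R[i].
  by move=> lj; rewrite -normc_eq0 normc_real_ge0 ?sqr_ge0// expf_neq0// gt_eqF.
have orth j : (j < n)%N -> ip (e j) (e n) = 0.
  move=> jn; have [h _] := IH j jn (lj0 j jn); have := h (e n).
  rewrite bTC (e_V jn) (conjcR 0) => /esym/eqP; rewrite mulf_eq0 (negbTE (l2 _ (lj0 j jn))) /=.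
  by move/eqP.
have vert h : V_ n h -> bT (e n) h = (lam n ^+ 2)%:C * ip (e n) h.
  move=> Vh; pose Q f g := (lam n ^+ 2)%:C * ip f g - bT f g.
  have Ql a f g u : Q (a *: f + g) u = a * Q f u + Q g u by rewrite /Q ipl bTl; ring.
  have QC f g : Q g f = conjc (Q f g).
    by rewrite /Q conjcD conjcN conjcM conjcR -ipC -bTC.
  have QE f : complex.Re (Q f f) = lam n ^+ 2 * N f - N (T f).
    by rewrite /Q /bT (form_real ipC f) (form_real ipC (T f)) -rmorphM -rmorphB.
  have : Q (e n) h = 0.
    apply: (form_vertex Ql QC); first by rewrite QE e_norm// mulr1 lam_sqr subrr.
    move=> s; rewrite QE subr_ge0; apply: max_V => j jn.
    by rewrite (formD bTl) (formZ bTl) (e_V jn) (Vh j jn) mulr0 addr0.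
  by rewrite /Q => /eqP; rewrite subr_eq0 => /eqP ->.
split; last by move=> j jn; rewrite ipC orth// (conjcR 0).
move=> h; pose h' := h - \sum_(j < n) ip h (e j) *: e j.
have hE : h = h' + \sum_(j < n) ip h (e j) *: e j by rewrite subrK.
have ee j i : (j < n)%N -> (i < n)%N -> ip (e j) (e i) = (j == i)%:R.
  move=> jn i_n; have [ij|ji|->] := ltngtP i j.
  - by have [_ o] := IH j jn (lj0 j jn); rewrite o.
  - by have [_ o] := IH i i_n (lj0 i i_n); rewrite ipC o// (conjcR 0).
  by rewrite (form_real ipC) e_norm ?lj0.
have Vh' : V_ n h'.
  move=> i i_n; have [hi _] := IH i i_n (lj0 i i_n).
  rewrite bTC hi /h' (formDr ipl ipC) (formNr ipl ipC) (form_sumr ipl ipC) (bigD1 (Ordinal i_n))//= big1.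
    by rewrite (formZr ipl ipC) ee// eqxx mulr1 addr0 -ipC subrr mulr0 (conjcR 0).
  move=> j; rewrite -val_eqE /= => ji; rewrite (formZr ipl ipC) ee// eq_sym (negbTE ji) mulr0//.
rewrite hE (formDr bTl bTC) (form_sumr bTl bTC) (formDr ipl ipC) (form_sumr ipl ipC) (vert _ Vh') mulrDr.
congr (_ + _); rewrite big1 => [|j _]; last by rewrite (formZr bTl bTC) (e_V (ltn_ord j)) mulr0.
rewrite big1 ?mulr0// => j _.
by rewrite (formZr ipl ipC) (ipC (e j) (e n)) orth// (conjcR 0) mulr0.
Qed.

Let orthonormal m n : 0 < lam m -> 0 < lam n -> ip (e m) (e n) = (m == n)%:R.
Proof.
move=> lm ln; have [mn|nm|->] := ltngtP m n.
- by rewrite ipC (key ln).2// (conjcR 0).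
- by rewrite (key lm).2.
by rewrite (form_real ipC) e_norm.
Qed.

Let decay n : lam n ^+ 2 <= C * k ^+ n.
Proof.
have k0 : 0 < k by case/andP: k01.
have [ln0|ln0] := leP (lam n) 0.
  have -> : lam n = 0 by apply/eqP; rewrite eq_le ln0 lam_ge0.
  by rewrite expr0n /= mulr_ge0// exprn_ge0// ltW.
have lj0 (j : 'I_n.+1) : 0 < lam j by apply: lt_le_trans (lam_mono (leq_ord j)).
have [x x0 xA] := homogeneous_solution (\matrix_(j < n.+1, m < n) co m (e j)).
pose f := \sum_(j < n.+1) x 0 j *: e j.
have cof m : (m < n)%N -> co m f = 0.
  move=> mn; have co0 : co m 0 = 0.
    by apply: (addrI (co m 0)); have := col m 1 0 0; rewrite scale1r !addr0 mul1r => <-.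
  have -> : co m f = \sum_(j < n.+1) x 0 j * co m (e j).
    have coD u v : co m (u + v) = co m u + co m v by rewrite -[u]scale1r col mul1r scale1r.
    rewrite /f (big_morph (co m) coD co0); apply: eq_bigr => j _.
    by rewrite -[x 0 j *: e j]addr0 col co0 addr0.
  have /matrixP/(_ 0 (Ordinal mn)) := xA; rewrite !mxE => H; rewrite -[RHS]H.
  by apply: eq_bigr => j _; rewrite mxE.
have Nf : N f = \sum_j normc (x 0 j) ^+ 2 * 1.
  apply: (form_pythagoras ipl ipC) => i j; rewrite orthonormal ?lj0// mulr1.
  by rewrite -val_eqE.
have NTf : N (T f) = \sum_j normc (x 0 j) ^+ 2 * lam j ^+ 2.
  apply: (form_pythagoras bTl bTC) => i j; rewrite (key (lj0 i)).1 orthonormal ?lj0//.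
  by rewrite mulrC -val_eqE.
have fp : 0 < N f.
  rewrite lt_neqAle ip_ge0 eq_sym andbT Nf; apply: contra x0 => /eqP.
  move=> /psumr_eq0P H; apply/eqP/rowP => j; rewrite mxE; apply/eqP; rewrite -normc_eq0 -sqrf_eq0.
  by rewrite -[_ ^+ 2]mulr1 H// => i _; rewrite mulr1 sqr_ge0.
rewrite -(ler_pM2r fp); apply: le_trans (tail cof).
rewrite NTf Nf mulr_sumr; apply: ler_sum => j _; rewrite mulr1 mulrC ler_wpM2l ?sqr_ge0//.
by apply: lerXn2r; rewrite ?nnegrE ?lam_ge0//; exact: lam_mono (leq_ord j).
Qed.

Lemma spectral_decomposition : exists (lam : nat -> R) (e : nat -> V),
  [/\ forall n, 0 <= lam n, forall n, lam n.+1 <= lam n, forall n, lam n ^+ 2 <= C * k ^+ n,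
      forall m n, 0 < lam m -> 0 < lam n -> ip (e m) (e n) = (m == n)%:R &
      (forall n, 0 < lam n -> S (T (e n)) = (lam n ^+ 2)%:C *: e n) /\
      (forall t f, 0 < t -> S (T f) = (t ^+ 2)%:C *: f ->
         exists (M : nat) (c : nat -> R[i]), f = \sum_(0 <= n < M | lam n == t) c n *: e n)].
Proof.
exists lam, e; split; [exact: lam_ge0|exact: lam_step|exact: decay|exact: orthonormal|split].
  move=> n ln; apply/eqP; rewrite -subr_eq0; apply/eqP/ip_eq0.
  suff H h : ip h (S (T (e n)) - (lam n ^+ 2)%:C *: e n) = 0 by rewrite H.
  rewrite (formDr ipl ipC) (formNr ipl ipC) (formZr ipl ipC) -TS -/(bT h (e n)) bTC (key ln).1.
  by rewrite conjcM -ipC !conjcR subrr.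
move=> t f t0 Ef.
have Tf g : bT f g = (t ^+ 2)%:C * ip f g.
  by rewrite /bT ipC TS Ef (formZr ipl ipC) conjcM !conjcR -ipC.
have t20 : 0 < t ^+ 2 by rewrite exprn_gt0.
(* From [M] on the singular values are below [t]. Once its components with [lam n = t] are removed,
   [f] lies in [V_ M], where [T] cannot stretch by [t]; so nothing is left. *)
have [M MP] : exists M, lam M ^+ 2 < t ^+ 2.
  have /cvgrPdist_lt/(_ (t ^+ 2 / (C + 1))) : k ^+ n @[n --> \oo] --> (0 : R).
    by apply: cvg_expr; case/andP: k01 => k0 k1; rewrite ger0_norm// ltW.
  rewrite divr_gt0 ?ltr_wpDl// => /(_ isT)[M _ MP]; exists M; apply: le_lt_trans (decay M) _.
  have := MP M (leqnn M) => /=; rewrite sub0r normrN ger0_norm ?exprn_ge0 ?(ltW (andP k01).1)// ltr_pdivlMr ?ltr_wpDl//.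
  apply: le_lt_trans; rewrite mulrC ler_wpM2l ?exprn_ge0 ?(ltW (andP k01).1)// lerDl//.
exists M, (fun n => ip f (e n)); rewrite big_mkord.
apply/eqP; rewrite -subr_eq0; apply/eqP; set f' := f - _.
have lt j : lam j == t -> 0 < lam j by move/eqP ->.
have Tf' g : bT f' g = (t ^+ 2)%:C * ip f' g.
  rewrite (formD bTl) (formN bTl) (form_suml bTl) (formD ipl) (formN ipl) (form_suml ipl) mulrDr mulrN Tf.
  congr (_ - _); rewrite mulr_sumr; apply: eq_bigr => j jt.
  by rewrite (formZ bTl) (formZ ipl) (key (lt j jt)).1 (eqP jt) mulrCA.
have Vf : V_ M f'.
  move=> i iM; have [li|li] := eqVneq (lam i) 0.
    by rewrite /bT (ip_eq0 (f := T (e i))) ?(form0r ipl ipC)// -lam_sqr li expr0n.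
  have li0 : 0 < lam i by rewrite lt_neqAle eq_sym li lam_ge0.
  suff E : ip f' (e i) = 0 by rewrite Tf' E mulr0.
  rewrite (formD ipl) (formN ipl) (form_suml ipl).
  have [lit|lit] := eqVneq (lam i) t.
    rewrite (bigD1 (Ordinal iM)) /= ?lit// big1 => [|j /andP[jt ji]].
      by rewrite (formZ ipl) orthonormal// eqxx mulr1 addr0 subrr.
    have /negbTE ji' : nat_of_ord j != i by apply: contra ji => /eqP E; apply/eqP/val_inj.
    by have := orthonormal (lt j jt) li0; rewrite ji' (formZ ipl) => ->; rewrite mulr0.
  rewrite big1 => [|j jt]; last first.
    have := orthonormal (lt j jt) li0; rewrite (_ : (_ == _ :> nat) = false); last first.
      by apply/negbTE; apply: contra lit => /eqP <-.
    by rewrite (formZ ipl) => ->; rewrite mulr0.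
  rewrite subr0; have := Tf (e i); rewrite bTC (key li0).1 conjcM conjcR -ipC => /eqP.
  rewrite -subr_eq0 -mulrBl mulf_eq0 => /orP[|/eqP//].
  rewrite subr_eq0 => /eqP[/eqP].
  by rewrite eqrXn2 ?lam_ge0 ?(ltW t0)// (negbTE lit).
apply: ip_eq0; apply/eqP; rewrite eq_le ip_ge0 andbT leNgt; apply/negP => fp.
have := max_V Vf; rewrite -[N (T f')]/(complex.Re (bT f' f')) Tf' (form_real ipC f') -rmorphM.
by rewrite [leLHS]/= ler_pM2r// leNgt MP.
Qed.

End spectral.

(** * The inner product and the monomials *)

Section inner_product.
Context {R : realType} (w : weight R).
Local Notation mu := (@lebesgue_measure R).
Local Notation MR := (measurableTypeR R).
Local Notation plane := (MR * MR)%type.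
Local Notation pi2 := (2 * pi : R).
Local Notation F2 := (fock w two_pos).
Implicit Types (f g h : F2) (z : R[i]).

Definition density f g z : R[i] := f z * conjc (g z) * (expR (- 2 * w (normc z)))%:C.

Lemma fn_sqr f : fn f `^ two_pos%:num = fn f ^+ 2.
Proof. by rewrite -[two_pos%:num]/(2%:R) powR_mulrn// fn_ge0. Qed.

Definition mass f z : R := normc (f z) ^+ 2 * expR (- 2 * w (normc z)).

Lemma mass_ge0 f z : 0 <= mass f z.
Proof. by rewrite mulr_ge0 ?sqr_ge0 ?expR_ge0. Qed.

Lemma measurable_mass f : measurable_fun [set: plane] (fun z : plane => mass f (cpl z) : MR).
Proof.
apply: measurable_funM.
  apply: (measurableT_comp (f := fun x : MR => x ^+ 2 : MR)); first exact: exprn_measurable.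
  exact: (measurable_normc_entire (fent f)).
apply: (measurableT_comp (@measurable_expR R)); apply: measurable_funM => //.
exact: weight_measurable.
Qed.

Lemma integral_mass f : (\int[area]_z (mass f (cpl z))%:E)%E = (fn f ^+ 2)%:E.
Proof.
rewrite -fn_sqr -fn_integral; apply: eq_integral => z _; congr EFin.
by rewrite /mass -[two_pos%:num]/(2%:R) powR_mulrn ?normc_ge0.
Qed.

Lemma mass_integrable f : area.-integrable setT (fun z : plane => (mass f (cpl z))%:E).
Proof.
apply/integrableP; split; first by apply/measurable_EFinP; exact: measurable_mass.
under eq_integral => z _ do rewrite gee0_abs ?lee_fin ?mass_ge0//.
by rewrite integral_mass ltry.
Qed.

Lemma Re_mul_conj (a b : R[i]) : complex.Re (a * conjc b) = (normc (a + b) ^+ 2 - normc (a - b) ^+ 2) / 4.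
Proof. by case: a b => x y [u v]; rewrite !normc_sqr /=; field. Qed.

Lemma normc_sqr_le (a b : R[i]) : `|complex.Re (a * conjc b)| <= normc a ^+ 2 + normc b ^+ 2.
Proof.
case: a b => x y [u v]; rewrite !normc_sqr /= ler_norml.
have := sqr_ge0 (x - u); have := sqr_ge0 (x + u); have := sqr_ge0 (y - v); have := sqr_ge0 (y + v).
rewrite !sqrrD !sqrrN => *; apply/andP; split; nra.
Qed.

Lemma Re_mulR (c : R) (a : R[i]) : complex.Re (c%:C * a) = c * complex.Re a.
Proof. by case: a => x y; rewrite /= mul0r subr0. Qed.

Lemma Re_density f g z : complex.Re (density f g z) = (mass (f + g) z - mass (f - g) z) / 4.
Proof.
rewrite /density /mass fockDE fockBE.
have -> : complex.Re (f z * conjc (g z) * (expR (- 2 * w (normc z)))%:C) =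
  complex.Re (f z * conjc (g z)) * expR (- 2 * w (normc z)).
  by case: (f z * _) => x y; rewrite /= mulr0 subr0.
by rewrite Re_mul_conj; move: (normc _ ^+ 2) (normc _ ^+ 2) (expR _) => a b c; field.
Qed.

(** Reduces imaginary parts to real ones, so that only the real form [rip] has to be integrated. *)
Lemma Im_density f g z : complex.Im (density f g z) = complex.Re (density f ('i%C *: g) z).
Proof.
rewrite /density fockZE; move: (f z) (g z) (expR _) => [a b] [c d] e /=; ring.
Qed.

Lemma measurable_Re_density f g : measurable_fun [set: plane] (fun z : plane => complex.Re (density f g (cpl z)) : MR).
Proof.
have -> : (fun z : plane => complex.Re (density f g (cpl z)) : MR) =
    (fun z : plane => (mass (f + g)%R (cpl z) - mass (f - g)%R (cpl z)) / 4 : MR).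
  by apply/funext => z; exact: Re_density.
by apply: measurable_funM => //; apply: measurable_funB; exact: measurable_mass.
Qed.

Lemma Re_density_le f g z : `|complex.Re (density f g z)| <= mass f z + mass g z.
Proof.
have -> : complex.Re (density f g z) = complex.Re (f z * conjc (g z)) * expR (- 2 * w (normc z)).
  by rewrite /density; case: (f z * _) => x y; rewrite /= mulr0 subr0.
by rewrite normrM (ger0_norm (expR_ge0 _)) -mulrDl ler_wpM2r ?expR_ge0 ?normc_sqr_le.
Qed.

Lemma dominated_integrable (u v : R[i] -> R) :
  measurable_fun [set: plane] (fun z : plane => u (cpl z) : MR) -> (forall z, `|u z| <= v z) ->
  area.-integrable setT (fun z : plane => (v (cpl z))%:E) ->
  area.-integrable setT (EFin \o (fun z : plane => u (cpl z))).
Proof.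
move=> mu' uv iv; apply: le_integrable iv => //; first exact/measurable_EFinP.
by move=> z _; rewrite /= lee_fin; apply: le_trans (uv _) (ler_norm _).
Qed.

Lemma Re_integrable f g : area.-integrable setT (EFin \o (fun z : plane => complex.Re (density f g (cpl z)))).
Proof.
apply: (@dominated_integrable (fun z => complex.Re (density f g z)) (fun z => mass f z + mass g z)).
- exact: measurable_Re_density.
- exact: Re_density_le.
have := integrableD measurableT (mass_integrable f) (mass_integrable g).
by apply: eq_integrable => // z _.
Qed.

Definition rip f g : R := (\int[area]_z complex.Re (density f g (cpl z)))%R.

Lemma innerE f g : inner f g = rip f g +i* rip f ('i%C *: g).
Proof.
rewrite /rip /inner; congr (_ +i* _); apply: eq_Rintegral => z _; exact: Im_density.
Qed.

Lemma ripD f g h : rip (f + g) h = rip f h + rip g h.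
Proof.
rewrite /rip -RintegralD//; try exact: Re_integrable.
apply: eq_Rintegral => z _; rewrite /density fockDE mulrDl mulrDl.
by move: (_ * _ * _) (_ * _ * _) => [a b] [c d].
Qed.

Lemma ripZ (c : R) f h : rip (c%:C *: f) h = c * rip f h.
Proof.
rewrite /rip -RintegralZl//; try exact: Re_integrable.
apply: eq_Rintegral => z _; by rewrite /density fockZE -!mulrA Re_mulR.
Qed.

Lemma ripC f g : rip g f = rip f g.
Proof.
rewrite /rip; apply: eq_Rintegral => z _; rewrite /density.
move: (f _) (g _) (expR _) => [a b] [c d] e /=; ring.
Qed.

Lemma ripi f g : rip ('i%C *: f) ('i%C *: g) = rip f g.
Proof.
rewrite /rip; apply: eq_Rintegral => z _; rewrite /density !fockZE.
move: (f _) (g _) (expR _) => [a b] [c d] e /=; ring.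
Qed.

Lemma rip_iN f g : rip ('i%C *: f) g = - rip f ('i%C *: g).
Proof.
have -> : - rip f ('i%C *: g) = -1 * rip f ('i%C *: g) by rewrite mulN1r.
rewrite -ripZ /rip; apply: eq_Rintegral => z _; rewrite /density !fockZE.
move: (f _) (g _) (expR _) => [a b] [c d] e /=; ring.
Qed.

Lemma rip_norm f : rip f f = fn f ^+ 2.
Proof.
apply: EFin_inj; rewrite -integral_mass /rip /Rintegral fineK.
  apply: eq_integral => z _; congr EFin; by rewrite /density [f _ * _]mulrC mul_conjc Re_mulR /mass.
by apply: integrable_fin_num => //; exact: Re_integrable.
Qed.

Lemma inner_linear (a : R[i]) f g h : inner (a *: f + g) h = a * inner f h + inner g h.
Proof.
have aE : a *: f = (complex.Re a)%:C *: f + (complex.Im a)%:C *: ('i%C *: f).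
  by rewrite scalerA -scalerDl; congr (_ *: _); case: a => x y; apply/eqP; rewrite eq_complex /=; apply/andP; split; apply/eqP; ring.
rewrite !innerE aE !ripD !ripZ ripi rip_iN.
case: a {aE} => x y; apply/eqP; rewrite eq_complex /=; apply/andP; split; apply/eqP; ring.
Qed.

Lemma inner_sym f g : inner g f = conjc (inner f g).
Proof. by rewrite !innerE ripC [rip g _]ripC rip_iN. Qed.

Lemma inner_norm f : complex.Re (inner f f) = fn f ^+ 2.
Proof. by rewrite innerE -rip_norm. Qed.

(** [rotation_average] for functions of both signs: it is applied to [u + v] and to [v], both
    nonnegative, and the results are subtracted. *)
Lemma rotation_mean (u v U : R[i] -> R) :
  measurable_fun [set: plane] (fun z : plane => u (cpl z) : MR) ->
  measurable_fun [set: plane] (fun z : plane => v (cpl z) : MR) ->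
  (forall z, `|u z| <= v z) ->
  area.-integrable setT (fun z : plane => (v (cpl z))%:E) ->
  area.-integrable setT (EFin \o (fun z : plane => U (cpl z))) ->
  (forall z, continuous (fun t => u (cis t * z))) -> (forall z, continuous (fun t => v (cis t * z))) ->
  (forall z, rint 0 pi2 (fun t => u (cis t * z)) = pi2 * U z) ->
  (\int[area]_z u (cpl z) = \int[area]_z U (cpl z))%R.
Proof.
move=> mu' mv uv iv iU cu cv uU.
have iu := dominated_integrable mu' uv iv.
have v0 z : 0 <= v z := le_trans (normr_ge0 _) (uv z).
have uv0 z : 0 <= u z + v z by have := uv z; rewrite ler_norml => /andP[]; lra.
have m1 : measurable_fun [set: plane] ((fun z => (u z + v z)%:E) \o cpl).
  by apply/measurable_EFinP; exact: measurable_funD.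
have m2 : measurable_fun [set: plane] ((fun z => (v z)%:E) \o cpl) by exact/measurable_EFinP.
have pi0 : 0 < pi2 by rewrite mulr_gt0// pi_gt0.
have E1 := rotation_average m1 (fun z => uv0 z : (0 <= (u z + v z)%:E)%E).
have E2 := rotation_average m2 (fun z => v0 z : (0 <= (v z)%:E)%E).
have IE (k : R -> R) : continuous k -> (\int[mu]_(t in `[0%R, pi2]) (k t)%:E = (rint 0 pi2 k)%:E)%E.
  move=> ck; rewrite /rint /Rintegral fineK//; apply: integrable_fin_num; first exact: measurable_itv.
  exact: cont_integrable.
pose V z := rint 0 pi2 (fun t => v (cis t * z)).
have E2' : (\int[area]_z (V (cpl z))%:E = pi2%:E * \int[area]_z (v (cpl z))%:E)%E.
  by rewrite -E2; apply: eq_integral => z _; rewrite IE.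
have E1' : (\int[area]_z (pi2 * U (cpl z) + V (cpl z))%:E = pi2%:E * \int[area]_z (u (cpl z) + v (cpl z))%:E)%E.
  rewrite -E1; apply: eq_integral => z _.
  rewrite (IE (fun t => u (cis t * cpl z) + v (cis t * cpl z))); last by move=> t; apply: cvgD; [exact: cu|exact: cv].
  by rewrite rintD ?uU.
have RE (k : plane -> R) : area.-integrable setT (EFin \o k) -> (\int[area]_z (k z)%:E = (\int[area]_z k z)%R%:E)%E.
  by move=> ik; rewrite /Rintegral fineK//; exact: integrable_fin_num.
have iV : area.-integrable setT (EFin \o (fun z : plane => V (cpl z))).
  apply/integrableP; split.
    have := measurable_rotation_average m2 (fun z => v0 z : (0 <= (v z)%:E)%E).
    by congr measurable_fun; apply/funext => z; rewrite IE.
  have V0 z : 0 <= V z by apply: rint_ge0 => t _.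
  under eq_integral => z _ do rewrite gee0_abs ?lee_fin ?V0//.
  by rewrite E2' RE// -EFinM ltry.
have ipU : area.-integrable setT (EFin \o (fun z : plane => pi2 * U (cpl z))).
  by apply: eq_integrable (integrableZl measurableT pi2 iU) => // z _.
move: E1' E2'; rewrite !RE//; last 2 first.
- by apply: eq_integrable (integrableD measurableT iu iv) => // z _.
- by apply: eq_integrable (integrableD measurableT ipU iV) => // z _.
rewrite !RintegralD// RintegralZl// -!EFinM => -[E1''] [E2'']; move: E1''; rewrite E2'' -mulrDr.
by move=> /(mulfI (lt0r_neq0 pi0)) /addIr ->.
Qed.

Definition moment m := fn (mono w two_pos m) ^+ 2.

Lemma mass_circle_cont f z : continuous (fun t => mass f (cis t * z)).
Proof.
have -> : (fun t => mass f (cis t * z)) = fun t => normc (f (z * cis t)) ^+ 2 * expR (- 2 * w (normc z)).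
  by apply/funext => t; rewrite /mass normcM normc_cis mul1r mulrC [cis t * z]mulrC mulrC.
have cn := ccont_normc (ccont_circle z (fent f)).
by move=> t; apply: cvgM; [apply: cvgM; exact: cn|exact: cvg_cst].
Qed.

(** On each circle the integral against [z ^+ m] is a Fourier coefficient, which [coef_circle]
    identifies with the Taylor coefficient; [rotation_mean] carries this to the plane. *)
Lemma inner_mono_Re f m : rip f (mono w two_pos m) = complex.Re (coef f m) * moment m.
Proof.
set g := mono w two_pos m.
have gE z : g z = z ^+ m by [].
pose U z := complex.Re (coef f m) * mass g z.
have -> : complex.Re (coef f m) * moment m = (\int[area]_z U (cpl z))%R.
  rewrite /U RintegralZl//; last exact: mass_integrable.
  by rewrite /moment -/g; congr (_ * _); apply: EFin_inj; rewrite -integral_mass /Rintegral fineK// integral_mass.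
have dE z t : density f g (cis t * z) = (conjc (z ^+ m) * (expR (- 2 * w (normc z)))%:C) * (f (z * cis t) * cis (- t) ^+ m).
  rewrite /density gE normcM normc_cis mul1r exprMn conjcM [cis t * z]mulrC.
  have -> : conjc (cis t ^+ m) = cis (- t) ^+ m.
    elim: (m) => [|k IH]; first by rewrite !expr0 (conjcR 1).
    by rewrite !exprS conjcM IH; congr (_ * _); rewrite !cisE cosN sinN.
  by ring.
have cc z : ccont (fun t => f (z * cis t) * cis (- t) ^+ m).
  apply: ccontM; last by apply: ccontX; exact: ccont_cisN.
  exact: (ccont_circle z (fent f)).
apply: (@rotation_mean (fun z => complex.Re (density f g z)) (fun z => mass f z + mass g z) U).
- exact: measurable_Re_density.
- by apply: measurable_funD; exact: measurable_mass.
- exact: Re_density_le.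
- by apply: eq_integrable (integrableD measurableT (mass_integrable f) (mass_integrable g)) => // z _.
- by apply: eq_integrable (integrableZl measurableT (complex.Re (coef f m)) (mass_integrable g)) => // z _.
- move=> z; have -> : (fun t => complex.Re (density f g (cis t * z))) = fun t => complex.Re
      ((conjc (z ^+ m) * (expR (- 2 * w (normc z)))%:C) * (f (z * cis t) * cis (- t) ^+ m)).
    by apply/funext => t; rewrite dE.
  by apply: ccont_Re; apply: ccontZ; exact: cc.
- move=> z t; apply: cvgD; exact: mass_circle_cont.
move=> z; have -> : (fun t => complex.Re (density f g (cis t * z))) = fun t => complex.Re
      ((conjc (z ^+ m) * (expR (- 2 * w (normc z)))%:C) * (f (z * cis t) * cis (- t) ^+ m)).
  by apply/funext => t; rewrite dE.
have := cintZ 0 pi2 (conjc (z ^+ m) * (expR (- 2 * w (normc z)))%:C) (cc z).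
move=> /(congr1 (fun x => complex.Re x)) => H; rewrite [LHS]H.
have eg : entire (fun u => f (z * u)) := entire_comp (fent f) (entireM (entire_cst z) entire_id).
have := @coef_circle _ _ 1 m eg ltr01; rewrite (coef_dilate _ _ (fent f)) expr1n mulr1.
under [X in cint _ _ X = _]eq_fun do rewrite mul1r.
move=> ->; rewrite /U /mass gE; move: (coef f m) (expR _) (z ^+ m) => c x y.
have -> : conjc y * x%:C * (pi2%:C * (c * y)) = (pi2 * (normc y ^+ 2 * x))%:C * c.
  have CM a b : (a * b)%:C = a%:C * b%:C := rmorphM (real_complex R) a b.
  have -> : (pi2 * (normc y ^+ 2 * x))%:C = pi2%:C * (conjc y * y * x%:C) by rewrite mul_conjc -!CM.
  by ring.
by rewrite Re_mulR; ring.
Qed.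

Lemma inner_mono f m : inner f (mono w two_pos m) = coef f m * (moment m)%:C.
Proof.
rewrite innerE inner_mono_Re -[rip f _]opprK -rip_iN inner_mono_Re.
have -> : coef ('i%C *: f) m = 'i%C * coef f m := coefZ 'i%C m (fent f).
by case: (coef f m) => x y; apply/eqP; rewrite eq_complex /=; apply/andP; split; apply/eqP; ring.
Qed.

End inner_product.

Lemma continuous_square_sum {R : realType} {X : topologicalType} (u : nat -> X -> R) (c : nat -> R) M :
  (forall m, continuous (u m)) -> continuous (fun x => \sum_(m < M) u m x ^+ 2 * c m).
Proof.
move=> cu; elim: M => [|M IH].
  by under eq_fun do rewrite big_ord0; move=> x; exact: cvg_cst.
under eq_fun do rewrite big_ord_recr /=.
move=> x; apply: cvgD; first exact: IH.
by apply: cvgM; [apply: cvgM; exact: cu|exact: cvg_cst].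
Qed.

Lemma form_sub {R : realType} {V : lmodType R[i]} (b : V -> V -> R[i]) :
  (forall a f g h, b (a *: f + g) h = a * b f h + b g h) -> (forall f g, b g f = conjc (b f g)) ->
  forall f g, complex.Re (b (f - g) (f - g)) = complex.Re (b f f) - 2 * complex.Re (b f g) + complex.Re (b g g).
Proof.
move=> bl bC f g; rewrite (formD bl) (formN bl) !(formDr bl bC) !(formNr bl bC) (bC f g).
by case: (b f f) (b f g) (b g g) => x x' [y y'] [z z'] /=; ring.
Qed.

(** * Expansion in monomials, adjoints and maximisers *)

Section fourier.
Context {R : realType} (w : weight R).
Local Notation MR := (measurableTypeR R).
Local Notation plane := (MR * MR)%type.
Local Notation F2 := (fock w two_pos).
Implicit Types (f g h : F2) (z : R[i]) (al : nat -> R[i]).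

Let il := @inner_linear R w.
Let isym := @inner_sym R w.

Lemma inner_eq0 f : complex.Re (inner f f) = 0 -> f = 0.
Proof. by rewrite inner_norm => /eqP; rewrite sqrf_eq0 => /eqP/fn_eq0. Qed.

Lemma inner_ge0 f : 0 <= complex.Re (inner f f).
Proof. by rewrite inner_norm sqr_ge0. Qed.

Lemma rip_le f g : `|rip f g| <= fn f ^+ 2 + fn g ^+ 2.
Proof.
have -> : fn f ^+ 2 + fn g ^+ 2 = (\int[area]_z (mass f (cpl z) + mass g (cpl z)))%R.
  rewrite RintegralD//; try exact: mass_integrable.
  by congr (_ + _); apply: EFin_inj; rewrite -integral_mass /Rintegral fineK// integral_mass.
apply: le_trans (le_normr_Rintegral _ _) _ => //; first exact: Re_integrable.
apply: le_Rintegral => //.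
- exact: integrable_norm (Re_integrable f g).
- by apply: eq_integrable (integrableD measurableT (mass_integrable f) (mass_integrable g)) => // z _.
by move=> z _; exact: Re_density_le.
Qed.

Lemma rip_cauchy f g : `|rip f g| <= 2 * (fn f * fn g).
Proof.
have [f0|f0] := eqVneq (fn f) 0.
  rewrite (fn_eq0 f0) (_ : rip 0 g = 0) ?normr0 ?mulr_ge0 ?fn_ge0//.
  by have := ripZ 0 0 g; rewrite scaler0 mul0r.
have [g0|g0] := eqVneq (fn g) 0.
  rewrite (fn_eq0 g0) ripC (_ : rip 0 f = 0) ?normr0 ?mulr_ge0 ?fn_ge0//.
  by have := ripZ 0 0 f; rewrite scaler0 mul0r.
(* Scaling [f] to the norm of [g] turns the bound by a sum of squares into one by the product. *)
have H c : 0 < c -> `|c * rip f g| <= (c * fn f) ^+ 2 + fn g ^+ 2.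
  by move=> c0; rewrite -ripZ; have := rip_le (c%:C *: f) g; rewrite fnZ (normc_real_ge0 (ltW c0)).
move: f0 g0 (fn_ge0 f) (fn_ge0 g) H; move: (rip f g) (fn f) (fn g) => r a b a0 b0 a1 b1 H.
have ap : 0 < a by rewrite lt_neqAle eq_sym a0.
have bp : 0 < b by rewrite lt_neqAle eq_sym b0.
have cp : 0 < b / a by rewrite divr_gt0.
have := H _ cp; rewrite divfK// normrM (ger0_norm (ltW cp)) -ler_pdivlMl// => /le_trans; apply.
by rewrite le_eqVlt; apply/orP; left; apply/eqP; field; rewrite a0 b0.
Qed.

Lemma inner_cauchy f g : normc (inner f g) <= 4 * (fn f * fn g).
Proof.
rewrite innerE; apply: le_trans (normc_le _ _) _.
have h1 := rip_cauchy f g; have := rip_cauchy f ('i%C *: g).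
rewrite fnZ (_ : normc 'i%C = 1) ?mul1r; last by rewrite /= expr0n expr1n add0r sqrtr1.
by move: h1; move: (fn f * fn g) => x; lra.
Qed.

Definition poly_of al M : F2 := \sum_(m < M) al m *: mono w two_pos m.

Lemma poly_ofE al M z : poly_of al M z = partial (fun m => al m * z ^+ m) M.
Proof.
rewrite /poly_of /partial; elim: M => [|M IH]; first by rewrite !big_ord0.
by rewrite big_ord_recr [RHS]big_ord_recr fockDE IH fockZE.
Qed.

Lemma inner_poly_of f al M :
  inner f (poly_of al M) = \sum_(m < M) conjc (al m) * (coef f m * (moment w m)%:C).
Proof.
rewrite /poly_of (form_sumr il isym); apply: eq_bigr => m _.
by rewrite (formZr il isym) inner_mono.
Qed.

Lemma coef_poly_of al M m : (m < M)%N -> coef (poly_of al M) m = al m.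
Proof.
move=> mM; rewrite -[RHS](coef_partial al mM); congr (coef _ m); apply/funext => z; exact: poly_ofE.
Qed.

Lemma sum_conj_coef al M : \sum_(m < M) conjc (al m) * (al m * (moment w m)%:C) =
  (\sum_(m < M) normc (al m) ^+ 2 * moment w m)%:C.
Proof.
rewrite (raddf_sum (real_complex R)); apply: eq_bigr => m _.
by rewrite mulrA mul_conjc -(rmorphM (real_complex R)).
Qed.

Lemma poly_of_norm al M : fn (poly_of al M) ^+ 2 = \sum_(m < M) normc (al m) ^+ 2 * moment w m.
Proof.
rewrite -inner_norm inner_poly_of.
under eq_bigr => m _ do rewrite coef_poly_of//.
by rewrite sum_conj_coef.
Qed.

Lemma fourier_remainder f M :
  fn (f - poly_of (coef f) M) ^+ 2 = fn f ^+ 2 - \sum_(m < M) normc (coef f m) ^+ 2 * moment w m.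
Proof.
set g := poly_of _ _; set s := \sum_(m < M) _.
have Eg : fn g ^+ 2 = s := poly_of_norm (coef f) M.
have E : inner f g = s%:C by rewrite inner_poly_of sum_conj_coef.
have arith (x y z t u : R) : x = y - 2 * t + z -> y = u -> z = t -> x = u - t by move=> -> -> ->; ring.
rewrite -(inner_norm (f - g)); apply: (arith _ _ (complex.Re (inner g g)) _ _ _ (inner_norm f)).
  by rewrite (form_sub il isym) E.
by rewrite (inner_norm g).
Qed.

Lemma bessel f M : \sum_(m < M) normc (coef f m) ^+ 2 * moment w m <= fn f ^+ 2.
Proof. by rewrite -subr_ge0 -fourier_remainder sqr_ge0. Qed.

(** The Riesz-Fischer theorem: the partial sums converge pointwise and have bounded norms, so
    Fatou's lemma applies. *)
Lemma psum_norm al (B : R) : rapid al -> (forall M, \sum_(m < M) normc (al m) ^+ 2 * moment w m <= B) ->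
  exists2 f : F2, fock_fun f = psum al & fn f ^+ 2 <= B.
Proof.
move=> ra H; have ef := psum_entire ra.
pose F n (z : plane) : \bar R := (mass (poly_of al n) (cpl z))%:E.
have mF n : measurable_fun [set: plane] (F n) by apply/measurable_EFinP; exact: measurable_mass.
have F0 n (z : plane) : [set: plane] z -> (0 <= F n z)%E by move=> _; rewrite lee_fin mass_ge0.
have Fl (z : plane) : limn_einf (F^~ z) =
    (normc (psum al (cpl z)) `^ two_pos%:num * expR (- two_pos%:num * w (normc (cpl z))))%:E.
  have cF : F n z @[n --> \oo] -->
      (normc (psum al (cpl z)) `^ two_pos%:num * expR (- two_pos%:num * w (normc (cpl z))))%:E.
    apply: cvg_EFin; first by near=> n.
    rewrite -[two_pos%:num]/(2%:R) powR_mulrn ?normc_ge0//.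
    apply: cvgM; last exact: cvg_cst.
    have cn : normc (poly_of al n (cpl z)) @[n --> \oo] --> normc (psum al (cpl z)).
      apply/cvgrPdist_le => e e0; have [N NP] := summable_cvg (rapid_summable (cpl z) ra) e0.
      exists N => // n Nn; have {}Nn : (N <= n)%N := Nn; rewrite poly_ofE; apply: le_trans (normc_dist _ _) _.
      by have := NP n Nn; rewrite normcB.
    by apply: cvgM; exact: cn.
  by rewrite is_cvg_limn_einfE; [exact: cvg_lim cF|apply/cvg_ex; eexists; exact: cF].
have I : (fock_integral w two_pos (psum al) <= B%:E)%E.
  apply: le_trans (_ : (limn_einf (fun n => \int[area]_z F n z) <= _)%E); last first.
    have cl : (fun n => \int[area]_z F n z)%E = fun n => (\sum_(m < n) normc (al m) ^+ 2 * moment w m)%:E.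
      by apply/funext => n; rewrite integral_mass poly_of_norm.
    rewrite cl limn_einf_lim; apply: lime_le; first exact: is_cvg_einfs.
    apply: nearW => n; apply: (@le_trans _ _ (\sum_(m < n) normc (al m) ^+ 2 * moment w m)%:E).
      by apply: ereal_inf_lbound; exists n => //=.
    by rewrite lee_fin; exact: H.
  have := @fatou _ _ _ area setT measurableT F mF F0.
  by under eq_integral => z _ do rewrite Fl.
have mf : psum al \in fock_pred w two_pos.
  by apply: mem_fock => //; apply: poweR_lty; apply: le_lt_trans I (ltry _).
exists (Fock mf) => //.
by rewrite -fn_sqr -lee_fin -fn_integral.
Unshelve. all: end_near. Qed.

(** If all remainders had norm at least [e], the partial sums would stay below [fn f ^+ 2 - e ^+ 2],
    and [psum_norm] would produce the same function with a smaller norm. *)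
Lemma fourier_cvg f (e : R) : 0 < e -> exists M, fn (f - poly_of (coef f) M) < e.
Proof.
move=> e0; apply: contrapT => N.
have H M : \sum_(m < M) normc (coef f m) ^+ 2 * moment w m <= fn f ^+ 2 - e ^+ 2.
  rewrite lerBrDl -lerBrDr -fourier_remainder; apply: lerXn2r; rewrite ?nnegrE ?fn_ge0 ?(ltW e0)//.
  by rewrite leNgt; apply/negP => h; apply: N; exists M.
have [g gE gn] := psum_norm (coef_rapid (fent f)) H.
have fg : f = g by apply: fock_ext => z; rewrite gE -fock_taylor.
by move: gn; rewrite fg lerBrDl gerDr leNgt exprn_gt0.
Qed.

(** Continuity of the norm, which the quasi-triangle inequality does not give, is obtained from the
    inner product. *)
Lemma sqr_fn_diff f g : `|fn f ^+ 2 - fn g ^+ 2| <= 8 * fn f * fn (g - f) + fn (g - f) ^+ 2.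
Proof.
have h1 := form_sub il isym g f; have h2 := inner_cauchy f (g - f).
have h3 : complex.Re (inner f (g - f)) = complex.Re (inner g f) - fn f ^+ 2.
  rewrite (formDr il isym) (formNr il isym) (isym g f) -(inner_norm f).
  by case: (inner g f) (inner f f) => x y [u v].
have h4 := le_trans (normc_Re _) h2; move: h1 h4; rewrite h3 (inner_norm f) (inner_norm g) (inner_norm (g - f)).
clear h2 h3; move: (complex.Re (inner g f)) (fn f) (fn g) (fn (g - f)) => r a b d E; have := sqr_ge0 d.
rewrite !ler_norml => ? => /andP[h4 h5]; apply/andP; split; lra.
Qed.

Section operator.
Context (T : F2 -> F2) (K : R).
Context (Tl : forall a f g, T (a *: f + g) = a *: T f + T g).
Context (K0 : 0 <= K).
Context (TK : forall f, fn (T f) <= K * fn f).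

Let TD f g : T (f + g) = T f + T g.
Proof. by rewrite -[f in LHS]scale1r Tl scale1r. Qed.

Let T0 : T 0 = 0.
Proof. by apply: (addrI (T 0)); rewrite -TD !addr0. Qed.

Let TZ a f : T (a *: f) = a *: T f.
Proof. by rewrite -[a *: f]addr0 Tl T0 addr0. Qed.

Let T_poly al M : T (poly_of al M) = \sum_(m < M) al m *: T (mono w two_pos m).
Proof.
rewrite /poly_of (big_morph T TD T0); apply: eq_bigr => m _; exact: TZ.
Qed.

Lemma moment_gt0 m : 0 < moment w m.
Proof. by rewrite exprn_gt0// fn_mono_gt0. Qed.

(* The coefficients of the adjoint applied to [g] are forced by testing against
   monomials; boundedness of [T] makes them square summable. *)
Lemma adjoint_exists : exists S : F2 -> F2, forall f g, inner (T f) g = inner f (S g).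
Proof.
suff H g : exists Sg : F2, forall f, inner (T f) g = inner f Sg.
  by have [S SP] := choice H; exists S => f g; exact: SP.
pose c m := inner g (T (mono w two_pos m)) * ((moment w m)^-1)%:C.
have cm m : c m * (moment w m)%:C = inner g (T (mono w two_pos m)).
  by rewrite /c -mulrA -(rmorphM (real_complex R)) mulVf ?mulr1// gt_eqF ?moment_gt0.
have E M : inner (T (poly_of c M)) g = (fn (poly_of c M) ^+ 2)%:C.
  rewrite T_poly (form_suml il) poly_of_norm -sum_conj_coef.
  have -> : (\sum_(m < M) conjc (c m) * (c m * (moment w m)%:C) = conjc (\sum_(m < M) conjc (c m) * (c m * (moment w m)%:C)))%R.
    by rewrite sum_conj_coef conjcR.
  rewrite (big_morph (@conjc R) (@conjcD R) (conjcR 0)); apply: eq_bigr => m _.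
  by rewrite (formZ il) conjcM conjcK cm isym.
(* By [E] the squared norm of the polynomial is an inner product with [g]; the Cauchy-Schwarz
   inequality and division by the norm give a bound independent of [M]. *)
have bd M : fn (poly_of c M) <= 4 * (K * fn g).
  have := inner_cauchy (T (poly_of c M)) g; rewrite E normc_real_ge0 ?sqr_ge0//.
  have := TK (poly_of c M); have := fn_ge0 g; have := fn_ge0 (poly_of c M).
  move: (fn (poly_of c M)) (fn (T _)) (fn g) => x y z x0 z0 yx h.
  have [->|x_neq0] := eqVneq x 0; first by rewrite !mulr_ge0.
  have xp : 0 < x by rewrite lt_neqAle eq_sym x_neq0.
  rewrite -(ler_pM2l xp); apply: le_trans (_ : x ^+ 2 <= _); first by [].
  apply: le_trans h _; have := ler_wpM2r z0 yx; lra.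
have [C1 C10 C1P] := fock_tame w two_pos.
have rc : rapid c.
  move=> r r0; exists (C1 * (4 * (K * fn g)) * expR (w (r + 1))).
    by rewrite !mulr_ge0 ?expR_ge0 ?fn_ge0 ?(ltW C10).
  move=> m; have := C1P (poly_of c m.+1) m r r0; rewrite coef_poly_of// => /le_trans; apply.
  by rewrite ler_wpM2r ?expR_ge0// ler_wpM2l ?(ltW C10).
have [|Sg SgE _] := @psum_norm c ((4 * (K * fn g)) ^+ 2) rc.
  move=> M; rewrite -poly_of_norm; apply: lerXn2r; rewrite ?nnegrE ?fn_ge0 ?bd//.
  by rewrite !mulr_ge0 ?fn_ge0.
have cS m : coef Sg m = c m by rewrite SgE coef_psum.
have mE m : inner (T (mono w two_pos m)) g = inner (mono w two_pos m) Sg.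
  by rewrite isym [RHS]isym inner_mono cS cm.
have pE al M : inner (T (poly_of al M)) g = inner (poly_of al M) Sg.
  rewrite T_poly (form_suml il) /poly_of (form_suml il); apply: eq_bigr => m _.
  by rewrite !(formZ il) mE.
exists Sg => f; apply/eqP; rewrite -subr_eq0; apply/eqP/normc_small0 => e e0.
pose D := 4 * (K * fn g) + 4 * fn Sg + 1.
have D0 : 0 < D by rewrite ltr_wpDl// addr_ge0 ?mulr_ge0 ?fn_ge0.
have eD : 0 < e / D by rewrite divr_gt0.
have [M MP] := fourier_cvg f eD.
set h := f - poly_of (coef f) M.
have -> : inner (T f) g - inner f Sg = inner (T h) g - inner h Sg.
  have fh : f = h + poly_of (coef f) M by rewrite subrK.
  by rewrite {1 2}fh TD !(formD il) pE; ring.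
apply: le_trans (normcB_le _ _) _.
have h1 := inner_cauchy (T h) g; have h2 := inner_cauchy h Sg.
have h3 := ler_wpM2r (fn_ge0 g) (TK h).
have := ltW MP; rewrite -/h ler_pdivlMr// /D => h4.
have := fn_ge0 h; move: h1 h2 h3 h4.
move: (normc _) (normc _) (fn (T h)) (fn h) (fn g) (fn Sg) => n1 n2 t x y z h1 h2 h3 h4 x0.
lra.
Qed.

Context (Tc : coefs R -> F2).
Context (TcE : forall f, T f = Tc (to_coefs (coef f))).
Context (Tc_near : forall N x (e : R), tame_set w N x -> 0 < e ->
  \forall y \near x, tame_set w N y -> fn (Tc y - Tc x) < e).

(** Weak compactness of the unit ball, on coefficients: [A] is closed in the compact set of tame
    sequences, and the function to be maximised is continuous on it, as [T] factors through [Tc]. By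
    [psum_norm] every sequence in [A] belongs to a function in the unit ball. *)
Lemma maximizer_exists (L : seq F2) : exists f, [/\ complex.Re (inner f f) <= 1,
  forall g, g \in L -> inner (T f) (T g) = 0 &
  forall h, complex.Re (inner h h) <= 1 -> (forall g, g \in L -> inner (T h) (T g) = 0) ->
    complex.Re (inner (T h) (T h)) <= complex.Re (inner (T f) (T f))].
Proof.
have [N N0 NP] := tame_ball w two_pos.
(* The unit ball, described by partial sums: each condition involves finitely many coordinates, so
   the set is closed. *)
pose B : set (coefs R) := [set x | forall M, \sum_(m < M) normc (cf x m - 0) ^+ 2 * moment w m <= 1].
pose O : set (coefs R) := [set x | forall g, g \in L -> inner (Tc x) (T g) = 0].
pose A := tame_set w N `&` (B `&` O).
have fn1 f : complex.Re (inner f f) <= 1 -> fn f <= 1.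
  by rewrite inner_norm => h; rewrite -(@ler_pXn2r _ 2) ?nnegrE ?fn_ge0// expr1n.
have inA f : complex.Re (inner f f) <= 1 -> (forall g, g \in L -> inner (T f) (T g) = 0) ->
    A (to_coefs (coef f)).
  move=> f1 fL; split; first exact: NP (fn1 f f1).
  split; last by move=> g gL; rewrite -TcE fL.
  move=> M; rewrite to_coefsK; under eq_bigr do rewrite subr0.
  by apply: le_trans (bessel f M) _; rewrite -inner_norm.
have outA x : A x -> exists2 f, complex.Re (inner f f) <= 1 & T f = Tc x /\ forall g, g \in L -> inner (T f) (T g) = 0.
  move=> [tx [Bx Ox]]; have rx : rapid (cf x) := tame_rapid (ltW N0) tx.
  have [|f fE f1] := @psum_norm (cf x) 1 rx.
    by move=> M; apply: le_trans (Bx M); under [leRHS]eq_bigr do rewrite subr0.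
  have Tf : T f = Tc x.
    rewrite TcE; congr Tc; apply/funext => -[m b]; rewrite fE.
    have -> : coef (psum (cf x)) = cf x by apply/funext => k; exact: coef_psum.
    by case: b.
  by exists f; rewrite ?inner_norm ?Tf.
have cB : closed B.
  have -> : B = \bigcap_(M in [set: nat]) [set x | \sum_(m < M) normc (cf x m - 0) ^+ 2 * moment w m <= 1].
    by apply/seteqP; split => [x Bx M _|x Bx M]; [exact: Bx|exact: (Bx M I)].
  apply: closed_bigI => M _; apply: closed_sublevel.
  by apply: (continuous_square_sum (u := fun m x => normc (cf x m - 0))) => m; exact: normc_cf_continuous.
have clA : closed A.
  move=> x cx; have tx : tame_set w N x by apply: (@closed_tame R w N); apply: closureS cx => y [].
  split => //; split; first by apply: cB; apply: closureS cx => y [_ []].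
  move=> g gL; apply/eqP; rewrite -normc_eq0 eq_le normc_ge0 andbT; apply/ler_addgt0Pl => e e0.
  have D0 : 0 < 4 * fn (T g) + 1 by rewrite ltr_wpDl// mulr_ge0 ?fn_ge0.
  have d0 : 0 < e / (4 * fn (T g) + 1) by rewrite divr_gt0.
  have [y [[ty [_ Oy]] ny]] := cx _ (Tc_near tx d0).
  have := inner_cauchy (Tc y - Tc x) (T g); rewrite (formD il) (formN il) (Oy g gL) sub0r normcN.
  rewrite addr0 => /le_trans; apply; have := ny ty; rewrite ltr_pdivlMr//.
  move=> /ltW; apply: le_trans; rewrite mulrCA; apply: (ler_wpM2l (fn_ge0 _)).
  by rewrite lerDl.
have cA : compact A by apply: (subclosed_compact clA (@compact_tame R w N)) => x [].
have A0 : A !=set0.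
  exists (to_coefs (coef (0 : F2))); apply: inA; first by rewrite (form0 il).
  by move=> g _; rewrite T0 (form0 il).
have cF : {within A, continuous (fun x => fn (Tc x) ^+ 2)}.
  apply/subspace_continuousP => x [tx _] U /nbhs_ballP[e /= e0 eU].
  have F0 := fn_ge0 (Tc x); have D0 : 0 < 8 * fn (Tc x) + 1 by rewrite ltr_wpDl// mulr_ge0.
  have d0 : 0 < Num.min 1 (e / (8 * fn (Tc x) + 1)) by rewrite lt_min ltr01 divr_gt0.
  change (nbhs x (fun y => A y -> U (fn (Tc y) ^+ 2))).
  apply: (filterS _ (Tc_near tx d0)) => y H [ty _]; apply: eU.
  change (is_true (`|fn (Tc x) ^+ 2 - fn (Tc y) ^+ 2| < e)).
  have := sqr_fn_diff (Tc x) (Tc y); have := H ty; rewrite lt_min => /andP[].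
  rewrite ltr_pdivlMr// => h1 h2; have := fn_ge0 (Tc y - Tc x); move: h1 h2.
  move: (fn (Tc x)) (fn (Tc y)) (fn (Tc y - Tc x)) F0 {D0 d0 H} => a b d a0 h1 h2 d0.
  by move=> /le_lt_trans; apply; nra.
have [x /set_mem Ax max] := compact_EVT_max A0 cA cF.
have [f f1 [fx fL]] := outA x Ax.
exists f; split; [exact: f1|exact: fL|move=> h h1 hL].
have := max (to_coefs (coef h)) (mem_set (inA h h1 hL)).
by rewrite (inner_norm (T h)) (inner_norm (T f)) -TcE -fx.
Qed.

End operator.

End fourier.

Lemma geometric_nneseries {R : realType} (u : nat -> R) (C k : R) : 0 <= C -> 0 <= k < 1 ->
  (forall n, 0 <= u n <= C * k ^+ n) -> (\sum_(0 <= n <oo) (u n)%:E < +oo)%E.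
Proof.
move=> C0 k01 H; apply: le_lt_trans (ltry (C / (1 - k))).
apply: lime_le; first by apply: is_cvg_nneseries => n _ _; rewrite lee_fin; case/andP: (H n).
apply: nearW => n; rewrite sumEFin lee_fin; apply: le_trans (geo_sum n C0 k01).
by rewrite big_mkord; apply: ler_sum => m _; case/andP: (H m).
Qed.

(** * Differences of contractions in the Schatten classes *)

Section schatten_class.
Context {R : realType} (w : weight R).
Local Notation F2 := (fock w two_pos).
Implicit Types (p q : {posnum R}).

Lemma comp_oper_linear p q psi (c : R[i]) (f g : fock w p) : bounded_symbol w p q psi ->
  comp_oper w p q psi (c *: f + g) = c *: comp_oper w p q psi f + comp_oper w p q psi g.
Proof.
move=> bs; apply: fock_ext => z.
have E1 := comp_operE (c *: f + g) bs; have E2 := comp_operE f bs; have E3 := comp_operE g bs.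
move: E1 E2 E3; move: (comp_oper w p q psi (c *: f + g)) (comp_oper w p q psi f) (comp_oper w p q psi g) => u v x E1 E2 E3.
by rewrite fockDE fockZE E1 E2 E3.
Qed.

Lemma contraction_tail p q (a b : R[i]) : normc a < 1 -> exists k C : R, [/\ 0 < k < 1, 0 < C &
  forall n (f : fock w p), (forall m, (m < n)%N -> coef f m = 0) ->
    fn (comp_oper w p q (aff a b) f) <= C * k ^+ n * fn f].
Proof.
move=> a1; have [C1 C10 C1P] := fock_tame w p; have [C2 C20 C2P] := fock_dominated w q.
have [k [C [k01 C0 CP]]] := psum_affine_tail w b a1; have k0 : 0 < k by case/andP: k01.
exists k, (C2 * (C * C1)); split => //; first by rewrite !mulr_gt0.
move=> n f fn0; have gE := comp_operE f (aff_bounded w p q b a1).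
move: (comp_oper w p q (aff a b) f) gE => g gE; apply: fn_le.
rewrite -!mulrA; apply: (C2P _ _ (fent g)).
  by apply: mulr_ge0; [exact: ltW|apply: mulr_ge0; [exact: ltW|apply: mulr_ge0; [rewrite exprn_ge0// ltW|exact: fn_ge0]]].
move=> z; have := CP _ _ (mulr_ge0 (ltW C10) (fn_ge0 f)) (C1P f) n z.
rewrite (_ : partial _ n = 0) ?subr0 -?fock_taylor; last first.
  by rewrite /partial big1// => m _; rewrite fn0 ?mul0r.
rewrite gE /= => /le_trans; apply; rewrite le_eqVlt /bump; apply/orP; left; apply/eqP; ring.
Qed.

Lemma contraction_diff_tail p q a1 b1 a2 b2 : normc a1 < 1 -> normc a2 < 1 -> exists k C : R, [/\ 0 < k < 1, 0 < C &
  forall n (f : fock w p), (forall m, (m < n)%N -> coef f m = 0) ->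
    fn (comp_oper w p q (aff a1 b1) f - comp_oper w p q (aff a2 b2) f) <= C * k ^+ n * fn f].
Proof.
move=> h1 h2; have [k1 [C1 [/andP[k10 k11] C10 P1]]] := contraction_tail p q b1 h1.
have [k2 [C2 [/andP[k20 k21] C20 P2]]] := contraction_tail p q b2 h2.
have K0 := fock_const_gt0 q.
exists (Num.max k1 k2), (fock_const q * (C1 + C2)); split.
- by rewrite lt_max k10 gt_max k11 k21.
- by rewrite mulr_gt0// addr_gt0.
move=> n f f0; move: (P1 n f f0) (P2 n f f0) (fn_ge0 f).
move: (comp_oper w p q (aff a1 b1) f) (comp_oper w p q (aff a2 b2) f) => g h.
have := fn_quasi g (- h); rewrite fnN; move: (fock_const q) K0 => K K0.
move: (fn (g - h)) (fn g) (fn h) (fn f) => u x y v /[swap] hx /[swap] hy /[swap] v0.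
move=> /le_trans; apply; rewrite -!mulrA ler_pM2l// mulrCA.
have e1 : k1 ^+ n <= Num.max k1 k2 ^+ n by apply: lerXn2r; rewrite ?nnegrE ?le_max ?(ltW k10) ?lexx.
have e2 : k2 ^+ n <= Num.max k1 k2 ^+ n by apply: lerXn2r; rewrite ?nnegrE ?le_max ?(ltW k20) ?lexx ?orbT.
have m0 : 0 <= Num.max k1 k2 ^+ n by rewrite exprn_ge0// le_max ltW.
move: (Num.max k1 k2 ^+ n) e1 e2 m0 => M e1 e2 m0.
have kx : C1 * k1 ^+ n * v <= (C1 + C2) * (M * v).
  rewrite -mulrA; apply: ler_pM; rewrite ?mulr_ge0 ?exprn_ge0 ?(ltW C10) ?(ltW k10)//.
    by rewrite lerDl ltW.
  by rewrite ler_wpM2r.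
have ky : C2 * k2 ^+ n * v <= (C1 + C2) * (M * v).
  rewrite -mulrA; apply: ler_pM; rewrite ?mulr_ge0 ?exprn_ge0 ?(ltW C20) ?(ltW k20)//.
    by rewrite lerDr ltW.
  by rewrite ler_wpM2r.
by rewrite ge_max mulrCA (le_trans hx)// (le_trans hy).
Qed.

Lemma schatten_contractions (s : R) a1 b1 a2 b2 : 0 < s -> normc a1 < 1 -> normc a2 < 1 ->
  schatten w s (comp_oper w two_pos two_pos (aff a1 b1) - comp_oper w two_pos two_pos (aff a2 b2)).
Proof.
move=> s0 h1 h2; split; first exact: psum_comp_diff_compact.
set T := _ - _.
pose C1 := comp_oper w two_pos two_pos (aff a1 b1); pose C2 := comp_oper w two_pos two_pos (aff a2 b2).
have TE f : T f = C1 f - C2 f by exact: operBE.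
have Tl a f g : T (a *: f + g) = a *: T f + T g.
  rewrite !TE /C1 /C2 (comp_oper_linear _ _ _ (aff_bounded w two_pos two_pos b1 h1)).
  rewrite (comp_oper_linear _ _ _ (aff_bounded w two_pos two_pos b2 h2)) scalerBr opprD addrACA.
  by [].
have [k [C [/andP[k0 k1] C0 tail]]] := contraction_diff_tail two_pos two_pos b1 b2 h1 h2.
have TK f : fn (T f) <= C * fn f by rewrite TE; have := tail 0%N f; rewrite expr0 mulr1; apply.
pose Tc x := psum_comp w a1 b1 two_pos x - psum_comp w a2 b2 two_pos x.
have TcE f : T f = Tc (to_coefs (coef f)) by rewrite TE /Tc /C1 /C2 /aff !comp_oper_psum.
have Tc_near N x (e : R) : tame_set w N x -> 0 < e ->
    \forall y \near x, tame_set w N y -> fn (Tc y - Tc x) < e.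
  by move=> tx e0; exact: psum_comp_diff_near.
have [S SP] := adjoint_exists Tl (ltW C0) TK.
have mx := maximizer_exists Tl TcE Tc_near.
have k2 : 0 < k ^+ 2 < 1 by rewrite exprn_gt0// exprn_ilt1// ltW.
have C20 : 0 <= C ^+ 2 by exact: sqr_ge0.
have tail2 n f : (forall m, (m < n)%N -> coef (f : F2) m = 0) ->
    complex.Re (inner (T f) (T f)) <= C ^+ 2 * (k ^+ 2) ^+ n * complex.Re (inner f f).
  move=> f0; rewrite (inner_norm (T f)) (inner_norm f) -exprM mulnC exprM -!exprMn.
  apply: lerXn2r; rewrite ?nnegrE ?fn_ge0 ?mulr_ge0 ?fn_ge0 ?exprn_ge0 ?(ltW k0) ?(ltW C0)//.
  by rewrite TE; exact: tail.
have col n a f g : coef (a *: f + g : F2) n = a * coef f n + coef g n.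
  have := @coefD R _ g n (@entireZ R a _ (fent f)) (fent g); rewrite (coefZ a n (fent f)) => <-.
  by [].
have [lam [e [lam0 lam1 lam2 oe [eig span]]]] :=
  spectral_decomposition (@inner_linear R w) (@inner_sym R w) (@inner_ge0 R w) (@inner_eq0 R w) Tl SP mx C20 col k2 tail2.
exists lam; first split => //.
- exact/nonincreasing_seqP.
- by exists S, e; split.
have p1 : 0 < (k ^+ 2) `^ (s / 2) by rewrite powR_gt0; case/andP: k2.
(* The decay is known for the squares of the singular values, whence the exponent [s / 2]. *)
apply: (@geometric_nneseries R _ ((C ^+ 2) `^ (s / 2)) ((k ^+ 2) `^ (s / 2))).
- exact: powR_ge0.
- rewrite powR_ge0 /=; case/andP: k2 => k20 k21.
  have E1 : 1 `^ (s / 2) = 1 :> R by rewrite powR1.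
  rewrite -[X in _ < X]E1; apply: gt0_ltr_powR; rewrite ?nnegrE ?divr_gt0// ltW//.
move=> n; rewrite powR_ge0 /=.
have -> : lam n `^ s = (lam n ^+ 2) `^ (s / 2).
  by rewrite -powR_mulrn// -powRrM; congr (_ `^ _); field.
have E2 : ((k ^+ 2) `^ (s / 2)) ^+ n = ((k ^+ 2) ^+ n) `^ (s / 2).
  have := sqr_ge0 k; move: (k ^+ 2) (s / 2) => x y x0.
  by rewrite -(powR_mulrn n x0) -(powR_mulrn n (powR_ge0 x y)) -!powRrM mulrC.
rewrite E2 -powRM ?exprn_ge0 ?(ltW k0) ?(ltW C0)//.
by apply: ge0_ler_powR; rewrite ?nnegrE ?sqr_ge0 ?divr_ge0 ?(ltW s0) ?mulr_ge0 ?exprn_ge0 ?(ltW k0) ?(ltW C0).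
Qed.

Lemma schatten_diff psi1 psi2 (s : R) :
  bounded_symbol w two_pos two_pos psi1 -> bounded_symbol w two_pos two_pos psi2 -> psi1 <> psi2 ->
  compact_oper (comp_oper w two_pos two_pos psi1 - comp_oper w two_pos two_pos psi2) -> 0 < s ->
  schatten w s (comp_oper w two_pos two_pos psi1 - comp_oper w two_pos two_pos psi2).
Proof.
move=> b1 b2 ne /(compact_diff_iff b1 b2 ne)[c1 c2] s0.
have [[a1 [d1 [E1 h1]]]|[a E h]] := symbol_cases b1; last first.
  by exfalso; apply: (rotation_noncompact (w := w) (p := two_pos) h); rewrite -E.
have [[a2 [d2 [E2 h2]]]|[a E h]] := symbol_cases b2; last first.
  by exfalso; apply: (rotation_noncompact (w := w) (p := two_pos) h); rewrite -E.
by rewrite E1 E2; exact: schatten_contractions.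
Qed.

End schatten_class.

Unset Implicit Arguments.

Theorem theorem2p6 (R : realType) (w : weight R) :
  (* (i) *)
  (forall (p q : {posnum R}) (psi : R[i] -> R[i]),
     bounded_symbol w p q psi ->
     p%:num <> q%:num -> connected (comp_opers w p q))
  /\
  (forall (p : {posnum R}) (psi : R[i] -> R[i]),
     bounded_symbol w p p psi ->
     (isolated (comp_opers w p p) (comp_oper w p p psi) <->
        ~ compact_oper (comp_oper w p p psi))
     /\
     (exists2 T, comp_opers w p p T &
        connected_component (comp_opers w p p) T =
        [set K | comp_opers w p p K /\ compact_oper K]))
  /\
  (* (ii) *)
  (forall (p : {posnum R}) (psi1 psi2 : R[i] -> R[i]),
     bounded_symbol w p p psi1 -> bounded_symbol w p p psi2 ->
     psi1 <> psi2 ->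
     (compact_oper (comp_oper w p p psi1 - comp_oper w p p psi2) <->
        compact_oper (comp_oper w p p psi1) /\
        compact_oper (comp_oper w p p psi2)))
  /\
  (forall psi1 psi2 : R[i] -> R[i],
     let C1 := comp_oper w two_pos two_pos psi1 in
     let C2 := comp_oper w two_pos two_pos psi2 in
     bounded_symbol w two_pos two_pos psi1 ->
     bounded_symbol w two_pos two_pos psi2 ->
     psi1 <> psi2 ->
     compact_oper (C1 - C2) ->
     forall s : R, 0 < s -> schatten w s (C1 - C2)).
Proof.
split; first by move=> p q psi _ pq; exact: connected_comp_opers.
split; [|split]; last by move=> psi1 psi2 C1 C2 b1 b2 ne cT s s0; exact: schatten_diff.
  move=> p psi bs; split; first exact: isolated_iff.
  exists (comp_oper w p p (aff 0 0)); last exact: compact_component.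
  by apply: comp_opersI; apply: aff_bounded; rewrite normc0.
by move=> p psi1 psi2; exact: compact_diff_iff.
Qed.
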